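(* Let $k\geq 2$ and $s$ be integers, and let $\lambda_1,\ldots,\lambda_s\in\mathbb{Z}$ satisfy $\lambda_1+\cdots+\lambda_s=0$. Consider the system \[ L_j(x_1,\ldots,x_s)=\lambda_1x_1^j+\cdots+\lambda_sx_s^j=0\qquad(1\leq j\leq k). \] Suppose that $s>s_0(k)$, where $s_0(k)=2k\left[k(\log k+2\log\log k)\right]+10k^2+6$, and suppose that the system possesses both a non-singular real solution and a non-singular $p$-adic solution for every rational prime $p$. Then there exists a constant $K>0$, depending at most on the $\lambda_i$, with the following property. Suppose $\mathcal{A}_N\subset[1,N]$ has cardinality $\delta_N N$ and is $\mathfrak{a}$-uniform of degree $k$, where \[ \mathfrak{a}\leq K\delta_N^{2^{k+1}(s_0(k)+2)}. \] Then for $N$ sufficiently large in terms of the $\lambda_i$, the set $\mathcal{A}_N^s$ necessarily contains non-trivial solutions to the system $L_k=\cdots=L_1=0$, and the number $\mathcal{N}$ of solutions in $\mathcal{A}_N^s$ satisfies \[ \mathcal{N}\gg\delta_N^sN^{s-k(k+1)/2}, \] where the implied constant depends at most on the $\lambda_i$ and $k$.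
   Context: $[x]$ denotes the integer part of $x$. A trivial solution is obtained by partitioning $\{1,\ldots,s\}$ into disjoint classes on each of which the $\lambda_i$ sum to $0$ and setting all $x_i$ in the same class equal; other solutions are non-trivial. A solution $\mathbf{a}$ is non-singular if for some indices $i_1,\ldots,i_k$ the Jacobian $\det(\partial L_j/\partial x_{i_l})_{1\le j,l\le k}$ at $\mathbf{a}$ is non-zero. Uniformity: let $A(x)$ be the indicator function of $\mathcal{A}_N$ and define the balanced function $\mathcal{E}_N(x)=\delta_N-A(x)$ for $1\leq x\leq N$ and $\mathcal{E}_N(x)=0$ otherwise. Define $\Delta_1(f(x);w)=f(x)\overline{f(x-w)}$ and recursively $\Delta_k(f(x);w_1,\ldots,w_k)=\Delta_1(\Delta_{k-1}(f(x);w_1,\ldots,w_{k-1});w_k)$. For $\mathbf{w}=(w_1,\ldots,w_{k+1})$ let $I_{\mathbf{w}}=[1,N]\cap([1,N]+w_1)\cap\cdots\cap([1,N]+w_1+\cdots+w_{k+1})$, where $[1,N]+w$ is the translate by $w$. The set $\mathcal{A}_N$ is $\mathfrak{a}$-uniform of degree $k$ if \[ \sum_{|w_1|,\ldots,|w_{k+1}|\leq N-1}\ \sum_{x\in I_{\mathbf{w}}}\Delta_{k+1}(\mathcal{E}_N(x);\mathbf{w})\leq\mathfrak{a}N^{k+2}. \]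
   Formalization: The formal statement adds that every λ_i is non-zero and that A_N is non-empty; without these the claim fails (e.g. k=2, λ=(1,1,−1,−1,0,…,0) has only trivial solutions, and the empty set is 0-uniform). *)

(* Defs.v *)
From HB Require Import structures.
From mathcomp Require Import all_boot all_order all_algebra finmap.
From mathcomp Require Import all_classical all_reals all_analysis.

Set Implicit Arguments.
Unset Strict Implicit.
Unset Printing Implicit Defensive.

Import Order.TTheory GRing.Theory Num.Theory.

Local Open Scope ring_scope.

(* The field Qp p of p-adic numbers is built as the completion of the
   rationals: p-adic Cauchy sequences modulo null sequences. *)

(* logn p is identically 0 when p is not prime, so for such p this is the
   trivial absolute value and Qp p below is just a copy of the rationals. *)
Definition padic_abs (p : nat) (x : rat) : rat :=
  if x == 0 then 0
  else p%:R ^ ((logn p `|denq x|%N)%:Z - (logn p `|numq x|%N)%:Z).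

Section PadicAbs.
Variable p : nat.
Local Notation v := (padic_abs p).
Let lz (m : int) := (logn p `|m|%N)%:Z.
Let q : rat := p%:R.

Lemma padic_abs0 : v 0 = 0.
Proof. by rewrite /padic_abs eqxx. Qed.

Lemma padic_abs_gt0 x : x != 0 -> 0 < v x.
Proof.
move=> x0; rewrite /padic_abs (negbTE x0).
have [p0|] := posnP p; last by move=> p0; rewrite exprz_gt0 // ltr0n.
by rewrite p0 /= expr0z.
Qed.

Lemma padic_abs_ge0 x : 0 <= v x.
Proof.
by have [->|/padic_abs_gt0/ltW//] := eqVneq x 0; rewrite padic_abs0.
Qed.

Lemma padic_abs1 : v 1 = 1.
Proof. by rewrite /padic_abs oner_eq0 /= logn1. Qed.

Let lzM m n : m != 0 -> n != 0 -> lz (m * n) = lz m + lz n.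
Proof. by move=> m0 n0; rewrite /lz abszM lognM ?absz_gt0. Qed.

Let absfrac (a b : int) : a != 0 -> b != 0 ->
  v (a%:~R / b%:~R) = q ^ (lz b - lz a).
Proof.
move=> a0 b0; set x : rat := _ / _.
have x0 : x != 0 by rewrite mulf_neq0 ?invr_eq0 ?intr_eq0.
have n0 : numq x != 0 by rewrite numq_eq0.
have d0 : denq x != 0 by rewrite denq_eq0.
have E : numq x * b = a * denq x.
  apply: (@intr_inj rat); rewrite !rmorphM /= numqE.
  by rewrite -mulrA [X in _ * X]mulrC mulrA /x divfK ?intr_eq0.
rewrite /padic_abs (negbTE x0); congr (_ ^ _).
move: (congr1 lz E); rewrite !lzM // /lz => e.
apply/eqP; rewrite subr_eq addrAC eq_sym subr_eq [X in X == _]addrC.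
by rewrite e addrC.
Qed.

Lemma padic_absM x y : v (x * y) = v x * v y.
Proof.
have [->|x0] := eqVneq x 0; first by rewrite !(mul0r, padic_abs0).
have [->|y0] := eqVneq y 0; first by rewrite !(mulr0, padic_abs0).
have nx : numq x != 0 by rewrite numq_eq0.
have ny : numq y != 0 by rewrite numq_eq0.
have dx := denq_neq0 x. have dy := denq_neq0 y.
have -> : x * y = (numq x * numq y)%:~R / (denq x * denq y)%:~R.
  by rewrite !rmorphM /= invfM mulrACA !divq_num_den.
rewrite absfrac ?mulf_neq0 // !lzM //.
rewrite /padic_abs (negbTE x0) (negbTE y0).
have [P0|p_gt0] := posnP p.
  by rewrite /q /lz P0 /= !subr0 expr0z mulr1.
rewrite -expfzDr ?pnatr_eq0 -?lt0n //; congr (_ ^ _).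
by rewrite opprD addrACA.
Qed.

Lemma padic_absN x : v (- x) = v x.
Proof.
rewrite /padic_abs oppr_eq0 numqN denqN abszN.
by [].
Qed.

Lemma padic_abs_ultra x y : v (x + y) <= Num.max (v x) (v y).
Proof.
have [->|x0] := eqVneq x 0.
  by rewrite add0r le_max lexx orbT.
have [->|y0] := eqVneq y 0.
  by rewrite addr0 le_max lexx.
have [->|s0] := eqVneq (x + y) 0.
  by rewrite padic_abs0 le_max padic_abs_ge0.
have [pp|np] := boolP (prime p); last first.
  have z n : logn p n = 0%N by rewrite lognE (negbTE np).
  by rewrite /padic_abs (negbTE x0) (negbTE y0) (negbTE s0) !z le_max lexx.
have nx : numq x != 0 by rewrite numq_eq0.
have ny : numq y != 0 by rewrite numq_eq0.
have dx := denq_neq0 x. have dy := denq_neq0 y.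
pose d := denq x * denq y; pose a := numq x * denq y; pose b := numq y * denq x.
have d0 : d != 0 by rewrite mulf_neq0.
have a0 : a != 0 by rewrite mulf_neq0.
have b0 : b != 0 by rewrite mulf_neq0.
have dr : d%:~R != 0 :> rat by rewrite intr_eq0.
have xE : x = a%:~R / d%:~R.
  by rewrite /a /d !rmorphM /= invfM mulrACA divq_num_den divff ?intr_eq0 // mulr1.
have yE : y = b%:~R / d%:~R.
  rewrite /b /d !rmorphM /= [X in _ / X]mulrC invfM mulrACA divq_num_den.
  by rewrite divff ?intr_eq0 // mulr1.
have sE : x + y = (a + b)%:~R / d%:~R by rewrite xE yE -mulrDl -rmorphD.
have ab0 : a + b != 0.
  by apply: contraNneq s0 => ab; rewrite sE ab mul0r.
have q1 : 1 < q by rewrite /q ltr1n prime_gt1.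
rewrite sE {1}xE {1}yE !absfrac //.
rewrite le_max !ler_eXz2l // !lerD2l !lerN2 /lz !lez_nat.
wlog ab : a b a0 b0 ab0 {xE yE sE} / (logn p `|a| <= logn p `|b|)%N.
  move=> H; have [/H->//|/ltnW/H H1] := leqP (logn p `|a|) (logn p `|b|).
  by rewrite orbC addrC H1 // addrC.
apply/orP; left.
have da : ((p ^ logn p `|a|)%N%:Z %| a)%Z by rewrite dvdzE /= pfactor_dvdnn.
have db : ((p ^ logn p `|a|)%N%:Z %| b)%Z.
  by rewrite dvdzE /= pfactor_dvdn ?absz_gt0.
by have := rpredD da db; rewrite dvdzE /= pfactor_dvdn ?absz_gt0.
Qed.

End PadicAbs.

Definition padic_cauchy (p : nat) : {pred nat -> rat} := fun u =>
  `[< forall eps : rat, 0 < eps -> exists M : nat, forall m n : nat,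
        (M <= m)%N -> (M <= n)%N -> padic_abs p (u m - u n) < eps >].

Section CauchySequences.
Variable p : nat.
Local Notation v := (padic_abs p).

Let ultra_lt x y eps : v x < eps -> v y < eps -> v (x + y) < eps.
Proof.
by move=> hx hy; apply: (le_lt_trans (padic_abs_ultra p x y)); rewrite gt_max hx.
Qed.

Lemma padic_cauchy_bounded u : u \in padic_cauchy p ->
  exists2 B : rat, 0 < B & forall n, v (u n) <= B.
Proof.
move=> /asboolP /(_ 1 ltr01) [M HM].
pose B := \sum_(i < M.+1) v (u i) + 1.
have Bi i : (i <= M)%N -> v (u i) <= B.
  move=> iM; rewrite /B (bigD1 (Ordinal (iM : (i < M.+1)%N))) //= -addrA lerDl.
  by rewrite addr_ge0 // sumr_ge0 // => j _; apply: padic_abs_ge0.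
have B1 : 1 <= B.
  by rewrite /B lerDr sumr_ge0 // => j _; apply: padic_abs_ge0.
exists B => [|n]; first exact: lt_le_trans B1.
have [/Bi//|/ltnW Mn] := leqP n M.
rewrite -[u n](subrK (u M)) (le_trans (padic_abs_ultra p _ _)) // ge_max.
by rewrite Bi // andbT (le_trans (ltW (HM n M Mn (leqnn M)))).
Qed.

Fact padic_cauchy_subring : subring_closed (padic_cauchy p).
Proof.
split.
- apply/asboolP => eps e0; exists 0%N => m n _ _.
  by rewrite subrr padic_abs0.
- move=> f g /asboolP Hf /asboolP Hg; apply/asboolP => eps e0.
  have [M HM] := Hf _ e0; have [N HN] := Hg _ e0.
  exists (maxn M N) => m n; rewrite !geq_max => /andP[? ?] /andP[? ?].
  rewrite !fctE opprD opprK addrACA; apply: ultra_lt; first exact: HM.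
  by rewrite addrC HN.
- move=> f g cf cg; have [Bf Bf0 HBf] := padic_cauchy_bounded cf.
  have [Bg Bg0 HBg] := padic_cauchy_bounded cg.
  move: cf cg => /asboolP Hf /asboolP Hg; apply/asboolP => eps e0.
  have [M HM] := Hf _ (divr_gt0 e0 Bg0).
  have [N HN] := Hg _ (divr_gt0 e0 Bf0).
  exists (maxn M N) => m n; rewrite !geq_max => /andP[? ?] /andP[? ?].
  rewrite !fctE.
  have -> : f m * g m - f n * g n = (f m - f n) * g m + f n * (g m - g n).
    by rewrite mulrBl mulrBr addrA subrK.
  apply: ultra_lt; rewrite padic_absM.
    apply: (@le_lt_trans _ _ (v (f m - f n) * Bg)).
      by rewrite ler_wpM2l ?padic_abs_ge0.
    by rewrite -ltr_pdivlMr // HM.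
  apply: (@le_lt_trans _ _ (Bf * v (g m - g n))).
    by rewrite ler_wpM2r ?padic_abs_ge0.
  by rewrite mulrC -ltr_pdivlMr // HN.
Qed.

HB.instance Definition _ := GRing.isSubringClosed.Build (nat -> rat)
  (padic_cauchy p) padic_cauchy_subring.

End CauchySequences.

Record cauchy_seq (p : nat) := CauchySeq {
  cauchy_val :> nat -> rat;
  _ : cauchy_val \in padic_cauchy p
}.

HB.instance Definition _ p := [isSub for @cauchy_val p].
HB.instance Definition _ p := [Choice of cauchy_seq p by <:].
HB.instance Definition _ p :=
  [SubChoice_isSubComNzRing of cauchy_seq p by <:].

Definition padic_null (p : nat) : {pred cauchy_seq p} := fun u =>
  `[< forall eps : rat, 0 < eps -> exists M : nat, forall n : nat,
        (M <= n)%N -> padic_abs p (u n) < eps >].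

Section NullIdeal.
Variable p : nat.
Local Notation v := (padic_abs p).

Fact padic_null_ideal : idealr_closed (@padic_null p).
Proof.
split.
- by apply/asboolP => eps e0; exists 0%N => n _; rewrite padic_abs0.
- apply/negP => /asboolP /(_ 1 ltr01) [M /(_ M (leqnn M))].
  by rewrite padic_abs1 ltxx.
- move=> a x y /asboolP Hx /asboolP Hy; apply/asboolP => eps e0.
  have [B B0 HB] := padic_cauchy_bounded (valP a).
  have [M HM] := Hx _ (divr_gt0 e0 B0); have [N HN] := Hy _ e0.
  exists (maxn M N) => n; rewrite geq_max => /andP[Mn Nn].
  rewrite -[cauchy_val _ n]/(a n * x n + y n).
  apply: (le_lt_trans (padic_abs_ultra p _ _)); rewrite gt_max HN // andbT.
  rewrite padic_absM; apply: (@le_lt_trans _ _ (B * v (x n))).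
    by apply: ler_wpM2r; [exact: padic_abs_ge0 | exact: HB].
  by rewrite mulrC -ltr_pdivlMr // HM.
Qed.

HB.instance Definition _ := isIdealr.Build (cauchy_seq p)
  (@padic_null p) padic_null_ideal.

End NullIdeal.

Definition Qp (p : nat) : Type := {ideal_quot (@padic_null p)}.
HB.instance Definition _ (p : nat) := GRing.ComNzRing.on (Qp p).

Section QpField.
Variable p : nat.
Local Notation v := (padic_abs p).

Local Notation pi := (\pi_({ideal_quot (@padic_null p)}))%qT.

Lemma Qp_mulVx (x : {ideal_quot (@padic_null p)}) :
  x != 0 -> exists y : {ideal_quot (@padic_null p)}, y * x = 1.
Proof.
rewrite -[x]reprK; set u := repr x => unz.
have {unz} unn : u \notin @padic_null p.
  apply: contra unz => un; rewrite -(rmorph0 pi).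
  by rewrite -Quotient.idealrBE subr0.
have [eps e0 He] : exists2 eps : rat, 0 < eps &
    forall M, exists2 n, (M <= n)%N & eps <= v (u n).
  apply: contrapT => H; case/negP: unn; apply/asboolP => eps e0.
  apply: contrapT => H1; apply: H; exists eps => // M.
  apply: contrapT => H2; apply: H1; exists M => n Mn.
  by rewrite ltNge; apply/negP => ?; apply: H2; exists n.
have /asboolP cu := valP u.
have [M HM] := cu _ e0; have [n0 Mn0 un0] := He M.
have lb m : (M <= m)%N -> eps <= v (u m).
  move=> Mm; rewrite leNgt; apply/negP => um.
  have := padic_abs_ultra p (u n0 - u m) (u m).
  rewrite subrK => /(le_trans un0); rewrite le_max leNgt HM //=.
  by rewrite leNgt um.
have nz m : (M <= m)%N -> u m != 0.
  by move=> /lb; apply: contraTneq => ->; rewrite padic_abs0 -ltNge.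
have vV z : z != 0 -> v z^-1 = (v z)^-1.
  move=> z0; apply: (@mulfI _ (v z)); first by rewrite gt_eqF ?padic_abs_gt0.
  by rewrite -padic_absM !divff ?padic_abs1 // gt_eqF ?padic_abs_gt0.
have cw : (fun m => (u m)^-1) \in padic_cauchy p.
  apply/asboolP => d d0.
  have [N HN] := cu _ (mulr_gt0 d0 (mulr_gt0 e0 e0)).
  exists (maxn M N) => m n; rewrite !geq_max => /andP[Mm Nm] /andP[Mn Nn].
  have -> : (u m)^-1 - (u n)^-1 = (u n - u m) * ((u m)^-1 * (u n)^-1).
    by rewrite mulrBl mulrCA divff ?nz // mulr1 mulrA divff ?nz // mul1r.
  rewrite !padic_absM !vV ?nz // -invfM ltr_pdivrMr; last first.
    by rewrite mulr_gt0 // padic_abs_gt0 ?nz.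
  apply: lt_le_trans (HN _ _ Nn Nm) _; rewrite ler_pM2l //.
  by rewrite ler_pM ?(ltW e0) ?lb.
exists (pi (CauchySeq cw)).
rewrite -[RHS](rmorph1 pi).
rewrite -(rmorphM pi).
apply/eqP; rewrite -Quotient.idealrBE; apply/asboolP => d d0.
exists M => n Mn.
rewrite -[cauchy_val _ n]/((u n)^-1 * u n - 1).
by rewrite mulVf ?nz // subrr padic_abs0.
Qed.

Definition Qp_inv (x : Qp p) : Qp p :=
  if pselect (exists y, y * x = 1) is left e then projT1 (cid e) else 0.

Fact Qp_mulVf (x : Qp p) : x != 0 -> Qp_inv x * x = 1.
Proof.
move=> /Qp_mulVx e; rewrite /Qp_inv; case: pselect => // e'.
by case: cid.
Qed.

Fact Qp_inv0 : Qp_inv 0 = 0.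
Proof.
rewrite /Qp_inv; case: pselect => // e; exfalso; case: e => y /eqP.
by rewrite mulr0 eq_sym oner_eq0.
Qed.

HB.instance Definition _ :=
  GRing.ComNzRing_isField.Build (Qp p) Qp_mulVf Qp_inv0.

End QpField.

Definition L (T : comNzRingType) (s : nat) (lam : 'I_s -> int) (j : nat)
    (x : 'I_s -> T) : T :=
  \sum_(i < s) (lam i)%:~R * x i ^+ j.

Definition solution (T : comNzRingType) (s : nat) (lam : 'I_s -> int)
    (k : nat) (x : 'I_s -> T) : bool :=
  [forall j : 'I_k, L lam j.+1 x == 0].

(* Formal partial derivative of L_j in the i-th variable, at x: make the i-th
   coordinate an indeterminate, differentiate, evaluate at x i. *)
Definition dL (T : comNzRingType) (s : nat) (lam : 'I_s -> int) (j : nat)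
    (i : 'I_s) (x : 'I_s -> T) : T :=
  ((L lam j (fun l => if l == i then 'X else (x l)%:P) : {poly T})^`()).[x i].

Lemma dLE (T : comNzRingType) (s : nat) (lam : 'I_s -> int) (j : nat)
    (i : 'I_s) (x : 'I_s -> T) :
  dL lam j i x = (lam i)%:~R * (x i ^+ j.-1 *+ j).
Proof.
rewrite /dL /L (bigD1 i) //= eqxx derivD raddf_sum /= big1 ?addr0.
  by rewrite -(rmorph_int polyC) mul_polyC derivZ derivXn hornerZ hornerMn hornerXn.
move=> l /negbTE ->.
by rewrite -(rmorph_int polyC) -polyC_exp -polyCM derivC.
Qed.

Definition nonsingular (T : comNzRingType) (s : nat) (lam : 'I_s -> int)
    (k : nat) (x : 'I_s -> T) : Prop :=
  exists i : 'I_k -> 'I_s,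
    \det (\matrix_(j < k, l < k) dL lam j.+1 (i l) x) != 0.

Definition has_nonsingular_solution (T : comNzRingType) (s : nat)
    (lam : 'I_s -> int) (k : nat) : Prop :=
  exists x : 'I_s -> T, solution lam k x /\ nonsingular lam k x.

Definition trivial_solution (s : nat) (lam : 'I_s -> int) (x : 'I_s -> int)
    : Prop :=
  exists2 P : {set {set 'I_s}}, finset.partition P [set: 'I_s]%SET &
    forall B, B \in P ->
      \sum_(i in B) lam i = 0 /\ {in B &, forall i j, x i = x j}.

(* Num.floor is the greatest integer not exceeding its argument; for k = 2
   that argument is negative. *)
Definition s0 (R : realType) (k : nat) : int :=
  (2 * k)%N%:Z * Num.floor (k%:R * (ln k%:R + 2 * ln (ln k%:R)) : R)
  + (10 * k ^ 2 + 6)%N%:Z.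

Definition zitv (a b : int) : {fset int} :=
  let len := `|(Num.max 0 (b - a + 1))%R|%N in
  let r := [seq a + i%:Z | i <- iota 0 len] in [fset x in r]%fset.

Lemma in_zitv (a b x : int) : (x \in zitv a b) = (a <= x <= b).
Proof.
rewrite !inE; apply/mapP/andP => [[i]|[ax xb]].
  rewrite mem_iota add0n /= => ilt ->; split; first by rewrite lerDl.
  move: ilt; rewrite -ltz_nat gez0_abs ?le_max ?lexx // lt_max.
  rewrite ltNge lez_nat leq0n /=.
  by rewrite ltzD1 lerBrDl.
exists `|x - a|%N; last by rewrite gez0_abs ?subr_ge0 // [RHS]addrC subrK.
rewrite mem_iota add0n /= -ltz_nat !gez0_abs ?subr_ge0 ?le_max ?lexx // lt_max.
by rewrite ltzD1 lerD2r xb orbT.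
Qed.

Definition density (R : realType) (N : nat) (A : {fset int}) : R :=
  #|` A|%:R / N%:R.

Definition balanced (R : realType) (N : nat) (A : {fset int}) (x : int) : R :=
  if x \in zitv 1 N%:Z then density R N A - (x \in A)%:R else 0.

(* Only real-valued f are needed (f = balanced N A), so the complex
   conjugation of the second factor is omitted. *)
Definition Delta1 (R : realType) (f : int -> R) (w : int) : int -> R :=
  fun x => f x * f (x - w).

Definition Delta (R : realType) (f : int -> R) (w : seq int) : int -> R :=
  foldl (@Delta1 R) f w.

Lemma Delta_rcons (R : realType) (f : int -> R) (w : seq int) (u : int) :
  Delta f (rcons w u) = Delta1 (Delta f w) u.
Proof. exact: foldl_rcons. Qed.

(* x lies in the translate of [1, N] by t iff x - t lies in [1, N]; the index
   i = 0 gives [1, N] itself. *)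
Definition Iw (N : nat) (w : seq int) : {fset int} :=
  [fset x in zitv 1 N%:Z |
    all (fun i => (x - \sum_(u <- take i w) u)%R \in zitv 1 N%:Z)
        (iota 0 (size w).+1)]%fset.

Definition uniform_of_degree (R : realType) (N : nat) (A : {fset int}) (a : R)
    (k : nat) : Prop :=
  \sum_(w : k.+1.-tuple (zitv (1 - N%:Z) (N%:Z - 1)))
    \sum_(x <- Iw N (map val w)) Delta (balanced R N A) (map val w) x
  <= a * N%:R ^+ k.+2.

Definition num_solutions (s : nat) (lam : 'I_s -> int) (k : nat)
    (A : {fset int}) : nat :=
  #|[set x : {ffun 'I_s -> A} | solution lam k (fun i => val (x i))]%SET|.

(* Main.v *)
From HB Require Import structures.
Require Import Defs.
From mathcomp Require Import all_boot all_order all_algebra perm finmap.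
From mathcomp Require Import all_classical all_reals all_analysis.
From mathcomp Require Import complex ring lra zify.

Set Implicit Arguments.
Unset Strict Implicit.
Unset Printing Implicit Defensive.

Import Order.TTheory GRing.Theory Num.Theory Normc.

Local Open Scope ring_scope.

(* Idea.  The circle method over finite grids: integrals over the torus are
   averages over the points a / M with M large, so orthogonality counts exactly.

   1. Nested efficient congruencing (after Wooley) for a large auxiliary prime p
      gives Vinogradov's mean value theorem with an eps-loss, by induction on
      the degree; it is phrased for functions that are equivariant under the
      characters of the curve, so that lower degrees apply to conditioned sums.
   2. The mean value bound implies an inverse theorem for Weyl sums: a Weyl sum
      of size N / Y forces rational approximations with denominators Y^O(1).
   3. Near such rational points a sum of length N p compares with one of length
      N by dilation, which removes the eps-loss: J_t(N) << N^(2t - k(k+1)/2) as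
      soon as t > k(k+1)/2.
   4. Hence the number of solutions in [1, N]^s differs little from the average
      number of representations of nearby divisible values; real and p-adic Newton
      iteration from the non-singular solutions bounds this average from below.
   5. The Gowers norm of degree k controls sums twisted by polynomial phases of
      degree k.  Replacing the balanced function factor by factor compares
      A^s with delta^s [1, N]^s, the remaining 2t factors being handled by step 3.
   6. Trivial solutions have at most s/2 distinct coordinates, and Parseval shows
      that uniformity forces delta^4 N >= 1, so they are outnumbered. *)

(** * Complex exponentials and grid averages *)

Section ComplexNorm.
Variable R : rcfType.
Implicit Types x y z : R[i].

Arguments normc : simpl never.

Lemma normc_ge0 z : 0 <= normc z.
Proof. by case: z => a b; exact: sqrtr_ge0. Qed.

Lemma normc_distC x y : normc (x - y) = normc (y - x).
Proof. by rewrite -normcN opprB. Qed.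

Lemma ler_normc_sum (I : Type) (r : seq I) (P : pred I) (F : I -> R[i]) :
  normc (\sum_(i <- r | P i) F i) <= \sum_(i <- r | P i) normc (F i).
Proof.
elim/big_rec2: _ => [|i y x _ le_xy]; first by rewrite normc0.
by apply: le_trans (le_normcD _ _) _; rewrite lerD2l.
Qed.

Lemma normc_prod (I : Type) (r : seq I) (P : pred I) (F : I -> R[i]) :
  normc (\prod_(i <- r | P i) F i) = \prod_(i <- r | P i) normc (F i).
Proof. by elim/big_rec2: _ => [|i y x _ <-]; rewrite ?normc1 ?normcM. Qed.

Lemma normcX z n : normc (z ^+ n) = normc z ^+ n.
Proof. by elim: n => [|n IHn]; rewrite ?expr0 ?normc1 // !exprS normcM IHn. Qed.

Lemma normc_real (r : R) : normc r%:C%C = `|r|.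
Proof. by rewrite /normc /= expr0n addr0 sqrtr_sqr. Qed.

Lemma normc_nat n : normc (n%:R : R[i]) = n%:R.
Proof. by rewrite -(rmorph_nat (real_complex R)) normc_real ger0_norm. Qed.

Lemma normc_conj z : normc z^*%C = normc z.
Proof. by case: z => a b; rewrite /normc /= sqrrN. Qed.

Lemma conjcM x y : (x * y)^*%C = x^*%C * y^*%C.
Proof. exact: rmorphM. Qed.

Lemma normc_sqr z : (normc z ^+ 2)%:C%C = z * z^*%C.
Proof.
case: z => a b; rewrite /normc /= sqr_sqrtr ?addr_ge0 ?sqr_ge0 //.
by apply/eqP; rewrite eq_complex /= !mulrN opprK -!expr2 eqxx addrC mulrC subrr eqxx.
Qed.

Lemma normcX_double z t : (normc z ^+ (2 * t))%:C%C = z ^+ t * (z ^+ t)^*%C.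
Proof. by rewrite exprM rmorphXn /= normc_sqr exprMn; congr (_ * _); rewrite rmorphXn. Qed.

Lemma lerB_normc x y : normc x - normc y <= normc (x - y).
Proof. by rewrite lerBlDr -{1}(subrK y x) le_normcD. Qed.

Lemma ler_dist_normc x y : `|normc x - normc y| <= normc (x - y).
Proof. by rewrite ler_norml lerNl opprB lerB_normc normc_distC lerB_normc. Qed.

End ComplexNorm.

Arguments normc : simpl never.

Section Exponential.
Variable R : realType.
Local Notation C := R[i].

Definition e2pi (x : R) : C := (cos (2 * pi * x) +i* sin (2 * pi * x))%C.

Lemma e2piD x y : e2pi (x + y) = e2pi x * e2pi y.
Proof.
rewrite /e2pi mulrDr cosD sinD.
by apply/eqP; rewrite eq_complex /= [in X in _ && X]addrC !eqxx.
Qed.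

Lemma e2pi0 : e2pi 0 = 1.
Proof. by rewrite /e2pi mulr0 cos0 sin0. Qed.

Lemma normc_e2pi x : normc (e2pi x) = 1.
Proof. by rewrite /normc /= cos2Dsin2 sqrtr1. Qed.

Lemma e2piN x : e2pi (- x) = (e2pi x)^*%C.
Proof. by rewrite /e2pi mulrN cosN sinN. Qed.

Lemma e2piX x n : e2pi (x *+ n) = e2pi x ^+ n.
Proof. by elim: n => [|n IHn]; rewrite ?mulr0n ?e2pi0 // mulrS exprS e2piD IHn. Qed.

Lemma e2pi_nat n : e2pi n%:R = 1.
Proof.
rewrite e2piX /e2pi mulr1 mulrC mulr_natr cos2pi sin2pi.
by rewrite -[(1 +i* 0)%C]/(1 : C) expr1n.
Qed.

Lemma e2pi_int (z : int) : e2pi z%:~R = 1.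
Proof.
case: z => n; first exact: e2pi_nat.
by rewrite NegzE mulrNz e2piN e2pi_nat conjc1.
Qed.

Lemma e2piDint x (z : int) : e2pi (x + z%:~R) = e2pi x.
Proof. by rewrite e2piD e2pi_int mulr1. Qed.

Lemma e2pi_sum (I : Type) (r : seq I) (P : pred I) (F : I -> R) :
  e2pi (\sum_(i <- r | P i) F i) = \prod_(i <- r | P i) e2pi (F i).
Proof. by elim/big_rec2: _ => [|i y x _ <-]; rewrite ?e2pi0 ?e2piD. Qed.

Lemma ler_norm_sin (x : R) : `|sin x| <= `|x|.
Proof.
wlog x_ge0 : x / 0 <= x.
  move=> pos; have [/pos//|/ltW] := leP 0 x.
  by rewrite -oppr_ge0 => /pos; rewrite sinN !normrN.
have [|c _] := @MVT_segment R sin cos 0 x x_ge0 (fun y _ => is_derive_sin y).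
  by apply: derivable_within_continuous => y _; exact: derivable_sin.
by rewrite sin0 !subr0 => ->; rewrite normrM ler_piMl // cos_max.
Qed.

Lemma sqr_normc_e2pi_sub1 x : normc (e2pi x - 1) ^+ 2 = 2 - 2 * cos (2 * pi * x).
Proof.
rewrite /normc /e2pi /= sqr_sqrtr ?addr_ge0 ?sqr_ge0 // subr0.
have := cos2Dsin2 (2 * pi * x); set c := cos _; set s := sin _ => cos2_sin2.
have -> : s ^+ 2 = 1 - c ^+ 2 by lra.
by ring.
Qed.

Lemma normc_e2pi_sub1_le x : normc (e2pi x - 1) <= 8 * `|x|.
Proof.
rewrite -ler_sqr ?nnegrE ?normc_ge0 ?mulr_ge0 // sqr_normc_e2pi_sub1.
have -> : 2 * pi * x = (pi * x) *+ 2 by rewrite mulr2n; ring.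
rewrite cos_mulr2n; have := sin2cos2 (pi * x); set c := cos _ => sin2E.
have : sin (pi * x) ^+ 2 <= (4 * `|x|) ^+ 2.
  rewrite -(real_normK (num_real (sin _))) ler_sqr ?nnegrE ?mulr_ge0 //.
  apply: le_trans (ler_norm_sin _) _; rewrite normrM ler_wpM2r //.
  by rewrite ger0_norm ?pi_ge0 //; have := @pihalf_lt2 R; lra.
rewrite !exprMn sin2E mulr2n; move: (`|x| ^+ 2) (c ^+ 2) => x2 c2; lra.
Qed.

Lemma e2pi_lipschitz x y : normc (e2pi x - e2pi y) <= 8 * `|x - y|.
Proof.
have -> : e2pi x - e2pi y = e2pi y * (e2pi (x - y) - 1).
  by rewrite mulrBr mulr1 -e2piD addrCA subrr addr0.
by rewrite normcM normc_e2pi mul1r normc_e2pi_sub1_le.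
Qed.

Lemma e2pi_near1 x : normc (e2pi x - 1) < 1 -> exists z : int, `|x - z%:~R| < 4^-1.
Proof.
move=> e2pi_x_near; pose z := Num.floor (x + 2^-1); exists z.
pose y := x - z%:~R.
have y_itv : - 2^-1 <= y < 2^-1.
  have := floor_le (x + 2^-1); have := floorD1_gt (x + 2^-1).
  by rewrite -/z intrD /y; lra.
have e2piE : e2pi y = e2pi x by rewrite -(e2piDint y z) /y subrK.
rewrite -/y ltNge; apply/negP => y_far.
have : normc (e2pi `|y| - 1) < 1.
  have [y_ge0|y_lt0] := leP 0 y; first by rewrite ger0_norm // e2piE.
  by rewrite ltr0_norm // e2piN e2piE -[1]conjc1 -rmorphB normc_conj.
rewrite -(expr_lt1 (isT : 0 < 2)%N) ?normc_ge0 // sqr_normc_e2pi_sub1.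
apply/negP; rewrite -leNgt.
have -> : 2 * pi * `|y| = (2 * pi * (`|y| - 4^-1)) + pi / 2 by field.
rewrite cosDpihalf; suff : 0 <= sin (2 * pi * (`|y| - 4^-1)) by lra.
have pi0 := @pi_ge0 R.
apply: sin_ge0_pi; apply/andP; split; first by rewrite !mulr_ge0 // subr_ge0.
have y_le : `|y| <= 2^-1 by rewrite ler_norml; lra.
by rewrite mulrAC -[leRHS]mul1r ler_wpM2r //; lra.
Qed.

Lemma e2pi_eq1 x : e2pi x = 1 -> exists z : int, x = z%:~R.
Proof.
move=> e2pi_x; have [|z z_near] := @e2pi_near1 x; first by rewrite e2pi_x subrr normc0.
exists z; apply/eqP; rewrite -subr_eq0; set y := x - _ in z_near *.
have : e2pi y = 1 by rewrite -(e2piDint y z) /y subrK.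
case=> _ sin_y; apply/negPn/negP => y_neq0.
have sin_norm_y : sin (2 * pi * `|y|) = 0.
  have [y_ge0|y_lt0] := leP 0 y; first by rewrite ger0_norm.
  by rewrite ltr0_norm // mulrN sinN sin_y oppr0.
have pi0 := @pi_gt0 R.
have : 0 < sin (2 * pi * `|y|).
  apply: sin_gt0_pihalf; apply/andP; split; first by rewrite !mulr_gt0 // normr_gt0.
  have -> : pi / 2 = 2 * pi * 4^-1 :> R by field.
  by rewrite ltr_pM2l // mulr_gt0.
by rewrite sin_norm_y ltxx.
Qed.

Lemma sum_e2pi_dvd (m : nat) (h : int) : (0 < m)%N ->
  \sum_(a < m) e2pi (a%:R / m%:R * h%:~R) = m%:R *+ (m%:Z %| h)%Z.
Proof.
move=> m_gt0; have m_neq0 : m%:R != 0 :> R by rewrite pnatr_eq0 -lt0n.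
have powE (a : 'I_m) : e2pi (a%:R / m%:R * h%:~R) = e2pi (h%:~R / m%:R) ^+ a.
  by rewrite -e2piX -[X in _ = e2pi X]mulr_natl mulrA mulrAC.
rewrite (eq_bigr _ (fun a _ => powE a)).
have [/dvdzP[w ->]|ndvd] := boolP (m%:Z %| h)%Z.
  rewrite intrM mulfK // e2pi_int (eq_bigr (fun=> 1)) => [|i _]; last by rewrite expr1n.
  by rewrite sumr_const card_ord mulr1n.
have e2pi_neq1 : e2pi (h%:~R / m%:R) - 1 != 0.
  apply: contra ndvd; rewrite subr_eq0 => /eqP /e2pi_eq1[w wE].
  by apply/dvdzP; exists w; apply: (@intr_inj R); rewrite intrM -wE divfK.
apply: (mulfI e2pi_neq1); rewrite -subrX1 mulr0n mulr0 -e2piX -[X in e2pi X]mulr_natr divfK //.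
by rewrite e2pi_int subrr.
Qed.

End Exponential.

Arguments e2pi : simpl never.

Section Grid.
Variables (R : realType) (k : nat).
Local Notation C := R[i].
Local Notation e2pi := (@e2pi R).
Implicit Types (al : 'I_k -> R).

Definition grid_point (M : nat) (a : {ffun 'I_k -> 'I_M}) : 'I_k -> R :=
  fun j => (a j)%:R / M%:R.

Definition grid_mean (T : unitRingType) (M : nat) (F : ('I_k -> R) -> T) : T :=
  (\sum_(a : {ffun 'I_k -> 'I_M}) F (grid_point a)) / (M ^ k)%:R.

Lemma grid_mean_e2pi M (h : 'I_k -> int) : (0 < M)%N ->
  grid_mean M (fun al => e2pi (\sum_j al j * (h j)%:~R)) = [forall j, (M%:Z %| h j)%Z]%:R.
Proof.
move=> M_gt0; rewrite /grid_mean.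
under eq_bigr => a _ do rewrite e2pi_sum.
rewrite -(bigA_distr_bigA (fun j (a : 'I_M) => e2pi (a%:R / M%:R * (h j)%:~R))) /=.
under eq_bigr => j _ do rewrite sum_e2pi_dvd //.
have [/forallP M_dvd|/forallPn[j M_ndvd]] := boolP [forall j, (M%:Z %| h j)%Z].
  under eq_bigr => j _ do rewrite M_dvd mulr1n.
  by rewrite prodr_const card_ord -natrX divff // pnatr_eq0 -lt0n expn_gt0 M_gt0.
by rewrite (bigD1 j) //= (negbTE M_ndvd) mulr0n !mul0r.
Qed.

Lemma grid_mean_sum (T : unitRingType) M (I : Type) (r : seq I) (P : pred I)
    (F : I -> ('I_k -> R) -> T) :
  grid_mean M (fun al => \sum_(i <- r | P i) F i al) = \sum_(i <- r | P i) grid_mean M (F i).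
Proof. by rewrite /grid_mean exchange_big /= mulr_suml. Qed.

Lemma grid_meanZ (T : unitRingType) M c (F : ('I_k -> R) -> T) :
  grid_mean M (fun al => c * F al) = c * grid_mean M F.
Proof. by rewrite /grid_mean -mulr_sumr mulrA. Qed.

Lemma eq_grid_mean (T : unitRingType) M (F G : ('I_k -> R) -> T) :
  F =1 G -> grid_mean M F = grid_mean M G.
Proof. by move=> FG; rewrite /grid_mean; congr (_ / _); apply: eq_bigr => a _. Qed.

Lemma grid_meanB (T : unitRingType) M (F G : ('I_k -> R) -> T) :
  grid_mean M (fun al => F al - G al) = grid_mean M F - grid_mean M G.
Proof. by rewrite /grid_mean -mulrBl sumrB. Qed.

Lemma ler_grid_mean M (F G : ('I_k -> R) -> R) :
  (forall al, F al <= G al) -> grid_mean M F <= grid_mean M G.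
Proof. by move=> FG; rewrite /grid_mean ler_wpM2r ?invr_ge0 // ler_sum. Qed.

Lemma normc_grid_mean_le M (F : ('I_k -> R) -> C) :
  normc (grid_mean M F) <= grid_mean M (fun al => normc (F al)).
Proof.
rewrite /grid_mean normcM normcV normc_nat ler_wpM2r ?invr_ge0 //; exact: ler_normc_sum.
Qed.

Lemma grid_mean_real M (F : ('I_k -> R) -> R) :
  grid_mean M (fun al => (F al)%:C%C : C) = (grid_mean M F)%:C%C.
Proof. by rewrite /grid_mean rmorphM fmorphV /= rmorph_nat rmorph_sum. Qed.

Lemma grid_mean_count (T : finType) M (w : T -> C) (h : T -> 'I_k -> int) : (0 < M)%N ->
  grid_mean M (fun al => \sum_t w t * e2pi (\sum_j al j * (h t j)%:~R)) =
  \sum_(t | [forall j, (M%:Z %| h t j)%Z]) w t.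
Proof.
move=> M_gt0; rewrite grid_mean_sum [RHS]big_mkcond; apply: eq_bigr => t _.
by rewrite grid_meanZ grid_mean_e2pi //; case: ifP; rewrite ?mulr1 ?mulr0.
Qed.

Definition phase al (x : int) : R := \sum_j al j * x%:~R ^+ j.+1.

Definition exp_sum (I : finType) (pos : I -> int) al : C := \sum_i e2pi (phase al (pos i)).

Lemma normc_exp_sum_le (I : finType) (pos : I -> int) al : normc (exp_sum pos al) <= #|I|%:R.
Proof.
apply: le_trans (ler_normc_sum _ _ _) _.
rewrite (eq_bigr (fun=> 1)) => [|i _]; last exact: normc_e2pi.
by rewrite sumr_const.
Qed.

End Grid.

(** * Curves close to the moment curve modulo p *)

Section ShiftedPowers.
Variable F : fieldType.
Implicit Type c : F.

Lemma size_exp_XaddC c n : size (('X + c%:P) ^+ n) = n.+1.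
Proof. by rewrite -[c]opprK polyCN size_exp_XsubC. Qed.

Lemma coef_exp_XaddC_gt c n m : (n < m)%N -> (('X + c%:P) ^+ n)`_m = 0.
Proof. by move=> nm; rewrite nth_default // size_exp_XaddC. Qed.

Lemma coef_exp_XaddC_lead c n : (('X + c%:P) ^+ n)`_n = 1.
Proof.
have := lead_coef_exp ('X + c%:P) n; rewrite lead_coefXaddC expr1n => <-.
by rewrite lead_coefE size_exp_XaddC.
Qed.

Lemma comp_exp_XaddC c n : ('X + c%:P) ^+ n \Po ('X - c%:P) = 'X^n.
Proof. by rewrite -(comp_Xn_poly ('X + c%:P)) comp_polyXaddC_K. Qed.

Lemma exp_XaddC_free c l (w : 'I_l -> F) :
  \sum_r w r *: ('X + c%:P) ^+ r = 0 -> forall r, w r = 0.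
Proof.
move=> /(congr1 (comp_poly ('X - c%:P))); rewrite comp_poly0 raddf_sum /= => lin r.
have /(congr1 (fun q : {poly F} => q`_r)) := lin.
rewrite coef0 coef_sum (bigD1 r) //= big1 ?addr0 => [|i i_neq_r].
  by rewrite comp_polyZ comp_exp_XaddC coefZ coefXn eqxx mulr1.
rewrite comp_polyZ comp_exp_XaddC coefZ coefXn eq_sym (inj_eq val_inj).
by rewrite (negbTE i_neq_r) mulr0.
Qed.

(* The hypothesis says that X^l divides f' for f = \sum_r v_r (X + c)^(n+r); as
   f' = (X + c)^(n-1) g with size g <= l, the factor g vanishes. *)
Lemma shifted_powers_free l n c (v : 'rV[F]_l) :
  (0 < n)%N -> (forall r : 'I_l, (n + r)%:R != 0 :> F) -> c != 0 ->
  (forall m : 'I_l, \sum_r v 0 r * (('X + c%:P) ^+ (n + r))`_m.+1 = 0) ->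
  v = 0.
Proof.
move=> n_gt0 exp_neq0 c_neq0 coef_f.
pose f := \sum_r v 0 r *: ('X + c%:P) ^+ (n + r).
pose g := \sum_r (v 0 r * (n + r)%:R) *: ('X + c%:P) ^+ r.
have deriv_f : f^`() = ('X + c%:P) ^+ n.-1 * g.
  rewrite /f /g raddf_sum /= mulr_sumr; apply: eq_bigr => r _.
  rewrite derivZ deriv_exp derivD derivX derivC addr0 mul1r.
  rewrite -scalerAr -exprD -scaler_nat scalerA.
  by congr (_ *: _ ^+ _); rewrite -{1}(prednK n_gt0) addSn.
have low_coefs : take_poly l f^`() = 0.
  apply/polyP => m; rewrite coef_take_poly coef0; case: ifP => // ml.
  rewrite coef_deriv /f coef_sum (_ : \sum_r _ = 0) ?mul0rn //.
  by rewrite -[RHS](coef_f (Ordinal ml)); apply: eq_bigr => r _; rewrite coefZ.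
have Xl_dvd : 'X^l %| ('X + c%:P) ^+ n.-1 * g.
  by rewrite -deriv_f -(poly_take_drop l f^`()) low_coefs add0r dvdp_mull.
have Xl_coprime : coprimep 'X^l (('X + c%:P) ^+ n.-1).
  by rewrite coprimep_expl // coprimep_expr // coprimep_sym coprimepX rootE !hornerE.
rewrite (Gauss_dvdpr _ Xl_coprime) in Xl_dvd.
have size_g : (size g <= l)%N.
  apply: leq_trans (size_sum _ _ _) _; apply/bigmax_leqP => r _.
  by rewrite (leq_trans (size_scale_leq _ _)) // size_exp_XaddC.
have g0 : g = 0.
  apply/eqP; apply: contraTT Xl_dvd => g_neq0; apply/negP => /(dvdp_leq g_neq0).
  by rewrite size_polyXn leqNgt ltnS size_g.
apply/rowP => r; have /eqP := exp_XaddC_free g0 r.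
by rewrite mulf_eq0 (negbTE (exp_neq0 r)) orbF mxE => /eqP.
Qed.

End ShiftedPowers.

Section CurveAlgebra.
Variable p : nat.
Hypothesis p_pr : prime p.
Local Notation F := 'F_p.
Local Notation redp := (map_poly (intr : int -> F)).

Lemma dvdz_Fp (x : int) : (p%:Z %| x)%Z = (x%:~R == 0 :> F).
Proof. exact: (dvdz_pcharf (pchar_Fp p_pr)). Qed.

Definition moment_curve_mod k (P : 'I_k -> {poly int}) :=
  exists2 D : int, ~~ (p%:Z %| D)%Z &
  exists Q : 'I_k -> {poly int}, forall j, P j = D *: 'X^(j.+1) + p%:Z *: Q j.

Section NormalForm.
Variables (l : nat) (G : 'I_l -> {poly int}) (xi : int).

Definition taylor_mx : 'M[int]_l := \matrix_(i, m) (G i \Po ('X + xi%:P))`_m.+1.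

Definition normal_poly (r : 'I_l) : {poly int} :=
  \sum_i (\adj taylor_mx) r i *: (G i \Po ('X + xi%:P)).

Lemma coef_normal_poly r (m : 'I_l) : (normal_poly r)`_m.+1 = \det taylor_mx *+ (r == m).
Proof.
have /matrixP/(_ r m) := mul_adj_mx taylor_mx; rewrite !mxE => <-.
by rewrite /normal_poly coef_sum; apply: eq_bigr => i _; rewrite coefZ !mxE.
Qed.

Lemma horner_normal_poly r w :
  (normal_poly r).[w] = \sum_i (\adj taylor_mx) r i * (G i).[xi + w].
Proof.
rewrite /normal_poly horner_sum; apply: eq_bigr => i _.
by rewrite hornerZ horner_comp !hornerE addrC.
Qed.

Lemma normal_form (b : nat) :
  ~~ (p%:Z %| \det taylor_mx)%Z ->
  (forall r m, (l < m)%N -> (p%:Z %| (normal_poly r)`_m * p%:Z ^+ b)%Z) ->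
  exists2 P' : 'I_l -> {poly int}, moment_curve_mod P' &
    forall r z, \sum_i (\adj taylor_mx) r i * (G i).[xi + p%:Z ^+ b * z] =
      (normal_poly r)`_0 + p%:Z ^+ (b * r.+1) * (P' r).[z].
Proof.
move=> det_unit dvd_high; pose N := \max_r size (normal_poly r).
pose high_coef r m := (normal_poly r)`_(l.+1 + m) * p%:Z ^+ (b * (l + m - r)).
have dvd_high_coef r m : (p%:Z %| high_coef r m)%Z.
  rewrite /high_coef; have -> : (b * (l + m - r) = b + b * (l + m - r).-1)%N.
    by rewrite -mulnS prednK // subn_gt0 ltn_addr.
  by rewrite exprD mulrA dvdz_mulr // dvd_high // leq_addr.
pose Q r := \sum_(m < N) (high_coef r m %/ p%:Z)%Z *: 'X^(l.+1 + m) : {poly int}.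
exists (fun r : 'I_l => \det taylor_mx *: 'X^(r.+1) + p%:Z *: Q r).
  by exists (\det taylor_mx) => //; exists Q.
move=> r z; rewrite -horner_normal_poly.
rewrite (@horner_coef_wide _ (1 + (l + N))); last first.
  by apply: leq_trans (leq_bigmax (F := fun r => size (normal_poly r)) r) _; rewrite addnA leq_addl.
rewrite big_split_ord big_ord1 /= expr0 mulr1 big_split_ord /=; congr (_ + _).
rewrite hornerD mulrDr; congr (_ + _).
  under eq_bigr => m _ do rewrite coef_normal_poly.
  rewrite (bigD1 r) //= eqxx big1 ?addr0 => [|m /negbTE]; last first.
    by rewrite eq_sym => ->; rewrite mul0r.
  by rewrite mulr1n exprMn -exprM hornerZ hornerXn add1n mulrCA.
rewrite hornerZ /Q horner_sum !mulr_sumr; apply: eq_bigr => m _.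
rewrite hornerZ hornerXn -/(normal_poly r) [p%:Z * (_ * _)]mulrA.
have <- : high_coef r m = p%:Z * (high_coef r m %/ p%:Z)%Z by rewrite mulrC divzK.
rewrite /bump /= /high_coef !add1n addSn exprMn -exprM.
have -> : (b * (l + m).+1 = b * r.+1 + b * (l + m - r))%N.
  by rewrite -mulnDr addSn subnKC // (leq_trans (ltnW (ltn_ord r))) ?leq_addr.
by rewrite exprD; ring.
Qed.

End NormalForm.

Lemma redp_shift (G : {poly int}) xi :
  redp (G \Po ('X + xi%:P)) = redp G \Po ('X + (xi%:~R)%:P).
Proof. by rewrite map_comp_poly rmorphD /= map_polyX map_polyC. Qed.

Lemma redp_moment_curve k (P : 'I_k -> {poly int}) D Q :
  (forall j, P j = D *: 'X^(j.+1) + p%:Z *: Q j) ->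
  forall j, redp (P j) = (D%:~R : F) *: 'X^(j.+1).
Proof.
move=> PE j; rewrite PE rmorphD /= !map_polyZ /= map_polyXn.
have -> : (p%:Z)%:~R = 0 :> F by apply/eqP; rewrite -dvdz_Fp dvdzz.
by rewrite scale0r addr0.
Qed.

Lemma moment_curve_taylor k (P : 'I_k -> {poly int}) xi : moment_curve_mod P ->
  ~~ (p%:Z %| \det (taylor_mx P xi))%Z /\
  (forall r m, (k < m)%N -> (p%:Z %| (normal_poly P xi r)`_m)%Z).
Proof.
move=> [D pD [Q PE]].
have coefE i m : ((P i \Po ('X + xi%:P))`_m)%:~R =
    (D%:~R : F) * (('X + (xi%:~R)%:P) ^+ i.+1)`_m.
  rewrite -coef_map /= redp_shift (redp_moment_curve PE) comp_polyZ coefZ.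
  by rewrite comp_Xn_poly.
split.
  rewrite dvdz_Fp -det_map_mx det_trig.
    apply/prodf_neq0 => i _; rewrite !mxE /= coefE coef_exp_XaddC_lead mulr1.
    by rewrite -dvdz_Fp.
  apply/is_trig_mxP => i j ij; rewrite !mxE /= coefE coef_exp_XaddC_gt ?mulr0 //.
move=> r m km; rewrite /normal_poly coef_sum; apply: rpred_sum => i _.
rewrite coefZ dvdz_mull // dvdz_Fp coefE coef_exp_XaddC_gt ?mulr0 //.
exact: leq_ltn_trans (ltn_ord i) km.
Qed.

Lemma moment_curve_rescale k (P : 'I_k -> {poly int}) xi b : moment_curve_mod P ->
  exists2 P' : 'I_k -> {poly int}, moment_curve_mod P' &
  exists (U : 'I_k -> 'I_k -> int) (c : 'I_k -> int), forall i z,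
    \sum_j U i j * (P j).[xi + p%:Z ^+ b * z] =
    c i + p%:Z ^+ (b * i.+1) * (P' i).[z].
Proof.
move=> P_mod; have [det_unit dvd_high] := moment_curve_taylor xi P_mod.
have [|P' P'_mod P'E] := @normal_form k P xi b det_unit.
  by move=> r m km; rewrite dvdz_mulr // dvd_high.
exists P' => //.
by exists (fun i j => (\adj (taylor_mx P xi)) i j), (fun i => (normal_poly P xi i)`_0).
Qed.

Section TopCurve.
Variables (k l : nat) (P : 'I_k -> {poly int}) (eta : int).
Hypotheses (P_mod : moment_curve_mod P) (lk : (l <= k)%N).

Lemma redp_normal_poly i :
  redp (normal_poly P eta i) =
  ((normal_poly P eta i)`_0)%:~R%:P + ((\det (taylor_mx P eta))%:~R : F) *: 'X^(i.+1).
Proof.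
have [_ dvd_high] := moment_curve_taylor eta P_mod.
apply/polyP => m; rewrite coef_map /= coefD coefC coefZ coefXn.
have [->|m_gt0] := posnP m; first by rewrite /= mulr0 addr0.
have [km|mk] := ltnP k m.
  have /eqP -> : ((normal_poly P eta i)`_m)%:~R == 0 :> F by rewrite -dvdz_Fp dvd_high.
  by rewrite add0r gtn_eqF ?mulr0 // (leq_ltn_trans (ltn_ord i)).
have ltmk : (m.-1 < k)%N by rewrite prednK.
have := coef_normal_poly P eta i (Ordinal ltmk); rewrite /= prednK // => ->.
rewrite add0r -(inj_eq val_inj) /= -[in RHS](prednK m_gt0) eqSS [in RHS]eq_sym.
by rewrite rmorphMn /= mulr_natr.
Qed.

Lemma top_index_subproof (r : 'I_l) : (k - l + r < k)%N.
Proof. by rewrite -ltn_subRL subKn. Qed.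

Definition top_index (r : 'I_l) : 'I_k := Ordinal (top_index_subproof r).

Definition top_curve (r : 'I_l) : {poly int} :=
  \sum_j (\adj (taylor_mx P eta)) (top_index r) j *: P j.

Lemma horner_top_curve r x :
  (top_curve r).[x] = \sum_j (\adj (taylor_mx P eta)) (top_index r) j * (P j).[x].
Proof. by rewrite /top_curve horner_sum; apply: eq_bigr => j _; rewrite hornerZ. Qed.

Lemma top_curve_recentred r :
  top_curve r \Po ('X + eta%:P) = normal_poly P eta (top_index r).
Proof. by rewrite /top_curve raddf_sum /=; apply: eq_bigr => j _; rewrite comp_polyZ. Qed.

Lemma redp_top_curve xi r :
  redp (top_curve r \Po ('X + xi%:P)) =
  ((normal_poly P eta (top_index r))`_0)%:~R%:P +
  ((\det (taylor_mx P eta))%:~R : F) *: ('X + ((xi - eta)%:~R)%:P) ^+ ((k - l).+1 + r).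
Proof.
have -> : top_curve r \Po ('X + xi%:P) =
    (top_curve r \Po ('X + eta%:P)) \Po ('X + (xi - eta)%:P).
  rewrite -comp_polyA rmorphD /= comp_polyX comp_polyC; congr (_ \Po _).
  by rewrite -addrA -rmorphD /= subrK.
rewrite redp_shift top_curve_recentred redp_normal_poly rmorphD /= comp_polyC.
by rewrite comp_polyZ comp_Xn_poly addSn.
Qed.

Lemma det_taylor_top_curve xi : (k < p)%N -> ~~ (p%:Z %| xi - eta)%Z ->
  ~~ (p%:Z %| \det (taylor_mx top_curve xi))%Z.
Proof.
move=> kp ndvd; rewrite dvdz_Fp -det_map_mx; apply/negP => /det0P[v v_neq0 v_ker].
have [det_unit _] := moment_curve_taylor eta P_mod; rewrite dvdz_Fp in det_unit.
case/negP: v_neq0; apply/eqP.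
apply: (@shifted_powers_free _ l (k - l).+1 ((xi - eta)%:~R : F)) => //.
- move=> r; rewrite -(dvdn_pcharf (pchar_Fp p_pr)) gtnNdvd // addSn.
  by rewrite (leq_trans _ kp) // !ltnS -ltn_subRL subKn.
- by rewrite -dvdz_Fp.
move=> m; have /rowP/(_ m) := v_ker; rewrite !mxE => kerE.
apply: (mulfI det_unit); rewrite mulr0 -[RHS]kerE mulr_sumr; apply: eq_bigr => r _.
by rewrite !mxE -coef_map /= redp_top_curve coefD coefC coefZ add0r mulrCA.
Qed.

Lemma top_curve_near_eta b r y :
  (p%:Z ^+ (b * (k - l).+1) %|
   (top_curve r).[(eta + p%:Z ^+ b * y)%R] - (normal_poly P eta (top_index r))`_0)%Z.
Proof.
have [det_unit dvd_high] := moment_curve_taylor eta P_mod.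
have [|P' _ P'E] := @normal_form k P eta b det_unit.
  by move=> i m km; rewrite dvdz_mulr // dvd_high.
rewrite horner_top_curve P'E addrC addKr; apply: dvdz_mulr; apply: dvdz_exp2l.
by rewrite leq_mul2l /= ltnS leq_addr orbT.
Qed.

End TopCurve.

(* The combinations of the coordinates given by U are constant up to p^(b(k-l+1))
   on the class of eta modulo p^b, whereas on the class of xi modulo p^a they
   rescale to a curve of degree l. *)
Lemma moment_curve_lower k l (P : 'I_k -> {poly int}) xi eta a : moment_curve_mod P ->
  (0 < l <= k)%N -> (k < p)%N -> (0 < a)%N -> ~~ (p%:Z %| xi - eta)%Z ->
  exists2 P' : 'I_l -> {poly int}, moment_curve_mod P' &
  exists (U : 'I_l -> 'I_k -> int) (c d : 'I_l -> int),
  (forall r z, \sum_j U r j * (P j).[xi + p%:Z ^+ a * z] =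
    c r + p%:Z ^+ (a * r.+1) * (P' r).[z]) /\
  (forall b r y, (p%:Z ^+ (b * (k - l).+1) %|
     \sum_j U r j * (P j).[eta + p%:Z ^+ b * y] - d r)%Z).
Proof.
move=> P_mod /andP[_ lk] kp a_gt0 ndvd.
pose G := top_curve P eta lk.
have [|P' P'_mod P'E] := @normal_form l G xi a (det_taylor_top_curve P_mod lk kp ndvd).
  by move=> r m _; rewrite dvdz_mull // -(prednK a_gt0) exprS dvdz_mulr.
pose adjG := \adj (taylor_mx G xi); pose adjP := \adj (taylor_mx P eta).
exists P' => //; exists (fun r j => \sum_i adjG r i * adjP (top_index lk i) j),
  (fun r => (normal_poly G xi r)`_0),
  (fun r => \sum_i adjG r i * (normal_poly P eta (top_index lk i))`_0).
have combE r x : \sum_j (\sum_i adjG r i * adjP (top_index lk i) j) * (P j).[x] =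
    \sum_i adjG r i * (G i).[x].
  under eq_bigr => j _ do rewrite mulr_suml.
  rewrite exchange_big /=; apply: eq_bigr => i _; rewrite horner_top_curve mulr_sumr.
  by apply: eq_bigr => j _; rewrite mulrA.
split=> [r z|b r y]; first by rewrite combE P'E.
rewrite combE -sumrB; apply: rpred_sum => i _.
by rewrite -mulrBr dvdz_mull // top_curve_near_eta.
Qed.

End CurveAlgebra.

Definition tri_num (k : nat) : nat := (k * k.+1)./2.

Lemma double_tri_num k : (2 * tri_num k = k * k.+1)%N.
Proof. by rewrite /tri_num mul2n halfK oddM /= andbN subn0. Qed.

Arguments tri_num : simpl never.

Lemma tri_num_hoelder l d :
  (d.+1 * tri_num l.+1 + tri_num d = d * tri_num l + tri_num (l.+1 + d))%N.
Proof.
apply/eqP; rewrite -(eqn_pmul2l (isT : 0 < 2)%N) !mulnDr.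
by rewrite (mulnCA 2 d.+1) (mulnCA 2 d) !double_tri_num; apply/eqP; lia.
Qed.

Lemma leq_tri_num k l : (l <= k)%N -> (tri_num l <= tri_num k)%N.
Proof. by move=> lk; rewrite half_leq // leq_mul. Qed.

(* The exponents of Hoelder's inequality between the bilinear moments of degrees l,
   l - 1 and k - l. *)
Lemma tri_num_hoelder_complement k l : (0 < l < k)%N ->
  ((k - l).+1 * tri_num l = (k - l) * tri_num l.-1 + (tri_num k - tri_num (k - l)))%N /\
  ((k - l).+1 * (tri_num k - tri_num l) =
   (k - l) * (tri_num k - tri_num l.-1) + tri_num (k - l))%N.
Proof.
move=> /andP[l_gt0 lk].
have le_kl := leq_tri_num (leq_subr l k).
have le_l : (tri_num l <= tri_num k)%N by rewrite leq_tri_num // ltnW.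
have le_pl : (tri_num l.-1 <= tri_num k)%N.
  by rewrite leq_tri_num // (leq_trans (leq_pred _)) // ltnW.
have := tri_num_hoelder l.-1 (k - l); rewrite prednK // subnKC 1?ltnW // => expE.
split; first by rewrite addnBA // -expE addnK.
move: (tri_num k) (tri_num l) (tri_num l.-1) (tri_num (k - l)) (k - l)%N le_kl le_l le_pl expE.
by move=> T A B E d; nia.
Qed.

Section PowerSums.
Variable R : realDomainType.

Lemma exprn_sum_le (J : finType) (x : J -> R) m : (0 < #|J|)%N ->
  (forall j, 0 <= x j) ->
  (\sum_j x j) ^+ m <= #|J|%:R ^+ m * \sum_j x j ^+ m.
Proof.
move=> J_gt0 x_ge0; have /card_gt0P[j0 _] := J_gt0.
pose M := [arg max_(i > j0) x i]%O.
have x_le_max j : x j <= x M by rewrite /M; case: arg_maxP => // i _ /(_ j); apply.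
apply: (@le_trans _ _ ((#|J|%:R * x M) ^+ m)).
  rewrite lerXn2r ?nnegrE ?mulr_ge0 ?sumr_ge0 //.
  by apply: le_trans (ler_sum _ (fun j _ => x_le_max j)) _; rewrite sumr_const mulr_natl.
rewrite exprMn ler_wpM2l ?exprn_ge0 // (bigD1 M) //= lerDl sumr_ge0 // => j _.
exact: exprn_ge0.
Qed.

Lemma ler_mulXn_add (x y : R) m n : 0 <= x -> 0 <= y ->
  x ^+ m * y ^+ n <= x ^+ (m + n) + y ^+ (m + n).
Proof.
move=> x_ge0 y_ge0; rewrite !exprD; have [xy|/ltW yx] := leP x y.
  apply: ler_wpDl; first by rewrite mulr_ge0 ?exprn_ge0.
  by rewrite ler_wpM2r ?exprn_ge0 // lerXn2r.
apply: ler_wpDr; first by rewrite mulr_ge0 ?exprn_ge0.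
by rewrite ler_wpM2l ?exprn_ge0 // lerXn2r.
Qed.

End PowerSums.

Lemma weighted_AGM (R : realFieldType) (u v : R) K : 0 <= u -> 0 <= v ->
  u ^+ K * v <= ((K%:R * u + v) / K.+1%:R) ^+ K.+1.
Proof.
move=> u_ge0 v_ge0.
have := @leif_AGM R 'I_K.+1 predT (fun i => if i == ord_max then v else u).
rewrite /= cardT size_enum_ord !big_ord_recr /= eqxx => -[|agm _]; first by move=> i; case: ifP.
have widen_neq_max (i : 'I_K) : (widen_ord (leqnSn K) i == ord_max) = false.
  by rewrite -(inj_eq val_inj) /= ltn_eqF.
move: agm; under eq_bigr => i _ do rewrite widen_neq_max.
under [in X in _ <= X -> _]eq_bigr => i _ do rewrite widen_neq_max.
by rewrite prodr_const sumr_const !card_ord mulr_natl.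
Qed.

Section Hoelder.
Variables (R : realType) (J : finType) (x y z : J -> R) (K : nat).
Hypotheses (x_ge0 : forall j, 0 <= x j) (y_ge0 : forall j, 0 <= y j).
Hypotheses (z_ge0 : forall j, 0 <= z j) (zE : forall j, z j ^+ K.+1 <= x j ^+ K * y j).
Local Notation X := (\sum_j x j).
Local Notation Y := (\sum_j y j).

Let X_ge0 : 0 <= X. Proof. exact: sumr_ge0. Qed.
Let Y_ge0 : 0 <= Y. Proof. exact: sumr_ge0. Qed.

Lemma hoelder_expn_pointwise (g : R) j : 0 < g -> g ^+ K.+1 = X ^+ K * Y ->
  z j <= g * ((K%:R * (x j / X) + y j / Y) / K.+1%:R).
Proof.
move=> g_gt0 gE.
have XK_Y_gt0 : 0 < X ^+ K * Y by rewrite -gE exprn_gt0.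
have agm := @weighted_AGM R (x j / X) (y j / Y) K (divr_ge0 (x_ge0 j) X_ge0)
  (divr_ge0 (y_ge0 j) Y_ge0).
have : 0 <= (K%:R * (x j / X) + y j / Y) / K.+1%:R.
  by rewrite divr_ge0 // addr_ge0 ?mulr_ge0 ?invr_ge0.
move: agm; set s := _ / K.+1%:R => agm s_ge0.
suff : z j ^+ K.+1 <= (g * s) ^+ K.+1 by rewrite ler_pXn2r // nnegrE ?z_ge0 // mulr_ge0 // ltW.
rewrite exprMn gE; apply: le_trans (zE j) _.
rewrite -ler_pdivrMl //; apply: le_trans agm.
rewrite exprMn exprVn invfM le_eqVlt; apply/orP; left; apply/eqP.
by rewrite mulrACA [X ^- K * _]mulrC [Y^-1 * _]mulrC.
Qed.

Lemma hoelder_expn_eq0 j : X ^+ K * Y = 0 -> z j = 0.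
Proof.
move=> XY0; apply/eqP; have := zE j.
suff -> : x j ^+ K * y j = 0.
  move=> zK_le0; have : z j ^+ K.+1 == 0 by rewrite eq_le zK_le0 exprn_ge0.
  by rewrite expf_eq0.
have summand_eq0 (f : J -> R) : (forall i, 0 <= f i) -> \sum_i f i = 0 -> f j = 0.
  move=> f_ge0 /eqP; rewrite psumr_eq0 // => /allP /(_ j).
  by rewrite mem_index_enum => /(_ isT) /eqP.
move/eqP: XY0; rewrite mulf_eq0 expf_eq0 => /orP[/andP[K_gt0 /eqP/summand_eq0 ->]|].
- by rewrite expr0n gtn_eqF // mul0r.
- exact: x_ge0.
by move=> /eqP/summand_eq0 ->; rewrite ?mulr0.
Qed.

Lemma hoelder_expn : (\sum_j z j) ^+ K.+1 <= X ^+ K * Y.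
Proof.
have [XY0|XY_neq0] := eqVneq (X ^+ K * Y) 0.
  by rewrite XY0 big1 ?expr0n // => j _; exact: hoelder_expn_eq0.
have XY_gt0 : 0 < X ^+ K * Y by rewrite lt_def XY_neq0 mulr_ge0 ?exprn_ge0.
pose g := (X ^+ K * Y) `^ (K.+1%:R^-1).
have g_gt0 : 0 < g by rewrite powR_gt0.
have gE : g ^+ K.+1 = X ^+ K * Y.
  by rewrite -powR_mulrn ?powR_ge0 // -powRrM mulVf ?pnatr_eq0 // powRr1 // ltW.
rewrite -gE lerXn2r ?nnegrE ?sumr_ge0 ?(ltW g_gt0) //.
apply: le_trans (ler_sum _ (fun j _ => hoelder_expn_pointwise j g_gt0 gE)) _.
rewrite -mulr_sumr -mulr_suml big_split /= -mulr_sumr -!mulr_suml ler_piMr ?(ltW g_gt0) //.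
rewrite ler_pdivrMr ?ltr0n // mul1r -natr1 lerD //.
  by rewrite ler_piMr //; have [->|X_neq0] := eqVneq X 0; rewrite ?mul0r ?divff.
by have [->|Y_neq0] := eqVneq Y 0; rewrite ?mul0r ?divff.
Qed.

End Hoelder.

Lemma dvdz_horner_sub (Q : {poly int}) (x y : int) :
  (x - y %| Q.[x] - Q.[y])%Z.
Proof.
elim/poly_ind: Q => [|Q c IHQ]; first by rewrite !horner0 subrr dvdz0.
rewrite !hornerMXaddC.
have -> : Q.[x] * x + c - (Q.[y] * y + c) = (Q.[x] - Q.[y]) * x + Q.[y] * (x - y) by ring.
by apply: rpredD; [rewrite dvdz_mulr|rewrite dvdz_mull].
Qed.

Section IntResidue.
Variable q : nat.
Hypothesis q_gt0 : (0 < q)%N.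

Let q_neq0 : q%:Z != 0. Proof. by rewrite eqz_nat -lt0n. Qed.

Lemma int_residue_subproof (x : int) : (`|(x %% q%:Z)%Z|%N < q)%N.
Proof. by rewrite -ltz_nat gez0_abs ?modz_ge0 // ltz_pmod // ltz_nat. Qed.

Definition int_residue (x : int) : 'I_q := Ordinal (int_residue_subproof x).

Lemma dvdz_sub_ord (x : int) (t : 'I_q) : (q%:Z %| x - t%:Z)%Z = (t == int_residue x).
Proof.
rewrite -(inj_eq val_inj) /= -eqz_mod_dvd -eqz_nat gez0_abs ?modz_ge0 //.
by rewrite [X in _ == X]modz_small ?ltz_nat ?ltn_ord // eq_sym.
Qed.

Lemma int_residueE (x : int) : exists z : int, x = (int_residue x : nat)%:Z + z * q%:Z.
Proof.
have := dvdz_sub_ord x (int_residue x); rewrite eqxx => /dvdzP[z xE].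
by exists z; rewrite -xE addrC subrK.
Qed.

Lemma int_residue_eq (x y : int) :
  (int_residue x == int_residue y) = (q%:Z %| x - y)%Z.
Proof.
rewrite eq_sym -dvdz_sub_ord; have [z yE] := int_residueE y.
have -> : x - y = x - (int_residue y : nat)%:Z - z * q%:Z by rewrite {1}yE opprD addrA.
by rewrite [RHS]rpredBr // dvdz_mull.
Qed.

End IntResidue.

(** * Nested efficient congruencing *)

Section ResidueParseval.
Variables (R : realType) (I : finType) (q : nat).
Hypothesis q_gt0 : (0 < q)%N.
Implicit Types (pos : I -> int) (f : I -> R[i]).

Lemma sum_normc_twist_sqr pos f :
  (\sum_(b < q) normc (\sum_i e2pi (b%:R / q%:R * (pos i)%:~R) * f i) ^+ 2)%:C%C =
  q%:R * \sum_i \sum_(i' | (q%:Z %| pos i - pos i')%Z) f i * (f i')^*%C.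
Proof.
rewrite rmorph_sum /= mulr_sumr.
under eq_bigr => b _ do rewrite normc_sqr rmorph_sum /= mulr_suml.
rewrite exchange_big /=; apply: eq_bigr => i _.
under eq_bigr => b _ do rewrite mulr_sumr.
rewrite exchange_big /= mulr_sumr [RHS]big_mkcond /=; apply: eq_bigr => i' _.
under eq_bigr => b _ do rewrite conjcM -e2piN mulrACA -e2piD -mulrBr -intrB.
by rewrite -mulr_suml sum_e2pi_dvd //; case: ifP; rewrite ?mul0r.
Qed.

Lemma sum_normc_residue_sqr pos f :
  (\sum_(t < q) normc (\sum_(i | (q%:Z %| pos i - t%:Z)%Z) f i) ^+ 2)%:C%C =
  \sum_i \sum_(i' | (q%:Z %| pos i - pos i')%Z) f i * (f i')^*%C.
Proof.
rewrite rmorph_sum /=.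
under eq_bigr => t _ do rewrite normc_sqr rmorph_sum /= mulr_suml big_mkcond.
rewrite exchange_big /=; apply: eq_bigr => i _.
move: (int_residue q_gt0 (pos i)) (dvdz_sub_ord q_gt0 (pos i)) => t0 dvd_pos.
rewrite (bigD1 t0) //= dvd_pos eqxx [X in _ + X]big1 ?addr0 => [|t t_neq]; last first.
  by rewrite dvd_pos (negbTE t_neq).
rewrite mulr_sumr; apply: eq_bigl => i'.
have := dvd_pos t0; rewrite eqxx => dvd_i.
have -> : pos i - pos i' = (pos i - t0%:Z) - (pos i' - t0%:Z) by ring.
by rewrite [RHS]rpredBl.
Qed.

Lemma residue_parseval pos pos' f :
  (forall i i', (q%:Z %| pos' i - pos' i')%Z = (q%:Z %| pos i - pos i')%Z) ->
  \sum_(b < q) normc (\sum_i e2pi (b%:R / q%:R * (pos' i)%:~R) * f i) ^+ 2 =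
  q%:R * \sum_(t < q) normc (\sum_(i | (q%:Z %| pos i - t%:Z)%Z) f i) ^+ 2.
Proof.
move=> same_classes; apply: (@complexI R).
rewrite rmorphM rmorph_nat /= sum_normc_twist_sqr sum_normc_residue_sqr.
by congr (_ * _); apply: eq_bigr => i _; apply: eq_bigl.
Qed.

End ResidueParseval.

Section Moment.
Variables (R : realType) (Om : finType).
Implicit Types (f g : Om -> R[i]) (Phi : Om -> R).

Definition moment f (m : nat) Phi : R := \sum_w normc (f w) ^+ m * Phi w.

Lemma moment_ge0 f m Phi : (forall w, 0 <= Phi w) -> 0 <= moment f m Phi.
Proof.
by move=> Phi_ge0; rewrite sumr_ge0 // => w _; rewrite mulr_ge0 ?exprn_ge0 ?normc_ge0.
Qed.

Lemma eq_moment f g m Phi : f =1 g -> moment f m Phi = moment g m Phi.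
Proof. by move=> fg; apply: eq_bigr => w _; rewrite fg. Qed.

Lemma moment_swap f g m1 m2 Phi :
  moment f m1 (fun w => normc (g w) ^+ m2 * Phi w) =
  moment g m2 (fun w => normc (f w) ^+ m1 * Phi w).
Proof. by apply: eq_bigr => w _; rewrite mulrCA. Qed.

Lemma moment_sum_le (J : finType) (f : J -> Om -> R[i]) m Phi :
  (0 < #|J|)%N -> (forall w, 0 <= Phi w) ->
  moment (fun w => \sum_j f j w) m Phi <= #|J|%:R ^+ m * \sum_j moment (f j) m Phi.
Proof.
move=> J_gt0 Phi_ge0; rewrite /moment exchange_big mulr_sumr /=; apply: ler_sum => w _.
rewrite -mulr_suml mulrA ler_wpM2r //.
apply: (@le_trans _ _ ((\sum_j normc (f j w)) ^+ m)).
  rewrite lerXn2r ?nnegrE ?normc_ge0 ?sumr_ge0 ?ler_normc_sum // => j _.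
  exact: normc_ge0.
by apply: exprn_sum_le => // j; exact: normc_ge0.
Qed.

End Moment.

Section BilinearSplitting.
Variables (R : realFieldType) (J : finType).

Lemma two_large_summands (x : J -> R) (s : R) :
  (0 < #|J|)%N -> (forall j, 0 <= x j) -> s <= \sum_j x j ->
  exists2 M, (forall j, x j <= x M) &
  s <= 2 * x M \/ exists2 j, j != M & s <= 2 * #|J|%:R * x j.
Proof.
move=> J_gt0 x_ge0 le_sum; have /card_gt0P[j0 _] := J_gt0.
pose M := [arg max_(i > j0) x i]%O.
exists M => [j|]; first by rewrite /M; case: arg_maxP => // i _ /(_ j); apply.
have [|lt_s] := leP s (2 * x M); [by left|right].
have J_gt0R : 0 < #|J|%:R :> R by rewrite ltr0n.
apply: contrapT => no_second.
have small j : j != M -> x j <= s / (2 * #|J|%:R).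
  move=> j_neq; rewrite ler_pdivlMr ?mulr_gt0 // mulrC leNgt; apply/negP => lt_j.
  by apply: no_second; exists j => //; exact: ltW.
have s_ge0 : 0 <= s by apply: le_trans (ltW lt_s); rewrite mulr_ge0.
suff : \sum_j x j <= x M + s / 2 by move/(le_trans le_sum); lra.
rewrite (bigD1 M) //= lerD2l; apply: le_trans (ler_sum _ small) _.
apply: (@le_trans _ _ (\sum_(j : J) s / (2 * #|J|%:R))).
  by rewrite [leRHS](bigD1 M) //= lerDr divr_ge0 // mulr_ge0.
by rewrite sumr_const -[_ *+ _]mulr_natr invfM mulrA -mulrA mulVf ?mulr1 // gt_eqF.
Qed.

Lemma bilinear_pointwise (x : J -> R) (s : R) m1 m2 :
  (0 < #|J|)%N -> (forall j, 0 <= x j) -> 0 <= s -> s <= \sum_j x j ->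
  s ^+ (m1 + m2) <= 2 ^+ (m1 + m2) * \sum_j x j ^+ (m1 + m2) +
    (2 * #|J|%:R) ^+ (m1 + m2) * \sum_j \sum_(j' | j' != j) x j ^+ m1 * x j' ^+ m2.
Proof.
move=> J_gt0 x_ge0 s_ge0 /(two_large_summands J_gt0 x_ge0)[M x_le [le_max|[j jM le_j]]].
  apply: ler_wpDr.
    rewrite mulr_ge0 ?exprn_ge0 ?mulr_ge0 // sumr_ge0 // => i _; rewrite sumr_ge0 // => i' _.
    by rewrite mulr_ge0 ?exprn_ge0.
  apply: (@le_trans _ _ ((2 * x M) ^+ (m1 + m2))); first by rewrite lerXn2r ?nnegrE ?mulr_ge0.
  rewrite exprMn ler_wpM2l ?exprn_ge0 // (bigD1 M) //= lerDl sumr_ge0 // => i _.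
  exact: exprn_ge0.
apply: ler_wpDl.
  by rewrite mulr_ge0 ?exprn_ge0 // sumr_ge0 // => i _; exact: exprn_ge0.
apply: (@le_trans _ _ ((2 * #|J|%:R) ^+ (m1 + m2) * (x M ^+ m1 * x j ^+ m2))).
  apply: (@le_trans _ _ ((2 * #|J|%:R * x j) ^+ (m1 + m2))).
    by rewrite lerXn2r ?nnegrE ?mulr_ge0.
  rewrite exprMn ler_wpM2l ?exprn_ge0 ?mulr_ge0 // exprD ler_wpM2r ?exprn_ge0 //.
  by rewrite lerXn2r ?nnegrE.
rewrite ler_wpM2l ?exprn_ge0 ?mulr_ge0 // (bigD1 M) //= (bigD1 j) //= -addrA lerDl.
rewrite addr_ge0 ?sumr_ge0 // => [i _|i _]; first by rewrite mulr_ge0 ?exprn_ge0.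
by rewrite sumr_ge0 // => ? _; rewrite mulr_ge0 ?exprn_ge0.
Qed.

End BilinearSplitting.

Lemma moment_sum_bilinear (R : realType) (Om J : finType) (f : J -> Om -> R[i]) m1 m2 Phi :
  (0 < #|J|)%N -> (forall w, 0 <= Phi w) ->
  moment (fun w => \sum_j f j w) (m1 + m2) Phi <=
  2 ^+ (m1 + m2) * \sum_j moment (f j) (m1 + m2) Phi +
  (2 * #|J|%:R) ^+ (m1 + m2) *
    \sum_j \sum_(j' | j' != j) moment (f j) m1 (fun w => normc (f j' w) ^+ m2 * Phi w).
Proof.
move=> J_gt0 Phi_ge0; rewrite /moment exchange_big /=.
under [X in _ <= _ + _ * X]eq_bigr => j _ do rewrite exchange_big /=.
rewrite [X in _ <= _ + _ * X]exchange_big /= !mulr_sumr -big_split /=.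
apply: ler_sum => w _.
have split_w := @bilinear_pointwise _ J (fun j => normc (f j w)) (normc (\sum_j f j w)) m1 m2
  J_gt0 (fun j => normc_ge0 _) (normc_ge0 _) (ler_normc_sum _ _ _).
apply: le_trans (ler_wpM2r (Phi_ge0 w) split_w) _.
rewrite mulrDl -!mulrA !mulr_suml le_eqVlt; apply/orP; left; apply/eqP.
congr (_ + _ * _); apply: eq_bigr => j _; rewrite mulr_suml.
by apply: eq_bigr => j' _; rewrite mulrA.
Qed.

Section Decoupling.
Variables (R : realType) (p : nat).
Hypothesis p_pr : prime p.
Local Notation C := R[i].
Local Notation e2pi := (@e2pi R).
Local Notation pz := (p%:Z).
Local Notation pr := (p%:R : R).

Let p_gt0 : (0 < p)%N. Proof. exact: prime_gt0. Qed.
Let pr_gt0 : 0 < pr. Proof. by rewrite ltr0n. Qed.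
Let pr_ge1 : 1 <= pr. Proof. by rewrite ler1n. Qed.
Let pr_neq0 : pr != 0. Proof. by rewrite gt_eqF. Qed.

Lemma intr_pexp m : (pz ^+ m)%:~R = pr ^+ m.
Proof. by rewrite rmorphXn. Qed.

Lemma pexp_neq0 m : pz ^+ m != 0.
Proof. by rewrite expf_neq0 // eqz_nat -lt0n. Qed.

Lemma pexp_natz m : (p ^ m)%N%:Z = pz ^+ m.
Proof. by rewrite -[pz]natz -rmorphXn /= natz. Qed.

Section ClassSums.
Variables (I Om : finType) (pos : I -> int) (F : I -> Om -> C).

Definition class_sum (n : nat) (z : int) (w : Om) : C :=
  \sum_(i | (pz ^+ n %| pos i - z)%Z) F i w.

Lemma class_sum0 z w : class_sum 0 z w = \sum_i F i w.
Proof. by rewrite /class_sum; apply: eq_bigl => i; rewrite expr0 dvd1z. Qed.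

Lemma dvd_class_coarser a b x z t :
  (pz ^+ (a + b) %| x - (z + pz ^+ a * t))%Z -> (pz ^+ a %| x - z)%Z.
Proof.
move=> dvd_ab; have : (pz ^+ a %| x - (z + pz ^+ a * t))%Z.
  by apply: dvdz_trans dvd_ab; rewrite exprD dvdz_mulr.
by rewrite opprD addrA rpredBr // dvdz_mulr.
Qed.

Lemma class_sum_split a a' z w : (a <= a')%N ->
  class_sum a z w = \sum_(t < p ^ (a' - a)) class_sum a' (z + pz ^+ a * t%:Z) w.
Proof.
move=> aa; rewrite /class_sum.
under [RHS]eq_bigr => t _ do rewrite big_mkcond.
rewrite exchange_big /= big_mkcond; apply: eq_bigr => i _.
have pexpE : pz ^+ a' = pz ^+ a * pz ^+ (a' - a) by rewrite -exprD subnKC.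
case: ifP => [/dvdzP[y posE]|ndvd]; last first.
  rewrite big1 // => t _; case: ifP => // dvd_t; case/negP: ndvd.
  by apply: (@dvd_class_coarser a (a' - a) _ _ t%:Z); rewrite subnKC.
have q_gt0 : (0 < p ^ (a' - a))%N by rewrite expn_gt0 p_gt0.
move: (int_residue q_gt0 y) (dvdz_sub_ord q_gt0 y) => t0 dvd_y.
have condE (t : 'I_(p ^ (a' - a))) :
    (pz ^+ a' %| pos i - (z + pz ^+ a * t%:Z))%Z = (t == t0).
  rewrite opprD addrA posE mulrC -mulrBr pexpE dvdz_mul2l ?pexp_neq0 //.
  by rewrite -dvd_y pexp_natz.
rewrite (bigD1 t0) //= condE eqxx big1 ?addr0 // => t t_neq.
by rewrite condE (negbTE t_neq).
Qed.

Lemma moment_class_sum_le a a' z m Phi B : (a <= a')%N -> (forall w, 0 <= Phi w) ->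
  (forall t, moment (class_sum a' (z + pz ^+ a * t)) m Phi <= B) ->
  moment (class_sum a z) m Phi <= (pr ^+ (a' - a)) ^+ m.+1 * B.
Proof.
move=> aa Phi_ge0 le_B; pose q := (p ^ (a' - a))%N.
have q_gt0 : (0 < #|'I_q|)%N by rewrite card_ord expn_gt0 p_gt0.
rewrite (eq_moment _ _ (fun w => class_sum_split z w aa)).
apply: le_trans (moment_sum_le (fun t : 'I_q => _) m q_gt0 Phi_ge0) _.
rewrite card_ord natrX exprSr -mulrA ler_wpM2l ?exprn_ge0 //.
rewrite -natrX -[X in X%:R * _](card_ord q) mulr_natl -sumr_const.
by apply: ler_sum => t _; exact: le_B.
Qed.

(* Rescaled coordinates on the class of xi modulo p^a: pos i = xi + p^a (rescaled_pos i). *)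
Definition rescaled_pos (a : nat) (xi : int) (i : I) : int := ((pos i - xi) %/ pz ^+ a)%Z.

Definition class_family (a : nat) (xi : int) (i : I) (w : Om) : C :=
  if (pz ^+ a %| pos i - xi)%Z then F i w else 0.

Lemma rescaled_posE a xi i : (pz ^+ a %| pos i - xi)%Z ->
  pos i = xi + pz ^+ a * rescaled_pos a xi i.
Proof. by move=> dvd_i; rewrite /rescaled_pos mulrC divzK // addrC subrK. Qed.

Lemma sum_class_family a xi w : \sum_i class_family a xi i w = class_sum a xi w.
Proof. by rewrite /class_sum [RHS]big_mkcond. Qed.

End ClassSums.

Lemma class_sum_rescaled (I Om : finType) (pos : I -> int) (F : I -> Om -> C) a b xi z w :
  class_sum (rescaled_pos pos a xi) (class_family pos F a xi) b z w =
  class_sum pos F (a + b) (xi + pz ^+ a * z) w.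
Proof.
rewrite /class_sum big_mkcond [RHS]big_mkcond; apply: eq_bigr => i _; rewrite /class_family.
have [dvd_i|ndvd] := boolP (pz ^+ a %| pos i - xi)%Z.
  rewrite [in RHS](rescaled_posE dvd_i) opprD addrACA subrr add0r -mulrBr exprD.
  by rewrite dvdz_mul2l ?pexp_neq0.
have -> : (pz ^+ (a + b) %| pos i - (xi + pz ^+ a * z))%Z = false.
  by apply: contraNF ndvd => /dvd_class_coarser.
by case: ifP.
Qed.

Section Modulation.
Variables (I Om : finType).
Implicit Types (F : I -> Om -> C) (Phi : Om -> R) (theta : I -> R) (pos : I -> int).

(* A model for translating the frequency of an exponential sum. *)
Definition modulation F Phi theta :=
  exists2 tau : Om -> Om, injective tau &
  exists2 u : Om -> C, (forall w, normc (u w) = 1 /\ Phi (tau w) = Phi w) &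
  forall i w, F i (tau w) = u w * e2pi (theta i) * F i w.

Lemma moment_modulation F Phi theta m : modulation F Phi theta ->
  moment (fun w => \sum_i F i w) m Phi = moment (fun w => \sum_i e2pi (theta i) * F i w) m Phi.
Proof.
move=> [tau tau_inj [u u_unit FE]].
rewrite /moment (reindex_inj tau_inj); apply: eq_bigr => w _.
have [u1 ->] := u_unit w; congr (_ ^+ m * _).
under eq_bigr => i _ do rewrite FE -mulrA.
by rewrite -mulr_sumr normcM u1 mul1r.
Qed.

Lemma modulation_weight F Phi theta pos b eta m (d : R) : modulation F Phi theta ->
  (forall i, (pz ^+ b %| pos i - eta)%Z -> exists z : int, theta i = d + z%:~R) ->
  modulation F (fun w => normc (class_sum pos F b eta w) ^+ m * Phi w) theta.
Proof.
move=> [tau tau_inj [u u_unit FE]] theta_const.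
exists tau => //; exists u => // w; have [u1 ->] := u_unit w; split=> //; congr (_ ^+ m * _).
have -> : class_sum pos F b eta (tau w) = u w * e2pi d * class_sum pos F b eta w.
  rewrite /class_sum mulr_sumr; apply: eq_bigr => i /theta_const[z thetaE].
  by rewrite FE thetaE e2piDint.
by rewrite !normcM u1 normc_e2pi !mul1r.
Qed.

Lemma modulation_class_family F Phi theta theta' pos a xi (c : R) : modulation F Phi theta ->
  (forall i, (pz ^+ a %| pos i - xi)%Z -> theta i = c + theta' i) ->
  modulation (class_family pos F a xi) Phi theta'.
Proof.
move=> [tau tau_inj [u u_unit FE]] thetaE.
exists tau => //; exists (fun w => u w * e2pi c).
  by move=> w; have [u1 ->] := u_unit w; rewrite normcM u1 normc_e2pi mul1r.
move=> i w; rewrite /class_family; case: ifP => [dvd_i|]; last by rewrite mulr0.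
by rewrite FE thetaE // e2piD !mulrA.
Qed.

Definition curve_phase k (P : 'I_k -> {poly int}) pos (m : nat) (be : 'I_k -> int) (i : I) : R :=
  (\sum_j be j * (P j).[pos i])%:~R / pr ^+ m.

Definition equivariant k (P : 'I_k -> {poly int}) (m : nat) pos F Phi :=
  (forall w, 0 <= Phi w) /\ forall be, modulation F Phi (curve_phase P pos m be).

Definition decoupling_datum k n (P : 'I_k -> {poly int}) pos F Phi (La : R) :=
  [/\ moment_curve_mod p P, equivariant P (k * n) pos F Phi &
   forall z, moment (class_sum pos F n z) (2 * tri_num k) Phi <= La].

Lemma decoupling_datum_ge0 k n (P : 'I_k -> {poly int}) pos F Phi La :
  decoupling_datum n P pos F Phi La -> 0 <= La.
Proof. by case=> _ [Phi_ge0 _] /(_ 0); apply: le_trans; exact: moment_ge0. Qed.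

End Modulation.

(* Square-root cancellation among the p^n residue classes at the critical exponent
   k(k+1), up to the factor D. *)
Definition decoupling k n (D : R) :=
  forall (P : 'I_k -> {poly int}) (I Om : finType) (pos : I -> int)
    (F : I -> Om -> C) (Phi : Om -> R) La,
  decoupling_datum n P pos F Phi La ->
  moment (fun w => \sum_i F i w) (2 * tri_num k) Phi <= D * pr ^+ (n * tri_num k) * La.

Lemma decoupling_le k n D D' : D <= D' -> decoupling k n D -> decoupling k n D'.
Proof.
move=> DD decD P I Om pos F Phi La datum; apply: le_trans (decD _ _ _ _ _ _ _ datum) _.
by rewrite !ler_wpM2r ?exprn_ge0 // (decoupling_datum_ge0 datum).
Qed.

Lemma decoupling_trivial k n : decoupling k n (pr ^+ (n * (tri_num k).+1)).
Proof.
move=> P I Om pos F Phi La [_ [Phi_ge0 _] le_La].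
have := @moment_class_sum_le _ _ pos F 0 n 0 (2 * tri_num k) Phi La (leq0n n) Phi_ge0
  (fun t => le_La _).
rewrite subn0 -exprM (eq_moment _ _ (class_sum0 pos F 0)).
move/le_trans; apply; rewrite -exprD le_eqVlt; apply/orP; left; apply/eqP.
by congr (_ ^+ _ * _); lia.
Qed.

Lemma moment_curve1_dvd (P : 'I_1 -> {poly int}) n x y : moment_curve_mod p P ->
  (pz ^+ n %| (P ord0).[x] - (P ord0).[y])%Z = (pz ^+ n %| x - y)%Z.
Proof.
move=> [D ndvd_D [Q PE]].
have /dvdzP[c cE] := dvdz_horner_sub (Q ord0) x y.
have -> : (P ord0).[x] - (P ord0).[y] = (x - y) * (D + pz * c).
  rewrite !PE !hornerD !hornerZ !hornerXn !expr1.
  by rewrite opprD addrACA -!mulrBr cE; ring.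
rewrite mulrC Gauss_dvdzr // coprimezXl //.
rewrite coprimezE /= prime_coprime // -(@dvdzE pz).
by rewrite rpredDr // dvdz_mulr.
Qed.

(* Averaging over the modulations is Parseval on Z/p^n. *)
Lemma decoupling_degree1 n : decoupling 1 n 1.
Proof.
move=> P I Om pos F Phi La [P_mod [Phi_ge0 modul] le_La].
have -> : (2 * tri_num 1 = 2)%N by [].
have -> : tri_num 1 = 1%N by [].
rewrite muln1 mul1r -natrX; set q := (p ^ n)%N.
have q_gt0 : (0 < q)%N by rewrite expn_gt0 p_gt0.
have twistE (b : 'I_q) : moment (fun w => \sum_i F i w) 2 Phi =
    moment (fun w => \sum_i e2pi (b%:R / q%:R * (P ord0).[pos i]%:~R) * F i w) 2 Phi.
  rewrite (moment_modulation 2 (modul (fun=> b%:Z))); apply: eq_moment => w.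
  apply: eq_bigr => i _; rewrite /curve_phase big_ord1 intrM mul1n natrX.
  by rewrite mulrAC.
have averaged : q%:R * moment (fun w => \sum_i F i w) 2 Phi =
    q%:R * \sum_(t < q) moment (class_sum pos F n t%:Z) 2 Phi.
  rewrite -[X in X%:R * _ = _](card_ord q) mulr_natl -sumr_const.
  rewrite (eq_bigr _ (fun b _ => twistE b)) /moment exchange_big [in RHS]exchange_big /=.
  rewrite mulr_sumr; apply: eq_bigr => w _; rewrite -!mulr_suml mulrA; congr (_ * _).
  rewrite (@residue_parseval _ _ q q_gt0 pos) => [|i i']; last first.
    by rewrite pexp_natz moment_curve1_dvd.
  by rewrite pexp_natz.
have q_gt0R : 0 < q%:R :> R by rewrite ltr0n.
rewrite -(ler_pM2l q_gt0R) averaged ler_pM2l // -[X in _ <= X%:R * _](card_ord q) mulr_natl.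
by rewrite -sumr_const; apply: ler_sum => t _; exact: le_La.
Qed.

Section Pullback.
Variables (k l : nat) (P : 'I_k -> {poly int}) (P' : 'I_l -> {poly int}).
Variables (U : 'I_l -> 'I_k -> int) (c : 'I_l -> int) (xi : int) (a a' m : nat).
Hypotheses (le_aa' : (a <= a')%N) (le_la' : (l * a' <= m)%N).
Hypothesis UE : forall r z, \sum_j U r j * (P j).[xi + pz ^+ a * z] =
  c r + pz ^+ (a * r.+1) * (P' r).[z].
Variables (I Om : finType) (pos : I -> int) (F : I -> Om -> C).

(* The modulation of the original family that induces the modulation be of the
   family rescaled to the class of xi. *)
Definition pullback (be : 'I_l -> int) (j : 'I_k) : int :=
  pz ^+ (m - l * a') * \sum_r be r * pz ^+ (a * (l - r.+1)) * U r j.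

Lemma curve_phase_pullback be i :
  curve_phase P pos m (pullback be) i =
  (\sum_r be r * pz ^+ (a * (l - r.+1)) * \sum_j U r j * (P j).[pos i])%:~R / pr ^+ (l * a').
Proof.
have -> : \sum_r be r * pz ^+ (a * (l - r.+1)) * \sum_j U r j * (P j).[pos i] =
    \sum_j (\sum_r be r * pz ^+ (a * (l - r.+1)) * U r j) * (P j).[pos i].
  under [RHS]eq_bigr => j _ do rewrite mulr_suml.
  rewrite [RHS]exchange_big /=; apply: eq_bigr => r _.
  by rewrite mulr_sumr; apply: eq_bigr => j _; rewrite mulrA.
rewrite /curve_phase /pullback; under eq_bigr => j _ do rewrite -mulrA.
rewrite -mulr_sumr intrM intr_pexp -{2}(subnK le_la') exprD invfM mulrACA divff ?mul1r //.
by rewrite expf_neq0.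
Qed.

Lemma curve_phase_pullback_class be i : (pz ^+ a %| pos i - xi)%Z ->
  curve_phase P pos m (pullback be) i =
  (\sum_r be r * pz ^+ (a * (l - r.+1)) * c r)%:~R / pr ^+ (l * a') +
  curve_phase P' (rescaled_pos pos a xi) (l * (a' - a)) be i.
Proof.
move=> dvd_i; rewrite curve_phase_pullback (rescaled_posE dvd_i).
under eq_bigr => r _ do rewrite UE mulrDr.
rewrite big_split /= intrD mulrDl; congr (_ + _).
have -> : \sum_r be r * pz ^+ (a * (l - r.+1)) *
      (pz ^+ (a * r.+1) * (P' r).[rescaled_pos pos a xi i]) =
    pz ^+ (a * l) * \sum_r be r * (P' r).[rescaled_pos pos a xi i].
  rewrite mulr_sumr; apply: eq_bigr => r _.
  have -> : pz ^+ (a * l) = pz ^+ (a * (l - r.+1)) * pz ^+ (a * r.+1).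
    by rewrite -exprD -mulnDr subnK.
  by ring.
have -> : (l * a' = a * l + l * (a' - a))%N by rewrite [(a * l)%N]mulnC -mulnDr subnKC.
by rewrite /curve_phase intrM intr_pexp exprD invfM mulrACA divff ?mul1r // expf_neq0.
Qed.

Lemma decoupling_on_class D (W : Om -> R) La : decoupling l (a' - a) D ->
  moment_curve_mod p P' -> (forall w, 0 <= W w) ->
  (forall be, modulation F W (curve_phase P pos m (pullback be))) ->
  (forall z, moment (class_sum pos F a' (xi + pz ^+ a * z)) (2 * tri_num l) W <= La) ->
  moment (class_sum pos F a xi) (2 * tri_num l) W <= D * pr ^+ ((a' - a) * tri_num l) * La.
Proof.
move=> decD P'_mod W_ge0 modul le_La.
have := decD P' I Om (rescaled_pos pos a xi) (class_family pos F a xi) W La.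
rewrite (eq_moment _ _ (sum_class_family pos F a xi)); apply; split=> //.
  split=> // be; apply: modulation_class_family (modul be) _ => i.
  exact: curve_phase_pullback_class.
by move=> z; rewrite (eq_moment _ _ (class_sum_rescaled pos F a (a' - a) xi z)) subnKC.
Qed.

End Pullback.

Lemma decoupling_rescale k n b D (P : 'I_k -> {poly int}) (I Om : finType)
    (pos : I -> int) (F : I -> Om -> C) (Phi : Om -> R) La eta :
  (b <= n)%N -> decoupling k (n - b) D -> decoupling_datum n P pos F Phi La ->
  moment (class_sum pos F b eta) (2 * tri_num k) Phi <= D * pr ^+ ((n - b) * tri_num k) * La.
Proof.
move=> bn decD [P_mod [Phi_ge0 modul] le_La].
have [P' P'_mod [U [c UE]]] := moment_curve_rescale p_pr eta b P_mod.
by apply: (@decoupling_on_class k k P P' U c eta b n (k * n) bn (leqnn _) UE).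
Qed.

(* The weight |f_b(eta)|^m is invariant under the modulations used here, so f_a(xi)
   can be decoupled by the degree l theorem against it. *)
Lemma decoupling_lower_degree k l n a a' b m D (P : 'I_k -> {poly int}) (I Om : finType)
    (pos : I -> int) (F : I -> Om -> C) (Phi : Om -> R) La La' xi eta :
  (0 < l <= k)%N -> (k < p)%N -> (0 < a <= a')%N -> (l * a' = b * (k - l).+1)%N ->
  (l * a' <= k * n)%N -> decoupling l (a' - a) D ->
  decoupling_datum n P pos F Phi La -> ~~ (pz %| xi - eta)%Z ->
  let W (w : Om) : R := normc (class_sum pos F b eta w) ^+ m * Phi w in
  (forall z, moment (class_sum pos F a' (xi + pz ^+ a * z)) (2 * tri_num l) W <= La') ->
  moment (class_sum pos F a xi) (2 * tri_num l) W <= D * pr ^+ ((a' - a) * tri_num l) * La'.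
Proof.
move=> lk kp /andP[a_gt0 aa'] lab lan decD [P_mod [Phi_ge0 modul] _] ndvd W le_La'.
have [P' P'_mod [U [c [d [UE Ueta]]]]] := moment_curve_lower p_pr P_mod lk kp a_gt0 ndvd.
apply: (@decoupling_on_class k l P P' U c xi a a' (k * n) aa' lan UE) => // [w|be].
  by rewrite /W mulr_ge0 ?exprn_ge0 ?normc_ge0.
pose ga r := be r * pz ^+ (a * (l - r.+1)).
apply: (@modulation_weight _ _ F Phi _ pos b eta m ((\sum_r ga r * d r)%:~R / pr ^+ (l * a'))).
  exact: modul.
move=> i dvd_i; rewrite curve_phase_pullback //.
have /dvdzP[z zE] : (pz ^+ (l * a') %| \sum_r ga r * \sum_j U r j * (P j).[pos i] -
    \sum_r ga r * d r)%Z.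
  rewrite -sumrB; apply: rpred_sum => r _; rewrite -mulrBr dvdz_mull // lab.
  by rewrite (rescaled_posE dvd_i) Ueta.
exists z; rewrite (canRL (subrK _) zE : \sum_r be r * pz ^+ (a * (l - r.+1)) * _ = _).
by rewrite addrC intrD intrM intr_pexp mulrDl mulfK // expf_neq0.
Qed.

Section FixedScale.
Variables k n : nat.

Definition bilinear_moment (I Om : finType) (pos : I -> int) (F : I -> Om -> C)
    (Phi : Om -> R) (l a b : nat) (xi eta : int) : R :=
  moment (class_sum pos F a xi) (2 * tri_num l)
    (fun w => normc (class_sum pos F b eta w) ^+ (2 * (tri_num k - tri_num l)) * Phi w).

(* The size of a bilinear moment under square-root cancellation in both classes. *)
Definition bilinear_size (l a b : nat) : R :=
  pr ^+ ((n - a) * tri_num l) * pr ^+ ((n - b) * (tri_num k - tri_num l)).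

Definition bilinear_bound l a b (B : R) :=
  forall (P : 'I_k -> {poly int}) (I Om : finType) (pos : I -> int)
    (F : I -> Om -> C) (Phi : Om -> R) La xi eta,
  decoupling_datum n P pos F Phi La -> ~~ (pz %| xi - eta)%Z ->
  bilinear_moment pos F Phi l a b xi eta <= B * bilinear_size l a b * La.

Lemma bilinear_moment_ge0 (I Om : finType) (pos : I -> int) (F : I -> Om -> C)
    (Phi : Om -> R) l a b xi eta : (forall w, 0 <= Phi w) ->
  0 <= bilinear_moment pos F Phi l a b xi eta.
Proof.
by move=> Phi_ge0; apply: moment_ge0 => w; rewrite mulr_ge0 ?exprn_ge0 ?normc_ge0.
Qed.

Lemma bilinear_size_ge0 l a b : 0 <= bilinear_size l a b.
Proof. by rewrite mulr_ge0 ?exprn_ge0. Qed.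

Lemma bilinear_bound_le l a b B B' : B <= B' ->
  bilinear_bound l a b B -> bilinear_bound l a b B'.
Proof.
move=> BB boundB P I Om pos F Phi La xi eta datum ndvd.
apply: le_trans (boundB _ _ _ _ _ _ _ _ _ datum ndvd) _.
by rewrite ler_wpM2r ?(decoupling_datum_ge0 datum) // ler_wpM2r // bilinear_size_ge0.
Qed.

Lemma bilinear_bound0 a b D : (b <= n)%N -> decoupling k (n - b) D -> bilinear_bound 0 a b D.
Proof.
move=> bn decD P I Om pos F Phi La xi eta datum _; rewrite /bilinear_moment /bilinear_size.
have -> : tri_num 0 = 0%N by [].
rewrite !muln0 expr0 mul1r subn0; apply: le_trans (decoupling_rescale eta bn decD datum).
by apply: ler_sum => w _; rewrite expr0 mul1r.
Qed.

Lemma bilinear_bound_lower l a a' b D B : (k < p)%N ->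
  (0 < l <= k)%N -> (0 < a <= a')%N -> (a' <= n)%N ->
  (l * a' = b * (k - l).+1)%N -> decoupling l (a' - a) D ->
  bilinear_bound l a' b B -> bilinear_bound l a b (D * B).
Proof.
move=> kp lk /andP[a_gt0 aa'] an lab decD boundB P I Om pos F Phi La xi eta datum ndvd.
have lan : (l * a' <= k * n)%N by rewrite leq_mul //; case/andP: lk.
apply: le_trans (@decoupling_lower_degree k l n a a' b _ D P I Om pos F Phi La
  (B * bilinear_size l a' b * La) xi eta lk kp _ lab lan decD datum ndvd _) _.
- by rewrite a_gt0.
- move=> z; apply: boundB datum _; rewrite addrAC rpredDr // dvdz_mulr //.
  by rewrite -(prednK a_gt0) exprS dvdz_mulr.
have -> : bilinear_size l a b = pr ^+ ((a' - a) * tri_num l) * bilinear_size l a' b.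
  rewrite /bilinear_size [RHS]mulrA; congr (_ * _); rewrite -exprD -mulnDl.
  by congr (_ ^+ (_ * _)); lia.
by rewrite le_eqVlt; apply/orP; left; apply/eqP; ring.
Qed.

Lemma bilinear_bound_trivial l a b D D' : (l <= k)%N -> (a <= n)%N -> (b <= n)%N ->
  decoupling k (n - a) D -> decoupling k (n - b) D' -> bilinear_bound l a b (D + D').
Proof.
move=> lk an bn decD decD' P I Om pos F Phi La xi eta datum ndvd.
have le_a := @decoupling_rescale k n a D P I Om pos F Phi La xi an decD datum.
have le_b := @decoupling_rescale k n b D' P I Om pos F Phi La eta bn decD' datum.
have [_ [Phi_ge0 _] _] := datum.
rewrite /bilinear_moment /bilinear_size; set A := tri_num l; set B := (tri_num k - A)%N.
have ABE : tri_num k = (A + B)%N by rewrite /B subnKC // leq_tri_num.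
rewrite !exprM in le_a le_b *; set x := pr ^+ (n - a) in le_a *; set y := pr ^+ (n - b) in le_b *.
have x_gt0 : 0 < x by rewrite exprn_gt0.
have y_gt0 : 0 < y by rewrite exprn_gt0.
clearbody x y; have xy_ge0 : 0 <= x ^+ A * y ^+ B by rewrite mulr_ge0 ?exprn_ge0 ?ltW.
apply: (@le_trans _ _ (x ^+ A * y ^+ B *
   (moment (class_sum pos F a xi) (2 * tri_num k) Phi / x ^+ tri_num k +
    moment (class_sum pos F b eta) (2 * tri_num k) Phi / y ^+ tri_num k))).
  rewrite /moment !mulr_suml -big_split mulr_sumr /=; apply: ler_sum => w _.
  set f := normc _; set g := normc (class_sum pos F b eta w).
  have := @ler_mulXn_add R (f ^+ 2 / x) (g ^+ 2 / y) A B.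
  rewrite !divr_ge0 ?exprn_ge0 ?normc_ge0 ?(ltW x_gt0) ?(ltW y_gt0) // => /(_ isT isT).
  rewrite -ABE !expr_div_n -!exprM => product_le.
  have -> : f ^+ (2 * A) * (g ^+ (2 * B) * Phi w) =
     x ^+ A * y ^+ B * (f ^+ (2 * A) / x ^+ A * (g ^+ (2 * B) / y ^+ B)) * Phi w.
    by field; rewrite !expf_neq0 ?gt_eqF.
  by rewrite ![_ * Phi w / _]mulrAC -mulrDl [leRHS]mulrA ler_wpM2r // ler_wpM2l.
have -> : (D + D') * (x ^+ A * y ^+ B) * La = x ^+ A * y ^+ B * (D * La + D' * La) by ring.
rewrite ler_wpM2l //.
by apply: lerD; rewrite ler_pdivrMr ?exprn_gt0 // mulrAC.
Qed.

Lemma bilinear_moment_hoelder (I Om : finType) (pos : I -> int) (F : I -> Om -> C)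
    (Phi : Om -> R) l a b xi eta : (0 < l < k)%N -> (forall w, 0 <= Phi w) ->
  bilinear_moment pos F Phi l a b xi eta ^+ (k - l).+1 <=
  bilinear_moment pos F Phi l.-1 a b xi eta ^+ (k - l) *
  bilinear_moment pos F Phi (k - l) b a eta xi.
Proof.
move=> lk Phi_ge0; have [expE1 expE2] := tri_num_hoelder_complement lk.
apply: hoelder_expn => w; rewrite ?mulr_ge0 ?exprn_ge0 ?normc_ge0 //.
move: (k - l)%N expE1 expE2 => K expE1 expE2.
set f := normc _; set g := normc _; rewrite le_eqVlt; apply/orP; left; apply/eqP.
rewrite !exprMn -!exprM.
rewrite -!mulnA ![(_ * K.+1)%N]mulnC ![(_ * K)%N]mulnC expE1 expE2 !mulnDr.
by rewrite !exprD exprS; ring.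
Qed.

Lemma bilinear_size_hoelder l a b : (0 < l < k)%N ->
  bilinear_size l a b ^+ (k - l).+1 =
  bilinear_size l.-1 a b ^+ (k - l) * bilinear_size (k - l) b a.
Proof.
move=> lk; have [expE1 expE2] := tri_num_hoelder_complement lk.
rewrite /bilinear_size; move: (k - l)%N expE1 expE2 => K expE1 expE2.
rewrite !exprMn -!exprM [X in _ = _ * X]mulrC mulrACA -!exprD.
congr (_ ^+ _); congr (_ + _)%N.
  by rewrite -!mulnA ![(_ * K.+1)%N]mulnC ![(_ * K)%N]mulnC expE1 mulnDr.
by rewrite -!mulnA ![(_ * K.+1)%N]mulnC ![(_ * K)%N]mulnC expE2 mulnDr.
Qed.

Lemma bilinear_bound_hoelder l a b B1 B2 B : (0 < l < k)%N ->
  0 <= B -> B1 ^+ (k - l) * B2 <= B ^+ (k - l).+1 -> 0 <= B1 ->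
  bilinear_bound l.-1 a b B1 -> bilinear_bound (k - l) b a B2 -> bilinear_bound l a b B.
Proof.
move=> lk B_ge0 leB B1_ge0 bound1 bound2 P I Om pos F Phi La xi eta datum ndvd.
have La_ge0 := decoupling_datum_ge0 datum; have [_ [Phi_ge0 _] _] := datum.
have le1 := bound1 _ _ _ _ _ _ _ _ _ datum ndvd.
have ndvd' : ~~ (pz %| eta - xi)%Z by rewrite -opprB rpredN.
have le2 := bound2 _ _ _ _ _ _ _ _ _ datum ndvd'.
have moment_ge0' l' a' b' x y := @bilinear_moment_ge0 I Om pos F Phi l' a' b' x y Phi_ge0.
have size_ge0 := bilinear_size_ge0.
suff : bilinear_moment pos F Phi l a b xi eta ^+ (k - l).+1 <=
    (B * bilinear_size l a b * La) ^+ (k - l).+1.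
  by rewrite ler_pXn2r // nnegrE ?moment_ge0' // !mulr_ge0.
apply: le_trans (bilinear_moment_hoelder pos F a b xi eta lk Phi_ge0) _.
apply: (@le_trans _ _ ((B1 * bilinear_size l.-1 a b * La) ^+ (k - l) *
  (B2 * bilinear_size (k - l) b a * La))).
  apply: ler_pM => //; rewrite ?exprn_ge0 ?moment_ge0' //.
  by rewrite lerXn2r // nnegrE ?moment_ge0' // !mulr_ge0.
move: (bilinear_size_hoelder a b lk) (size_ge0 l.-1 a b) (size_ge0 (k - l)%N b a).
move: (bilinear_size l a b) (bilinear_size l.-1 a b) (bilinear_size _ b a).
move: (k - l)%N leB => K leB N N1 N2 sizeE N1_ge0 N2_ge0.
rewrite !exprMn sizeE.
have -> : B1 ^+ K * N1 ^+ K * La ^+ K * (B2 * N2 * La) =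
  (B1 ^+ K * B2) * (N1 ^+ K * N2) * La ^+ K.+1 by rewrite exprS; ring.
by rewrite ler_wpM2r ?exprn_ge0 // ler_wpM2r // mulr_ge0 ?exprn_ge0.
Qed.

Lemma bilinear_bound_separated l a b B (P : 'I_k -> {poly int}) (I Om : finType)
    (pos : I -> int) (F : I -> Om -> C) (Phi : Om -> R) La (t t' : 'I_p) :
  (l <= k)%N -> (0 < a)%N -> (0 < b)%N -> 0 <= B -> bilinear_bound l a b B ->
  decoupling_datum n P pos F Phi La -> t' != t ->
  moment (class_sum pos F 1 t%:Z) (2 * tri_num l)
    (fun w => normc (class_sum pos F 1 t'%:Z w) ^+ (2 * (tri_num k - tri_num l)) * Phi w) <=
  pr ^+ ((a + b) * (2 * tri_num k).+1) * (B * bilinear_size l a b * La).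
Proof.
move=> lk a_gt0 b_gt0 B_ge0 boundB datum tt'.
have La_ge0 := decoupling_datum_ge0 datum; have [_ [Phi_ge0 _] _] := datum.
set A := (2 * tri_num l)%N; set E := (2 * (tri_num k - tri_num l))%N.
have AE : (2 * tri_num k = A + E)%N by rewrite /A /E -mulnDr subnKC // leq_tri_num.
have separated z z' : ~~ (pz %| (t%:Z + pz ^+ 1 * z) - (t'%:Z + pz ^+ 1 * z'))%Z.
  have -> : t%:Z + pz ^+ 1 * z - (t'%:Z + pz ^+ 1 * z') = (t%:Z - t'%:Z) + pz * (z - z').
    by rewrite expr1; ring.
  rewrite rpredDr ?dvdz_mulr // -eqz_mod_dvd !modz_small ?ltz_nat ?ltn_ord //.
  by rewrite eqz_nat eq_sym (inj_eq val_inj).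
have weight_ge0 m z b' w : 0 <= normc (class_sum pos F b' z w) ^+ m * Phi w.
  by rewrite mulr_ge0 ?exprn_ge0 ?normc_ge0.
set N := B * _ * La; have N_ge0 : 0 <= N by rewrite !mulr_ge0 ?exprn_ge0.
apply: (@le_trans _ _ ((pr ^+ (a - 1)) ^+ A.+1 * ((pr ^+ (b - 1)) ^+ E.+1 * N))).
  apply: moment_class_sum_le => // z; rewrite moment_swap.
  apply: moment_class_sum_le => // z'; rewrite moment_swap.
  exact: boundB datum (separated z z').
rewrite mulrA ler_wpM2r // -!exprM -exprD ler_weXn2l // mulnDl AE.
by apply: leq_add; apply: leq_mul; rewrite ?leq_subr // ltnS ?leq_addr ?leq_addl.
Qed.

Lemma decoupling_of_bilinear l a b D B :
  (l <= k)%N -> (0 < a <= n)%N -> (0 < b <= n)%N -> 0 <= B ->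
  decoupling k n.-1 D -> bilinear_bound l a b B ->
  decoupling k n (4 ^+ tri_num k * pr * D / pr ^+ tri_num k +
    (2 * pr) ^+ (2 * tri_num k) * pr ^+ 2 * pr ^+ ((a + b) * (2 * tri_num k).+1) * B).
Proof.
move=> lk /andP[a_gt0 an] /andP[b_gt0 bn] B_ge0 decD boundB P I Om pos F Phi La datum.
have La_ge0 := decoupling_datum_ge0 datum; have [_ [Phi_ge0 _] _] := datum.
have n_gt0 : (0 < n)%N by exact: leq_trans an.
pose f (t : 'I_p) := class_sum pos F 1 t%:Z.
have sum_f w : \sum_i F i w = \sum_t f t w.
  rewrite -(class_sum0 pos F 0) (class_sum_split pos F 0 w (leq0n 1)) subn0 expn1.
  by apply: eq_bigr => t _; rewrite expr0 mul1r add0r.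
have AE : (2 * tri_num k = 2 * tri_num l + 2 * (tri_num k - tri_num l))%N.
  by rewrite -mulnDr subnKC // leq_tri_num.
rewrite (eq_moment _ _ sum_f) AE.
apply: le_trans (moment_sum_bilinear f _ _ _ Phi_ge0) _; first by rewrite card_ord.
rewrite card_ord -AE -[leRHS]mulrA [leRHS]mulrDl; apply: lerD.
  apply: (@le_trans _ _ (2 ^+ (2 * tri_num k) * (pr * (D * pr ^+ (n.-1 * tri_num k) * La)))).
    rewrite ler_wpM2l ?exprn_ge0 // -[X in X%:R * _](card_ord p) mulr_natl -sumr_const.
    apply: ler_sum => t _; rewrite -(subn1 n) in decD *.
    exact: decoupling_rescale n_gt0 decD datum.
  rewrite exprM (_ : 2 ^+ 2 = 4); last by rewrite expr2 -natrM.
  have -> : (n * tri_num k = tri_num k + n.-1 * tri_num k)%N by rewrite -mulSn prednK.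
  by rewrite exprD le_eqVlt; apply/orP; left; apply/eqP; field; rewrite expf_neq0.
rewrite -!mulrA ler_wpM2l ?exprn_ge0 ?mulr_ge0 //.
set N := pr ^+ ((a + b) * (2 * tri_num k).+1) * (B * bilinear_size l a b * La).
have N_ge0 : 0 <= N by rewrite !mulr_ge0 ?exprn_ge0.
apply: (@le_trans _ _ (pr ^+ 2 * N)).
  have -> : pr ^+ 2 = \sum_(t < p) \sum_(t' < p) 1 by rewrite !sumr_const card_ord expr2 mulr_natr.
  rewrite mulr_suml; apply: ler_sum => t _; rewrite mulr_suml.
  rewrite [leRHS](bigID (fun t' => t' != t)) /=; apply: ler_wpDr.
    by rewrite sumr_ge0 // => ? _; rewrite mul1r.
  by apply: ler_sum => t' tt'; rewrite mul1r; apply: bilinear_bound_separated datum tt'.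
rewrite expr2 -mulrA; do 2![rewrite ler_wpM2l //].
rewrite /N ler_wpM2l ?exprn_ge0 // -mulrA ler_wpM2l // ler_wpM2r //.
have -> : (n * tri_num k = n * tri_num l + n * (tri_num k - tri_num l))%N.
  by rewrite -mulnDr subnKC // leq_tri_num.
rewrite /bilinear_size -exprD ler_weXn2l //.
by apply: leq_add; rewrite leq_mul2r leq_subr orbT.
Qed.

End FixedScale.
End Decoupling.

Section Iteration.
Variables (R : realType) (p : nat).
Hypothesis p_pr : prime p.
Local Notation pr := (p%:R : R).
Local Notation decoupling := (@decoupling R p).
Local Notation bilinear_bound := (@bilinear_bound R p).

Let p_gt0 : (0 < p)%N. Proof. exact: prime_gt0. Qed.
Let pr_gt0 : 0 < pr. Proof. by rewrite ltr0n. Qed.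
Let pr_ge1 : 1 <= pr. Proof. by rewrite ler1n. Qed.

Definition ppow (x : R) : R := pr `^ x.

Lemma ppow_ge0 x : 0 <= ppow x.
Proof. exact: powR_ge0. Qed.

Lemma ppowD x y : ppow (x + y) = ppow x * ppow y.
Proof. by rewrite /ppow powRD //; apply/implyP => _; rewrite gt_eqF. Qed.

Lemma ppow0 : ppow 0 = 1.
Proof. exact: powRr0. Qed.

Lemma ppowX x n : ppow x ^+ n = ppow (x * n%:R).
Proof. by rewrite /ppow powRrM powR_mulrn // powR_ge0. Qed.

Lemma ppow_nat n : ppow n%:R = pr ^+ n.
Proof. by rewrite /ppow powR_mulrn // ltW. Qed.

Lemma ler_ppow x y : x <= y -> ppow x <= ppow y.
Proof. by move=> xy; exact: ler_powR. Qed.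

Lemma ppow_ge1 x : 0 <= x -> 1 <= ppow x.
Proof. by move=> x_ge0; rewrite -ppow0 ler_ppow. Qed.

Definition decoupling_exponent k (eta : R) :=
  exists2 C, 0 <= C & forall n, decoupling k n (C * ppow (eta * n%:R)).

Lemma decoupling_exponent_le k x y :
  x <= y -> decoupling_exponent k x -> decoupling_exponent k y.
Proof.
move=> xy [C C_ge0 decC]; exists C => // n; apply: decoupling_le (decC n) => //.
by rewrite ler_wpM2l // ler_ppow // ler_wpM2r.
Qed.

Lemma decoupling_exponent_trivial k : decoupling_exponent k (tri_num k).+1%:R.
Proof.
exists 1 => // n; apply: decoupling_le (@decoupling_trivial R p p_pr k n) => //.
by rewrite mul1r -ppow_nat ler_ppow // mulnC natrM.
Qed.

Section Improvement.
Variables (k : nat) (eta : R).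
Hypotheses (k_gt1 : (1 < k)%N) (kp : (k < p)%N) (eta_ge0 : 0 <= eta).
Hypothesis lower_degrees :
  forall l, (0 < l < k)%N -> forall eps, 0 < eps -> decoupling_exponent l eps.
Hypothesis exponent_eta : decoupling_exponent k eta.
Local Notation K := (tri_num k).

Let k_gt0 : (0 < k)%N. Proof. exact: ltnW. Qed.

(* The exponent saved over the trivial bilinear bound after m rounds; the recursion
   is Hoelder's inequality between the degrees l - 1 and k - l. *)
Fixpoint gain (m l : nat) : R :=
  if l == 0%N then eta else
  if m is m'.+1 then
    (k - l)%:R / (k - l).+1%:R * gain m' l.-1 + gain m' (k - l) / l%:R
  else 0.

Lemma gain0 m : gain m 0 = eta.
Proof. by case: m. Qed.

Lemma sum_gain m : \sum_(1 <= l < k) gain m l = m%:R * ((k.-1)%:R / k%:R * eta).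
Proof.
have kE : k = k.-1.+1 by rewrite prednK.
elim: m => [|m IHm].
  by rewrite mul0r big_nat big1 // => -[|l].
have -> : \sum_(1 <= l < k) gain m.+1 l =
    \sum_(1 <= l < k) (k - l)%:R / (k - l).+1%:R * gain m l.-1 +
    \sum_(1 <= l < k) gain m (k - l) / l%:R.
  by rewrite -big_split; apply: eq_big_nat => -[|l].
have -> : \sum_(1 <= l < k) gain m (k - l) / l%:R = \sum_(1 <= l < k) gain m l / (k - l)%:R.
  rewrite big_nat_rev; apply: eq_big_nat => l /andP[_ lk].
  by rewrite add1n subSS subKn // ltnW.
have -> : \sum_(1 <= l < k) (k - l)%:R / (k - l).+1%:R * gain m l.-1 =
   (k.-1)%:R / k%:R * eta + \sum_(1 <= l < k) (k - l.+1)%:R / (k - l)%:R * gain m l.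
  rewrite big_add1 /=.
  have -> : \sum_(0 <= i < k.-1) (k - i.+1)%:R / (k - i.+1).+1%:R * gain m i =
    \sum_(0 <= i < k) (k - i.+1)%:R / (k - i)%:R * gain m i.
    rewrite [in RHS]kE big_nat_recr //= -kE subnn !mul0r addr0.
    apply: eq_big_nat => l /= lk.
    by rewrite subnSK //; move: lk; rewrite kE /= => /leq_trans; apply.
  by rewrite [LHS]big_ltn // gain0 subn0 subn1.
rewrite -addrA -big_split /= -natr1 mulrDl mul1r [RHS]addrC; congr (_ + _).
rewrite -IHm; apply: eq_big_nat => l /andP[_ lk].
have kl_neq0 : (k - l)%:R != 0 :> R by rewrite pnatr_eq0 -lt0n subn_gt0.
have klE : (k - l)%:R = (k - l.+1)%:R + 1 :> R by rewrite natr1 subnSK.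
by rewrite klE in kl_neq0 *; field.
Qed.

Lemma exists_large_gain (T : R) m : k%:R * T <= m%:R * eta ->
  exists2 l, (0 < l < k)%N & T <= gain m l.
Proof.
move=> le_T; apply: contrapT => no_large.
have small l : (1 <= l < k)%N -> gain m l < T.
  by move=> lk; rewrite ltNge; apply/negP => le_Tl; apply: no_large; exists l.
have : \sum_(1 <= l < k) gain m l < \sum_(1 <= l < k) T by apply: ltr_sum_nat.
rewrite sum_gain // sumr_const_nat subn1; apply/negP; rewrite -leNgt -[leLHS]mulr_natr.
have -> : m%:R * ((k.-1)%:R / k%:R * eta) = (m%:R * eta / k%:R) * (k.-1)%:R by ring.
by rewrite ler_wpM2r // ler_pdivlMr ?ltr0n // mulrC.
Qed.

(* The level a with l a = b (k - l + 1) at which the degree l decoupling of a class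
   of level b becomes available. *)
Definition level (l b : nat) : nat := (b * (k - l).+1) %/ l.

Lemma levelE l b : (l %| b)%N -> (l * level l b = b * (k - l).+1)%N.
Proof. by move=> lb; rewrite mulnC /level divnK // dvdn_mulr. Qed.

Lemma level_le l b : (0 < l <= k)%N -> (l %| b)%N -> (level l b <= k * b)%N.
Proof.
move=> /andP[l_gt0 lk] lb.
rewrite -(leq_pmul2l l_gt0) levelE // [leqRHS]mulnA [leqRHS]mulnC.
rewrite leq_mul2l; apply/orP; right; apply: (@leq_trans k); last by rewrite leq_pmull.
by rewrite ltn_subrL l_gt0 (leq_trans l_gt0 lk).
Qed.

Lemma dvdn_fact_exp l m b : (0 < l <= k)%N -> (k`! ^ m.+1 %| b)%N -> (l %| b)%N.
Proof. by move=> lk; apply: dvdn_trans; rewrite expnS dvdn_mulr // dvdn_fact. Qed.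

Lemma dvdn_level l m b : (0 < l <= k)%N -> (k`! ^ m.+2 %| b)%N -> (k`! ^ m.+1 %| level l b)%N.
Proof.
move=> lk b_dvd; have lb := dvdn_fact_exp lk b_dvd; have [l_gt0 _] := andP lk.
have /dvdnP[b' bE] := b_dvd; have /dvdnP[g gE] : (l %| k`!)%N by rewrite dvdn_fact.
apply/dvdnP; exists (b' * g * (k - l).+1)%N; apply/eqP.
by rewrite -(eqn_pmul2l l_gt0) levelE // bE expnS {1}gE; apply/eqP; ring.
Qed.

Lemma lower_decoupling_uniform eps : 0 < eps -> exists2 C, 0 <= C &
  forall l, (0 < l < k)%N -> forall n, decoupling l n (C * ppow (eps * n%:R)).
Proof.
move=> eps_gt0.
suff below : forall j, (j <= k)%N -> exists2 C, 0 <= C &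
    forall l, (0 < l < j)%N -> forall n, decoupling l n (C * ppow (eps * n%:R)).
  exact: below (leqnn k).
elim=> [|j IHj] jk; first by exists 0 => // l; rewrite ltn0 andbF.
have [C C_ge0 decC] := IHj (ltnW jk).
have [j0|j_gt0] := posnP j; first by exists C => // l; rewrite j0 ltnS leqn0; case: l.
have [C' C'_ge0 decC'] := @lower_degrees j (introT andP (conj j_gt0 jk)) eps eps_gt0.
exists (C + C'); first exact: addr_ge0.
move=> l /andP[l_gt0]; rewrite ltnS leq_eqVlt => /orP[/eqP->|lj] n.
  by apply: decoupling_le (decC' n) => //; rewrite ler_wpM2r ?ppow_ge0 // lerDr.
by apply: decoupling_le (decC l _ n); rewrite ?l_gt0 // ler_wpM2r ?ppow_ge0 // lerDl.
Qed.

Definition gain_bound m (de C : R) := forall n b l,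
  (0 < l < k)%N -> (k`! ^ m.+1 %| b)%N -> (0 < b)%N -> (k ^ m.+1 * b <= n)%N ->
  bilinear_bound k n l (level l b) b (C * ppow (eta * n%:R - gain m l * b%:R + de * n%:R)).

Lemma gain_bound0 de : 0 < de -> exists2 C, 0 <= C & gain_bound 0 de C.
Proof.
move=> de_gt0; have [C C_ge0 decC] := exponent_eta.
exists (2 * C) => [|n b l /andP[l_gt0 lk] kb b_gt0]; first exact: mulr_ge0.
rewrite expn1 => bn; have lk' : (0 < l <= k)%N by rewrite l_gt0 ltnW.
have an : (level l b <= n)%N.
  by rewrite (leq_trans (level_le lk' (dvdn_fact_exp lk' kb))).
have bn' : (b <= n)%N by rewrite (leq_trans _ bn) // leq_pmull.
have dec_sub m : decoupling k (n - m) (C * ppow (eta * n%:R)).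
  apply: decoupling_le (decC (n - m)%N) => //; rewrite ler_wpM2l // ler_ppow //.
  by rewrite ler_wpM2l // ler_nat leq_subr.
apply: (bilinear_bound_le _
  (bilinear_bound_trivial p_pr (ltnW lk) an bn' (dec_sub _) (dec_sub _))).
rewrite -mulr2n -[_ *+ 2]mulr_natl mulrA ler_wpM2l ?mulr_ge0 // ler_ppow //=.
by rewrite gtn_eqF // mul0r subr0 lerDl mulr_ge0 // ltW.
Qed.

Section GainStep.
Variables (m : nat) (de C1 C2 C3 : R).
Hypotheses (de_gt0 : 0 < de) (C1_ge0 : 0 <= C1) (C2_ge0 : 0 <= C2) (C3_ge0 : 0 <= C3).
Hypothesis gain_m : gain_bound m (de / 2) C1.
Hypothesis lower_dec :
  forall l, (0 < l < k)%N -> forall n, decoupling l n (C2 * ppow (de / 2 * n%:R)).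
Hypothesis dec_k : forall n, decoupling k n (C3 * ppow (eta * n%:R)).
Local Notation C := (C1 * C2 + C3).

Lemma bilinear_bound_below_level n j a b :
  (0 < j < k)%N -> (k`! ^ m.+1 %| b)%N -> (0 < b)%N -> (k ^ m.+1 * b <= n)%N ->
  (0 < a)%N -> (j * a <= b * (k - j).+1)%N ->
  bilinear_bound k n j a b (C * ppow (eta * n%:R - gain m j * b%:R + de * n%:R)).
Proof.
move=> jk kb b_gt0 bn a_gt0 ja; have [j_gt0 lt_jk] := andP jk.
have jk' : (0 < j <= k)%N by rewrite j_gt0 ltnW.
have jb := dvdn_fact_exp jk' kb; have jE := levelE jb.
have aa : (0 < a <= level j b)%N by rewrite a_gt0 -(leq_pmul2l j_gt0) jE.
have kbn : (k * b <= n)%N.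
  by apply: leq_trans bn; rewrite leq_mul2r -{1}(expn1 k) leq_pexp2l ?orbT.
have ln : (level j b <= n)%N by rewrite (leq_trans (level_le jk' jb)).
have := bilinear_bound_lower p_pr kp jk' aa ln jE (@lower_dec j jk _) (gain_m jk kb b_gt0 bn).
apply: bilinear_bound_le.
have -> : eta * n%:R - gain m j * b%:R + de * n%:R =
  de / 2 * n%:R + (eta * n%:R - gain m j * b%:R + de / 2 * n%:R) by lra.
rewrite [ppow (de / 2 * n%:R + _)]ppowD [leRHS]mulrA mulrA ler_wpM2r ?ppow_ge0 //.
rewrite mulrAC [C2 * C1]mulrC.
apply: ler_pM; rewrite ?mulr_ge0 ?ppow_ge0 //; first by rewrite lerDl.
rewrite ler_ppow // ler_wpM2l ?divr_ge0 ?(ltW de_gt0) // ler_nat.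
exact: leq_trans (leq_subr _ _) ln.
Qed.

Lemma bilinear_bound_pred n l b : (0 < l < k)%N -> (k`! ^ m.+2 %| b)%N -> (0 < b)%N ->
  (k ^ m.+2 * b <= n)%N -> (0 < level l b)%N ->
  bilinear_bound k n l.-1 (level l b) b
    (C * ppow (eta * n%:R - gain m l.-1 * b%:R + de * n%:R)).
Proof.
move=> /andP[l_gt0 lk] kb b_gt0 bn a_gt0.
have bn' : (b <= n)%N by apply: leq_trans bn; rewrite leq_pmull // expn_gt0 k_gt0.
have [l1|l_gt1] := leqP l 1.
  have -> : l.-1 = 0%N by case: (l) l1 => [|[]].
  have := bilinear_bound0 p_pr (level l b) bn' (@dec_k (n - b)%N); apply: bilinear_bound_le.
  apply: ler_pM; rewrite ?ppow_ge0 //; first by rewrite lerDr mulr_ge0.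
  by rewrite gain0 ler_ppow // natrB // mulrBr lerDl mulr_ge0 // ltW.
apply: bilinear_bound_below_level => //.
- by apply/andP; split; [rewrite -ltnS prednK|exact: leq_ltn_trans (leq_pred l) lk].
- by apply: dvdn_trans kb; rewrite dvdn_exp2l.
- by apply: leq_trans bn; rewrite leq_mul2r leq_pexp2l ?orbT.
apply: (@leq_trans (l * level l b)); first by rewrite leq_mul2r leq_pred orbT.
have lb : (l %| b)%N by rewrite (dvdn_fact_exp _ kb) // l_gt0 ltnW.
by rewrite levelE // leq_mul2l ltnS leq_sub2l ?orbT // leq_pred.
Qed.

Lemma bilinear_bound_swapped n l b : (0 < l < k)%N -> (k`! ^ m.+2 %| b)%N -> (0 < b)%N ->
  (k ^ m.+2 * b <= n)%N -> (0 < level l b)%N ->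
  bilinear_bound k n (k - l) b (level l b)
    (C * ppow (eta * n%:R - gain m (k - l) * (level l b)%:R + de * n%:R)).
Proof.
move=> /andP[l_gt0 lk] kb b_gt0 bn a_gt0.
have lk' : (0 < l <= k)%N by rewrite l_gt0 ltnW.
have lb := dvdn_fact_exp lk' kb.
apply: bilinear_bound_below_level => //.
- by rewrite subn_gt0 lk ltn_subrL l_gt0.
- exact: dvdn_level.
- by apply: leq_trans bn; rewrite [(k ^ m.+2)%N]expnSr -mulnA leq_mul2l level_le ?orbT.
rewrite subKn ?(ltnW lk) // -(leq_pmul2l l_gt0) [leqRHS]mulnA levelE //.
by rewrite mulnC -mulnA mulnCA -mulnA leq_mul2l leq_mul ?orbT.
Qed.

Lemma gain_boundS : gain_bound m.+1 de C.
Proof.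
move=> n b l lk kb b_gt0 bn; have [l_gt0 lt_lk] := andP lk.
have laE : (l * level l b = b * (k - l).+1)%N.
  by rewrite levelE // (dvdn_fact_exp _ kb) // l_gt0 ltnW.
have a_gt0 : (0 < level l b)%N by rewrite -(ltn_pmul2l l_gt0) muln0 laE muln_gt0 b_gt0.
have C_ge0 : 0 <= C by rewrite addr_ge0 ?mulr_ge0.
apply: (bilinear_bound_hoelder lk _ _ _ (bilinear_bound_pred lk kb b_gt0 bn a_gt0)
  (bilinear_bound_swapped lk kb b_gt0 bn a_gt0)); rewrite ?mulr_ge0 ?ppow_ge0 //.
rewrite !exprMn !ppowX mulrACA -exprSr -ppowD ler_wpM2l ?exprn_ge0 // ler_ppow //.
have aE : (level l b)%:R = b%:R * (k - l).+1%:R / l%:R :> R.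
  by apply: (canRL (mulfK _)); rewrite ?pnatr_eq0 -?lt0n // -!natrM mulnC laE.
rewrite [in leRHS]/= gtn_eqF // aE -natr1 le_eqVlt; apply/orP; left; apply/eqP.
set x := (k - l)%:R; field.
by rewrite pnatr_eq0 -lt0n l_gt0 natr1 pnatr_eq0.
Qed.

End GainStep.

Lemma exists_gain_bound m de : 0 < de -> exists2 C, 0 <= C & gain_bound m de C.
Proof.
elim: m de => [|m IHm] de de_gt0; first exact: gain_bound0.
have de2_gt0 : 0 < de / 2 by rewrite divr_gt0.
have [C1 C1_ge0 gain_m] := IHm _ de2_gt0.
have [C2 C2_ge0 lower_dec] := lower_decoupling_uniform de2_gt0.
have [C3 C3_ge0 dec_k] := exponent_eta.
by exists (C1 * C2 + C3); [rewrite addr_ge0 ?mulr_ge0|exact: gain_boundS].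
Qed.

Section DecouplingStep.
Variables (m l : nat) (C : R).
Local Notation f := (k`! ^ m.+1)%N.
Local Notation Q := (k ^ m.+1 * f)%N.
Local Notation saving := (2^-1 / (k ^ m.+1)%:R : R).
Local Notation T := (k.+1 * (2 * K).+1).+1.
Hypotheses (lk : (0 < l < k)%N) (large_gain : T%:R <= gain m l).
Hypotheses (C_ge0 : 0 <= C) (gain_C : gain_bound m saving C).

Let f_gt0 : (0 < f)%N. Proof. by rewrite expn_gt0 fact_gt0. Qed.
Let Q_gt0 : (0 < Q)%N. Proof. by rewrite muln_gt0 f_gt0 expn_gt0 k_gt0. Qed.

Definition bilinear_constant : R := (2 * pr) ^+ (2 * K) * pr ^+ 2 * C * ppow f%:R.

Lemma bilinear_constant_ge0 : 0 <= bilinear_constant.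
Proof. by rewrite !mulr_ge0 ?exprn_ge0 ?ppow_ge0 ?mulr_ge0 // ltW. Qed.

Lemma bilinear_term_le n b :
  (0 < b)%N -> (level l b <= k * b)%N -> 2 * saving * n%:R <= b%:R + f%:R ->
  (2 * pr) ^+ (2 * K) * pr ^+ 2 * pr ^+ ((level l b + b) * (2 * K).+1) *
    (C * ppow (eta * n%:R - gain m l * b%:R + saving * n%:R)) <=
  bilinear_constant * ppow ((eta - saving) * n%:R).
Proof.
move=> b_gt0 ab nb; rewrite /bilinear_constant.
set G := (2 * pr) ^+ (2 * K) * pr ^+ 2; set y := ppow _.
have -> : G * pr ^+ ((level l b + b) * (2 * K).+1) * (C * y) =
   G * C * (pr ^+ ((level l b + b) * (2 * K).+1) * y) by ring.
rewrite -[leRHS]mulrA; apply: ler_wpM2l.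
  by rewrite !mulr_ge0 ?exprn_ge0 ?mulr_ge0 // ltW.
rewrite -ppow_nat /y -!ppowD ler_ppow //.
have levels_le : ((level l b + b) * (2 * K).+1)%:R <= (T%:R - 1) * b%:R :> R.
  have -> : T%:R - 1 = (k.+1 * (2 * K).+1)%:R :> R by rewrite -natr1 addrK.
  rewrite -natrM ler_nat mulnAC leq_mul2r; apply/orP; right.
  by rewrite mulSn addnC leq_add2l.
have gain_le : T%:R * b%:R <= gain m l * b%:R by rewrite ler_wpM2r.
by move: levels_le gain_le nb; rewrite mulrBl mul1r mulrBl; lra.
Qed.

Lemma saving_scale n : 2 * saving * n%:R <= (f * (n %/ Q))%:R + f%:R.
Proof.
rewrite mulrA divff ?pnatr_eq0 // mul1r mulrC ler_pdivrMr ?ltr0n ?expn_gt0 ?k_gt0 //.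
rewrite -natrD -natrM ler_nat -mulnSr [(f * _)%N]mulnC -mulnA [(f * _)%N]mulnC.
by rewrite ltnW // ltn_ceil.
Qed.

Lemma decoupling_large_scale n D : (Q <= n)%N -> decoupling k n.-1 D ->
  decoupling k n (4 ^+ K * pr * D / pr ^+ K +
    bilinear_constant * ppow ((eta - saving) * n%:R)).
Proof.
move=> Qn decD; pose b := (f * (n %/ Q))%N.
have [l_gt0 lt_lk] := andP lk; have lk' : (0 < l <= k)%N by rewrite l_gt0 ltnW.
have b_gt0 : (0 < b)%N by rewrite muln_gt0 f_gt0 divn_gt0.
have bn : (k ^ m.+1 * b <= n)%N by rewrite /b mulnA mulnC leq_trunc_div.
have fb : (f %| b)%N by rewrite dvdn_mulr.
have lb := dvdn_fact_exp lk' fb; have ab := level_le lk' lb.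
have kb : (k * b <= n)%N.
  by apply: leq_trans bn; rewrite leq_mul2r -{1}(expn1 k) leq_pexp2l ?orbT.
have an : (0 < level l b <= n)%N.
  by rewrite -(ltn_pmul2l l_gt0) muln0 levelE // muln_gt0 b_gt0 (leq_trans ab).
have bn' : (0 < b <= n)%N by rewrite b_gt0 (leq_trans _ kb) // leq_pmull.
apply: decoupling_le (decoupling_of_bilinear p_pr (ltnW lt_lk) an bn' _ decD
  (gain_C lk fb b_gt0 bn)); last by rewrite mulr_ge0 ?ppow_ge0.
by rewrite lerD2l bilinear_term_le // saving_scale.
Qed.

Lemma decoupling_exponent_saved : 2 * (4 ^+ K * pr) <= pr ^+ K ->
  decoupling_exponent k (Num.max (eta - saving) 0).
Proof.
move=> large_p; set et := Num.max _ 0; have et_ge0 : 0 <= et by rewrite le_max lexx orbT.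
pose B := bilinear_constant; have B_ge0 := bilinear_constant_ge0 : 0 <= B.
pose C' := 2 * B + pr ^+ (Q * K.+1).
have C'_ge0 : 0 <= C' by apply: addr_ge0; [exact: mulr_ge0|exact: exprn_ge0].
exists C' => // n; elim: n => [|n IHn].
  apply: decoupling_le (@decoupling_trivial R p p_pr k 0) => //.
  rewrite mul0n expr0 mulr0 ppow0 mulr1 /C'; apply: ler_wpDl; first by rewrite mulr_ge0.
  exact: exprn_ege1.
have [nQ|Qn] := ltnP n.+1 Q.
  apply: decoupling_le (@decoupling_trivial R p p_pr k n.+1) => //.
  apply: (@le_trans _ _ (C' * 1)); last by rewrite ler_wpM2l // ppow_ge1 // mulr_ge0.
  rewrite mulr1 /C'; apply: ler_wpDl; first by rewrite mulr_ge0.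
  by rewrite ler_weXn2l // leq_mul2r ltnW ?orbT.
apply: decoupling_le (decoupling_large_scale Qn IHn) => //.
set X := ppow (et * n.+1%:R); have X_ge0 : 0 <= X by exact: ppow_ge0.
have -> : C' * X = (C' * X) / 2 + (C' * X) / 2 by lra.
apply: lerD.
  rewrite ler_pdivrMr ?exprn_gt0 // [leRHS]mulrAC -[leRHS]mulrA mulrC.
  apply: ler_pM; rewrite ?mulr_ge0 ?ppow_ge0 ?exprn_ge0 ?(ltW pr_gt0) //.
    by rewrite ler_wpM2l // ler_ppow // ler_wpM2l // ler_nat.
  by rewrite ler_pdivlMr // mulrC.
apply: (@le_trans _ _ (B * X)).
  by rewrite ler_wpM2l // ler_ppow // ler_wpM2r // le_max lexx.
rewrite /C' mulrDl mulrDl; apply: ler_wpDr; last by lra.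
by rewrite !mulr_ge0 ?exprn_ge0 // ltW.
Qed.

End DecouplingStep.
End Improvement.

Lemma decoupling_exponent_improve k eps : (1 < k)%N -> (k < p)%N ->
  2 * (4 ^+ tri_num k * pr) <= pr ^+ tri_num k ->
  (forall l, (0 < l < k)%N -> forall de, 0 < de -> decoupling_exponent l de) -> 0 < eps ->
  exists2 ta, 0 < ta & forall eta, eps <= eta -> decoupling_exponent k eta ->
    decoupling_exponent k (Num.max (eta - ta) 0).
Proof.
move=> k_gt1 kp large_p lower_degrees eps_gt0.
pose T := (k.+1 * (2 * tri_num k).+1).+1.
pose m := Num.bound (k%:R * T%:R / eps).
have le_m : k%:R * T%:R <= m%:R * eps.
  by rewrite -ler_pdivrMr // ltW // archi_boundP // divr_ge0 // ltW.
have saving_gt0 : 0 < 2^-1 / (k ^ m.+1)%:R :> R.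
  by rewrite divr_gt0 // ltr0n expn_gt0 (ltnW k_gt1).
exists (2^-1 / (k ^ m.+1)%:R) => // eta eps_eta exponent_eta.
have eta_ge0 : 0 <= eta by rewrite (le_trans _ eps_eta) // ltW.
have [|l lk large_gain] := @exists_large_gain k eta k_gt1 T%:R m.
  by rewrite (le_trans le_m) // ler_wpM2l.
have [C C_ge0 gain_C] := exists_gain_bound k_gt1 kp eta_ge0 lower_degrees exponent_eta m saving_gt0.
exact: decoupling_exponent_saved lk large_gain C_ge0 gain_C large_p.
Qed.

Lemma decoupling_exponent_iterate k ta eps : 0 < ta -> 0 < eps ->
  (forall eta, eps <= eta -> decoupling_exponent k eta ->
    decoupling_exponent k (Num.max (eta - ta) 0)) ->
  decoupling_exponent k eps.
Proof.
move=> ta_gt0 eps_gt0 improve; set T : R := (tri_num k).+1%:R.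
have iterated i : decoupling_exponent k (Num.max (T - i%:R * ta) eps).
  elim: i => [|i IHi].
    apply: decoupling_exponent_le (decoupling_exponent_trivial k).
    by rewrite mul0r subr0 le_max lexx.
  apply: decoupling_exponent_le (improve _ _ IHi); last by rewrite le_max lexx orbT.
  rewrite ge_max [X in _ && X]le_max (ltW eps_gt0) orbT andbT -natr1 lerBlDr ge_max.
  have le_left : T - (i%:R + 1) * ta <= Num.max (T - (i%:R + 1) * ta) eps by rewrite le_max lexx.
  have le_right : eps <= Num.max (T - (i%:R + 1) * ta) eps by rewrite le_max lexx orbT.
  by move: (Num.max _ _) le_left le_right => x; lra.
pose i := Num.bound (T / ta).
apply: decoupling_exponent_le (iterated i); rewrite ge_max lexx andbT.
have : T < i%:R * ta by rewrite -ltr_pdivrMr // archi_boundP // divr_ge0 // ltW.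
by move=> lt_T; rewrite lerBlDr (le_trans (ltW lt_T)) // lerDr ltW.
Qed.

Theorem nested_congruencing k : (0 < k)%N -> (2 * 4 ^ tri_num k <= p)%N ->
  forall eps, 0 < eps -> decoupling_exponent k eps.
Proof.
elim/ltn_ind: k => k IHk k_gt0 large_p eps eps_gt0.
have k_tri : (k <= tri_num k)%N.
  by rewrite -(leq_pmul2l (isT : 0 < 2)%N) double_tri_num mulnC leq_mul2l ltnS k_gt0 orbT.
have kp : (k < p)%N.
  apply: leq_trans large_p; apply: (@leq_trans (4 ^ k)); first exact: ltn_expl.
  by apply: leq_trans (leq_pmull _ _) => //; rewrite leq_exp2l.
have [k_le1|k_gt1] := leqP k 1.
  have -> : k = 1%N by apply/eqP; rewrite eqn_leq k_le1 k_gt0.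
  exists 1 => // n; apply: decoupling_le (@decoupling_degree1 R p p_pr n) => //.
  by rewrite mul1r ppow_ge1 // mulr_ge0 // ltW.
have large_pR : 2 * (4 ^+ tri_num k * pr) <= pr ^+ tri_num k.
  apply: (@le_trans _ _ (pr ^+ 2)); last by rewrite ler_weXn2l // (leq_trans k_gt1).
  by rewrite expr2 mulrA ler_wpM2r ?(ltW pr_gt0) // -natrX -natrM ler_nat.
have lower_degrees l : (0 < l < k)%N -> forall de, 0 < de -> decoupling_exponent l de.
  move=> /andP[l_gt0 lk]; apply: IHk => //; apply: leq_trans large_p.
  by rewrite leq_mul2l /= leq_exp2l // leq_tri_num // ltnW.
have [ta ta_gt0 improve] := decoupling_exponent_improve k_gt1 kp large_pR lower_degrees eps_gt0.
exact: decoupling_exponent_iterate ta_gt0 eps_gt0 improve.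
Qed.

End Iteration.

(** * Vinogradov's mean values *)

Definition vinogradov_count (k t N : nat) : nat :=
  #|[set xy : {ffun 'I_t -> 'I_N} * {ffun 'I_t -> 'I_N} |
     [forall j : 'I_k, (\sum_i (xy.1 i) ^ j.+1 == \sum_i (xy.2 i) ^ j.+1)%N]]|.

Lemma sum_e2pi_sqr (R : realType) (T : finType) (A : T -> R) :
  (\sum_x e2pi (A x)) * (\sum_x e2pi (A x))^*%C =
  \sum_(xy : T * T) e2pi (A xy.1 - A xy.2).
Proof.
rewrite rmorph_sum mulr_suml; under eq_bigr => x _ do rewrite mulr_sumr.
by rewrite pair_bigA; apply: eq_bigr => -[x y] _; rewrite e2piD e2piN.
Qed.

Section NearInt.
Variable R : realType.
Implicit Types (x y eps : R).

Definition near_int eps x := exists z : int, `|x - z%:~R| <= eps.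

Lemma near_int_le eps1 eps2 x : eps1 <= eps2 -> near_int eps1 x -> near_int eps2 x.
Proof. by move=> le_eps [z z_near]; exists z; exact: le_trans le_eps. Qed.

Lemma near_intN eps x : near_int eps x -> near_int eps (- x).
Proof. by case=> z z_near; exists (- z); rewrite intrN -opprD normrN. Qed.

Lemma near_intD eps1 eps2 x y :
  near_int eps1 x -> near_int eps2 y -> near_int (eps1 + eps2) (x + y).
Proof.
move=> [z z_near] [w w_near]; exists (z + w); rewrite intrD opprD addrACA.
exact: le_trans (ler_normD _ _) (lerD z_near w_near).
Qed.

Lemma near_int_sum (I : Type) (r : seq I) (P : pred I) (eps x : I -> R) :
  (forall i, P i -> near_int (eps i) (x i)) ->
  near_int (\sum_(i <- r | P i) eps i) (\sum_(i <- r | P i) x i).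
Proof.
move=> near; elim/big_rec2: _ => [|i y1 y2 Pi]; last exact: near_intD (near i Pi).
by exists 0; rewrite subrr normr0.
Qed.

Lemma near_intM eps x (n : nat) : near_int eps x -> near_int (n%:R * eps) (n%:R * x).
Proof.
case=> z z_near; exists (n%:Z * z).
by rewrite intrM -[(n%:Z)%:~R]/(n%:R) -mulrBr normrM ger0_norm // ler_wpM2l.
Qed.

Lemma near_int_small eps x : `|x| + eps < 1 -> near_int eps x -> `|x| <= eps.
Proof.
move=> lt1 [z z_near]; suff z0 : z = 0 by move: z_near; rewrite z0 subr0.
have : `|z%:~R| < 1 :> R.
  rewrite -[z%:~R](subKr x); apply: le_lt_trans (ler_normB _ _) _.
  by apply: le_lt_trans lt1; rewrite lerD2l.
by rewrite -intr_norm -[1]/(1%:~R) ltr_int; lia.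
Qed.

(* Successive multiples move by less than 1/2, so they all stay near the same
   multiple of the nearest integer. *)
Lemma near_int_of_multiples x (H : nat) : (0 < H)%N ->
  (forall h, (0 < h <= H)%N -> exists z : int, `|h%:R * x - z%:~R| < 4^-1) ->
  near_int (4 * H%:R)^-1 x.
Proof.
move=> H_gt0 multiples; have [|z0] := multiples 1%N; first by rewrite H_gt0.
rewrite mul1r => near1; exists z0; set y := x - _ in near1 *.
have small h : (0 < h <= H)%N -> `|h%:R * y| < 4^-1.
  elim: h => // h IHh /andP[_ hH].
  have [h0|h_gt0] := posnP h; first by rewrite h0 mul1r.
  have small_h : `|h%:R * y| < 4^-1 by apply: IHh; rewrite h_gt0 ltnW.
  have [|z z_near] := multiples h.+1; first by rewrite hH.
  have yE : h.+1%:R * y - (z - h.+1%:Z * z0)%:~R = h.+1%:R * x - z%:~R.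
    by rewrite intrB intrM -[(h.+1%:Z)%:~R]/(h.+1%:R) /y; ring.
  apply: le_lt_trans (_ : _ <= `|h.+1%:R * x - z%:~R|) (z_near).
  apply: near_int_small; last by exists (z - h.+1%:Z * z0); rewrite yE.
  have := ler_normD (h%:R * y) y; move: small_h near1 z_near.
  by rewrite -(natr1 h) [(_ + 1) * y]mulrDl mul1r; lra.
have := small H; rewrite H_gt0 leqnn => /(_ isT).
have H_gt0R : 0 < H%:R :> R by rewrite ltr0n.
rewrite normrM ger0_norm // => small_H; rewrite -(ler_pM2l H_gt0R).
have -> : H%:R * (4 * H%:R)^-1 = 4^-1 :> R by field; rewrite gt_eqF.
exact: ltW.
Qed.

End NearInt.

Section Moments.
Variables (R : realType) (k : nat).
Local Notation C := R[i].
Local Notation e2pi := (@e2pi R).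
Implicit Types (al be : 'I_k -> R).

Definition scale_coef (lam : int) al : 'I_k -> R := fun j => lam%:~R * al j.

Lemma scale_coef1 al : scale_coef 1 al = al.
Proof. by apply: boolp.funext => j; rewrite /scale_coef mul1r. Qed.

Lemma phase_scale_coef lam al x :
  phase (scale_coef lam al) x = \sum_j al j * (lam * x ^+ j.+1)%:~R.
Proof.
apply: eq_bigr => j _; rewrite /scale_coef rmorphM rmorphXn /=.
by rewrite [_ * al j]mulrC -mulrA.
Qed.

Definition power_diff (I : finType) (pos : I -> int) t
    (xy : {ffun 'I_t -> I} * {ffun 'I_t -> I}) (j : 'I_k) : int :=
  \sum_i pos (xy.1 i) ^+ j.+1 - \sum_i pos (xy.2 i) ^+ j.+1.

Lemma exp_sumX (I : finType) (pos : I -> int) al t :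
  exp_sum pos al ^+ t = \sum_(x : {ffun 'I_t -> I}) e2pi (\sum_i phase al (pos (x i))).
Proof.
rewrite -[in LHS](card_ord t) -prodr_const.
rewrite (bigA_distr_bigA (fun (i : 'I_t) x => e2pi (phase al (pos x)))) /=.
by apply: eq_bigr => x _; rewrite e2pi_sum.
Qed.

Lemma moment_exp_sum (I : finType) (pos : I -> int) t M lam : (0 < M)%N ->
  grid_mean M (fun al : 'I_k -> R => normc (exp_sum pos (scale_coef lam al)) ^+ (2 * t)) =
  #|[set xy : {ffun 'I_t -> I} * {ffun 'I_t -> I} |
     [forall j, (M%:Z %| lam * power_diff pos xy j)%Z]]|%:R.
Proof.
move=> M_gt0; apply: (@complexI R); rewrite -grid_mean_real.
have -> : (#|[set xy : {ffun 'I_t -> I} * {ffun 'I_t -> I} |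
     [forall j, (M%:Z %| lam * power_diff pos xy j)%Z]]|%:R)%:C%C =
   \sum_(xy : {ffun 'I_t -> I} * {ffun 'I_t -> I} |
      [forall j, (M%:Z %| lam * power_diff pos xy j)%Z]) (1 : C).
  by rewrite sumr_const rmorph_nat cardsE.
rewrite -(@grid_mean_count R k _ M (fun=> 1)) //; apply: eq_grid_mean => al.
rewrite normcX_double exp_sumX sum_e2pi_sqr; apply: eq_bigr => -[x y] _; rewrite mul1r /=.
congr e2pi.
have phaseE (z : {ffun 'I_t -> I}) : \sum_i phase (scale_coef lam al) (pos (z i)) =
    \sum_j al j * (\sum_i lam * pos (z i) ^+ j.+1)%:~R.
  rewrite (eq_bigr _ (fun i _ => phase_scale_coef lam al (pos (z i)))) exchange_big /=.
  by apply: eq_bigr => j _; rewrite rmorph_sum mulr_sumr.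
rewrite !phaseE -sumrB; apply: eq_bigr => j _; rewrite -mulrBr -rmorphB.
by rewrite /power_diff /= mulrBr !mulr_sumr.
Qed.

Definition nat_pos (N : nat) : 'I_N -> int := fun i => (i : nat)%:Z.

Definition weyl_sum (N : nat) al : C := exp_sum (@nat_pos N) al.

Lemma power_diff_nat (I : finType) (io : I -> nat) (pos : I -> int) t
    (xy : {ffun 'I_t -> I} * {ffun 'I_t -> I}) j : (forall i, pos i = (io i)%:Z) ->
  power_diff pos xy j =
  (\sum_i io (xy.1 i) ^ j.+1)%N%:Z - (\sum_i io (xy.2 i) ^ j.+1)%N%:Z.
Proof.
move=> posE; have sumE (z : {ffun 'I_t -> I}) :
    \sum_i pos (z i) ^+ j.+1 = (\sum_i io (z i) ^ j.+1)%N%:Z.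
  by rewrite -[RHS]natz natr_sum; apply: eq_bigr => i _; rewrite natrX natz posE.
by rewrite /power_diff !sumE.
Qed.

Lemma vinogradov_count_le_moment N t M : (0 < M)%N ->
  (vinogradov_count k t N)%:R <=
  grid_mean M (fun al : 'I_k -> R => normc (weyl_sum N al) ^+ (2 * t)).
Proof.
move=> M_gt0.
rewrite (@eq_grid_mean R k _ _ _
  (fun al => normc (exp_sum (@nat_pos N) (scale_coef 1 al)) ^+ (2 * t))); last first.
  by move=> al; rewrite scale_coef1.
rewrite moment_exp_sum // ler_nat; apply: subset_leq_card; apply/fintype.subsetP => xy.
rewrite !inE => /forallP xyP; apply/forallP => j.
by rewrite (@power_diff_nat _ (fun i : 'I_N => i : nat)) // (eqP (xyP j)) subrr mulr0 dvdz0.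
Qed.

Lemma dvdz_small_eq0 (M : nat) (z : int) : (`|z| < M)%N -> (M%:Z %| z)%Z -> z = 0.
Proof.
move=> z_lt; rewrite dvdzE /= => M_dvd; apply/eqP; rewrite -absz_eq0.
by apply: contraLR M_dvd => z_neq0; rewrite gtnNdvd // lt0n.
Qed.

Lemma abs_subz_leq (a b m : nat) : (a <= m)%N -> (b <= m)%N -> (`|a%:Z - b%:Z| <= m)%N.
Proof. by move=> am bm; lia. Qed.

Lemma moment_le_vinogradov_count (I : finType) (io : I -> nat) (pos : I -> int) N t M lam :
  injective io -> (forall i, (io i < N)%N) -> (forall i, pos i = (io i)%:Z) ->
  lam != 0 -> (`|lam| * (t * N ^ k) < M)%N ->
  grid_mean M (fun al : 'I_k -> R => normc (exp_sum pos (scale_coef lam al)) ^+ (2 * t)) <=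
  (vinogradov_count k t N)%:R.
Proof.
move=> io_inj io_lt posE lam_neq0 M_large.
rewrite moment_exp_sum ?(leq_ltn_trans _ M_large) // ler_nat.
pose g (x : {ffun 'I_t -> I}) : {ffun 'I_t -> 'I_N} := [ffun i => Ordinal (io_lt (x i))].
have g_inj : injective g.
  move=> x y /ffunP gE; apply/ffunP => i; apply: io_inj.
  by have := gE i; rewrite !ffunE => -[].
rewrite -(card_imset (f := fun xy => (g xy.1, g xy.2))); last first.
  by move=> [x y] [x' y'] [/g_inj -> /g_inj ->].
apply: subset_leq_card; apply/fintype.subsetP => _ /imsetP[[x y] + ->].
rewrite !inE => /forallP dvd_xy; apply/forallP => j /=.
have sum_gE (z : {ffun 'I_t -> I}) : (\sum_i (g z i) ^ j.+1 = \sum_i io (z i) ^ j.+1)%N.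
  by apply: eq_bigr => i _; rewrite ffunE.
have sum_le (z : {ffun 'I_t -> I}) : (\sum_i io (z i) ^ j.+1 <= t * N ^ k)%N.
  apply: (@leq_trans (\sum_(i < t) N ^ k)); last by rewrite sum_nat_const card_ord.
  apply: leq_sum => i _; have N_gt0 : (0 < N)%N by exact: leq_ltn_trans (io_lt (z i)).
  apply: (@leq_trans (N ^ j.+1)); first by rewrite leq_exp2r // ltnW.
  by rewrite leq_pexp2l.
have := dvd_xy j; rewrite (power_diff_nat _ _ posE) /= !sum_gE => /dvdz_small_eq0.
rewrite abszM (leq_ltn_trans _ M_large) => [/(_ isT)/eqP|]; last first.
  by rewrite leq_mul2l abs_subz_leq ?orbT.
by rewrite mulf_eq0 (negbTE lam_neq0) /= subr_eq0 eqz_nat.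
Qed.

Lemma moment_weyl_sum_le N t M : (t * N ^ k < M)%N ->
  grid_mean M (fun al : 'I_k -> R => normc (weyl_sum N al) ^+ (2 * t)) <=
  (vinogradov_count k t N)%:R.
Proof.
move=> M_large.
have := @moment_le_vinogradov_count _ (fun i : 'I_N => i : nat) (@nat_pos N) N t M 1.
rewrite /= mul1n => /(_ _ _ _ _ M_large) moment_le.
rewrite (@eq_grid_mean R k _ _ _
  (fun al => normc (exp_sum (@nat_pos N) (scale_coef 1 al)) ^+ (2 * t))).
  by apply: moment_le => //; exact: ord_inj.
by move=> al; rewrite scale_coef1.
Qed.

Definition close_mod1 N (eps : R) al be :=
  forall j : 'I_k, near_int (eps / N%:R ^+ j.+1) (al j - be j).

Lemma close_mod1_sym N eps al be : close_mod1 N eps al be -> close_mod1 N eps be al.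
Proof. by move=> close j; rewrite -opprB; exact: near_intN. Qed.

Lemma close_mod1_trans N eps1 eps2 al be ga :
  close_mod1 N eps1 al be -> close_mod1 N eps2 be ga -> close_mod1 N (eps1 + eps2) al ga.
Proof.
move=> close1 close2 j; rewrite mulrDl -[al j - ga j](subrKA (be j)).
exact: near_intD.
Qed.

Lemma phase_close N eps al be x : (0 < N)%N -> (x <= N)%N -> close_mod1 N eps al be ->
  normc (e2pi (phase al x%:Z) - e2pi (phase be x%:Z)) <= 8 * (k%:R * eps).
Proof.
move=> N_gt0 xN close; have [z z_close] := boolp.choice close.
have N_gt0R : 0 < N%:R :> R by rewrite ltr0n.
pose w : int := \sum_j z j * (x%:Z ^+ j.+1).
rewrite -(e2piDint (phase be _) w); apply: le_trans (e2pi_lipschitz _ _) _; rewrite ler_pM2l //.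
rewrite opprD addrA /phase -sumrB /w rmorph_sum /= -sumrB.
apply: le_trans (ler_norm_sum _ _ _) _.
rewrite mulr_natl -[X in _ *+ X](card_ord k) -sumr_const; apply: ler_sum => j _.
rewrite rmorphM rmorphXn /= -!mulrBl normrM normrX.
have -> : `|(x%:Z)%:~R : R| = x%:R by rewrite ger0_norm.
apply: le_trans (ler_wpM2r _ (z_close j)) _; first exact: exprn_ge0.
have eps_ge0 : 0 <= eps.
  have := le_trans (normr_ge0 _) (z_close j).
  by rewrite pmulr_lge0 // invr_gt0 exprn_gt0.
by rewrite mulrAC ler_pdivrMr ?exprn_gt0 // ler_wpM2l // lerXn2r ?nnegrE // ler_nat.
Qed.

Lemma weyl_sum_close N eps al be : (0 < N)%N -> close_mod1 N eps al be ->
  normc (weyl_sum N al - weyl_sum N be) <= N%:R * (8 * (k%:R * eps)).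
Proof.
move=> N_gt0 close; rewrite /weyl_sum /exp_sum -sumrB.
apply: le_trans (ler_normc_sum _ _ _) _.
rewrite mulr_natl -[X in _ *+ X](card_ord N) -sumr_const; apply: ler_sum => i _.
exact: (phase_close N_gt0 (ltnW (ltn_ord i)) close).
Qed.

Lemma card_large_weyl_sum N t M (c : R) : 0 <= c -> (t * N ^ k < M)%N ->
  #|[set a : {ffun 'I_k -> 'I_M} | c <= normc (weyl_sum N (grid_point R a))]|%:R *
    c ^+ (2 * t) <= (M ^ k)%:R * (vinogradov_count k t N)%:R.
Proof.
move=> c_ge0 M_large; set X := [set a | _].
have M_gt0 : (0 < M)%N by exact: leq_ltn_trans M_large.
have := moment_weyl_sum_le M_large.
rewrite /grid_mean ler_pdivrMr ?ltr0n ?expn_gt0 ?M_gt0 // mulrC => /(le_trans _); apply.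
rewrite mulr_natl -sumr_const [leRHS](bigID (mem X)) /=.
rewrite ler_wpDr ?sumr_ge0 // => [a _|]; first by rewrite exprn_ge0 ?normc_ge0.
by apply: ler_sum => a; rewrite inE => le_a; rewrite lerXn2r ?nnegrE ?normc_ge0.
Qed.

End Moments.

Lemma prod_pow_succ k N : (\prod_(j < k) N ^ j.+1 = N ^ tri_num k)%N.
Proof.
elim: k => [|k IHk]; first by rewrite big_ord0.
rewrite big_ord_recr /= IHk -expnD; congr (_ ^ _)%N; apply/eqP.
by rewrite -(eqn_pmul2l (isT : 0 < 2)%N) mulnDr !double_tri_num; apply/eqP; lia.
Qed.

Lemma prod_anisotropic_box k N :
  ((\prod_(j < k) N ^ (k - j.+1)) * N ^ tri_num k = N ^ (k * k))%N.
Proof.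
rewrite -prod_pow_succ -big_split /= (eq_bigr (fun=> N ^ k)%N) => [|j _].
  by rewrite prod_nat_const card_ord -expnM.
by rewrite -expnD subnK.
Qed.

Lemma card_box k M (b : 'I_k -> nat) : (forall j, (b j <= M)%N) ->
  #|family (fun j : 'I_k => [pred x : 'I_M | (x < b j)%N])| = (\prod_j b j)%N.
Proof.
move=> b_le; rewrite card_family foldrE big_map big_enum /=; apply: eq_bigr => j _.
rewrite -sum1_card; have := b_le j; move: (b j) => q qM.
rewrite (eq_bigl (fun i : 'I_M => (i < q)%N)) //.
by rewrite (big_ord_narrow qM) sum1_card card_ord.
Qed.

(* Around each point al i one places an anisotropic box of grid points, with sides
   1 / (D N^(j+1)). If the boxes were disjoint, the grid points with a large Weyl sum
   would be too many for the mean value bound. *)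
Section LargeValues.
Variables (R : realType) (k N D T : nat) (al : 'I_T -> 'I_k -> R).
Hypotheses (N_gt0 : (0 < N)%N) (D_gt0 : (0 < D)%N).
Local Notation M := (D * N ^ k)%N.
Local Notation grid := {ffun 'I_k -> 'I_M}.

Let M_gt0 : (0 < M)%N. Proof. by rewrite muln_gt0 D_gt0 expn_gt0 N_gt0. Qed.
Let N_gt0R : 0 < N%:R :> R. Proof. by rewrite ltr0n. Qed.
Let D_gt0R : 0 < D%:R :> R. Proof. by rewrite ltr0n. Qed.
Let M_gt0R : 0 < M%:R :> R. Proof. by rewrite ltr0n. Qed.

Definition box : {pred grid} :=
  family (fun j : 'I_k => [pred b : 'I_M | (b < N ^ (k - j.+1))%N]).

Definition box_point (ib : 'I_T * grid) : grid :=
  [ffun j => int_residue M_gt0 (Num.floor (al ib.1 j * M%:R) + (ib.2 j : nat)%:Z)].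

Lemma card_box_M : #|box| = (\prod_(j < k) N ^ (k - j.+1))%N.
Proof.
apply: card_box => j; apply: (@leq_trans (N ^ k)); last by rewrite leq_pmull.
by rewrite leq_pexp2l // leq_subr.
Qed.

Lemma box_sideE (j : 'I_k) : (N ^ (k - j.+1))%:R = D%:R^-1 / N%:R ^+ j.+1 * M%:R :> R.
Proof.
have -> : M%:R = D%:R * (N ^ (k - j.+1))%:R * N%:R ^+ j.+1 :> R.
  by rewrite -natrX -!natrM -mulnA -expnD subnK.
by field; rewrite expf_neq0 gt_eqF //= gt_eqF.
Qed.

Lemma box_point_close i b : b \in box ->
  close_mod1 N D%:R^-1 (al i) (grid_point R (box_point (i, b))).
Proof.
move=> /familyP b_box j; set x := al i j * M%:R.
have [z zE] := int_residueE M_gt0 (Num.floor x + (b j : nat)%:Z).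
exists z; rewrite /grid_point ffunE /= -/x.
have floor_x : 0 <= x - (Num.floor x)%:~R < 1.
  by have := floor_le x; have := floorD1_gt x; rewrite intrD; lra.
have residueE : (int_residue M_gt0 (Num.floor x + (b j : nat)%:Z) : nat)%:R =
    (Num.floor x)%:~R + (b j)%:R - z%:~R * M%:R :> R.
  apply: (canRL (addrK _)); rewrite -[(b j)%:R]/(((b j : nat)%:Z)%:~R) -intrD {2}zE.
  by rewrite intrD intrM.
have -> : al i j - (int_residue M_gt0 (Num.floor x + (b j : nat)%:Z))%:R / M%:R - z%:~R =
    (x - (Num.floor x)%:~R - (b j)%:R) / M%:R.
  by rewrite residueE !mulrBl mulrDl /x !mulfK ?gt_eqF //; ring.
rewrite normrM normfV (gtr0_norm M_gt0R) ler_pdivrMr // -box_sideE.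
have := b_box j; rewrite inE -(ltr_nat R) => b_lt.
have side_ge1 : 1 <= (N ^ (k - j.+1))%:R :> R by rewrite ler1n expn_gt0 N_gt0.
have b_ge0 : 0 <= (b j)%:R :> R by [].
rewrite ler_norml; move: (b j)%:R b_lt b_ge0 => y; lra.
Qed.

Lemma box_point_inj i : injective (fun b => box_point (i, b)).
Proof.
move=> b b' /ffunP pointE; apply/ffunP => j.
have /eqP := pointE j; rewrite !ffunE /= int_residue_eq opprD addrACA subrr add0r.
by rewrite -eqz_mod_dvd !modz_small ?ltz_nat ?ltn_ord // => /eqP[/ord_inj].
Qed.

Lemma close_of_box_collision : (exists2 ib, ib.2 \in box & exists2 ib', ib'.2 \in box &
    box_point ib = box_point ib' /\ ib <> ib') ->
  exists i i' : 'I_T, (i < i')%N /\ close_mod1 N (2 / D%:R) (al i') (al i).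
Proof.
move=> [[i b] b_box [[i' b'] b'_box [pointE neq]]].
have close : close_mod1 N (2 / D%:R) (al i) (al i').
  have -> : 2 / D%:R = D%:R^-1 + D%:R^-1 :> R by ring.
  apply: close_mod1_trans (box_point_close i b_box) _; rewrite pointE.
  exact/close_mod1_sym/box_point_close.
have [lt|gt|/ord_inj eq_i] := ltngtP i i'.
- by exists i, i'; split=> //; exact: close_mod1_sym.
- by exists i', i.
by case: neq; move: pointE; rewrite eq_i => /box_point_inj ->.
Qed.

Lemma box_points_large Y i b : (0 < Y)%N -> (16 * k * Y <= D)%N ->
  N%:R / Y%:R <= normc (weyl_sum N (al i)) -> b \in box ->
  N%:R / (2 * Y%:R) <= normc (weyl_sum N (grid_point R (box_point (i, b)))).
Proof.
move=> Y_gt0 large_D large_al b_box.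
have Y_gt0R : 0 < Y%:R :> R by rewrite ltr0n.
have close := weyl_sum_close N_gt0 (box_point_close i b_box).
have dist := lerB_normc (weyl_sum N (al i)) (weyl_sum N (grid_point R (box_point (i, b)))).
have small : N%:R * (8 * (k%:R * D%:R^-1)) <= N%:R / (2 * Y%:R) :> R.
  rewrite ler_pM2l // -[leRHS]mul1r ler_pdivlMr ?mulr_gt0 //.
  have -> : 8 * (k%:R * D%:R^-1) * (2 * Y%:R) = (16 * k * Y)%:R / D%:R :> R.
    by rewrite !natrM; field; rewrite gt_eqF.
  by rewrite ler_pdivrMr // mul1r ler_nat.
have halves : N%:R / Y%:R = N%:R / (2 * Y%:R) + N%:R / (2 * Y%:R) :> R.
  by field; rewrite gt_eqF.
by move: close dist large_al small halves; set x := N%:R / Y%:R; set y := N%:R / (2 * Y%:R); lra.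
Qed.

Lemma card_box_points_le Y : (0 < Y)%N -> (16 * k * Y <= D)%N ->
  (forall i, N%:R / Y%:R <= normc (weyl_sum N (al i))) ->
  {in [pred ib | ib.2 \in box] &, injective box_point} ->
  (T * \prod_(j < k) N ^ (k - j.+1) <=
   #|[set a : grid | (N%:R / (2 * Y%:R) <= normc (weyl_sum N (grid_point R a)))%R]|)%N.
Proof.
move=> Y_gt0 large_D large_al point_inj; set X := [set a | _].
pose boxes := finset.setX [set: 'I_T]%SET [set b in box].
have boxesP ib : (ib \in boxes) = (ib.2 \in box) by case: ib => i b; rewrite !inE.
have <- : #|boxes| = (T * \prod_(j < k) N ^ (k - j.+1))%N.
  by rewrite cardsX cardsT card_ord cardsE card_box_M.
rewrite -(card_in_imset (f := box_point)) => [|ib ib']; last first.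
  by rewrite !boxesP => ib_box ib'_box; apply: point_inj.
apply: subset_leq_card; apply/fintype.subsetP => _ /imsetP[[i b] ib_box ->].
by rewrite inE box_points_large // -[b \in _](boxesP (i, b)).
Qed.

End LargeValues.

Lemma large_values_close (R : realType) k N u D Y T (W : R) (al : 'I_T -> 'I_k -> R) :
  (0 < N)%N -> (0 < Y)%N -> (u < D)%N -> (16 * k * Y <= D)%N ->
  (vinogradov_count k u N)%:R <= W * (N ^ (2 * u))%:R / (N ^ tri_num k)%:R ->
  (forall i, N%:R / Y%:R <= normc (weyl_sum N (al i))) ->
  W * (2 * Y%:R) ^+ (2 * u) * D%:R ^+ k < T%:R ->
  exists i i' : 'I_T, (i < i')%N /\ close_mod1 N (2 / D%:R) (al i') (al i).
Proof.
move=> N_gt0 Y_gt0 uD large_D mean_value large_al; apply: contraPP => not_close.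
have D_gt0 : (0 < D)%N by exact: leq_ltn_trans uD.
have [N_gt0R Y_gt0R] : 0 < N%:R :> R /\ 0 < Y%:R :> R by rewrite !ltr0n.
apply/negP; rewrite -leNgt; set P := (\prod_(j < k) N ^ (k - j.+1))%N.
have card_le := @card_box_points_le R k N D T al N_gt0 D_gt0 Y Y_gt0 large_D large_al.
rewrite -(ler_nat R) natrM -/P in card_le.
have box_inj : {in [pred ib | ib.2 \in @box k N D] &, injective (box_point al N_gt0 D_gt0)}.
  move=> ib ib' ib_box ib'_box pointE; apply: contrapT => neq; apply: not_close.
  by apply: (close_of_box_collision (N_gt0 := N_gt0) (D_gt0 := D_gt0)); exists ib => //; exists ib'.
have c_ge0 : 0 <= N%:R / (2 * Y%:R) :> R by rewrite divr_ge0 // mulr_ge0.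
have M_large : (u * N ^ k < D * N ^ k)%N by rewrite ltn_mul2r expn_gt0 N_gt0.
have := le_trans (ler_wpM2r (exprn_ge0 (2 * u) c_ge0) (card_le box_inj))
  (card_large_weyl_sum c_ge0 M_large).
move=> /le_trans/(_ (ler_wpM2l (ler0n _ _) mean_value)).
have gridE : ((D * N ^ k) ^ k)%:R = D%:R ^+ k * (P%:R * (N ^ tri_num k)%:R) :> R.
  by rewrite -natrM prod_anisotropic_box expnMn -expnM natrM natrX.
rewrite gridE expr_div_n (natrX _ N (2 * u)).
have N_tri_gt0 : 0 < (N ^ tri_num k)%:R :> R by rewrite ltr0n expn_gt0 N_gt0.
have Y_pow_gt0 : 0 < (2 * Y%:R) ^+ (2 * u) :> R by rewrite exprn_gt0 // mulr_gt0.
have N_pow_gt0 : 0 < N%:R ^+ (2 * u) :> R by rewrite exprn_gt0.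
have P_gt0 : 0 < P%:R :> R by rewrite ltr0n prodn_gt0 // => j; rewrite expn_gt0 N_gt0.
have -> : D%:R ^+ k * (P%:R * (N ^ tri_num k)%:R) *
      (W * N%:R ^+ (2 * u) / (N ^ tri_num k)%:R) =
    W * (2 * Y%:R) ^+ (2 * u) * D%:R ^+ k *
    (P%:R * (N%:R ^+ (2 * u) / (2 * Y%:R) ^+ (2 * u))) :> R.
  by field; rewrite !gt_eqF.
by rewrite -mulrA ler_pM2r // mulr_gt0 // divr_gt0.
Qed.

(** * The inverse theorem for Weyl sums *)

Lemma bin_le_exp2 n m : ('C(n, m) <= 2 ^ n)%N.
Proof.
elim: n m => [|n IHn] [|m] //; first by rewrite bin0 expn_gt0.
by rewrite binS expnS mul2n -addnn leq_add.
Qed.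

Lemma sum_nat_shift (V : zmodType) (F : nat -> V) N h :
  \sum_(x < N) F (x + h)%N - \sum_(x < N) F x =
  \sum_(N <= x < N + h) F x - \sum_(x < h) F x.
Proof.
rewrite -(big_mkord xpredT (fun x => F (x + h)%N)) -!(big_mkord xpredT F).
have -> : \sum_(0 <= x < N) F (x + h)%N = \sum_(h <= x < N + h) F x.
  by have := big_addn 0 (N + h) h xpredT F; rewrite add0n addnK => ->.
have split_h : \sum_(0 <= x < N + h) F x = \sum_(0 <= x < h) F x + \sum_(h <= x < N + h) F x.
  by apply: big_cat_nat => //; rewrite leq_addl.
have split_N : \sum_(0 <= x < N + h) F x = \sum_(0 <= x < N) F x + \sum_(N <= x < N + h) F x.
  by apply: big_cat_nat => //; rewrite leq_addr.
apply/eqP; rewrite subr_eq addrAC eq_sym subr_eq; apply/eqP.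
by rewrite [LHS]addrC -split_N split_h addrC.
Qed.

Section ShiftCoefficients.
Variables (R : realType) (k : nat).
Local Notation e2pi := (@e2pi R).
Implicit Types (al be : 'I_k -> R).

(* The coefficients of the polynomial phase al (x + h) - phase al h in x. *)
Definition shift_coef (h : nat) al : 'I_k -> R := fun j =>
  \sum_(i < k | (j <= i)%N) 'C(i.+1, j.+1)%:R * h%:R ^+ (i - j) * al i.

Lemma phase_shift h al (x : nat) :
  phase al (x + h)%N%:Z = phase (shift_coef h al) x%:Z + phase al h%:Z.
Proof.
rewrite /phase /shift_coef; under [X in _ = X + _]eq_bigr => j _ do rewrite mulr_suml.
rewrite (exchange_big_dep predT) //= -big_split /=; apply: eq_bigr => i _.
rewrite -[((x + h)%N%:Z)%:~R]/((x + h)%:R) -[(x%:Z)%:~R]/(x%:R) -[(h%:Z)%:~R]/(h%:R).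
rewrite natrD [x%:R + _]addrC exprDn big_ord_recl /= bin0 expr0 mulr1 mulr1n subn0 mulrDr.
rewrite [LHS]addrC.
congr (_ + _); rewrite mulr_sumr.
rewrite (big_ord_widen k (fun j => al i * (h%:R ^+ (i.+1 - bump 0 j) *
   x%:R ^+ bump 0 j *+ 'C(i.+1, bump 0 j)))) //.
apply: eq_big => [j|j _]; first by rewrite ltnS.
by rewrite /bump /= add1n subSS -mulr_natr; ring.
Qed.

Lemma sum_phase_shift h al N :
  \sum_(x < N) e2pi (phase al (x + h)%N%:Z) =
  e2pi (phase al h%:Z) * weyl_sum N (shift_coef h al).
Proof.
rewrite /weyl_sum /exp_sum mulr_sumr; apply: eq_bigr => x _.
by rewrite phase_shift e2piD mulrC.
Qed.

Lemma weyl_sum_shift_close h al N :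
  normc (e2pi (phase al h%:Z) * weyl_sum N (shift_coef h al) - weyl_sum N al) <= 2 * h%:R.
Proof.
rewrite -sum_phase_shift /weyl_sum /exp_sum (sum_nat_shift (fun x => e2pi (phase al x%:Z))).
have seq_sum_le (r : seq nat) : normc (\sum_(x <- r) e2pi (phase al x%:Z)) <= (size r)%:R.
  apply: le_trans (ler_normc_sum _ _ _) _.
  rewrite (eq_bigr (fun=> 1)) => [|i _]; last exact: normc_e2pi.
  by rewrite big_const_seq count_predT iter_addr_0.
apply: le_trans (le_normcD _ _) _; rewrite normcN mulr2n mulrDl mul1r; apply: lerD.
  by apply: le_trans (seq_sum_le _) _; rewrite size_iota addKn.
rewrite -(big_mkord xpredT (fun x => e2pi (phase al x%:Z))).
by apply: le_trans (seq_sum_le _) _; rewrite size_iota subn0.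
Qed.

Lemma normc_weyl_sum_shift h al N :
  normc (weyl_sum N al) - 2 * h%:R <= normc (weyl_sum N (shift_coef h al)).
Proof.
have := weyl_sum_shift_close h al N; set z := e2pi _ * _ => z_close.
have -> : normc (weyl_sum N (shift_coef h al)) = normc z.
  by rewrite /z normcM normc_e2pi mul1r.
have := lerB_normc (weyl_sum N al) z; rewrite normc_distC; move: z_close; lra.
Qed.

Lemma shift_coef_self h al (j : 'I_k) :
  shift_coef h al j - al j =
  \sum_(i < k | (j < i)%N) 'C(i.+1, j.+1)%:R * h%:R ^+ (i - j) * al i.
Proof.
rewrite /shift_coef (bigD1 j) //= binn subnn expr0 !mul1r [al j + _]addrC addrK.
by apply: eq_bigl => i; rewrite ltn_neqAle andbC eq_sym.
Qed.

Lemma shift_coef_pred h al (j j1 : 'I_k) : (j1.+1 = j)%N ->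
  shift_coef h al j1 = al j1 + j.+1%:R * h%:R * al j +
  \sum_(i < k | (j < i)%N) 'C(i.+1, j)%:R * h%:R ^+ (i - j1) * al i.
Proof.
move=> jE; rewrite /shift_coef (bigD1 j1) //= binn subnn expr0 !mul1r -addrA; congr (_ + _).
rewrite (bigD1 j) /=; last by rewrite -jE leqnSn -(inj_eq val_inj) /= -jE gtn_eqF.
rewrite jE binSn; have -> : (j - j1 = 1)%N by rewrite -jE subSnn.
rewrite expr1; congr (_ + _); apply: eq_bigl => i; rewrite -!(inj_eq val_inj) /= -jE.
by move=> /=; lia.
Qed.

End ShiftCoefficients.

Section Weyl.
Variables (R : realType) (k u : nat).
Local Notation C := R[i].
Local Notation e2pi := (@e2pi R).
Local Notation weyl_sum := (@weyl_sum R k).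
Implicit Types (al be : 'I_k -> R).

(* Inverse theorem for the coefficients of index at least j: u is an exponent whose
   mean value is sharp up to Y, and E does not depend on N, Y, al. *)
Definition weyl_inverse (j E : nat) := forall N Y al, (1 < Y)%N -> (Y ^ E <= N)%N ->
  (vinogradov_count k u N)%:R <= Y%:R * (N ^ (2 * u))%:R / (N ^ tri_num k)%:R :> R ->
  N%:R / Y%:R <= normc (weyl_sum N al) ->
  exists2 q : nat, (0 < q <= Y ^ E)%N & forall i : 'I_k, (j <= i)%N ->
    near_int ((Y ^ E)%:R / N%:R ^+ i.+1) (q%:R * al i).

Lemma weyl_inverse_top : weyl_inverse k 0.
Proof. by move=> N Y al _ _ _ _; exists 1%N => // i; rewrite leqNgt ltn_ord. Qed.

(* Y ^ absorbing_exp exceeds every constant that occurs below, as Y >= 2. *)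
Let absorbing_exp := (k * 2 ^ k + u + 64 * k + 64)%N.
Let d := absorbing_exp.+1.

Section Level.
Variables (N Y E q : nat) (al : 'I_k -> R).
Hypotheses (Y_gt1 : (1 < Y)%N) (N_gt0 : (0 < N)%N) (q_gt0 : (0 < q)%N).

Let Y_gt0 : (0 < Y)%N. Proof. exact: ltnW. Qed.
Let YR_gt0 a : 0 < (Y ^ a)%:R :> R. Proof. by rewrite ltr0n expn_gt0 Y_gt0. Qed.
Let NR_gt0 : 0 < N%:R :> R. Proof. by rewrite ltr0n. Qed.

Lemma leq_absorbing_exp m : (m <= absorbing_exp)%N -> (m <= Y ^ absorbing_exp)%N.
Proof.
move=> m_le; apply: leq_trans m_le _.
apply: leq_trans (ltnW (ltn_expl absorbing_exp (isT : 1 < 2)%N)) _.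
by rewrite leq_exp2r // /absorbing_exp addn_gt0 orbT.
Qed.

Lemma leq_muln_expd m : (m <= absorbing_exp)%N -> (m * Y <= Y ^ d)%N.
Proof. by move=> m_le; rewrite /d expnSr leq_mul2r leq_absorbing_exp ?orbT. Qed.

Lemma near_int_shift_term g h m j (i : 'I_k) :
  (q %| h)%N -> (h * Y ^ g <= N)%N -> (m + j = i.+1)%N -> (0 < m)%N ->
  near_int ((Y ^ E)%:R / N%:R ^+ i.+1) (q%:R * al i) ->
  near_int ((Y ^ E)%:R / (Y ^ g)%:R / N%:R ^+ j) (h%:R ^+ m * al i).
Proof.
move=> /dvdnP[w hE] h_small mj m_gt0 /(near_intM (w * h ^ m.-1)).
have -> : (w * h ^ m.-1)%:R * (q%:R * al i) = h%:R ^+ m * al i.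
  by rewrite mulrA -natrM mulnAC -hE -expnS prednK // natrX.
apply: near_int_le; have h_le : h%:R <= N%:R / (Y ^ g)%:R :> R.
  by rewrite ler_pdivlMr // -natrM ler_nat.
apply: (@le_trans _ _ (h%:R ^+ m * ((Y ^ E)%:R / N%:R ^+ i.+1))).
  rewrite ler_wpM2r ?divr_ge0 ?exprn_ge0 // -natrX ler_nat -{2}(prednK m_gt0) expnS.
  by rewrite leq_mul2r hE leq_pmulr ?orbT.
have hm_le : h%:R ^+ m <= N%:R ^+ m / (Y ^ g)%:R :> R.
  apply: (@le_trans _ _ ((N%:R / (Y ^ g)%:R) ^+ m)).
    by rewrite lerXn2r ?nnegrE ?divr_ge0.
  rewrite expr_div_n ler_wpM2l ?exprn_ge0 // lef_pV2 ?posrE ?exprn_gt0 //.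
  by rewrite -{1}[(Y ^ g)%:R]expr1 ler_weXn2l // ler1n expn_gt0 Y_gt0.
apply: le_trans (ler_wpM2r _ hm_le) _; first by rewrite divr_ge0 ?exprn_ge0.
rewrite -mj exprD le_eqVlt; apply/orP; left; apply/eqP.
by field; rewrite !expf_neq0 ?(gt_eqF NR_gt0) //= gt_eqF.
Qed.

(* The coefficients al i with a good approximation of denominator q contribute almost
   integers to the shifted coefficients, provided q divides the shift. *)
Lemma near_int_shift_tail g h (P : pred 'I_k) (c m : 'I_k -> nat) (j : nat) :
  (E + d + absorbing_exp <= g)%N -> (q %| h)%N -> (h * Y ^ g <= N)%N ->
  (forall i, P i -> near_int ((Y ^ E)%:R / N%:R ^+ i.+1) (q%:R * al i)) ->
  (forall i, P i -> (c i <= 2 ^ k)%N) -> (forall i, P i -> (m i + j = i.+1)%N /\ (0 < m i)%N) ->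
  near_int ((Y ^ d)%:R^-1 / N%:R ^+ j) (\sum_(i < k | P i) (c i)%:R * h%:R ^+ m i * al i).
Proof.
move=> g_large q_dvd h_small approx c_le mE.
pose eps : R := (Y ^ E)%:R / (Y ^ g)%:R / N%:R ^+ j.
have eps_ge0 : 0 <= eps by rewrite !divr_ge0 ?exprn_ge0.
have near_term i : P i -> near_int ((2 ^ k)%:R * eps) ((c i)%:R * h%:R ^+ m i * al i).
  move=> Pi; have [mj m_gt0] := mE i Pi; rewrite -mulrA.
  apply: near_int_le (near_intM _ (near_int_shift_term q_dvd h_small mj m_gt0 (approx i Pi))).
  by rewrite ler_wpM2r // ler_nat c_le.
apply: near_int_le (near_int_sum _ near_term).
apply: (@le_trans _ _ (\sum_(i < k) (2 ^ k)%:R * eps)).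
  by rewrite [leRHS](bigID P) /= lerDl sumr_ge0 // => i _; rewrite mulr_ge0.
rewrite sumr_const card_ord -[_ *+ k]mulr_natl mulrA -natrM mulrA ler_wpM2r ?invr_ge0 ?exprn_ge0 //.
rewrite mulrA -natrM ler_pdivrMr // mulrC ler_pdivlMr // -natrM ler_nat.
apply: (@leq_trans (Y ^ absorbing_exp * Y ^ E * Y ^ d)).
  rewrite !leq_mul2r; apply/orP; right; apply/orP; right; apply: leq_absorbing_exp.
  by rewrite /absorbing_exp -!addnA leq_addr.
by rewrite -!expnD leq_exp2l //; move: g_large; lia.
Qed.

Section Step.
Variables j j1 : 'I_k.
Hypothesis jE : j1.+1 = j :> nat.
Hypothesis mean_value :
  (vinogradov_count k u N)%:R <= Y%:R * (N ^ (2 * u))%:R / (N ^ tri_num k)%:R :> R.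
Hypothesis large_sum : N%:R / Y%:R <= normc (weyl_sum N al).
Hypothesis approx : forall i : 'I_k, (j < i)%N ->
  near_int ((Y ^ E)%:R / N%:R ^+ i.+1) (q%:R * al i).
Hypothesis q_le : (q <= Y ^ E)%N.

Let b := (1 + 6 * u + d * k)%N.
Let g := (E + d + absorbing_exp + 3)%N.
Let G := (E + 2 * b + g)%N.
Local Notation be := (j.+1%:R * q%:R * al j).
Local Notation eps := (4 / (Y ^ d)%:R / N%:R ^+ j : R).

Lemma shifted_weyl_sum_large h : (h * Y ^ g <= N)%N ->
  N%:R / (2 * Y)%:R <= normc (weyl_sum N (shift_coef h al)).
Proof.
move=> h_small; apply: le_trans (normc_weyl_sum_shift _ _ _).
have shift_le : (4 * Y * h <= N)%N.
  apply: leq_trans h_small; rewrite mulnC leq_mul2l; apply/orP; right.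
  apply: (@leq_trans (Y ^ 3)); last by rewrite leq_exp2l // /g; clear; lia.
  by rewrite expnSr leq_mul2r (@leq_exp2r 2 Y 2) // Y_gt1 orbT.
rewrite -(ler_nat R) !natrM in shift_le; rewrite natrM.
have YR1_gt0 : 0 < Y%:R :> R by rewrite ltr0n.
apply: (@le_trans _ _ (N%:R / Y%:R - 2 * h%:R)); last by rewrite lerD2r.
rewrite lerBrDl -lerBrDr.
have -> : N%:R / Y%:R - N%:R / (2 * Y%:R) = N%:R / (2 * Y%:R) :> R.
  by field; rewrite gt_eqF.
by rewrite ler_pdivlMr ?mulr_gt0 //; move: shift_le; lra.
Qed.

Lemma near_int_of_close_shifts h h' : (h <= h')%N -> (q %| h)%N -> (q %| h')%N ->
  (h' * Y ^ g <= N)%N ->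
  close_mod1 N (2 / (Y ^ d)%:R) (shift_coef h' al) (shift_coef h al) ->
  near_int eps (j.+1%:R * (h' - h)%:R * al j).
Proof.
move=> hh' q_h q_h' h'_small /(_ j1); rewrite !(shift_coef_pred _ _ jE) jE => close.
have tail h0 : (q %| h0)%N -> (h0 * Y ^ g <= N)%N -> near_int ((Y ^ d)%:R^-1 / N%:R ^+ j)
    (\sum_(i < k | (j < i)%N) 'C(i.+1, j)%:R * h0%:R ^+ (i - j1) * al i).
  move=> q_h0 h0_small; apply: (@near_int_shift_tail g h0) => //.
  - by rewrite /g leq_addr.
  - by move=> i _; apply: leq_trans (bin_le_exp2 _ _) _; rewrite leq_exp2l // ltn_ord.
  - by move=> i; rewrite -jE; split; lia.
have h_small : (h * Y ^ g <= N)%N by apply: leq_trans h'_small; rewrite leq_mul2r hh' orbT.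
have := near_intD (near_intD close (tail h q_h h_small)) (near_intN (tail h' q_h' h'_small)).
set A := \sum_(_ < k | _) _; set A' := \sum_(_ < k | _) _.
rewrite natrB //; have -> : eps = 2 / (Y ^ d)%:R / N%:R ^+ j + (Y ^ d)%:R^-1 / N%:R ^+ j +
  (Y ^ d)%:R^-1 / N%:R ^+ j :> R by ring.
by congr near_int; ring.
Qed.

(* Among B + 1 equally spaced shifts two are close by the large values estimate. *)
Lemma small_multiple_near_int w : (q * w * Y ^ b * Y ^ g <= N)%N ->
  exists2 r : nat, (0 < r <= Y ^ b)%N & near_int eps (r%:R * w%:R * be).
Proof.
move=> w_small; pose shifts (i : 'I_(Y ^ b).+1) := shift_coef (q * (w * i)) al.
have shift_small (i : 'I_(Y ^ b).+1) : (q * (w * i) * Y ^ g <= N)%N.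
  apply: leq_trans w_small; rewrite leq_mul2r mulnA leq_mul2l.
  by rewrite -ltnS ltn_ord !orbT.
have large i := shifted_weyl_sum_large (shift_small i).
have Y2_gt0 : (0 < 2 * Y)%N by rewrite muln_gt0.
have u_lt : (u < Y ^ d)%N.
  apply: (@leq_trans (u.+1 * Y)); first by rewrite leq_pmulr.
  by apply: leq_muln_expd; rewrite /absorbing_exp; clear; lia.
have Y_small : (16 * k * (2 * Y) <= Y ^ d)%N.
  have -> : (16 * k * (2 * Y) = 32 * k * Y)%N by lia.
  by apply: leq_muln_expd; rewrite /absorbing_exp; clear; lia.
have many : Y%:R * (2 * (2 * Y)%:R) ^+ (2 * u) * (Y ^ d)%:R ^+ k < (Y ^ b).+1%:R :> R.
  have -> : 2 * (2 * Y)%:R = (4 * Y)%:R :> R by rewrite !natrM; ring.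
  rewrite -!natrX -!natrM ltr_nat ltnS (_ : b = (6 * u).+1 + d * k)%N //.
  rewrite [(Y ^ (_ + _))%N]expnD [(Y ^ (6 * u).+1)%N]expnS -expnM.
  rewrite leq_mul2r; apply/orP; right; rewrite leq_mul2l; apply/orP; right.
  have -> : (6 * u = 3 * (2 * u))%N by lia.
  rewrite [(Y ^ (3 * _))%N]expnM; case: (posnP (2 * u)) => [->//|u_gt0]; rewrite leq_exp2r //.
  by rewrite expnSr leq_mul2r (@leq_exp2r 2 Y 2) // Y_gt1 orbT.
have [i [i' [ii' close]]] := large_values_close N_gt0 Y2_gt0 u_lt Y_small mean_value large many.
exists (i' - i)%N; first by rewrite subn_gt0 ii' (leq_trans (leq_subr _ _)) // -ltnS ltn_ord.
have shifts_le : (q * (w * i) <= q * (w * i'))%N by rewrite !leq_mul2l ltnW ?orbT.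
have := near_int_of_close_shifts shifts_le (dvdn_mulr _ (dvdnn q)) (dvdn_mulr _ (dvdnn q))
  (shift_small i') close.
by congr near_int; rewrite -!mulnBr !natrM; ring.
Qed.

(* At the scale L = N / Y^G, a multiple r L ga that is small and nearly an integer is tiny. *)
Lemma tiny_of_rescaled (r : nat) (ga : R) : (0 < r <= Y ^ b)%N -> (Y ^ G <= N)%N ->
  `|ga| <= eps -> near_int eps ((r * (N %/ Y ^ G))%:R * ga) ->
  `|ga| <= (Y ^ G)%:R / N%:R ^+ j.+1.
Proof.
move=> /andP[r_gt0 r_le] N_large ga_le; set L := (N %/ Y ^ G)%N => near_ga.
have YG_gt0 : (0 < Y ^ G)%N by rewrite expn_gt0 Y_gt0.
have L_le : L%:R <= N%:R / (Y ^ G)%:R :> R.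
  by rewrite ler_pdivlMr // -natrM ler_nat leq_trunc_div.
have N_le : N%:R / (Y ^ G)%:R <= 2 * L%:R :> R.
  rewrite ler_pdivrMr // -!natrM ler_nat; apply: leq_trans (ltnW (ltn_ceil N YG_gt0)) _.
  by rewrite -/L leq_mul2r mul2n -addnn -addn1 leq_add2l divn_gt0 // N_large orbT.
have d_large : 64 <= (Y ^ d)%:R :> R.
  rewrite (ler_nat _ 64); apply: leq_trans (leq_muln_expd (m := 64) _).
    by rewrite leq_pmulr.
  by rewrite /absorbing_exp leq_addl.
have four_le : 4 / (Y ^ d)%:R <= 16^-1 :> R by rewrite ler_pdivrMr //; lra.
have eps_le : eps <= 16^-1.
  apply: le_trans four_le; rewrite ler_pdivrMr ?exprn_gt0 // ler_peMr ?divr_ge0 //.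
  by rewrite exprn_ege1 // ler1n.
have small_ga : `|(r * L)%:R * ga| <= 16^-1.
  rewrite normrM ger0_norm // natrM.
  apply: (@le_trans _ _ ((Y ^ b)%:R * (N%:R / (Y ^ G)%:R) * eps)).
    by rewrite !ler_pM ?mulr_ge0 // ler_nat.
  have -> : (Y ^ b)%:R * (N%:R / (Y ^ G)%:R) * eps =
     ((Y ^ b)%:R / (Y ^ G)%:R) * (N%:R / N%:R ^+ j) * (4 / (Y ^ d)%:R) :> R by ring.
  apply: le_trans four_le; rewrite ler_piMl ?divr_ge0 // mulr_ile1 ?divr_ge0 ?exprn_ge0 //.
    by rewrite ler_pdivrMr // mul1r ler_nat leq_exp2l // /G; clear; lia.
  by rewrite ler_pdivrMr ?exprn_gt0 // mul1r -{1}[N%:R]expr1 ler_weXn2l ?ler1n // -jE.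
have lt1 : `|(r * L)%:R * ga| + eps < 1 by move: small_ga eps_le; lra.
have := near_int_small lt1 near_ga; rewrite normrM ger0_norm // => tiny.
have L_ga : L%:R * `|ga| <= eps.
  by apply: le_trans tiny; rewrite ler_wpM2r // ler_nat leq_pmull.
have : N%:R / (Y ^ G)%:R * `|ga| <= 2 * eps.
  by apply: le_trans (ler_wpM2r (normr_ge0 ga) N_le) _; rewrite -(mulrA 2) ler_pM2l.
rewrite -ler_pdivlMl ?divr_gt0 // => /le_trans; apply.
rewrite invf_div; have -> : (Y ^ G)%:R / N%:R * (2 * eps) =
    8 / (Y ^ d)%:R * ((Y ^ G)%:R / (N%:R ^+ j * N%:R)) :> R.
  by field; rewrite expf_neq0 gt_eqF //= gt_eqF.
by rewrite -exprSr ler_piMl ?divr_ge0 ?exprn_ge0 // ler_pdivrMr //; move: d_large; lra.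
Qed.

Lemma next_coefficient_near_int : (Y ^ G <= N)%N ->
  exists2 r, (0 < r <= Y ^ b)%N & near_int ((Y ^ G)%:R / N%:R ^+ j.+1) (r%:R * be).
Proof.
move=> N_large.
have GE : (Y ^ G = Y ^ E * Y ^ b * Y ^ b * Y ^ g)%N.
  by rewrite -!expnD; congr (_ ^ _)%N; rewrite /G; clear; lia.
have [|r1 /andP[r1_gt0 r1_le] near1] := small_multiple_near_int (w := 1).
  apply: leq_trans N_large; rewrite muln1 GE !leq_mul //.
  by rewrite (leq_trans q_le) // leq_pmulr // expn_gt0 Y_gt0.
have [|r2 r2_itv [z2 z2_near]] := small_multiple_near_int (w := r1 * (N %/ Y ^ G)).
  apply: leq_trans (leq_trunc_div N (Y ^ G)); rewrite [X in (_ <= _ * X)%N]GE.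
  rewrite [leqLHS](_ : _ = N %/ Y ^ G * (q * r1 * Y ^ b * Y ^ g))%N; last by ring.
  by rewrite leq_mul2l !leq_mul ?orbT.
exists r1; first by rewrite r1_gt0.
rewrite mulr1 in near1; have [z z_near] := near1; exists z.
apply: tiny_of_rescaled r2_itv N_large z_near _.
exists (z2 - (r2 * (N %/ Y ^ G))%:Z * z); move: z2_near; congr (`|_| <= _).
by rewrite intrB intrM -[(_%:Z)%:~R]/(_%:R) !natrM; ring.
Qed.

End Step.
End Level.

Lemma weyl_inverse_step (j : 'I_k) E : (0 < j)%N -> weyl_inverse j.+1 E ->
  exists E', weyl_inverse j E'.
Proof.
move=> j_gt0 inverse_j; pose b := (1 + 6 * u + d * k)%N.
pose g := (E + d + absorbing_exp + 3)%N; pose G := (E + 2 * b + g)%N.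
pose E' := (G + b + absorbing_exp + E)%N.
exists E' => N Y al Y_gt1 N_large mean_value large_sum.
have Y_gt0 : (0 < Y)%N by exact: ltnW.
have N_gt0 : (0 < N)%N by apply: leq_trans N_large; rewrite expn_gt0 Y_gt0.
have N_ge a : (a <= E')%N -> (Y ^ a <= N)%N.
  by move=> aE'; apply: leq_trans N_large; rewrite leq_exp2l.
have [|q /andP[q_gt0 q_le] approx] := inverse_j N Y al Y_gt1 _ mean_value large_sum.
  by apply: N_ge; rewrite /E'; clear; lia.
have j1_lt : (j.-1 < k)%N by apply: leq_ltn_trans (leq_pred j) (ltn_ord j).
have [||r /andP[r_gt0 r_le] near_j] := @next_coefficient_near_int N Y E q al Y_gt1 N_gt0 q_gt0
  j (Ordinal j1_lt) _ mean_value large_sum approx q_le.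
- by rewrite /= prednK.
- by apply: N_ge; rewrite /E' /G /g /b; clear; lia.
have rj_le : (r * j.+1 <= Y ^ b * Y ^ absorbing_exp)%N.
  rewrite leq_mul //; apply: leq_absorbing_exp => //; apply: leq_trans (ltn_ord j) _.
  by rewrite /absorbing_exp; clear; lia.
exists (r * j.+1 * q)%N.
  rewrite !muln_gt0 r_gt0 q_gt0 /=; apply: leq_trans (leq_mul rj_le q_le) _.
  by rewrite -!expnD leq_exp2l // /E'; clear; lia.
move=> i; rewrite leq_eqVlt => /orP[/eqP/ord_inj <-|ji].
  have -> : (r * j.+1 * q)%:R * al j = r%:R * (j.+1%:R * q%:R * al j).
    by rewrite !natrM; ring.
  apply: near_int_le near_j; rewrite ler_wpM2r ?invr_ge0 ?exprn_ge0 // ler_nat leq_exp2l //.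
  by rewrite /E' /G /g /b; clear; lia.
rewrite natrM -mulrA; apply: near_int_le (near_intM (r * j.+1) (approx i ji)).
rewrite mulrA -natrM ler_wpM2r ?invr_ge0 ?exprn_ge0 // ler_nat.
apply: leq_trans (leq_mul rj_le (leqnn _)) _.
by rewrite -!expnD leq_exp2l // /E'; clear; lia.
Qed.

Section LastCoefficient.
Variables (N Y E q : nat) (al : 'I_k -> R) (o : 'I_k).
Hypotheses (Y_gt1 : (1 < Y)%N) (N_gt0 : (0 < N)%N) (q_gt0 : (0 < q)%N).
Hypotheses (o0 : o = 0%N :> nat) (large_sum : N%:R / Y%:R <= normc (weyl_sum N al)).
Hypothesis approx : forall i : 'I_k, (0 < i)%N ->
  near_int ((Y ^ E)%:R / N%:R ^+ i.+1) (q%:R * al i).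

Let g := (E + d + absorbing_exp)%N.
Let Y_gt0 : (0 < Y)%N. Proof. exact: ltnW. Qed.
Let NR_gt0 : 0 < N%:R :> R. Proof. by rewrite ltr0n. Qed.
Let Yd_gt0 : 0 < (Y ^ d)%:R :> R. Proof. by rewrite ltr0n expn_gt0 Y_gt0. Qed.

Lemma shift_coef_close h : (q %| h)%N -> (h * Y ^ g <= N)%N ->
  close_mod1 N (Y ^ d)%:R^-1 (shift_coef h al) al.
Proof.
move=> q_h h_small j; rewrite shift_coef_self.
apply: (near_int_shift_tail Y_gt1 N_gt0 q_gt0 (leqnn g)) => //.
- by move=> i ji; apply: approx; apply: leq_ltn_trans ji.
- by move=> i _; apply: leq_trans (bin_le_exp2 _ _) _; rewrite leq_exp2l // ltn_ord.
- by move=> i; split; lia.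
Qed.

Lemma e2pi_phase_close h : (q %| h)%N -> (h * Y ^ g <= N)%N ->
  normc (e2pi (h%:R * al o) - e2pi (phase al h%:Z)) <= 8 * (Y ^ d)%:R^-1.
Proof.
move=> q_h h_small.
have phaseE : phase al h%:Z = h%:R * al o + \sum_(i < k | (0 < i)%N) 1%:R * h%:R ^+ i.+1 * al i.
  rewrite /phase (bigD1 o) //= o0 expr1 mulrC; congr (_ + _).
  apply: eq_big => [i|i _]; last by rewrite mul1r mulrC.
  by rewrite -(inj_eq val_inj) /= o0 lt0n.
have [||z] := @near_int_shift_tail N Y E q al Y_gt1 N_gt0 q_gt0 g h
  (fun i => 0 < i)%N (fun=> 1%N) (fun i => i.+1) 0 (leqnn g) q_h h_small approx.
- by move=> i _; rewrite expn_gt0.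
- by move=> i _; rewrite addn0.
rewrite expr0 divr1 => z_near; rewrite -(e2piDint (h%:R * al o) z).
apply: le_trans (e2pi_lipschitz _ _) _; rewrite ler_pM2l // distrC phaseE.
by rewrite opprD addrACA subrr add0r.
Qed.

Lemma e2pi_multiple_near1 h : (q %| h)%N -> (h * Y ^ g <= N)%N ->
  normc (e2pi (h%:R * al o) - 1) < 1.
Proof.
move=> q_h h_small.
have YR_gt0 : 0 < Y%:R :> R by rewrite ltr0n.
have phase_near := e2pi_phase_close q_h h_small.
have sum_near := weyl_sum_close N_gt0 (shift_coef_close q_h h_small).
have shift_near := weyl_sum_shift_close h al N.
rewrite -subr_gt0 -(pmulr_rgt0 _ (divr_gt0 NR_gt0 YR_gt0)) mulrBr mulr1 subr_gt0.
apply: le_lt_trans (ler_wpM2r (normc_ge0 _) large_sum) _; rewrite mulrC -normcM.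
set A := e2pi _ in phase_near *; set B := e2pi (phase _ _) in phase_near shift_near *.
set S := weyl_sum N al in sum_near shift_near *; set S' := weyl_sum N _ in sum_near shift_near.
have -> : (A - 1) * S = (A - B) * S + (B * (S - S') + (B * S' - S)) by ring.
apply: le_lt_trans (le_normcD _ _) _; have triangle := le_normcD (B * (S - S')) (B * S' - S).
rewrite !normcM normc_e2pi mul1r [normc (S - S')]normc_distC in triangle *.
have phase_term : normc (A - B) * normc S <= 8 * (Y ^ d)%:R^-1 * N%:R.
  apply: ler_pM; rewrite ?normc_ge0 //; apply: le_trans (normc_exp_sum_le _ _) _.
  by rewrite card_ord.
have h_le : h%:R <= N%:R / (Y ^ d)%:R :> R.
  rewrite ler_pdivlMr // -natrM ler_nat; apply: leq_trans h_small.
  by rewrite leq_mul2l leq_exp2l // /g; clear; lia.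
apply: (@le_lt_trans _ _ (N%:R * (8 * k + 8 + 2)%:R / (Y ^ d)%:R)).
  move: sum_near shift_near triangle phase_term h_le; rewrite 2!natrD natrM.
  set v := (Y ^ d)%:R^-1; set x1 := normc _; set x2 := normc _; set x3 := normc _.
  by set x4 := _ * normc _; nra.
rewrite ltr_pdivrMr // -mulrA ltr_pM2l // mulrC ltr_pdivlMr // -natrM ltr_nat.
apply: leq_trans (leq_muln_expd Y_gt1 (m := 8 * k + 11) _); last first.
  by rewrite /absorbing_exp; clear; lia.
by rewrite ltn_mul2r Y_gt0 /=; clear; lia.
Qed.

End LastCoefficient.

Lemma weyl_inverse_last (o : 'I_k) E : o = 0%N :> nat -> weyl_inverse 1 E ->
  exists E', weyl_inverse 0 E'.
Proof.
move=> o0 inverse_1; pose g := (E + d + absorbing_exp)%N; pose E' := (E + g)%N.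
exists E' => N Y al Y_gt1 N_large mean_value large_sum.
have Y_gt0 : (0 < Y)%N by exact: ltnW.
have YE'_gt0 : (0 < Y ^ E')%N by rewrite expn_gt0 Y_gt0.
have N_gt0 : (0 < N)%N by apply: leq_trans N_large.
have [|q /andP[q_gt0 q_le] approx] := inverse_1 N Y al Y_gt1 _ mean_value large_sum.
  by apply: leq_trans N_large; rewrite leq_exp2l // leq_addr.
exists q; first by rewrite q_gt0 (leq_trans q_le) // leq_exp2l // leq_addr.
pose H := (N %/ Y ^ E')%N; have H_gt0 : (0 < H)%N by rewrite divn_gt0.
have near_o : near_int (4 * H%:R)^-1 (q%:R * al o).
  apply: near_int_of_multiples => // w /andP[w_gt0 wH]; apply: e2pi_near1.
  rewrite mulrA -natrM mulnC; apply: e2pi_multiple_near1 approx _ _ _ => //.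
    exact: dvdn_mulr.
  apply: leq_trans (leq_trunc_div N (Y ^ E')); rewrite -/H [(Y ^ E')%N]expnD.
  rewrite [leqRHS](_ : _ = Y ^ g * (Y ^ E * H))%N; last by lia.
  by rewrite mulnC leq_mul2l leq_mul ?orbT.
move=> i _; case: (posnP i) => [i0|i_gt0].
  have -> : i = o by apply: val_inj; rewrite /= o0.
  apply: near_int_le near_o; rewrite o0 expr1.
  rewrite ler_pdivlMr ?ltr0n // ler_pdivrMl ?mulr_gt0 ?ltr0n // -!natrM ler_nat.
  apply: leq_trans (ltnW (ltn_ceil N YE'_gt0)) _; rewrite -/H leq_mul2r; apply/orP; right; lia.
apply: near_int_le (approx i i_gt0).
by rewrite ler_wpM2r ?invr_ge0 ?exprn_ge0 // ler_nat leq_exp2l // leq_addr.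
Qed.

Theorem weyl_inverse_theorem : exists E, weyl_inverse 0 E.
Proof.
have descend j : (j <= k)%N -> (0 < k - j)%N \/ k = 0%N -> exists E, weyl_inverse (k - j) E.
  elim: j => [|j IHj] jk kj; first by rewrite subn0; exists 0%N; exact: weyl_inverse_top.
  have [E inverse_j] := IHj (ltnW jk) (or_introl (ltac:(lia) : (0 < k - j)%N)).
  have lt_k : (k - j.+1 < k)%N by lia.
  apply: (@weyl_inverse_step (Ordinal lt_k) E); first by case: kj => //= kj; lia.
  by rewrite /= subnSK.
have [k0|k_gt0] := posnP k.
  by exists 0%N; rewrite -[X in weyl_inverse X]k0; exact: weyl_inverse_top.
have [||E inverse_1] := descend k.-1; [by lia|by left; lia|].
apply: (@weyl_inverse_last (Ordinal k_gt0) E) => //.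
by have -> : 1%N = (k - k.-1)%N by lia.
Qed.

End Weyl.

(** * Removal of the eps-loss *)

Lemma sum_blocks (V : nmodType) (F : nat -> V) L m :
  \sum_(x < L * m) F x = \sum_(i < m) \sum_(y < L) F (L * i + y)%N.
Proof.
elim: m => [|m IHm]; first by rewrite muln0 !big_ord0.
by rewrite mulnSr big_split_ord big_ord_recr /= IHm.
Qed.

Lemma periodic_muln (T : Type) (u : nat -> T) q x i :
  (forall x, u (x + q)%N = u x) -> u (x + q * i)%N = u x.
Proof. by move=> per; elim: i => [|i IHi]; rewrite ?muln0 ?addn0 // mulnSr addnA per. Qed.

(* The sum of a q-periodic function u against a function v that is nearly constant on
   blocks of length q l. *)
Lemma block_sum_approx (R : rcfType) (u v v0 : nat -> R[i]) q l n (eta : R) :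
  (0 < q * l)%N -> 0 <= eta -> (forall x, u (x + q)%N = u x) ->
  (forall x, normc (u x) <= 1) -> (forall x, normc (v x) <= 1) ->
  (forall i y, (y < q * l)%N -> (q * l * i + y < n)%N ->
     normc (v (q * l * i + y)%N - v0 i) <= eta) ->
  normc (\sum_(x < n) u x * v x - l%:R * (\sum_(x < q) u x) * \sum_(i < n %/ (q * l)) v0 i) <=
  n%:R * eta + (q * l)%:R.
Proof.
move=> L_gt0 eta_ge0 per u_le1 v_le1 v_near.
set L := (q * l)%N in L_gt0 v_near *; set m := (n %/ L)%N.
have -> : l%:R * (\sum_(x < q) u x) = \sum_(x < L) u x.
  rewrite [RHS]sum_blocks [RHS](eq_bigr (fun=> \sum_(x < q) u x)) => [|i _].
    by rewrite sumr_const card_ord mulr_natl.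
  by apply: eq_bigr => y _; rewrite addnC periodic_muln.
have nE : n = (L * m + n %% L)%N by rewrite mulnC -divn_eq.
rewrite [in \sum_(x < n) _]nE big_split_ord /= addrAC.
apply: le_trans (le_normcD _ _) _; apply: lerD; last first.
  apply: le_trans (ler_normc_sum _ _ _) _; apply: (@le_trans _ _ (\sum_(i < n %% L) 1)).
    by apply: ler_sum => i _; rewrite normcM mulr_ile1 ?normc_ge0.
  by rewrite sumr_const card_ord ler_nat ltnW // ltn_pmod.
rewrite (sum_blocks (fun x => u x * v x)) mulr_sumr -sumrB.
apply: le_trans (ler_normc_sum _ _ _) _.
apply: (@le_trans _ _ (\sum_(i < m) L%:R * eta)); last first.
  rewrite sumr_const card_ord -[_ *+ m]mulr_natl mulrA ler_wpM2r // -natrM ler_nat.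
  by rewrite [X in (_ <= X)%N]nE mulnC leq_addr.
apply: ler_sum => i _; rewrite mulr_suml -sumrB; apply: le_trans (ler_normc_sum _ _ _) _.
rewrite -[L in L%:R]card_ord mulr_natl -sumr_const; apply: ler_sum => y _.
have -> : u (L * i + y)%N = u y by rewrite addnC /L -mulnA periodic_muln.
rewrite -mulrBr normcM; apply: le_trans (ler_wpM2r (normc_ge0 _) (u_le1 _)) _; rewrite mul1r.
apply: v_near => //; rewrite [X in (_ < X)%N]nE.
apply: (@leq_trans (L * i.+1)); first by rewrite mulnSr ltn_add2l.
by apply: leq_trans (leq_addr _ _); rewrite leq_mul2l ltn_ord orbT.
Qed.

Lemma ler_norm_subXn (R : realDomainType) (x y b : R) n : 0 <= x <= b -> 0 <= y <= b ->
  `|x ^+ n.+1 - y ^+ n.+1| <= n.+1%:R * b ^+ n * `|x - y|.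
Proof.
move=> /andP[x_ge0 xb] /andP[y_ge0 yb]; rewrite subrXX normrM mulrC ler_wpM2r //.
apply: le_trans (ler_norm_sum _ _ _) _.
rewrite mulr_natl -[X in _ *+ X](card_ord n.+1) -sumr_const.
apply: ler_sum => i _; rewrite ger0_norm ?mulr_ge0 ?exprn_ge0 //.
have -> : b ^+ n = b ^+ (n - i) * b ^+ i by rewrite -exprD subnK // -ltnS.
by rewrite ler_pM ?exprn_ge0 // lerXn2r ?nnegrE ?(le_trans x_ge0 xb).
Qed.

Lemma exprn_lipschitz01 (R : realDomainType) (x y : R) n : 0 <= x <= 1 -> 0 <= y <= 1 ->
  x ^+ n <= y ^+ n + n%:R * `|x - y|.
Proof.
case: n => [|n] x01 y01; first by rewrite !expr0 mul0r addr0.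
have := ler_norm_subXn n x01 y01; rewrite expr1n mulr1 => dist_le.
by rewrite -lerBlDl; apply: le_trans (ler_norm _) dist_le.
Qed.

Section Phase.
Variables (R : realType) (k : nat).
Local Notation e2pi := (@e2pi R).
Implicit Types (al be : 'I_k -> R).

Lemma phaseD al be x : phase (fun j => al j + be j) x = phase al x + phase be x.
Proof. by rewrite /phase -big_split; apply: eq_bigr => j _; rewrite mulrDl. Qed.

Lemma phase_dilate p be (x : nat) :
  phase (fun j => p%:R ^+ j.+1 * be j) x%:Z = phase be (p * x)%N%:Z.
Proof.
apply: eq_bigr => j _; rewrite -[((p * x)%N%:Z)%:~R]/((p * x)%:R) -[(x%:Z)%:~R]/(x%:R).
by rewrite natrM exprMn; ring.
Qed.

Lemma phase_lipschitz be (B : R) N x y : (0 < N)%N -> 0 <= B ->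
  (forall j, `|be j| <= B / N%:R ^+ j.+1) -> (x <= N)%N -> (y <= N)%N ->
  `|phase be x%:Z - phase be y%:Z| <= (k * k)%:R * B / N%:R * `|x%:R - y%:R|.
Proof.
move=> N_gt0 B_ge0 be_le xN yN; have N_gt0R : 0 < N%:R :> R by rewrite ltr0n.
rewrite /phase -sumrB; apply: le_trans (ler_norm_sum _ _ _) _.
apply: (@le_trans _ _ (\sum_(j < k) k%:R * B / N%:R * `|x%:R - y%:R|)); last first.
  by rewrite sumr_const card_ord -[leLHS]mulr_natl natrM !mulrA.
apply: ler_sum => j _; rewrite -mulrBr normrM.
have pow_le := @ler_norm_subXn R x%:R y%:R N%:R j.
apply: le_trans (ler_pM _ _ (be_le j) (pow_le _ _)) _; rewrite ?ler0n ?ler_nat //.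
have -> : B / N%:R ^+ j.+1 * (j.+1%:R * N%:R ^+ j * `|x%:R - y%:R|) =
   j.+1%:R * B / N%:R * `|x%:R - y%:R|.
  by rewrite exprSr; field; rewrite expf_neq0 gt_eqF.
by rewrite ler_wpM2r // ler_wpM2r ?invr_ge0 // ler_wpM2r // ler_nat.
Qed.

Lemma e2pi_phase_periodic (c : 'I_k -> int) q (x : nat) : (0 < q)%N ->
  e2pi (phase (fun j => (c j)%:~R / q%:R) (x + q)%N%:Z) =
  e2pi (phase (fun j => (c j)%:~R / q%:R) x%:Z).
Proof.
move=> q_gt0; have q_neq0 : q%:R != 0 :> R by rewrite pnatr_eq0 -lt0n.
pose Z (j : 'I_k) : int := \sum_(i < j.+1) (x + q)%N%:Z ^+ (j.+1.-1 - i) * x%:Z ^+ i.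
rewrite -[RHS](e2piDint _ (\sum_j c j * Z j)); congr e2pi.
rewrite rmorph_sum /= /phase -big_split; apply: eq_bigr => j _ /=.
have powE : (x + q)%N%:Z ^+ j.+1 = x%:Z ^+ j.+1 + q%:Z * Z j.
  have := subrXX (x + q)%N%:Z x%:Z j.+1; rewrite -/(Z j) {2}PoszD addrAC subrr add0r.
  by move/eqP; rewrite subr_eq addrC => /eqP.
have -> : (((x + q)%N%:Z)%:~R : R) ^+ j.+1 = (x%:Z)%:~R ^+ j.+1 + q%:R * (Z j)%:~R.
  by rewrite -rmorphXn /= powE rmorphD rmorphM rmorphXn.
by rewrite rmorphM /=; field.
Qed.

End Phase.

(* Near a point with rational coordinates c j / q, the exponential sum of length p N
   at al and the one of length N at the dilated point share the same complete sum
   modulo q and the same slowly varying factor. *)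
Section DilatedWeylSum.
Variables (R : realType) (k p N q Q : nat) (c : 'I_k -> int) (al : 'I_k -> R).
Hypotheses (p_gt0 : (0 < p)%N) (N_gt0 : (0 < N)%N) (q_itv : (0 < q <= Q)%N).
Hypothesis approx : forall j : 'I_k,
  `|q%:R * al j - (c j)%:~R| <= Q%:R / (p * N)%:R ^+ j.+1.
Local Notation C := R[i].
Local Notation e2pi := (@e2pi R).
Local Notation weyl_sum := (@weyl_sum R k).
Local Notation be := (fun j : 'I_k => al j - (c j)%:~R / q%:R).

Let q_gt0 : (0 < q)%N. Proof. by case/andP: q_itv. Qed.
Let q_le : (q <= Q)%N. Proof. by case/andP: q_itv. Qed.
Let qR_gt0 : 0 < q%:R :> R. Proof. by rewrite ltr0n. Qed.
Let NR_gt0 : 0 < N%:R :> R. Proof. by rewrite ltr0n. Qed.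
Let pR_gt0 : 0 < p%:R :> R. Proof. by rewrite ltr0n. Qed.

Definition dilated_coef (j : 'I_k) : R := (c j)%:~R / q%:R + p%:R ^+ j.+1 * be j.

Definition rational_character (x : nat) : C := e2pi (phase (fun j => (c j)%:~R / q%:R) x%:Z).

Definition dilated_main_term : C :=
  (\sum_(x < q) rational_character x) *
  \sum_(i < N %/ q) e2pi (phase be (p * (q * i))%N%:Z).

Definition block_oscillation : R := 8 * ((k * k)%:R * Q%:R / N%:R).

Lemma block_oscillation_ge0 : 0 <= block_oscillation.
Proof. by rewrite mulr_ge0 // divr_ge0 // mulr_ge0. Qed.

Lemma rational_character_le1 x : normc (rational_character x) <= 1.
Proof. by rewrite normc_e2pi. Qed.

Lemma rational_character_periodic x : rational_character (x + q) = rational_character x.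
Proof. exact: e2pi_phase_periodic. Qed.

Lemma residual_phase_close x y :
  (y <= x)%N -> (x <= p * N)%N -> (x <= y + p * q)%N ->
  normc (e2pi (phase be x%:Z) - e2pi (phase be y%:Z)) <= block_oscillation.
Proof.
move=> yx xN x_le; apply: le_trans (e2pi_lipschitz _ _) _; rewrite ler_pM2l //.
have be_le j : `|be j| <= (Q%:R / q%:R) / (p * N)%:R ^+ j.+1.
  have -> : be j = (q%:R * al j - (c j)%:~R) / q%:R by field; rewrite gt_eqF.
  by rewrite normrM normfV (ger0_norm (ltW qR_gt0)) [leRHS]mulrAC ler_wpM2r ?invr_ge0.
apply: le_trans (phase_lipschitz _ _ be_le xN (leq_trans yx xN)) _.
- by rewrite muln_gt0 p_gt0.
- by rewrite divr_ge0.
have dist_le : `|x%:R - y%:R| <= (p * q)%:R :> R.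
  by rewrite -natrB // ger0_norm // ler_nat leq_subLR.
apply: le_trans (ler_wpM2l _ dist_le) _; first by rewrite divr_ge0 // mulr_ge0 // divr_ge0.
by rewrite !natrM le_eqVlt; apply/orP; left; apply/eqP; field; rewrite !gt_eqF.
Qed.

Lemma long_weyl_sum_approx :
  normc (weyl_sum (p * N) al - p%:R * dilated_main_term) <=
  (p * N)%:R * block_oscillation + (q * p)%:R.
Proof.
have -> : weyl_sum (p * N) al =
    \sum_(x < p * N) rational_character x * e2pi (phase be x%:Z).
  apply: eq_bigr => x _; rewrite /rational_character -e2piD -phaseD; congr (e2pi (phase _ _)).
  by apply: boolp.funext => j; rewrite addrC subrK.
have -> : p%:R * dilated_main_term = p%:R * (\sum_(x < q) rational_character x) *
   \sum_(i < (p * N) %/ (q * p)) e2pi (phase be (q * p * i)%N%:Z).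
  have -> : ((p * N) %/ (q * p) = N %/ q)%N by rewrite [(q * p)%N]mulnC divnMl.
  rewrite /dilated_main_term -mulrA; congr (_ * (_ * _)).
  by apply: eq_bigr => i _; rewrite mulnA [(q * p)%N]mulnC.
apply: (@block_sum_approx _ rational_character (fun x => e2pi (phase be x%:Z))
  (fun i => e2pi (phase be (q * p * i)%N%:Z))).
- by rewrite muln_gt0 q_gt0.
- exact: block_oscillation_ge0.
- exact: rational_character_periodic.
- exact: rational_character_le1.
- by move=> x; rewrite normc_e2pi.
move=> i y yq lt_pN; apply: residual_phase_close; first exact: leq_addr.
- exact: ltnW.
- by rewrite [(p * q)%N]mulnC leq_add2l ltnW.
Qed.

Lemma short_weyl_sum_approx :
  normc (weyl_sum N dilated_coef - dilated_main_term) <= N%:R * block_oscillation + q%:R.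
Proof.
have -> : weyl_sum N dilated_coef =
    \sum_(x < N) rational_character x * e2pi (phase be (p * x)%N%:Z).
  by apply: eq_bigr => x _; rewrite /rational_character -e2piD -phase_dilate -phaseD.
have := @block_sum_approx _ rational_character (fun x => e2pi (phase be (p * x)%N%:Z))
  (fun i => e2pi (phase be (p * (q * i))%N%:Z)) q 1 N block_oscillation.
rewrite !muln1 mul1r; apply => //.
- exact: block_oscillation_ge0.
- exact: rational_character_periodic.
- exact: rational_character_le1.
- by move=> x; rewrite normc_e2pi.
move=> i y yq lt_N; apply: residual_phase_close.
- by rewrite leq_mul2l leq_addr orbT.
- by rewrite leq_mul2l ltnW ?orbT.
- by rewrite mulnDr leq_add2l leq_mul2l ltnW ?orbT.
Qed.

Lemma weyl_sum_dilate :
  normc (weyl_sum (p * N) al / (p * N)%:R - weyl_sum N dilated_coef / N%:R) <=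
  ((16 * (k * k) + 2) * Q)%:R / N%:R.
Proof.
have long := long_weyl_sum_approx; have short := short_weyl_sum_approx.
set eta := block_oscillation in long short; set T := dilated_main_term in long short.
set S1 := weyl_sum (p * N) al in long *; set S2 := weyl_sum N _ in short *.
have -> : S1 / (p * N)%:R - S2 / N%:R = (S1 - p%:R * T) / (p * N)%:R - (S2 - T) / N%:R.
  have NC_neq0 : N%:R != 0 :> C by rewrite pnatr_eq0 -lt0n.
  have pC_neq0 : p%:R != 0 :> C by rewrite pnatr_eq0 -lt0n.
  by rewrite natrM; field; rewrite NC_neq0 pC_neq0.
apply: le_trans (le_normcD _ _) _; rewrite normcN !normcM !normcV !normc_nat.
apply: (@le_trans _ _ (((p * N)%:R * eta + (q * p)%:R) / (p * N)%:R + (N%:R * eta + q%:R) / N%:R)).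
  by apply: lerD; rewrite ler_wpM2r ?invr_ge0.
have -> : ((p * N)%:R * eta + (q * p)%:R) / (p * N)%:R + (N%:R * eta + q%:R) / N%:R =
   (16 * ((k * k)%:R * Q%:R) + 2 * q%:R) / N%:R.
  by rewrite /eta /block_oscillation !natrM; field; rewrite !gt_eqF.
rewrite ler_wpM2r ?invr_ge0 //.
have -> : ((16 * (k * k) + 2) * Q)%:R = 16 * ((k * k)%:R * Q%:R) + 2 * Q%:R :> R.
  by rewrite natrM natrD (natrM _ 16); ring.
by rewrite lerD2l ler_pM2l // ler_nat.
Qed.

End DilatedWeylSum.

Section DilationInjective.
Variables (M m m' q q' P a a' r r' : nat) (c c' B B' w : int).
Hypotheses (q_gt0 : (0 < q)%N) (q'_gt0 : (0 < q')%N).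
Hypotheses (ME : M = (q * m)%N) (ME' : M = (q' * m')%N).
Hypotheses (aE : a%:Z = c * m%:Z + B) (aE' : a'%:Z = c' * m'%:Z + B').
Hypotheses (aM : (a < M)%N) (aM' : (a' < M)%N) (rP : (r < P)%N) (rP' : (r' < P)%N).
Hypothesis same_image :
  (c * m%:Z + P%:Z * B + r%:Z) - (c' * m'%:Z + P%:Z * B' + r'%:Z) = w * M%:Z.
Hypothesis small : (q * q')%:Z * `|P%:Z * (B - B') + (r%:Z - r'%:Z)| < M%:Z.

Let M_gt0 : 0 < M%:Z. Proof. by rewrite ltz_nat; exact: leq_ltn_trans aM. Qed.

Lemma multiple_lt_eq0 (n z : int) : 0 < n -> `|n * z| < n -> z = 0.
Proof.
move=> n_gt0; rewrite normrM gtr0_norm // -[ltRHS]mulr1 ltr_pM2l //.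
by clear; lia.
Qed.

(* Two rationals with denominators q and q' that differ by less than 1 / (q q') are
   equal, so the offsets of the two images cancel. *)
Lemma offsets_eq : P%:Z * (B - B') + (r%:Z - r'%:Z) = 0.
Proof.
have lt_M := small; set V := P%:Z * (B - B') + (r%:Z - r'%:Z) in lt_M *.
have VE : V = w * M%:Z - (c * m%:Z - c' * m'%:Z) by rewrite -same_image /V; ring.
set z := w * (q * q')%:Z - (c * q'%:Z - c' * q%:Z).
have qmE : q%:Z * m%:Z = M%:Z by rewrite ME.
have qmE' : q'%:Z * m'%:Z = M%:Z by rewrite ME'.
have mult : (q * q')%:Z * V = M%:Z * z.
  rewrite VE /z.
  have -> : M%:Z * (w * (q * q')%:Z - (c * q'%:Z - c' * q%:Z)) =
     w * (q * q')%:Z * M%:Z - (c * q'%:Z * M%:Z - c' * q%:Z * M%:Z) by ring.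
  by rewrite -{3}qmE -{3}qmE' PoszM; ring.
have z0 : z = 0 by apply: (multiple_lt_eq0 M_gt0); rewrite -mult normrM ger0_norm.
move: mult; rewrite z0 mulr0 => /eqP; rewrite mulf_eq0 => /orP[|/eqP//].
by move=> /eqP[] /eqP; rewrite muln_eq0 !eqn0Ngt q_gt0 q'_gt0.
Qed.

Lemma dilation_inj : a = a' /\ r = r'.
Proof.
have BE : B = B'.
  apply/eqP; rewrite -subr_eq0; apply/eqP; apply: (@multiple_lt_eq0 P%:Z).
    by rewrite ltz_nat; exact: leq_ltn_trans rP.
  have -> : P%:Z * (B - B') = r'%:Z - r%:Z by move: offsets_eq; clear; lia.
  by move: rP rP'; clear; lia.
have rE : r = r' by move: offsets_eq; rewrite BE subrr mulr0; clear; lia.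
split=> //; have aa' : a%:Z - a'%:Z = M%:Z * w.
  by rewrite [RHS]mulrC -same_image aE aE' BE rE; ring.
have w0 : w = 0.
  by apply: (multiple_lt_eq0 M_gt0); rewrite -aa'; move: aM aM'; clear; lia.
by move: aa'; rewrite w0 mulr0; clear; lia.
Qed.

End DilationInjective.

Section WeylRatio.
Variables (R : realType) (k : nat).
Local Notation weyl_sum := (@weyl_sum R k).
Implicit Type al : 'I_k -> R.

Definition weyl_ratio N al : R := normc (weyl_sum N al) / N%:R.

Lemma weyl_ratio_ge0 N al : 0 <= weyl_ratio N al.
Proof. by rewrite divr_ge0 ?normc_ge0. Qed.

Lemma weyl_ratio_itv N al : (0 < N)%N -> 0 <= weyl_ratio N al <= 1.
Proof.
move=> N_gt0; rewrite weyl_ratio_ge0 ler_pdivrMr ?ltr0n // mul1r.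
by apply: le_trans (normc_exp_sum_le _ _) _; rewrite card_ord.
Qed.

Lemma moment_weyl_ratio M N t :
  grid_mean M (fun al => weyl_ratio N al ^+ (2 * t)) =
  grid_mean M (fun al => normc (weyl_sum N al) ^+ (2 * t)) / N%:R ^+ (2 * t).
Proof.
rewrite mulrC -grid_meanZ; apply: eq_grid_mean => al.
by rewrite /weyl_ratio expr_div_n mulrC.
Qed.

Lemma vinogradov_count_le_ratio M N t : (0 < M)%N ->
  (vinogradov_count k t N)%:R / N%:R ^+ (2 * t) <=
  grid_mean M (fun al => weyl_ratio N al ^+ (2 * t)).
Proof.
move=> M_gt0; rewrite moment_weyl_ratio ler_wpM2r ?invr_ge0 ?exprn_ge0 //.
exact: vinogradov_count_le_moment.
Qed.

Lemma moment_weyl_ratio_le M N t : (t * N ^ k < M)%N ->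
  grid_mean M (fun al => weyl_ratio N al ^+ (2 * t)) <=
  (vinogradov_count k t N)%:R / N%:R ^+ (2 * t).
Proof.
move=> M_large; rewrite moment_weyl_ratio ler_wpM2r ?invr_ge0 ?exprn_ge0 //.
exact: moment_weyl_sum_le.
Qed.

End WeylRatio.

(* Every point of the grid near a rational point has p^(k(k+1)/2) dilated images, one
   for each choice of the lowest digits, and all these images are distinct. *)
Section DilationEmbedding.
Variables (R : realType) (k p N Q M : nat).
Hypotheses (p_gt0 : (0 < p)%N) (N_gt0 : (0 < N)%N) (M_gt0 : (0 < M)%N).
Hypothesis dvd_M : forall q, (0 < q <= Q)%N -> (q %| M)%N.
Hypothesis M_large : (4 * Q ^ 2 * (p * N) ^ k.+1 <= M)%N.
Hypothesis Q_small : (4 * Q ^ 3 < N)%N.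
Local Notation grid := {ffun 'I_k -> 'I_M}.
Local Notation grid_point := (@grid_point R k M).
Variables (X : pred grid) (q : grid -> nat) (c : grid -> 'I_k -> int).
Hypothesis q_itv : forall a, X a -> (0 < q a <= Q)%N.
Hypothesis approx : forall a, X a -> forall j : 'I_k,
  `|(q a)%:R * grid_point a j - (c a j)%:~R| <= Q%:R / (p * N)%:R ^+ j.+1.
Implicit Types (a : grid) (r : {ffun 'I_k -> 'I_(p ^ k)}) (j : 'I_k).

Definition residual a j : int := (a j : nat)%:Z - c a j * (M %/ q a)%N%:Z.

Definition low_digits : pred {ffun 'I_k -> 'I_(p ^ k)} :=
  family (fun j : 'I_k => [pred x : 'I_(p ^ k) | (x < p ^ j.+1)%N]).

Definition dilated_numerator a r j : int :=
  c a j * (M %/ q a)%N%:Z + (p ^ j.+1)%N%:Z * residual a j + (r j : nat)%:Z.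

Definition dilated_grid a r : grid := [ffun j => int_residue M_gt0 (dilated_numerator a r j)].

Definition dilation_error : R := ((16 * (k * k) + 2) * Q + 8 * k)%:R / N%:R.

Let MR_gt0 : 0 < M%:R :> R. Proof. by rewrite ltr0n. Qed.
Let NR_gt0 : 0 < N%:R :> R. Proof. by rewrite ltr0n. Qed.
Let pR_gt0 : 0 < p%:R :> R. Proof. by rewrite ltr0n. Qed.

Lemma card_low_digits : #|low_digits| = (p ^ tri_num k)%N.
Proof.
rewrite /low_digits (@card_box _ (p ^ k) (fun j => (p ^ j.+1)%N)) ?prod_pow_succ // => j.
by rewrite leq_pexp2l.
Qed.

Lemma ltn_low_digits r j : low_digits r -> (r j < p ^ j.+1)%N.
Proof. by move/forallP/(_ j); rewrite inE. Qed.

Lemma dilation_error_ge0 : 0 <= dilation_error. Proof. exact: divr_ge0. Qed.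

Lemma denomR_neq0 a : X a -> (q a)%:R != 0 :> R.
Proof. by move=> /q_itv/andP[q_gt0 _]; rewrite pnatr_eq0 -lt0n. Qed.

Lemma divn_denomR a : X a -> (M %/ q a)%:R = M%:R / (q a)%:R :> R.
Proof.
move=> Xa; have q_dvd := dvd_M (q_itv Xa).
by apply: (mulIf (denomR_neq0 Xa)); rewrite divfK ?denomR_neq0 // -natrM divnK.
Qed.

Lemma residualE a j : X a ->
  (residual a j)%:~R = M%:R * (grid_point a j - (c a j)%:~R / (q a)%:R) :> R.
Proof.
move=> Xa; rewrite /residual rmorphB rmorphM /=.
rewrite -[((M %/ q a)%:Z)%:~R]/((M %/ q a)%:R) divn_denomR //.
rewrite -[(((a j : nat)%:Z)%:~R : R)]/((a j)%:R) /grid_point; field.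
by rewrite denomR_neq0 // gt_eqF.
Qed.

Lemma residual_le a j : X a ->
  `|(p ^ j.+1)%:R * (residual a j)%:~R| <= M%:R * Q%:R / N%:R :> R.
Proof.
move=> Xa; have /andP[q_gt0 _] := q_itv Xa; have q_neq0 := denomR_neq0 Xa.
have dist_le : `|grid_point a j - (c a j)%:~R / (q a)%:R| <= Q%:R / (p * N)%:R ^+ j.+1.
  apply: le_trans (approx Xa j).
  have -> : (q a)%:R * grid_point a j - (c a j)%:~R =
      (q a)%:R * (grid_point a j - (c a j)%:~R / (q a)%:R) by field.
  by rewrite normrM ger0_norm // ler_peMl // ler1n.
rewrite residualE // normrM ger0_norm // normrM (ger0_norm (ltW MR_gt0)) mulrCA -mulrA.
rewrite ler_pM2l //; apply: le_trans (ler_wpM2l _ dist_le) _ => //.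
have -> : (p ^ j.+1)%:R * (Q%:R / (p * N)%:R ^+ j.+1) = Q%:R / N%:R ^+ j.+1 :> R.
  by rewrite natrM natrX exprMn; field; rewrite !expf_neq0 ?gt_eqF.
rewrite ler_wpM2l // lef_pV2 ?posrE ?exprn_gt0 //.
by rewrite -{1}[N%:R]expr1 ler_weXn2l // ler1n.
Qed.

Lemma residual_diff_small a a' r r' j : X a -> X a' -> low_digits r -> low_digits r' ->
  (q a * q a')%N%:Z * `|(p ^ j.+1)%N%:Z * (residual a j - residual a' j) +
    ((r j : nat)%:Z - (r' j : nat)%:Z)| < M%:Z.
Proof.
move=> Xa Xa' /(@ltn_low_digits _ j) r_lt /(@ltn_low_digits _ j) r'_lt.
have /andP[_ q_le] := q_itv Xa; have /andP[_ q'_le] := q_itv Xa'.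
have intE (P u v : nat) (x y : int) : (P%:Z * (x - y) + (u%:Z - v%:Z))%:~R =
    P%:R * (x%:~R - y%:~R) + (u%:R - v%:R) :> R by rewrite intrD intrM !intrB.
rewrite -(ltr_int R) rmorphM /= intr_norm intE.
apply: (@le_lt_trans _ _ ((Q ^ 2)%:R * (2 * (M%:R * Q%:R / N%:R) + (p ^ k)%:R))).
  apply: ler_pM => //; first by rewrite -[((_)%:~R : R)]/((q a * q a')%:R) ler_nat leq_mul.
  apply: le_trans (ler_normD _ _) _; apply: lerD.
    rewrite mulrBr mulr2n mulrDl mul1r; apply: le_trans (ler_normB _ _) _.
    by apply: lerD; apply: residual_le.
  apply: (@le_trans _ _ (p ^ j.+1)%:R); last by rewrite ler_nat leq_pexp2l.
  move: r_lt r'_lt; rewrite -(ltr_nat R) -[in X in _ -> X -> _](ltr_nat R).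
  have : 0 <= (r j)%:R :> R by []. have : 0 <= (r' j)%:R :> R by [].

  by set x := (r j)%:R; set x' := (r' j)%:R; rewrite ler_norml; lra.
rewrite -[((M%:Z)%:~R : R)]/(M%:R) mulrDr.
have residual_part : (Q ^ 2)%:R * (2 * (M%:R * Q%:R / N%:R)) < M%:R / 2 :> R.
  have -> : (Q ^ 2)%:R * (2 * (M%:R * Q%:R / N%:R)) = (M%:R / 2) * ((4 * Q ^ 3)%:R / N%:R) :> R.
    by rewrite natrM !natrX; field; rewrite gt_eqF.
  by rewrite gtr_pMr ?divr_gt0 // ltr_pdivrMr // mul1r ltr_nat.
have digit_part : (Q ^ 2)%:R * (p ^ k)%:R <= M%:R / 4 :> R.
  rewrite ler_pdivlMr // mulrC mulrA -!natrM ler_nat; apply: leq_trans M_large.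
  rewrite leq_mul2l expnMn (leq_trans _ (leq_pmulr _ _)) ?orbT ?expn_gt0 ?N_gt0 //.
  by rewrite leq_pexp2l.
by move: residual_part digit_part MR_gt0; lra.
Qed.

Lemma dilated_gridE a r j :
  exists w : int, (dilated_grid a r j : nat)%:Z = dilated_numerator a r j - w * M%:Z.
Proof.
have [w wE] := int_residueE M_gt0 (dilated_numerator a r j).
by exists w; rewrite ffunE {2}wE addrK.
Qed.

Lemma dilated_grid_inj :
  {in [pred ar | X ar.1 && low_digits ar.2] &, injective (fun ar => dilated_grid ar.1 ar.2)}.
Proof.
move=> [a r] [a' r'] /andP[/= Xa r_low] /andP[/= Xa' r'_low] same_image.
have coords j : a j = a' j :> nat /\ r j = r' j :> nat.
  have /andP[q_gt0 _] := q_itv Xa; have /andP[q'_gt0 _] := q_itv Xa'.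
  have [w wE] := dilated_gridE a r j; have [w' wE'] := dilated_gridE a' r' j.
  have numerators : dilated_numerator a r j - dilated_numerator a' r' j = (w - w') * M%:Z.
    move: wE; rewrite same_image wE' => wE.
    have -> : dilated_numerator a r j = dilated_numerator a' r' j - w' * M%:Z + w * M%:Z.
      by rewrite wE subrK.
    by ring.
  apply: (dilation_inj q_gt0 q'_gt0 _ _ _ _ _ _ (ltn_low_digits j r_low)
    (ltn_low_digits j r'_low) numerators (residual_diff_small j Xa Xa' r_low r'_low)).
  - by rewrite mulnC divnK // dvd_M ?q_itv.
  - by rewrite mulnC divnK // dvd_M ?q_itv.
  - by rewrite addrC subrK.
  - by rewrite addrC subrK.
  - exact: ltn_ord.
  - exact: ltn_ord.
by congr (_, _); apply/ffunP => j; apply: val_inj; case: (coords j).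
Qed.

Lemma dilated_grid_close a r : X a -> low_digits r ->
  close_mod1 N N%:R^-1 (grid_point (dilated_grid a r)) (dilated_coef p (q a) (c a) (grid_point a)).
Proof.
move=> Xa r_low j; have [w wE] := dilated_gridE a r j; exists (- w).
have q_neq0 := denomR_neq0 Xa; have /andP[q_gt0 q_le] := q_itv Xa.
have -> : grid_point (dilated_grid a r) j - dilated_coef p (q a) (c a) (grid_point a) j -
    (- w)%:~R = (r j)%:R / M%:R.
  have intE (x y : int) (m P d : nat) : (x * m%:Z + P%:Z * y + d%:Z - w * M%:Z)%:~R =
      x%:~R * m%:R + P%:R * y%:~R + d%:R - w%:~R * M%:R :> R.
    by rewrite rmorphB !rmorphD !rmorphM.
  have numeratorE : (dilated_grid a r j)%:R = (dilated_numerator a r j - w * M%:Z)%:~R :> R.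
    by rewrite -wE.
  rewrite {1}/grid_point numeratorE intE residualE // divn_denomR // natrX /dilated_coef rmorphN /=.
  by field; rewrite q_neq0 gt_eqF.
rewrite ger0_norm ?divr_ge0 // ler_pdivrMr //.
apply: (@le_trans _ _ (p ^ j.+1)%:R); first by rewrite ler_nat ltnW // ltn_low_digits.
rewrite -invfM -exprS mulrC ler_pdivlMr ?exprn_gt0 // -natrX -natrM ler_nat.
apply: leq_trans M_large; apply: (@leq_trans ((p * N) ^ k.+1)).
  by rewrite expnMn; apply: leq_mul; rewrite leq_pexp2l // ltnS // ltnW.
by rewrite leq_pmull // muln_gt0 expn_gt0 (leq_trans q_gt0 q_le).
Qed.

Lemma weyl_ratio_dilated a r : X a -> low_digits r ->
  `|weyl_ratio (p * N) (grid_point a) - weyl_ratio N (grid_point (dilated_grid a r))| <=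
  dilation_error.
Proof.
move=> Xa r_low; rewrite /weyl_ratio.
have dilate := weyl_sum_dilate p_gt0 N_gt0 (q_itv Xa) (approx Xa).
have close := weyl_sum_close N_gt0 (dilated_grid_close Xa r_low).
set S1 := weyl_sum (p * N) _ in dilate *.
set S2 := weyl_sum N (dilated_coef _ _ _ _) in dilate close.
set S3 := weyl_sum N _ in close *.
have normc_div (z : R[i]) (n : nat) : normc z / n%:R = normc (z / n%:R).
  by rewrite normcM normcV normc_nat.
rewrite !normc_div; apply: le_trans (ler_dist_normc _ _) _.
have -> : S1 / (p * N)%:R - S3 / N%:R = (S1 / (p * N)%:R - S2 / N%:R) + (S2 - S3) / N%:R.
  by rewrite mulrBl addrA subrK.
apply: le_trans (le_normcD _ _) _; rewrite /dilation_error (natrD _ _ (8 * k)%N).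
rewrite [leRHS]mulrDl; apply: lerD => //.
rewrite normcM normcV normc_nat normc_distC ler_wpM2r ?invr_ge0 //.
apply: le_trans close _; rewrite le_eqVlt; apply/orP; left; apply/eqP.
by rewrite natrM; field; rewrite gt_eqF.
Qed.

Lemma sum_weyl_ratio_dilate u :
  (p ^ tri_num k)%:R * (\sum_(a | X a) weyl_ratio (p * N) (grid_point a) ^+ u) <=
  \sum_a weyl_ratio N (grid_point a) ^+ u +
  (#|X| * p ^ tri_num k)%:R * (u%:R * dilation_error).
Proof.
have pN_gt0 : (0 < p * N)%N by rewrite muln_gt0 p_gt0.
pose dg (ar : grid * {ffun 'I_k -> 'I_(p ^ k)}) := dilated_grid ar.1 ar.2.
pose D := [pred ar : grid * {ffun 'I_k -> 'I_(p ^ k)} | X ar.1 && low_digits ar.2].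
have pairs (f : grid -> R) :
    (p ^ tri_num k)%:R * (\sum_(a | X a) f a) = \sum_(ar | D ar) f ar.1.
  rewrite -(pair_big X low_digits (fun a r => f a)) /= mulr_sumr.
  by apply: eq_bigr => a _; rewrite sumr_const card_low_digits mulr_natl.
rewrite pairs; apply: (@le_trans _ _ (\sum_(ar | D ar)
    (weyl_ratio N (grid_point (dg ar)) ^+ u + u%:R * dilation_error))).
  apply: ler_sum => -[a r] /andP[/= Xa r_low].
  apply: le_trans (exprn_lipschitz01 _ (weyl_ratio_itv _ pN_gt0)
    (weyl_ratio_itv (grid_point (dg (a, r))) N_gt0)) _.
  by rewrite lerD2l ler_wpM2l // weyl_ratio_dilated.
rewrite big_split /=; apply: lerD; last first.
  rewrite -(pairs (fun=> u%:R * dilation_error)) sumr_const natrM mulrAC.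
  by rewrite [#|X|%:R * _]mulr_natl mulrC.
have -> : \sum_(ar | D ar) weyl_ratio N (grid_point (dg ar)) ^+ u =
    \sum_(d in [set dg ar | ar in D]) weyl_ratio N (grid_point d) ^+ u.
  by rewrite big_imset //=; exact: dilated_grid_inj.
rewrite [leRHS](bigID (mem [set dg ar | ar in D])) /= lerDl sumr_ge0 // => d _.
by rewrite exprn_ge0 // weyl_ratio_ge0.
Qed.

End DilationEmbedding.

Section DilationStep.
Variables (R : realType) (k t p N Y E M : nat).
Local Notation K := (tri_num k).
Local Notation Q := (Y ^ E)%N.
Local Notation grid := {ffun 'I_k -> 'I_M}.
Local Notation ratio n a := (weyl_ratio n (grid_point R (a : grid))).
Hypotheses (p_gt0 : (0 < p)%N) (N_gt0 : (0 < N)%N) (Kt : (K < t)%N) (Y_gt1 : (1 < Y)%N).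
Hypothesis Q_le : (Q <= p * N)%N.
Hypothesis Q_small : (4 * Q ^ 3 < N)%N.
Hypothesis mean_value : (vinogradov_count k K (p * N))%:R <=
  Y%:R * ((p * N) ^ (2 * K))%:R / ((p * N) ^ K)%:R :> R.
Hypothesis inverse : weyl_inverse R k K 0 E.
Hypothesis dvd_M : forall q, (0 < q <= Q)%N -> (q %| M)%N.
Hypothesis M_large : (4 * Q ^ 2 * (p * N) ^ k.+1 <= M)%N.
Hypothesis M_moment : ((t + K) * (p * N) ^ k < M)%N.

Let M_gt0 : (0 < M)%N. Proof. exact: leq_ltn_trans M_moment. Qed.
Let pN_gt0 : (0 < p * N)%N. Proof. by rewrite muln_gt0 p_gt0. Qed.
Let pN_gt0R : 0 < (p * N)%:R :> R. Proof. by rewrite ltr0n. Qed.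
Let Y_gt0 : 0 < Y%:R :> R. Proof. by rewrite ltr0n ltnW. Qed.

Definition large_ratio : pred grid := fun a => Y%:R^-1 <= ratio (p * N) a.

Lemma large_ratio_approx : exists qc : grid -> nat * ('I_k -> int), forall a, large_ratio a ->
  (0 < (qc a).1 <= Q)%N /\
  forall j, `|(qc a).1%:R * grid_point R a j - ((qc a).2 j)%:~R| <= Q%:R / (p * N)%:R ^+ j.+1.
Proof.
suff approx a : exists qc : nat * ('I_k -> int), large_ratio a -> (0 < qc.1 <= Q)%N /\
    forall j, `|qc.1%:R * grid_point R a j - (qc.2 j)%:~R| <= Q%:R / (p * N)%:R ^+ j.+1.
  by have [qc qcE] := boolp.choice approx; exists qc.
have [a_large|] := boolP (large_ratio a); last by exists (0%N, fun=> 0).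
have [|q q_itv near] := inverse (al := grid_point R a) Y_gt1 Q_le mean_value.
  by move: a_large; rewrite /large_ratio /weyl_ratio ler_pdivlMr // mulrC.
by have [c cE] := boolp.choice (fun i : 'I_k => near i isT); exists (q, c).
Qed.

Lemma critical_moment_le :
  (\sum_a ratio (p * N) a ^+ (2 * K)) / (M ^ k)%:R <= Y%:R / (p * N)%:R ^+ K.
Proof.
have M_ok : (K * (p * N) ^ k < M)%N.
  by apply: leq_ltn_trans M_moment; rewrite leq_mul2r leq_addl orbT.
apply: le_trans (moment_weyl_ratio_le R M_ok) _.
rewrite ler_pdivrMr ?exprn_gt0 //; apply: le_trans mean_value _.
by rewrite !natrX mulrAC.
Qed.

Lemma card_large_ratio :
  #|large_ratio|%:R / (M ^ k)%:R <= Y%:R ^+ (2 * K + 1) / (p * N)%:R ^+ K :> R.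
Proof.
have markov : #|large_ratio|%:R * Y%:R^-1 ^+ (2 * K) <= \sum_a ratio (p * N) a ^+ (2 * K).
  rewrite mulr_natl -sumr_const [leRHS](bigID large_ratio) /= -[leLHS]addr0; apply: lerD.
    by apply: ler_sum => a a_large; rewrite lerXn2r ?nnegrE ?invr_ge0 ?weyl_ratio_ge0.
  by apply: sumr_ge0 => a _; rewrite exprn_ge0 ?weyl_ratio_ge0.
rewrite addn1 exprSr -mulrA; apply: le_trans (ler_wpM2l _ critical_moment_le).
  rewrite mulrA ler_wpM2r ?invr_ge0 // -ler_pdivrMl ?exprn_gt0 // mulrC.
  by apply: le_trans markov; rewrite exprVn.
by rewrite exprn_ge0.
Qed.

Lemma minor_arcs_le : (\sum_(a | ~~ large_ratio a) ratio (p * N) a ^+ (2 * t)) / (M ^ k)%:R <=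
  Y%:R^-1 / (p * N)%:R ^+ K.
Proof.
have pointwise : \sum_(a | ~~ large_ratio a) ratio (p * N) a ^+ (2 * t) <=
    Y%:R^-1 ^+ 2 * \sum_a ratio (p * N) a ^+ (2 * K).
  rewrite mulr_sumr [leRHS](bigID large_ratio) /= -[leLHS]add0r; apply: lerD.
    by apply: sumr_ge0 => a _; rewrite mulr_ge0 ?exprn_ge0 ?weyl_ratio_ge0 ?invr_ge0.
  apply: ler_sum => a a_small.
  have -> : (2 * t = 2 * (t - K.+1) + 2 + 2 * K)%N by move: Kt; clear; lia.
  rewrite exprD ler_wpM2r ?exprn_ge0 ?weyl_ratio_ge0 // exprD.
  have /andP[ratio_ge0 ratio_le1] := weyl_ratio_itv (grid_point R a) pN_gt0.
  rewrite -[leRHS]mul1r ler_pM ?exprn_ge0 // ?exprn_ile1 //.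
  by rewrite lerXn2r ?nnegrE ?invr_ge0 // ltW // ltNge.
apply: le_trans (ler_wpM2r _ pointwise) _; first by rewrite invr_ge0.
rewrite -mulrA; apply: le_trans (ler_wpM2l _ critical_moment_le) _.
  by rewrite exprn_ge0 ?invr_ge0.
by rewrite mulrA expr2 mulfVK ?gt_eqF.
Qed.

Lemma major_arcs_le : (\sum_(a | large_ratio a) ratio (p * N) a ^+ (2 * t)) / (M ^ k)%:R <=
  (vinogradov_count k t N)%:R / N%:R ^+ (2 * t) / (p ^ K)%:R +
  Y%:R ^+ (2 * K + 1) / (p * N)%:R ^+ K * ((2 * t)%:R * dilation_error R k N Q).
Proof.
have [qc qcE] := large_ratio_approx.
have dilate := sum_weyl_ratio_dilate p_gt0 N_gt0 M_gt0 dvd_M M_large Q_small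
  (fun a a_large => (qcE a a_large).1) (fun a a_large => (qcE a a_large).2) (2 * t).
have pK_gt0 : 0 < (p ^ K)%:R :> R by rewrite ltr0n expn_gt0 p_gt0.
rewrite -(ler_pM2l pK_gt0) mulrA.
apply: le_trans (ler_wpM2r _ dilate) _; first by rewrite invr_ge0.
rewrite mulrDl mulrDr; apply: lerD.
  rewrite mulrCA divff ?mulr1 ?gt_eqF //; apply: moment_weyl_ratio_le.
  apply: leq_ltn_trans M_moment; apply: leq_mul; first exact: leq_addr.
  by rewrite expnMn leq_pmull // expn_gt0 p_gt0.
set err := (2 * t)%:R * _; have err_ge0 : 0 <= err by rewrite mulr_ge0 ?dilation_error_ge0.
have -> : (#|large_ratio| * p ^ K)%:R * err / (M ^ k)%:R =
    (p ^ K)%:R * (#|large_ratio|%:R / (M ^ k)%:R * err) by rewrite natrM; ring.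
by rewrite ler_pM2l // ler_wpM2r // card_large_ratio.
Qed.

Lemma vinogradov_count_dilate_grid :
  (vinogradov_count k t (p * N))%:R * (p * N)%:R ^+ K / (p * N)%:R ^+ (2 * t) <=
  (vinogradov_count k t N)%:R * N%:R ^+ K / N%:R ^+ (2 * t) + Y%:R^-1 +
  (2 * t)%:R * dilation_error R k N Q * Y%:R ^+ (2 * K + 1) :> R.
Proof.
have NR_gt0 : 0 < N%:R :> R by rewrite ltr0n.
have pR_gt0 : 0 < p%:R :> R by rewrite ltr0n.
rewrite [leLHS]mulrAC -ler_pdivlMr ?exprn_gt0 //.
apply: le_trans (vinogradov_count_le_ratio R k (p * N) t M_gt0) _.
rewrite /grid_mean (bigID large_ratio) /= mulrDl.
apply: le_trans (lerD major_arcs_le minor_arcs_le) _; rewrite le_eqVlt.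
rewrite natrM exprMn natrX; apply/orP; left; apply/eqP; field.
by rewrite !gt_eqF ?exprn_gt0.
Qed.

End DilationStep.

Lemma vinogradov_count_dilate (R : realType) k t p N Y E :
  (0 < p)%N -> (0 < N)%N -> (tri_num k < t)%N -> (1 < Y)%N ->
  (Y ^ E <= p * N)%N -> (4 * (Y ^ E) ^ 3 < N)%N ->
  (vinogradov_count k (tri_num k) (p * N))%:R <=
    Y%:R * ((p * N) ^ (2 * tri_num k))%:R / ((p * N) ^ tri_num k)%:R :> R ->
  weyl_inverse R k (tri_num k) 0 E ->
  (vinogradov_count k t (p * N))%:R * (p * N)%:R ^+ tri_num k / (p * N)%:R ^+ (2 * t) <=
  (vinogradov_count k t N)%:R * N%:R ^+ tri_num k / N%:R ^+ (2 * t) + Y%:R^-1 +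
  (2 * t)%:R * dilation_error R k N (Y ^ E) * Y%:R ^+ (2 * tri_num k + 1) :> R.
Proof.
move=> p_gt0 N_gt0 Kt Y_gt1 Q_le Q_small mean_value inverse.
set Q := (Y ^ E)%N in Q_le Q_small *; set K := tri_num k in Kt mean_value inverse *.
have Q_gt0 : (0 < Q)%N by rewrite expn_gt0 ltnW.
have pN_gt0 : (0 < p * N)%N by rewrite muln_gt0 p_gt0.
pose M := (Q`! * (4 * Q ^ 2 * (t + K).+1 * (p * N) ^ k.+1))%N.
have Q4_gt0 : (0 < 4 * Q ^ 2)%N by rewrite muln_gt0 expn_gt0 Q_gt0.
apply: (@vinogradov_count_dilate_grid _ _ _ _ _ _ _ M) => //.
- by move=> q q_itv; rewrite dvdn_mulr // dvdn_fact.
- rewrite (leq_trans _ (leq_pmull _ (fact_gt0 Q))) // leq_mul2r.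
  by rewrite leq_pmulr ?orbT.
rewrite (leq_trans _ (leq_pmull _ (fact_gt0 Q))) //.
apply: (@leq_trans ((t + K).+1 * (p * N) ^ k)); first by rewrite ltn_mul2r expn_gt0 pN_gt0 /=.
by apply: leq_mul; [rewrite leq_pmull | rewrite leq_pexp2l].
Qed.

Lemma leq_vinogradov_count k t N N' : (N <= N')%N ->
  (vinogradov_count k t N <= vinogradov_count k t N')%N.
Proof.
move=> NN'; pose widen (x : {ffun 'I_t -> 'I_N}) := [ffun i => widen_ord NN' (x i)].
have widen_inj : injective widen.
  move=> x y /ffunP xy; apply/ffunP => i; apply: val_inj.
  by have /(congr1 val) := xy i; rewrite !ffunE.
pose widen2 (xy : {ffun 'I_t -> 'I_N} * {ffun 'I_t -> 'I_N}) := (widen xy.1, widen xy.2).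
have widen2_inj : injective widen2 by move=> [x y] [x' y'] [/widen_inj-> /widen_inj->].
rewrite /vinogradov_count -(card_imset _ widen2_inj); apply: subset_leq_card.
apply/fintype.subsetP => _ /imsetP[xy xyP ->]; rewrite !inE in xyP *.
apply/forallP => j; have /eqP := forallP xyP j => xyE; apply/eqP.
by under eq_bigr do rewrite ffunE; under [RHS]eq_bigr do rewrite ffunE.
Qed.

Lemma geometric_recursion_le (R : realFieldType) (F : nat -> R) (c x : R) n0 :
  0 <= c -> 2 <= x -> (forall n, (n0 <= n)%N -> F n.+1 <= F n + c / x ^+ n) ->
  forall n, (n0 <= n)%N -> F n <= F n0 + 2 * c / x ^+ n0.
Proof.
move=> c_ge0 x_ge2 step n n0n; have x_gt0 : 0 < x by apply: lt_le_trans x_ge2.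
suff tail : F n + 2 * c / x ^+ n <= F n0 + 2 * c / x ^+ n0.
  by apply: le_trans tail; rewrite lerDl divr_ge0 ?mulr_ge0 ?exprn_ge0 // ltW.
elim: n n0n => [|n IHn]; first by rewrite leqn0 => /eqP <-.
rewrite leq_eqVlt => /orP[/eqP <-//|]; rewrite ltnS => n0n.
apply: le_trans (IHn n0n); apply: le_trans (lerD (step n n0n) (lexx _)) _.
rewrite -addrA lerD2l exprS.
have -> : 2 * c / x ^+ n = c / x ^+ n + c / x ^+ n by rewrite -mulrA mulr2n mulrDl mul1r.
rewrite lerD2l invfM mulrA ler_wpM2r ?invr_ge0 ?exprn_ge0 ?(ltW x_gt0) //.
by rewrite ler_pdivrMr // mulrC ler_wpM2l.
Qed.

Lemma bound_between_powers (R : realDomainType) (f : nat -> R) P n0 d (B : R) : (1 < P)%N ->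
  {homo f : m n / (m <= n)%N >-> m <= n} -> 0 <= B ->
  (forall n, (n0 <= n)%N -> f (P ^ n)%N <= B * (P ^ n)%:R ^+ d) ->
  forall N, (0 < N)%N -> f N <= B * (P ^ n0.+1)%:R ^+ d * N%:R ^+ d.
Proof.
move=> P_gt1 f_mono B_ge0 f_le N N_gt0; pose n := (n0 + up_log P N)%N.
have N_le : (N <= P ^ n)%N.
  by apply: leq_trans (up_logP N P_gt1) _; rewrite leq_exp2l // leq_addl.
apply: le_trans (f_mono _ _ N_le) _; apply: le_trans (f_le n (leq_addr _ _)) _.
rewrite -mulrA ler_wpM2l // -exprMn -natrM lerXn2r ?nnegrE // ler_nat.
rewrite /n expnD expnS [(P * _)%N]mulnC -mulnA leq_mul2l; apply/orP; right.
case: N N_gt0 {N_le n} => // -[|N] _; first by rewrite up_log1 expn0 muln1 ltnW.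
have /andP[pow_lt _] := @up_log_bounds P N.+2 P_gt1 isT.
have up_gt0 : (0 < up_log P N.+2)%N by rewrite up_log_gt0 P_gt1.
by rewrite -{1}(prednK up_gt0) expnS leq_mul2l ltnW ?orbT.
Qed.

Section GridShift.
Variables (R : realType) (k M : nat).
Hypothesis M_gt0 : (0 < M)%N.
Local Notation grid := {ffun 'I_k -> 'I_M}.
Local Notation e2pi := (@e2pi R).
Implicit Types (be : 'I_k -> int) (w : grid).

Definition grid_shift be w : grid := [ffun j => int_residue M_gt0 ((w j : nat)%:Z + be j)].

Lemma grid_shift_inj be : injective (grid_shift be).
Proof.
move=> w w' /ffunP same; apply/ffunP => j; have /eqP := same j; rewrite !ffunE int_residue_eq.
have -> : (w j : nat)%:Z + be j - ((w' j : nat)%:Z + be j) = (w j : nat)%:Z - (w' j : nat)%:Z.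
  by rewrite opprD addrACA subrr addr0.
rewrite -eqz_mod_dvd !modz_small ?ltz_nat ?ltn_ord // eqz_nat => /eqP.
exact: ord_inj.
Qed.

Lemma phase_grid_shift be w x :
  e2pi (phase (grid_point R (grid_shift be w)) x) =
  e2pi ((\sum_j be j * x ^+ j.+1)%:~R / M%:R) * e2pi (phase (grid_point R w) x).
Proof.
rewrite -e2piD; have [z zE] := boolp.choice (fun j => int_residueE M_gt0 ((w j : nat)%:Z + be j)).
rewrite -[LHS](e2piDint _ (\sum_j z j * x ^+ j.+1)); congr e2pi.
rewrite !rmorph_sum /= /phase mulr_suml -!big_split; apply: eq_bigr => j _ /=.
have coordE : (grid_shift be w j)%:R = (w j)%:R + (be j)%:~R - (z j)%:~R * M%:R :> R.
  have /(congr1 (fun y : int => y%:~R : R)) := zE j.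
  by rewrite rmorphD [in RHS]rmorphD rmorphM ffunE /= => ->; rewrite addrK.
rewrite /grid_point coordE !rmorphM !rmorphXn /=; field.
by rewrite pnatr_eq0 -lt0n.
Qed.

End GridShift.

Section SharpMeanPrime.
Variables (R : realType) (k p t : nat).
Local Notation K := (tri_num k).
Hypotheses (k_gt0 : (0 < k)%N) (p_pr : prime p) (p_large : (2 * 4 ^ K <= p)%N).
Local Notation e2pi := (@e2pi R).
Local Notation ppow := (@ppow R p).
Local Notation pr := (p%:R : R).

Let p_gt0 : (0 < p)%N. Proof. exact: prime_gt0. Qed.
Let p_gt1 : (1 < p)%N. Proof. exact: prime_gt1. Qed.
Let pr_gt0 : 0 < pr. Proof. by rewrite ltr0n. Qed.

Lemma weyl_sum_decoupling_datum n :
  decoupling_datum p n (fun j : 'I_k => 'X^(j.+1)) (@nat_pos (p ^ n))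
    (fun i (w : {ffun 'I_k -> 'I_(p ^ (k * n))}) => e2pi (phase (grid_point R w) (nat_pos i)))
    (fun=> 1) #|{ffun 'I_k -> 'I_(p ^ (k * n))}|%:R.
Proof.
have M_gt0 : (0 < p ^ (k * n))%N by rewrite expn_gt0 p_gt0.
split.
- exists 1; last by exists (fun=> 0) => j; rewrite scale1r scaler0 addr0.
  by rewrite dvdz1 absz_nat eqn_leq leqNgt p_gt1.
- split=> // be; exists (grid_shift M_gt0 be); first exact: grid_shift_inj.
  exists (fun=> 1); first by move=> w; rewrite normc1.
  move=> i w; rewrite mul1r phase_grid_shift /curve_phase natrX; congr (e2pi (_%:~R / _) * _).
  by apply: eq_bigr => j _; rewrite hornerXn.
move=> z; rewrite /moment -sumr_const; apply: ler_sum => w _; rewrite mulr1.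
apply: exprn_ile1; rewrite ?normc_ge0 // /class_sum.
have pn_gt0 : (0 < p ^ n)%N by rewrite expn_gt0 p_gt0.
rewrite (eq_bigl (pred1 (int_residue pn_gt0 z))) ?big_pred1_eq ?normc_e2pi // => i.
by rewrite /= -dvdz_sub_ord -opprB rpredN /nat_pos -[p%:Z]natz -rmorphXn /= natz.
Qed.

Lemma vinogradov_count_prime_power eps : 0 < eps -> exists2 C, 0 <= C & forall n,
  (vinogradov_count k K (p ^ n))%:R <= C * ppow (eps * n%:R) * pr ^+ (n * K).
Proof.
move=> eps_gt0; have [C C_ge0 decoupled] := nested_congruencing p_pr k_gt0 p_large eps_gt0.
exists C => // n; have M_gt0 : (0 < p ^ (k * n))%N by rewrite expn_gt0 p_gt0.
have := decoupled n _ _ _ _ _ _ _ (weyl_sum_decoupling_datum n).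
rewrite card_ffun !card_ord => moment_le.
apply: le_trans (@vinogradov_count_le_moment R k (p ^ n) K _ M_gt0) _; rewrite /grid_mean.
rewrite ler_pdivrMr ?ltr0n ?expn_gt0 ?p_gt0 //; apply: le_trans moment_le.
by apply: ler_sum => w _; rewrite mulr1.
Qed.

Variable E : nat.
Hypotheses (Kt : (K < t)%N) (inverse : weyl_inverse R k K 0 E).

(* Lengths grow by the factor p^m, so that a saving p^n is available at length P n. *)
Let m := (3 * E + 2 * K + 2)%N.
Let P n := ((p ^ m) ^ n)%N.

Definition normalized_count n : R :=
  (vinogradov_count k t (P n))%:R * (P n)%:R ^+ K / (P n)%:R ^+ (2 * t).

Lemma ltn_4_prime : (4 < p)%N.
Proof.
apply: leq_trans p_large; apply: (@leq_trans (2 * 4 ^ 1)) => //.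
rewrite leq_mul2l /= leq_exp2l // -(leq_pmul2l (isT : 0 < 2)%N) double_tri_num muln1.
by move: k_gt0; clear; nia.
Qed.

Lemma critical_count_le : exists n0, forall n, (n0 <= n)%N ->
  (vinogradov_count k K (P n.+1))%:R <=
    (p ^ n)%:R * (P n.+1 ^ (2 * K))%:R / (P n.+1 ^ K)%:R :> R.
Proof.
have m_gt0 : 0 < m%:R :> R by rewrite ltr0n /m addn_gt0 orbT.
have eps_gt0 : 0 < (2 * m%:R)^-1 :> R by rewrite invr_gt0 mulr_gt0.
have [C C_ge0 count_le] := vinogradov_count_prime_power eps_gt0.
pose e := Num.bound C; exists (2 * e + 1)%N => n n_large.
have C_le : C <= pr ^+ e.
  apply: le_trans (ltW (archi_boundP C_ge0)) _; rewrite -natrX ler_nat.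
  exact: ltnW (ltn_expl _ p_gt1).
rewrite /P -!expnM; apply: le_trans (count_le _) _.
have -> : (p ^ n)%:R * (p ^ (m * n.+1 * (2 * K)))%:R / (p ^ (m * n.+1 * K))%:R =
    pr ^+ n * pr ^+ (m * n.+1 * K).
  have -> : (m * n.+1 * (2 * K) = m * n.+1 * K + m * n.+1 * K)%N by clear; lia.
  by rewrite !natrX exprD; field; rewrite expf_neq0 // gt_eqF.
rewrite ler_wpM2r ?exprn_ge0 //.
have -> : (2 * m%:R)^-1 * (m * n.+1)%:R = n.+1%:R / 2 :> R.
  by rewrite natrM; field; rewrite gt_eqF.
apply: (@le_trans _ _ (pr ^+ e * ppow (n - e)%:R)).
  apply: ler_pM; rewrite ?ppow_ge0 //; apply: ler_ppow => //.
  by rewrite ler_pdivrMr // -natrM ler_nat; move: n_large; clear; lia.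
by rewrite /ppow powR_mulrn // -exprD subnKC //; move: n_large; clear; lia.
Qed.

Lemma dilation_error_pow n :
  dilation_error R k (P n) ((p ^ n) ^ E) * (p ^ n)%:R ^+ (2 * K + 1) <=
  (16 * (k * k) + 2 + 8 * k)%:R / pr ^+ n.
Proof.
have count_le : ((16 * (k * k) + 2) * p ^ (n * E) + 8 * k)%:R <=
    (16 * (k * k) + 2 + 8 * k)%:R * pr ^+ (n * E).
  by rewrite -natrX -natrM ler_nat [leqRHS]mulnDl leq_add2l leq_pmulr // expn_gt0 p_gt0.
rewrite /dilation_error -expnM mulrAC.
apply: le_trans (ler_wpM2r _ (ler_wpM2r _ count_le)) _; rewrite ?exprn_ge0 ?invr_ge0 //.
rewrite -!mulrA ler_wpM2l // /P -expnM !natrX -exprM.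
rewrite mulrA -exprD ler_pdivrMr ?exprn_gt0 // mulrC ler_pdivlMr ?exprn_gt0 // -exprD.
by rewrite ler_weXn2l ?ler1n // /m; clear; nia.
Qed.

Lemma normalized_count_step : exists n0, forall n, (n0 <= n)%N ->
  normalized_count n.+1 <=
  normalized_count n + (1 + (2 * t)%:R * (16 * (k * k) + 2 + 8 * k)%:R) / pr ^+ n.
Proof.
have [n0 critical] := critical_count_le; exists n0.+1 => n n0n.
have n_gt0 : (0 < n)%N by exact: leq_trans n0n.
have pm_gt0 : (0 < p ^ m)%N by rewrite expn_gt0 p_gt0.
have Pn_gt0 : (0 < P n)%N by rewrite expn_gt0 pm_gt0.
have pn_gt1 : (1 < p ^ n)%N by rewrite -(exp1n n) ltn_exp2r.
have := vinogradov_count_dilate pm_gt0 Pn_gt0 Kt pn_gt1 _ _ _ inverse.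
rewrite -[(p ^ m * P n)%N]/((p ^ m) ^ 1 * (p ^ m) ^ n)%N -expnD add1n => dilate.
apply: le_trans (dilate _ _ (critical n (ltnW n0n))) _.
- by rewrite -!expnM leq_exp2l // /m; move: n_gt0; clear; nia.
- rewrite /P -!expnM; apply: (@leq_trans (p ^ (n * E * 3) * p ^ n)).
    rewrite -[(n * E * 3)%N]mulnA [ltnRHS]mulnC ltn_mul2r expn_gt0 p_gt0 /=.
    by apply: leq_trans ltn_4_prime _; rewrite -[X in (X <= _)%N]expn1 leq_exp2l.
  by rewrite -expnD leq_exp2l // /m; clear; nia.
rewrite -[leLHS]addrA lerD2l mulrDl mul1r natrX lerD2l -[leLHS]mulrA -[leRHS]mulrA.
by have := dilation_error_pow n; rewrite natrX => error_le; rewrite ler_wpM2l.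
Qed.

Lemma sharp_mean_prime : exists2 C : R, 0 < C & forall N, (0 < N)%N ->
  (vinogradov_count k t N)%:R <= C * N%:R ^+ (2 * t - K).
Proof.
have [n0 step] := normalized_count_step; set c := 1 + _ in step.
have c_ge0 : 0 <= c by rewrite addr_ge0 // mulr_ge0.
have p_ge2 : 2 <= pr by rewrite (ler_nat R 2).
have := geometric_recursion_le c_ge0 p_ge2 step.
set B := normalized_count n0 + _ => B_bound; set d := (2 * t - K)%N.
have norm_ge0 n : 0 <= normalized_count n by rewrite divr_ge0 // mulr_ge0.
have B_ge0 : 0 <= B by rewrite addr_ge0 // divr_ge0 ?mulr_ge0 ?exprn_ge0.
have pm_gt1 : (1 < p ^ m)%N by rewrite -(exp1n m) ltn_exp2r // /m addn_gt0 orbT.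
exists ((B + 1) * ((p ^ m) ^ n0.+1)%:R ^+ d).
  by rewrite mulr_gt0 ?exprn_gt0 ?ltr_pwDr // ltr0n !expn_gt0 p_gt0.
apply: (@bound_between_powers R (fun N => (vinogradov_count k t N)%:R) (p ^ m)%N) => //.
- by move=> N N' NN'; rewrite ler_nat leq_vinogradov_count.
- by rewrite addr_ge0.
move=> n n0n.
have Pn_neq0 : (P n)%:R != 0 :> R by rewrite pnatr_eq0 -lt0n !expn_gt0 p_gt0.
have -> : (vinogradov_count k t (P n))%:R = normalized_count n * (P n)%:R ^+ d.
  have tE : (2 * t = d + K)%N by rewrite /d subnK //; move: Kt; clear; lia.
  by rewrite /normalized_count tE exprD; field; rewrite !expf_neq0.
rewrite ler_wpM2r ?exprn_ge0 //; apply: le_trans (B_bound n n0n) _.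
by rewrite lerDl.
Qed.

End SharpMeanPrime.

Theorem sharp_mean (R : realType) k t : (0 < k)%N -> (tri_num k < t)%N ->
  exists2 C : R, 0 < C & forall N, (0 < N)%N ->
    (vinogradov_count k t N)%:R <= C * N%:R ^+ (2 * t - tri_num k).
Proof.
move=> k_gt0 Kt; have [p p_large p_pr] := prime_above (2 * 4 ^ tri_num k).
have [E inverse] := @weyl_inverse_theorem R k (tri_num k).
exact: (sharp_mean_prime k_gt0 p_pr (ltnW p_large) Kt inverse).
Qed.

(** * Uniformity and polynomial phases *)

Lemma power_mean (R : realType) (J : finType) (x : J -> R) m : (forall j, 0 <= x j) ->
  (\sum_j x j) ^+ m.+1 <= #|J|%:R ^+ m * \sum_j x j ^+ m.+1.
Proof.
move=> x_ge0; have := @hoelder_expn R J (fun=> 1) (fun j => x j ^+ m.+1) x m.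
by rewrite sumr_const; apply=> // j; rewrite ?exprn_ge0 // expr1n mul1r.
Qed.

Lemma sum_cons_tuple (V : nmodType) (T : finType) n (F : n.+1.-tuple T -> V) :
  \sum_w F w = \sum_(x : T) \sum_(v : n.-tuple T) F (cons_tuple x v).
Proof.
rewrite pair_bigA /=; apply: (reindex (fun xv : T * n.-tuple T => cons_tuple xv.1 xv.2)).
apply: onW_bij; exists (fun w => (thead w, behead_tuple w)) => [[x v]|w] /=.
  by congr (_, _); apply: val_inj.
by apply: val_inj; case: (tupleP w).
Qed.

Lemma card_zitv (a b : int) : #|` zitv a b| = `|(Num.max 0 (b - a + 1))%R|%N.
Proof.
rewrite card_fseq undup_id ?size_map ?size_iota // map_inj_uniq ?iota_uniq // => i j.
by move/addrI => [].
Qed.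

Section Gowers.
Variables (R : realType) (N : nat).
Local Notation C := R[i].
Local Notation e2pi := (@e2pi R).
Local Notation itv := (zitv 1 N%:Z).
Local Notation shifts := (zitv (1 - N%:Z) (N%:Z - 1)).
Implicit Types (f : int -> C) (w : seq int).

Definition interval_sum f : C := \sum_(x <- itv) f x.
Definition interval_supported (V : nmodType) (f : int -> V) := forall x, x \notin itv -> f x = 0.
Definition mul_diff1 f (u : int) : int -> C := fun x => f x * (f (x - u))^*%C.
Definition mul_diff f w : int -> C := foldl mul_diff1 f w.

Lemma mul_diff1_supported f u : interval_supported f -> interval_supported (mul_diff1 f u).
Proof. by move=> f_supp x /f_supp; rewrite /mul_diff1 => ->; rewrite mul0r. Qed.

Lemma normc_interval_sum_sqr f : interval_supported f ->
  (normc (interval_sum f) ^+ 2)%:C%C = \sum_(u <- shifts) interval_sum (mul_diff1 f u).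
Proof.
move=> f_supp; rewrite normc_sqr /interval_sum rmorph_sum mulr_suml exchange_big /=.
rewrite [LHS]big_seq [RHS]big_seq; apply: eq_bigr => x xI.
rewrite /mul_diff1 -mulr_sumr; congr (_ * _).
have sub_inj : {in shifts &, injective (fun u => x - u)} by move=> y z _ _ /addrI/oppr_inj.
rewrite -(big_imfset _ imfset_key (fun y => (f y)^*%C) sub_inj) /=.
apply: big_fset_incl => [|y _ /f_supp->]; last exact: conjc0.
apply/fsubsetP => y yI; apply/imfsetP; exists (x - y); last by rewrite opprB addrC subrK.
by move: xI yI; rewrite /= !in_zitv; lia.
Qed.

Lemma card_shifts : (0 < N)%N -> (#|` shifts| <= 2 * N)%N.
Proof. by move=> N_gt0; rewrite card_zitv; lia. Qed.

Lemma normc_interval_sum_sqr_le f : interval_supported f ->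
  normc (interval_sum f) ^+ 2 <= \sum_(u : shifts) normc (interval_sum (mul_diff1 f (val u))).
Proof.
move=> f_supp; have -> : normc (interval_sum f) ^+ 2 =
    normc (\sum_(u <- shifts) interval_sum (mul_diff1 f u)).
  by rewrite -normc_interval_sum_sqr // normc_real ger0_norm // exprn_ge0 ?normc_ge0.
by rewrite big_seq_fsetE; exact: ler_normc_sum.
Qed.

Lemma Re_sum (J : finType) (F : J -> C) : complex.Re (\sum_i F i) = \sum_i complex.Re (F i).
Proof. by apply: (big_morph (@complex.Re R)) => // -[a b] [c d]. Qed.

Lemma gowers_weyl_differencing d f : (0 < N)%N -> interval_supported f ->
  normc (interval_sum f) ^+ (2 ^ d.+1) <= (2 * N)%:R ^+ (2 ^ d.+1 - d.+2) *
   complex.Re (\sum_(w : d.+1.-tuple shifts) interval_sum (mul_diff f (map val w))).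
Proof.
move=> N_gt0; elim: d f => [|d IHd] f f_supp.
  rewrite expn1 subnn expr0 mul1r sum_cons_tuple.
  rewrite (_ : \sum_x _ = \sum_(u <- shifts) interval_sum (mul_diff1 f u)); last first.
    rewrite [RHS]big_seq_fsetE; apply: eq_bigr => u _.
    rewrite (bigD1 [tuple]) //= [X in _ + X]big1 ?addr0 // => v /negP[].
    by apply/eqP; exact: tuple0.
  by rewrite -normc_interval_sum_sqr.
rewrite [in leLHS]expnS exprM.
have sum_ge0 : 0 <= \sum_(u : shifts) normc (interval_sum (mul_diff1 f (val u))).
  by apply: sumr_ge0 => u _; exact: normc_ge0.
apply: le_trans (lerXn2r _ _ _ (normc_interval_sum_sqr_le f_supp)) _;
  rewrite ?nnegrE ?exprn_ge0 ?normc_ge0 //.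
have -> : (2 ^ d.+1 = (2 ^ d.+1).-1.+1)%N by rewrite prednK // expn_gt0.
apply: le_trans (power_mean _ (fun u => normc_ge0 _)) _; rewrite prednK ?expn_gt0 //.
have shifts_le : #|{: shifts}|%:R <= (2 * N)%:R :> R by rewrite ler_nat -cardfE card_shifts.
apply: (@le_trans _ _ ((2 * N)%:R ^+ (2 ^ d.+1).-1 * \sum_(u : shifts)
   ((2 * N)%:R ^+ (2 ^ d.+1 - d.+2) * complex.Re (\sum_(v : d.+1.-tuple shifts)
      interval_sum (mul_diff (mul_diff1 f (val u)) (map val v)))))).
  apply: ler_pM; rewrite ?exprn_ge0 //.
  - by apply: sumr_ge0 => u _; rewrite exprn_ge0 ?normc_ge0.
  - by rewrite lerXn2r ?nnegrE.
  by apply: ler_sum => u _; apply: IHd; exact: mul_diff1_supported.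
rewrite -mulr_sumr mulrA -exprD sum_cons_tuple Re_sum.
have -> // : ((2 ^ d.+1).-1 + (2 ^ d.+1 - d.+2) = 2 ^ d.+2 - d.+3)%N.
have : (d.+2 <= 2 ^ d.+1)%N by rewrite ltn_expl.
by rewrite [(2 ^ d.+2)%N]expnS; move: (2 ^ d.+1)%N; clear; lia.
Qed.

Definition add_diff (psi : int -> R) (u : int) : int -> R := fun x => psi x - psi (x - u).

Lemma mul_diff_phase (E psi : int -> R) w x :
  mul_diff (fun y => (E y)%:C%C * e2pi (psi y)) w x =
  (Delta E w x)%:C%C * e2pi (foldl add_diff psi w x).
Proof.
elim: w E psi => [|u w IHw] E psi //=.
have -> : mul_diff1 (fun y => (E y)%:C%C * e2pi (psi y)) u =
    fun y => (Delta1 E u y)%:C%C * e2pi (add_diff psi u y).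
  apply: boolp.funext => y.
  by rewrite /mul_diff1 /Delta1 /add_diff e2piD e2piN conjcM conjc_real rmorphM /=; ring.
exact: IHw.
Qed.

Lemma size_diff_poly (P : {poly R}) (c : R) :
  (size (P - (P \Po ('X - c%:P)))%R <= (size P).-1)%N.
Proof.
have [->|P_neq0] := eqVneq P 0; first by rewrite comp_poly0 subr0 size_poly0.
have size2 : size ('X - c%:P) = 2%N by rewrite size_XsubC.
apply/leq_sizeP => j; rewrite leq_eqVlt coefB => /orP[/eqP <-|j_large].
  have : lead_coef (P \Po ('X - c%:P)) = lead_coef P.
    by rewrite lead_coef_comp ?size2 // lead_coefXsubC expr1n mulr1.
  by rewrite !lead_coefE size_comp_poly2 // => ->; rewrite subrr.
rewrite !nth_default ?subr0 //; last by move: j_large; case: (size P).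
by rewrite size_comp_poly2 //; move: j_large; case: (size P).
Qed.

Lemma add_diff_poly w (P : {poly R}) (psi : int -> R) :
  (forall x, psi x = P.[x%:~R]) -> (size P <= size w)%N -> forall x, foldl add_diff psi w x = 0.
Proof.
elim: w P psi => [|u w IHw] P psi psiE sizeP x /=.
  by move: sizeP; rewrite leqn0 size_poly_eq0 => /eqP P0; rewrite psiE P0 horner0.
apply: (IHw (P - (P \Po ('X - (u%:~R)%:P)))) => [y|].
  by rewrite /add_diff !psiE hornerD hornerN horner_comp !hornerE rmorphB.
by apply: leq_trans (size_diff_poly _ _) _; move: sizeP => /=; case: (size P).
Qed.

Lemma Delta_supported (E : int -> R) w x : interval_supported E -> Delta E w x != 0 ->
  forall i, (i <= size w)%N -> x - \sum_(u <- take i w) u \in itv.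
Proof.
move=> E_supp; elim/last_ind: w x => [|w u IHw] x.
  move=> Ex_neq0 i; rewrite leqn0 => /eqP ->; rewrite big_nil subr0.
  by apply: contraNT Ex_neq0 => /E_supp; rewrite /Delta /= => ->.
rewrite Delta_rcons /Delta1 mulf_eq0 negb_or => /andP[Dx_neq0 Dxu_neq0] i.
rewrite size_rcons leq_eqVlt => /orP[/eqP ->|].
  rewrite take_oversize ?size_rcons // -cats1 big_cat big_seq1 /=.
  have := IHw _ Dxu_neq0 (size w) (leqnn _); rewrite take_size.
  by have -> : x - (\sum_(v <- w) v + u) = x - u - \sum_(v <- w) v by ring.
by rewrite ltnS => i_le; rewrite -cats1 takel_cat // IHw.
Qed.

Lemma mem_Iw w x : (x \in Iw N w) =
  (x \in itv) && all (fun i => (x - \sum_(u <- take i w) u)%R \in itv) (iota 0 (size w).+1).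
Proof. by rewrite !inE. Qed.

Lemma sum_Iw (E : int -> R) w : interval_supported E ->
  \sum_(x <- itv) Delta E w x = \sum_(x <- Iw N w) Delta E w x.
Proof.
move=> E_supp; symmetry; apply: big_fset_incl => [|x xI].
  by apply/fsubsetP => x; rewrite mem_Iw => /andP[].
apply: contraNeq => Dx_neq0; rewrite mem_Iw xI andTb.
have in_itv i : (i <= size w)%N -> x - \sum_(u <- take i w) u \in itv.
  exact: (Delta_supported E_supp Dx_neq0).
apply/allP => i.
by rewrite mem_iota add0n ltnS => /andP[_ /in_itv].
Qed.

End Gowers.

Section UniformPhase.
Variables (R : realType) (k N : nat) (A : {fset int}).
Local Notation e2pi := (@e2pi R).
Local Notation shifts := (zitv (1 - N%:Z) (N%:Z - 1)).
Local Notation E := (balanced R N A).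
Implicit Type al : 'I_k -> R.

Lemma balanced_supported : interval_supported N E.
Proof. by move=> x /negbTE; rewrite /balanced => ->. Qed.

Definition phase_poly al : {poly R} := \sum_(j < k) al j *: 'X^(j.+1).

Lemma size_phase_poly al : (size (phase_poly al) <= k.+1)%N.
Proof.
apply: leq_trans (size_sum _ _ _) _; apply/bigmax_leqP => j _.
by apply: leq_trans (size_scale_leq _ _) _; rewrite size_polyXn ltnS.
Qed.

Lemma horner_phase_poly al (x : int) : phase al x = (phase_poly al).[x%:~R].
Proof. by rewrite horner_sum; apply: eq_bigr => j _; rewrite hornerZ hornerXn. Qed.

Lemma interval_sum_mul_diff al (w : seq int) : size w = k.+1 ->
  interval_sum N (mul_diff (fun x => (E x)%:C%C * e2pi (phase al x)) w) =
  (\sum_(x <- Iw N w) Delta E w x)%:C%C.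
Proof.
move=> size_w; rewrite -(sum_Iw w balanced_supported) rmorph_sum.
apply: eq_bigr => x _; rewrite mul_diff_phase (add_diff_poly (horner_phase_poly al)).
  by rewrite e2pi0 mulr1.
by rewrite size_w size_phase_poly.
Qed.

Theorem uniform_phase (a : R) al : (0 < N)%N -> uniform_of_degree N A a k ->
  normc (interval_sum N (fun x => (E x)%:C%C * e2pi (phase al x))) ^+ (2 ^ k.+1) <=
  a * (2 * N)%:R ^+ (2 ^ k.+1).
Proof.
move=> N_gt0 uniform; set F := fun x => _.
have F_supp : interval_supported N F.
  by move=> x /balanced_supported; rewrite /F => ->; rewrite mul0r.
have differenced := gowers_weyl_differencing k N_gt0 F_supp.
have GE : \sum_(w : k.+1.-tuple shifts) interval_sum N (mul_diff F (map val w)) =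
    (\sum_(w : k.+1.-tuple shifts) \sum_(x <- Iw N (map val w)) Delta E (map val w) x)%:C%C.
  rewrite rmorph_sum; apply: eq_bigr => w _; apply: interval_sum_mul_diff.
  by rewrite size_map size_tuple.
rewrite GE [complex.Re _]/= in differenced.
set D := (2 ^ k.+1 - k.+2)%N in differenced; set G := \sum_w _ in differenced.
have D_gt0 : 0 < (2 * N)%:R ^+ D :> R by rewrite exprn_gt0 // ltr0n muln_gt0.
have G_ge0 : 0 <= G.
  by rewrite -(pmulr_rge0 _ D_gt0); apply: le_trans differenced; rewrite exprn_ge0 ?normc_ge0.
apply: le_trans differenced _; apply: le_trans (ler_wpM2l (ltW D_gt0) uniform) _.
have aN_ge0 : 0 <= a * N%:R ^+ k.+2 by exact: le_trans G_ge0 uniform.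
have -> : (2 ^ k.+1 = D + k.+2)%N by rewrite subnK // ltn_expl.
rewrite exprD [leRHS]mulrCA ler_pM2l // natrM exprMn [leRHS]mulrCA ler_peMl //.
by rewrite exprn_ege1 // ler1n.
Qed.

End UniformPhase.

(** * Solutions in boxes and local densities *)

Lemma prod_except_le_moment (R : realType) (I : finType) (a : I -> R) n i0 :
  (forall i, 0 <= a i <= 1) -> (0 < n < #|I|)%N -> \prod_(i | i != i0) a i <= \sum_i a i ^+ n.
Proof.
move=> a_itv /andP[n_gt0 n_lt]; have a_ge0 i : 0 <= a i by have /andP[] := a_itv i.
have [i1 _ a_max] := @arg_maxP _ _ _ i0 xpredT a isT.
apply: (@le_trans _ _ (\prod_(i | i != i0) a i1)).
  by apply: ler_prod => i _; rewrite a_ge0 /=; exact: a_max.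
rewrite prodr_const cardC1; apply: (@le_trans _ _ (a i1 ^+ n)).
  by apply: ler_wiXn2l; [|have /andP[] := a_itv i1 | move: n_lt; case: #|I|].
by rewrite (bigD1 i1) //= lerDl sumr_ge0 // => i _; rewrite exprn_ge0.
Qed.

Lemma prod_le_moment (R : realType) (I : finType) (a : I -> R) n i0 :
  (forall i, 0 <= a i <= 1) -> (0 < n < #|I|)%N -> \prod_i a i <= a i0 * \sum_i a i ^+ n.
Proof.
move=> a_itv n_itv; rewrite (bigD1 i0) //= ler_wpM2l ?prod_except_le_moment //.
by have /andP[] := a_itv i0.
Qed.

Lemma prodrM_const (R : comPzRingType) (I : finType) (c : R) (a : I -> R) :
  \prod_i (c * a i) = c ^+ #|I| * \prod_i a i.
Proof. by rewrite big_split prodr_const. Qed.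

Lemma sqr_card_le_fibers (R : realType) (T V : finType) (A : {set T}) (v : T -> V)
    (D : {set V}) : (forall x, x \in A -> v x \in D) ->
  #|A|%:R ^+ 2 <= #|D|%:R * \sum_(x in A) #|[set y in A | v y == v x]|%:R :> R.
Proof.
move=> vD; pose fiber c := #|[set x in A | v x == c]|.
have cardA : #|A|%:R = \sum_(c in D) (fiber c)%:R :> R.
  rewrite -natr_sum -sum1_card (partition_big v (mem D)) //=; congr (_%:R).
  by apply: eq_bigr => c _; rewrite sum1dep_card; apply: eq_card => x; rewrite !inE.
have fibersE : \sum_(x in A) #|[set y in A | v y == v x]|%:R =
    \sum_(c in D) (fiber c)%:R ^+ 2 :> R.
  rewrite (partition_big v (mem D)) //=; apply: eq_bigr => c _.
  rewrite expr2 mulr_natl -sumr_const.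
  by apply: eq_big => [x|x /andP[_ /eqP->]]; rewrite ?inE.
have := @power_mean R 'I_#|D| (fun i => (fiber (enum_val i))%:R) 1 (fun i => ler0n _ _).
rewrite card_ord expr1 -(big_enum_val (fun c => (fiber c)%:R)) /=.
by rewrite -(big_enum_val (fun c => (fiber c)%:R ^+ 2)) /= -cardA -fibersE.
Qed.

Lemma card_le_fibers (T V : finType) (A : {set T}) (v : T -> V) (D : {set V}) n :
  (forall x, x \in A -> v x \in D) ->
  (forall c, c \in D -> (#|[set x in A | v x == c]| <= n)%N) -> (#|A| <= #|D| * n)%N.
Proof.
move=> vD fiber_le; rewrite -sum1_card (partition_big v (mem D)) //= -sum_nat_const.
apply: leq_sum => c cD; apply: leq_trans (fiber_le c cD).
by rewrite sum1dep_card; apply: eq_leq; apply: eq_card => x; rewrite !inE.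
Qed.

Lemma small_multiples_encoding (T : finType) k (A : {set T}) (f : T -> 'I_k -> int) q
    (H : 'I_k -> nat) : (0 < q)%N ->
  (forall x j, x \in A -> (q%:Z %| f x j)%Z /\ (`|f x j| <= H j * q)%N) ->
  exists (V : finType) (v : T -> V) (D : {set V}), [/\ #|D| = (\prod_j (2 * H j + 1))%N,
    forall x, x \in A -> v x \in D &
    forall x y, x \in A -> y \in A -> v x = v y -> f x =1 f y].
Proof.
move=> q_gt0 f_small; pose m := (\sum_j (2 * H j + 1))%N.
have m_ge j : (2 * H j + 1 <= m.+1)%N by rewrite /m (bigD1 j) //= leqW // leq_addr.
pose shifted x j : nat := absz ((f x j %/ q%:Z)%Z + (H j)%:Z).
have shiftedP x j : x \in A ->
    f x j = ((shifted x j)%:Z - (H j)%:Z) * q%:Z /\ (shifted x j < 2 * H j + 1)%N.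
  move=> xA; have [/divzK fE f_le] := f_small x j xA; rewrite /shifted.
  set d := (f x j %/ q%:Z)%Z in fE *; have d_le : (`|d| <= H j)%N.
    by rewrite -(leq_pmul2r q_gt0); move: f_le; rewrite -fE abszM absz_nat.
  have d_ge0 : 0 <= d + (H j)%:Z by move: d_le; clear; lia.
  rewrite gez0_abs // addrK fE; split=> //; rewrite -ltz_nat gez0_abs //.
  by move: d_le; clear; lia.
pose v x : {ffun 'I_k -> 'I_m.+1} := [ffun j => inord (shifted x j)].
have vE x j : x \in A -> v x j = shifted x j :> nat.
  by move=> /(shiftedP x j)[_ lt_H]; rewrite ffunE inordK // (leq_trans lt_H).
exists {ffun 'I_k -> 'I_m.+1}, v.
exists [set c in family (fun j : 'I_k => [pred x : 'I_m.+1 | (x < 2 * H j + 1)%N])].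
split=> [|x xA|x y xA yA vxy j]; first by rewrite cardsE card_box.
  by rewrite inE; apply/familyP => j; rewrite inE vE //; have [] := shiftedP x j xA.
by have [-> _] := shiftedP x j xA; have [-> _] := shiftedP y j yA; rewrite -!vE // vxy.
Qed.

Section System.
Variables (R : realType) (k s : nat) (lam : 'I_s -> int).
Local Notation C := R[i].
Local Notation e2pi := (@e2pi R).
Local Notation weyl_sum := (@weyl_sum R k).
Local Notation K := (tri_num k).
Implicit Types (al : 'I_k -> R) (c : 'I_k -> int).

Definition system_value (x : 'I_s -> int) (j : 'I_k) : int := \sum_i lam i * x i ^+ j.+1.
Definition coef_norm : nat := (\sum_i `|lam i|%N)%N.

Lemma leq_coef_norm i : (`|lam i| <= coef_norm)%N.
Proof. by rewrite /coef_norm (bigD1 i) //= leq_addr. Qed.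

Lemma solutionE (x : 'I_s -> int) : solution lam k x = [forall j, system_value x j == 0].
Proof.
by apply: eq_forallb => j; congr (_ == _); apply: eq_bigr => i _; rewrite intz.
Qed.

Lemma prod_exp_sum (I : finType) (pos : I -> int) al :
  \prod_i exp_sum pos (scale_coef (lam i) al) = \sum_(x : {ffun 'I_s -> I})
    e2pi (\sum_j al j * (system_value (fun i => pos (x i)) j)%:~R).
Proof.
rewrite /exp_sum (bigA_distr_bigA (fun i x => e2pi (phase (scale_coef (lam i) al) (pos x)))) /=.
apply: eq_bigr => x _; rewrite -e2pi_sum; congr e2pi.
transitivity (\sum_i \sum_j al j * (lam i * pos (x i) ^+ j.+1)%:~R).
  by apply: eq_bigr => i _; exact: phase_scale_coef.
rewrite exchange_big /=; apply: eq_bigr => j _.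
by rewrite -mulr_sumr /system_value rmorph_sum.
Qed.

Lemma grid_mean_prod_exp_sum (I : finType) (pos : I -> int) c M : (0 < M)%N ->
  grid_mean M (fun al => \prod_i exp_sum pos (scale_coef (lam i) al) *
    e2pi (- \sum_j al j * (c j)%:~R)) =
  #|[set x : {ffun 'I_s -> I} |
     [forall j, (M%:Z %| system_value (fun i => pos (x i)) j - c j)%Z]]|%:R.
Proof.
move=> M_gt0; transitivity (grid_mean M (fun al => \sum_(x : {ffun 'I_s -> I}) 1 *
    e2pi (\sum_j al j * (system_value (fun i => pos (x i)) j - c j)%:~R))).
  apply: eq_grid_mean => al; rewrite prod_exp_sum mulr_suml; apply: eq_bigr => x _.
  rewrite mul1r -e2piD -sumrN -big_split; congr e2pi; apply: eq_bigr => j _ /=.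
  by rewrite rmorphB mulrBr.
rewrite grid_mean_count // -sum1_card natr_sum.
by apply: eq_bigl => x; rewrite inE.
Qed.

Lemma e2pi_opp_sum0 al : e2pi (- \sum_(j < k) al j * 0%:~R) = 1.
Proof. by rewrite big1 ?oppr0 ?e2pi0 // => j _; rewrite mulr0. Qed.

Lemma grid_mean_prod_exp_sum0 (I : finType) (pos : I -> int) M : (0 < M)%N ->
  grid_mean M (fun al => \prod_i exp_sum pos (scale_coef (lam i) al)) =
  #|[set x : {ffun 'I_s -> I} |
     [forall j, (M%:Z %| system_value (fun i => pos (x i)) j)%Z]]|%:R.
Proof.
move=> M_gt0; rewrite -(@eq_card _ [set x : {ffun 'I_s -> I} |
    [forall j, (M%:Z %| system_value (fun i => pos (x i)) j - 0)%Z]]) => [|x]; last first.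
  by rewrite !inE; apply: eq_forallb => j; rewrite subr0.
rewrite -(grid_mean_prod_exp_sum pos (fun=> 0) M_gt0); apply: eq_grid_mean => al.
by rewrite e2pi_opp_sum0 mulr1.
Qed.

Lemma system_value_bound (x : 'I_s -> int) N j : (0 < N)%N -> (forall i, (`|x i| <= N)%N) ->
  (`|system_value x j| <= coef_norm * N ^ k)%N.
Proof.
move=> N_gt0 x_le; apply: (@leq_trans (coef_norm * N ^ j.+1)); last first.
  by rewrite leq_mul2l leq_pexp2l ?orbT.
rewrite -lez_nat abszE; apply: le_trans (ler_norm_sum _ _ _) _.
rewrite /coef_norm big_distrl /= -natz natr_sum; apply: ler_sum => i _.
by rewrite natz -abszE abszM abszX lez_nat leq_mul2l leq_exp2r // x_le orbT.
Qed.

Lemma dvdz_system_value_sub (x : 'I_s -> int) (c : int) N M j : (0 < N)%N ->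
  (forall i, (`|x i| <= N)%N) -> (coef_norm * N ^ k + `|c| < M)%N ->
  (M%:Z %| system_value x j - c)%Z = (system_value x j == c).
Proof.
move=> N_gt0 x_le M_large; rewrite -subr_eq0; apply/idP/eqP => [|->]; last exact: dvdz0.
apply: dvdz_small_eq0; apply: leq_ltn_trans M_large.
apply: leq_trans (leq_add (system_value_bound j N_gt0 x_le) (leqnn _)).
by rewrite -lez_nat PoszD !abszE; exact: ler_normB.
Qed.

Definition box_value N (x : {ffun 'I_s -> 'I_N}) : 'I_k -> int :=
  system_value (fun i => nat_pos (x i)).

Definition representations N c : nat :=
  #|[set x : {ffun 'I_s -> 'I_N} | [forall j, box_value x j == c j]]|.

Lemma representations0 N : representations N (fun=> 0) =
  #|[set x : {ffun 'I_s -> 'I_N} | solution lam k (fun i => nat_pos (x i))]|.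
Proof. by apply: eq_card => x; rewrite !inE solutionE. Qed.

Lemma leq_nat_pos N (x : {ffun 'I_s -> 'I_N}) i : (`|nat_pos (x i)| <= N)%N.
Proof. by rewrite /nat_pos absz_nat ltnW. Qed.

Lemma representationsE N M c : (0 < N)%N -> (forall j, (coef_norm * N ^ k + `|c j| < M)%N) ->
  (0 < M)%N -> (representations N c)%:R = grid_mean M (fun al =>
    \prod_i weyl_sum N (scale_coef (lam i) al) * e2pi (- \sum_j al j * (c j)%:~R)) :> C.
Proof.
move=> N_gt0 c_small M_gt0; rewrite grid_mean_prod_exp_sum //; congr (_%:R).
apply: eq_card => x; rewrite !inE; apply: eq_forallb => j.
by rewrite (dvdz_system_value_sub _ N_gt0 (leq_nat_pos x)).
Qed.

Lemma moment_weyl_ratio_scale (lam0 : int) N t M : lam0 != 0 ->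
  (`|lam0| * (t * N ^ k) < M)%N ->
  grid_mean M (fun al => weyl_ratio N (scale_coef lam0 al) ^+ (2 * t)) <=
  (vinogradov_count k t N)%:R / N%:R ^+ (2 * t).
Proof.
move=> lam_neq0 M_large; rewrite (@eq_grid_mean R k _ _ _ (fun al => (N%:R ^+ (2 * t))^-1 *
    normc (exp_sum (@nat_pos N) (scale_coef lam0 al)) ^+ (2 * t))); last first.
  by move=> al; rewrite /weyl_ratio expr_div_n mulrC.
rewrite grid_meanZ mulrC ler_wpM2r ?invr_ge0 ?exprn_ge0 //.
by apply: (@moment_le_vinogradov_count R k _ (fun x : 'I_N => x : nat)) => //; exact: ord_inj.
Qed.

Lemma normc_prod_weyl_sum N al : (0 < N)%N ->
  normc (\prod_i weyl_sum N (scale_coef (lam i) al)) =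
  N%:R ^+ s * \prod_i weyl_ratio N (scale_coef (lam i) al).
Proof.
move=> N_gt0; rewrite normc_prod -[in X in N%:R ^+ X](card_ord s) -prodrM_const.
by apply: eq_bigr => i _; rewrite /weyl_ratio mulrC divfK // pnatr_eq0 -lt0n.
Qed.

(* The values considered are divisible by all the denominators that occur on the major
   arcs and are small there, so moving from 0 to such a value changes little. *)
Section Compare.
Variables (N Y t E : nat) (eta : R) (i0 : 'I_s).
Hypothesis inverse : weyl_inverse R k t 0 E.
Hypotheses (t_gt0 : (0 < t)%N) (ts : (2 * t < s)%N) (Y_gt1 : (1 < Y)%N).
Hypotheses (Y_le : (Y ^ E <= N)%N) (lam_neq0 : forall i, lam i != 0) (eta_ge0 : 0 <= eta).
Hypothesis mean_value :
  (vinogradov_count k t N)%:R <= Y%:R * (N ^ (2 * t))%:R / (N ^ K)%:R :> R.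
Local Notation ratio al i := (weyl_ratio N (scale_coef (lam i) al)).

Let N_gt0 : (0 < N)%N.
Proof. by apply: leq_trans Y_le; rewrite expn_gt0 ltnW. Qed.

Definition comparison_error : R := 2 / Y%:R + 8 * (k%:R * eta).

Lemma comparison_error_ge0 : 0 <= comparison_error.
Proof. by rewrite addr_ge0 ?divr_ge0 ?mulr_ge0. Qed.

Section Character.
Variable c : 'I_k -> int.
Hypothesis c_dvd : forall j, ((`|lam i0| * (Y ^ E)`!)%N%:Z %| c j)%Z.
Hypothesis c_small : forall j, (Y ^ E)%:R * `|(c j)%:~R| <= eta * N%:R ^+ j.+1.
Local Notation character al := (e2pi (- \sum_j al j * (c j)%:~R)).

Lemma character_near1 al : Y%:R^-1 <= ratio al i0 ->
  normc (character al - 1) <= 8 * (k%:R * eta).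
Proof.
move=> large; have NR_gt0 : 0 < N%:R :> R by rewrite ltr0n.
have [|q /andP[q_gt0 q_le] near] := inverse (al := scale_coef (lam i0) al) Y_gt1 Y_le mean_value.
  by move: large; rewrite /weyl_ratio ler_pdivlMr // mulrC.
have [z z_near] := boolp.choice (fun j => near j isT).
have [m mE] : exists m : 'I_k -> int, forall j, c j = m j * (q%:Z * lam i0).
  suff quot j : exists m : int, c j = m * (q%:Z * lam i0).
    by have [m mE] := boolp.choice quot; exists m.
  apply/dvdzP; apply: dvdz_trans (c_dvd j).
  by rewrite dvdzE /= abszM absz_nat mulnC dvdn_mul // dvdn_fact // q_gt0.
rewrite -[character al](e2piDint _ (\sum_j m j * z j)) rmorph_sum /= [- _ + _]addrC -sumrB.
apply: le_trans (normc_e2pi_sub1_le _) _; rewrite ler_pM2l //.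
apply: le_trans (ler_norm_sum _ _ _) _; rewrite -[k in k%:R]card_ord mulr_natl -sumr_const.
apply: ler_sum => j _.
have -> : (m j * z j)%:~R - al j * (c j)%:~R =
    - (m j)%:~R * (q%:R * scale_coef (lam i0) al j - (z j)%:~R).
  by rewrite mE !rmorphM /= /scale_coef; ring.
rewrite normrM normrN; apply: le_trans (ler_wpM2l (normr_ge0 _) (z_near j)) _.
rewrite mulrA ler_pdivrMr ?exprn_gt0 //; apply: le_trans (c_small j).
rewrite mulrC ler_wpM2l // mE rmorphM normrM ler_peMr // -intr_norm -[1]/(1%:~R) ler_int.
by rewrite -gtz0_ge1 normr_gt0 mulf_neq0 // eqz_nat -lt0n.
Qed.

Lemma prod_weyl_sum_character_sub al :
  normc (\prod_i weyl_sum N (scale_coef (lam i) al) * (character al - 1)) <=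
  N%:R ^+ s * comparison_error * \sum_i ratio al i ^+ (2 * t).
Proof.
rewrite normcM normc_prod_weyl_sum // -!mulrA ler_wpM2l ?exprn_ge0 //.
have prod_le : \prod_i ratio al i <= ratio al i0 * \sum_i ratio al i ^+ (2 * t).
  apply: prod_le_moment => [i|]; first exact: weyl_ratio_itv.
  by rewrite muln_gt0 t_gt0 card_ord.
set moment := \sum_i _ in prod_le *.
have moment_ge0 : 0 <= moment by apply: sumr_ge0 => i _; rewrite exprn_ge0 ?weyl_ratio_ge0.
have prod_ge0 : 0 <= \prod_i ratio al i by apply: prodr_ge0 => i _; exact: weyl_ratio_ge0.
have /andP[_ ratio_le1] := weyl_ratio_itv (scale_coef (lam i0) al) N_gt0.
have [large|small] := leP Y%:R^-1 (ratio al i0).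
  rewrite [leRHS]mulrC; apply: ler_pM; rewrite ?normc_ge0 //.
    by apply: le_trans prod_le _; rewrite ler_piMl.
  by apply: le_trans (character_near1 large) _; rewrite lerDr divr_ge0.
apply: (@le_trans _ _ ((Y%:R^-1 * moment) * 2)).
  apply: ler_pM; rewrite ?normc_ge0 //.
    by apply: le_trans prod_le _; rewrite ler_wpM2r // ltW.
  by apply: le_trans (le_normcD _ _) _; rewrite normcN normc_e2pi normc1.
have -> : Y%:R^-1 * moment * 2 = 2 / Y%:R * moment by ring.
by rewrite ler_wpM2r // lerDl !mulr_ge0.
Qed.

Lemma representations_le_solutions :
  (representations N c)%:R <= (representations N (fun=> 0))%:R + s%:R * comparison_error *
    ((vinogradov_count k t N)%:R * N%:R ^+ s / N%:R ^+ (2 * t)) :> R.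
Proof.
pose M := (coef_norm * (t.+1 * N ^ k) + \sum_j `|c j|).+1.
have M_large j : (coef_norm * N ^ k + `|c j| < M)%N.
  rewrite ltnS leq_add //; last by rewrite (bigD1 j) //= leq_addr.
  by rewrite leq_mul2l leq_pmull ?orbT.
have M_large0 (j : 'I_k) : (coef_norm * N ^ k + `|0%R : int| < M)%N.
  by apply: leq_ltn_trans (M_large j); rewrite leq_add2l.
have diffE : (representations N c)%:R - (representations N (fun=> 0))%:R =
    grid_mean M (fun al =>
      \prod_i weyl_sum N (scale_coef (lam i) al) * (character al - 1)) :> C.
  rewrite (representationsE N_gt0 M_large) // (representationsE N_gt0 M_large0) // -grid_meanB.
  by apply: eq_grid_mean => al; rewrite e2pi_opp_sum0 mulrBr.
rewrite -lerBlDl; apply: le_trans (ler_norm _) _; rewrite -normc_real rmorphB /= !rmorph_nat diffE.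
apply: le_trans (normc_grid_mean_le _ _) _.
apply: le_trans (ler_grid_mean M prod_weyl_sum_character_sub) _.
rewrite grid_meanZ grid_mean_sum.
have -> : s%:R * comparison_error * ((vinogradov_count k t N)%:R * N%:R ^+ s / N%:R ^+ (2 * t)) =
    N%:R ^+ s * comparison_error * (s%:R * ((vinogradov_count k t N)%:R / N%:R ^+ (2 * t))).
  by ring.
rewrite ler_wpM2l ?mulr_ge0 ?exprn_ge0 ?comparison_error_ge0 //.
rewrite -[s in s%:R]card_ord mulr_natl -sumr_const; apply: ler_sum => i _.
apply: moment_weyl_ratio_scale => //; rewrite ltnS; apply: leq_trans (leq_addr _ _).
by apply: leq_mul; [exact: leq_coef_norm | rewrite leq_mul2r leqnSn orbT].
Qed.

End Character.

Lemma compare_solutions (B : {set {ffun 'I_s -> 'I_N}}) (V : finType)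
    (v : {ffun 'I_s -> 'I_N} -> V) (D : {set V}) :
  (forall x, x \in B -> forall j, ((`|lam i0| * (Y ^ E)`!)%N%:Z %| box_value x j)%Z) ->
  (forall x, x \in B -> forall j, (Y ^ E)%:R * `|(box_value x j)%:~R| <= eta * N%:R ^+ j.+1) ->
  (forall x, x \in B -> v x \in D) ->
  (forall x y, x \in B -> y \in B -> v x = v y -> box_value x =1 box_value y) ->
  #|B|%:R / #|D|%:R <= (representations N (fun=> 0))%:R +
    s%:R * comparison_error * ((vinogradov_count k t N)%:R * N%:R ^+ s / N%:R ^+ (2 * t)).
Proof.
move=> value_dvd value_small vD v_inj; set bound := _ + _.
have bound_ge0 : 0 <= bound.
  by rewrite addr_ge0 // !mulr_ge0 ?comparison_error_ge0 ?invr_ge0 ?exprn_ge0.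
have [B0|B_gt0] := posnP #|B|; first by rewrite B0 mul0r.
have D_gt0 : (0 < #|D|)%N.
  by move: B_gt0 => /card_gt0P[x xB]; apply/card_gt0P; exists (v x); exact: vD.
rewrite ler_pdivrMr ?ltr0n // -(ler_pM2l (_ : 0 < #|B|%:R)) ?ltr0n // -expr2.
apply: le_trans (sqr_card_le_fibers R vD) _.
rewrite [leRHS]mulrA [leRHS]mulrC ler_wpM2l // mulr_natl -sumr_const.
apply: ler_sum => x xB.
apply: le_trans (representations_le_solutions (value_dvd x xB) (value_small x xB)).
rewrite ler_nat; apply: subset_leq_card; apply/fintype.subsetP => y; rewrite !inE.
by move=> /andP[yB /eqP vyx]; apply/forallP => j; apply/eqP; exact: v_inj.
Qed.

End Compare.

End System.

Definition rough (W q : nat) := forall p, prime p -> (p %| q)%N -> (W < p)%N.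

Section Congruences.
Variables (R : realType) (k : nat).
Local Notation C := R[i].
Local Notation e2pi := (@e2pi R).
Local Notation weyl_sum := (@weyl_sum R k).
Local Notation K := (tri_num k).
Implicit Types (al : 'I_k -> R).

Lemma power_diff_exp_sumX (I : finType) (pos : I -> int) t (h : 'I_k -> int) M : (0 < M)%N ->
  grid_mean M (fun al => (normc (exp_sum pos al) ^+ (2 * t))%:C%C *
    e2pi (- \sum_j al j * (h j)%:~R)) =
  #|[set xy : {ffun 'I_t -> I} * {ffun 'I_t -> I} |
     [forall j, (M%:Z %| power_diff pos xy j - h j)%Z]]|%:R.
Proof.
move=> M_gt0; transitivity (grid_mean M (fun al : 'I_k -> R =>
    \sum_(xy : {ffun 'I_t -> I} * {ffun 'I_t -> I}) 1 *
      e2pi (\sum_j al j * (power_diff pos xy j - h j)%:~R))); last first.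
  rewrite grid_mean_count // -sum1_card natr_sum.
  by apply: eq_bigl => xy; rewrite inE.
apply: eq_grid_mean => al; rewrite normcX_double exp_sumX sum_e2pi_sqr mulr_suml.
apply: eq_bigr => xy _; rewrite mul1r -e2piD; congr e2pi.
have phasesE (x : {ffun 'I_t -> I}) : \sum_i phase al (pos (x i)) =
    \sum_j al j * (\sum_i pos (x i) ^+ j.+1)%:~R.
  rewrite /phase exchange_big /=; apply: eq_bigr => j _; rewrite -mulr_sumr rmorph_sum /=.
  by congr (_ * _); apply: eq_bigr => i _; rewrite rmorphXn.
rewrite !phasesE -!sumrB; apply: eq_bigr => j _.
by rewrite -!mulrBr /power_diff !rmorphB.
Qed.

(* Fourier coefficients of a nonnegative function are at most its mean. *)
Lemma card_power_diff_le (h : 'I_k -> int) t N :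
  (#|[set xy : {ffun 'I_t -> 'I_N} * {ffun 'I_t -> 'I_N} |
     [forall j, power_diff (@nat_pos N) xy j == h j]]| <= vinogradov_count k t N)%N.
Proof.
rewrite -(ler_nat R); pose M := (t * N ^ k).+1; have M_gt0 : (0 < M)%N by [].
apply: le_trans (@moment_weyl_sum_le R k N t M (leqnn _)).
apply: (@le_trans _ _ #|[set xy : {ffun 'I_t -> 'I_N} * {ffun 'I_t -> 'I_N} |
     [forall j, (M%:Z %| power_diff (@nat_pos N) xy j - h j)%Z]]|%:R).
  rewrite ler_nat; apply: subset_leq_card; apply/fintype.subsetP => xy; rewrite !inE.
  by move=> /forallP xyE; apply/forallP => j; rewrite (eqP (xyE j)) subrr dvdz0.
rewrite -normc_nat -power_diff_exp_sumX //.
apply: le_trans (normc_grid_mean_le _ _) _; apply: ler_grid_mean => al.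
by rewrite normcM normc_e2pi mulr1 normc_real ger0_norm // exprn_ge0 ?normc_ge0.
Qed.

Lemma power_diff_le t q (xy : {ffun 'I_t -> 'I_q} * {ffun 'I_t -> 'I_q}) (j : 'I_k) :
  (`|power_diff (@nat_pos q) xy j| <= t * q ^ j * q)%N.
Proof.
have sum_le (x : {ffun 'I_t -> 'I_q}) : (\sum_i x i ^ j.+1 <= t * q ^ j * q)%N.
  rewrite -mulnA -expnSr -[X in (_ <= X * _)%N]card_ord -sum_nat_const.
  by apply: leq_sum => i _; rewrite leq_exp2r // ltnW.
rewrite (power_diff_nat _ _ (fun=> erefl)).
exact: abs_subz_leq (sum_le _) (sum_le _).
Qed.

Lemma congruence_count_le t q : (0 < t)%N -> (0 < q)%N ->
  (#|[set xy : {ffun 'I_t -> 'I_q} * {ffun 'I_t -> 'I_q} |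
     [forall j : 'I_k, (q%:Z %| power_diff (@nat_pos q) xy j)%Z]]| <=
   (\prod_(j < k) (3 * t * q ^ j)) * vinogradov_count k t q)%N.
Proof.
move=> t_gt0 q_gt0; set A := [set xy | _].
have A_small xy (j : 'I_k) : xy \in A -> (q%:Z %| power_diff (@nat_pos q) xy j)%Z /\
    (`|power_diff (@nat_pos q) xy j| <= t * q ^ j * q)%N.
  by rewrite inE => /forallP/(_ j); split=> //; exact: power_diff_le.
have [V [v [D [D_card vD v_inj]]]] := small_multiples_encoding q_gt0 A_small.
apply: (@leq_trans (#|D| * vinogradov_count k t q)); last first.
  rewrite D_card leq_mul2r; apply/orP; right; apply: leq_prod => j _.
  have : (0 < t * q ^ j)%N by rewrite muln_gt0 t_gt0 expn_gt0 q_gt0.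
  by clear; rewrite -mulnA; lia.
apply: (card_le_fibers vD) => c _.
have [empty|/set0Pn[xy0 xy0P]] := eqVneq [set xy in A | v xy == c] finset.set0.
  by rewrite empty cards0.
apply: leq_trans (card_power_diff_le (power_diff (@nat_pos q) xy0) t q).
apply: subset_leq_card; apply/fintype.subsetP => xy; rewrite !inE => /andP[xyP /eqP vxy].
move: xy0P; rewrite inE => /andP[xy0A /eqP vxy0]; apply/forallP => j; apply/eqP.
by apply: v_inj; rewrite ?vxy ?vxy0 // inE.
Qed.

Lemma weyl_sum_periodic_mul (c : 'I_k -> int) q m : (0 < q)%N ->
  weyl_sum (q * m) (fun j => (c j)%:~R / q%:R) = m%:R * weyl_sum q (fun j => (c j)%:~R / q%:R).
Proof.
move=> q_gt0; rewrite /weyl_sum /exp_sum /nat_pos.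
rewrite (sum_blocks (fun x => e2pi (phase (fun j => (c j)%:~R / q%:R) x%:Z))).
rewrite (eq_bigr (fun=> \sum_(y < q) e2pi (phase (fun j => (c j)%:~R / q%:R) y%:Z))) => [|i _].
  by rewrite sumr_const card_ord mulr_natl.
apply: eq_bigr => y _; rewrite addnC.
apply: (periodic_muln (u := fun x : nat => e2pi (phase _ x%:Z))) => x.
exact: e2pi_phase_periodic.
Qed.

Lemma prod_pow_tri_num q : ((\prod_(j < k) q ^ j) * q ^ k = q ^ K)%N.
Proof.
rewrite -prod_pow_succ -[X in (_ * q ^ X)%N]card_ord -prod_nat_const -big_split /=.
by apply: eq_bigr => j _; rewrite -expnSr.
Qed.

Definition cong_solutions s (lam : 'I_s -> int) q := #|[set x : {ffun 'I_s -> 'I_q} |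
   [forall j : 'I_k, (q%:Z %| box_value lam x j)%Z]]|.

Section Rough.
Variables (s : nat) (lam : 'I_s -> int) (t E : nat) (C0 : R).
Hypotheses (inverse : weyl_inverse R k t 0 E) (t_gt0 : (0 < t)%N) (ts : (2 * t < s)%N).
Hypotheses (Kt : (K <= 2 * t)%N) (lam_neq0 : forall i, lam i != 0) (C0_gt0 : 0 < C0).
Hypothesis mean_value : forall N, (0 < N)%N ->
  (vinogradov_count k t N)%:R <= C0 * N%:R ^+ (2 * t - K).

Lemma vinogradov_count_le_scaled Y N : C0 <= Y%:R -> (0 < N)%N ->
  (vinogradov_count k t N)%:R <= Y%:R * (N ^ (2 * t))%:R / (N ^ K)%:R :> R.
Proof.
move=> C0_le N_gt0; apply: le_trans (mean_value N_gt0) _; rewrite !natrX -mulrA.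
have -> : N%:R ^+ (2 * t) / N%:R ^+ K = N%:R ^+ (2 * t - K) :> R.
  by rewrite -{1}(subnK Kt) exprD mulfK // expf_neq0 // pnatr_eq0 -lt0n.
by rewrite ler_wpM2r ?exprn_ge0.
Qed.

Section RoughModulus.
Variables (q Y : nat).
Hypotheses (q_gt0 : (0 < q)%N) (Y_gt1 : (1 < Y)%N) (C0_le : C0 <= Y%:R).
Hypothesis q_rough : rough (Y ^ E + coef_norm lam) q.
Local Notation grid := {ffun 'I_k -> 'I_q}.
Local Notation ratio a i := (weyl_ratio q (scale_coef (lam i) (grid_point R (a : grid)))).
Local Notation zero := ([ffun=> Ordinal q_gt0] : grid).

Let q_neq0 : q%:R != 0 :> R. Proof. by rewrite pnatr_eq0 -lt0n. Qed.

Lemma coprime_rough d i : (0 < d <= Y ^ E)%N -> coprime q (d * `|lam i|).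
Proof.
move=> /andP[d_gt0 d_le]; rewrite /coprime; apply: contraT => gcd_neq1.
have gcd_gt1 : (1 < gcdn q (d * `|lam i|))%N by rewrite ltn_neqAle eq_sym gcd_neq1 gcdn_gt0 q_gt0.
have := pdiv_dvd (gcdn q (d * `|lam i|)); have := pdiv_prime gcd_gt1.
move: (pdiv _) => p p_pr p_dvd; have := q_rough p_pr (dvdn_trans p_dvd (dvdn_gcdl _ _)).
have := dvdn_trans p_dvd (dvdn_gcdr _ _); rewrite Euclid_dvdM // => /orP[] /dvdn_leq p_le.
  by rewrite ltnNge (leq_trans (p_le d_gt0)) // (leq_trans d_le) // leq_addr.
rewrite ltnNge (leq_trans (p_le _)) ?absz_gt0 // (leq_trans _ (leq_addl _ _)) //.
exact: leq_coef_norm.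
Qed.

(* A large complete sum modulo q stays large on a long interval, so that the inverse
   theorem applies with an approximation error below 1 / q. *)
Lemma large_ratio_denominator (a : grid) i : Y%:R^-1 <= ratio a i ->
  exists2 d, (0 < d <= Y ^ E)%N & forall j, (q %| d * `|lam i| * a j)%N.
Proof.
move=> large; pose c j : int := lam i * (a j : nat)%:Z.
have coefE : scale_coef (lam i) (grid_point R a) = fun j => (c j)%:~R / q%:R.
  by apply: boolp.funext => j; rewrite /scale_coef /grid_point /c rmorphM /= mulrA.
pose m := (Y ^ E * q).+1; pose N := (q * m)%N.
have N_gt0 : (0 < N)%N by rewrite muln_gt0 q_gt0.
have N_large : (Y ^ E * q < N)%N by rewrite /N /m leq_pmull.
have [|||d d_itv near] := inverse (N := N) (Y := Y) (al := fun j => (c j)%:~R / q%:R) Y_gt1.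
- by apply: leq_trans (ltnW N_large); rewrite leq_pmulr.
- exact: vinogradov_count_le_scaled.
- rewrite weyl_sum_periodic_mul // normcM normc_nat; move: large; rewrite /weyl_ratio coefE.
  rewrite ler_pdivlMr ?ltr0n // => large; apply: le_trans (ler_wpM2l (ler0n _ m) large).
  by rewrite natrM mulrA [q%:R * _]mulrC mulrAC.
exists d => // j; have [z z_near] := near j isT.
have lt1 : `|d%:Z * c j - z * q%:Z| < 1.
  rewrite -(ltr_int R) intr_norm; have -> : (d%:Z * c j - z * q%:Z)%:~R =
      (d%:R * ((c j)%:~R / q%:R) - z%:~R) * q%:R :> R.
    by rewrite rmorphB !rmorphM /=; field.
  rewrite normrM normr_nat; apply: le_lt_trans (ler_wpM2r (ler0n _ q) z_near) _.
  rewrite mulrAC ltr_pdivrMr ?exprn_gt0 ?ltr0n // mul1r -natrM -natrX ltr_nat.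
  by apply: leq_trans N_large _; rewrite -{1}[N]expn1 leq_pexp2l.
have -> : (d * `|lam i| * a j = absz (d%:Z * c j)%R)%N by rewrite /c !abszM !absz_nat mulnA.
have -> : d%:Z * c j = z * q%:Z by move: lt1; clear; lia.
by rewrite abszM absz_nat dvdn_mull.
Qed.

Lemma nonzero_ratio_small (a : grid) i : a != zero -> ratio a i <= Y%:R^-1.
Proof.
move=> a_neq0; rewrite leNgt; apply: contra a_neq0 => /ltW large; apply/eqP/ffunP => j.
have [d d_itv /(_ j)] := large_ratio_denominator large.
rewrite Gauss_dvdr ?coprime_rough // => /dvdn_leq q_le.
apply: val_inj; rewrite ffunE /=; apply/eqP; rewrite -leqn0 leqNgt; apply/negP => /q_le.
by rewrite leqNgt ltn_ord.
Qed.

Lemma sum_ratioE i : \sum_(a : grid) ratio a i ^+ (2 * t) =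
  (q ^ k)%:R / q%:R ^+ (2 * t) * #|[set xy : {ffun 'I_t -> 'I_q} * {ffun 'I_t -> 'I_q} |
     [forall j : 'I_k, (q%:Z %| lam i * power_diff (@nat_pos q) xy j)%Z]]|%:R.
Proof.
rewrite -(@moment_exp_sum R) // /grid_mean mulrCA mulrAC divff ?natrX ?expf_neq0 // mul1r.
by rewrite mulr_suml; apply: eq_bigr => a _; rewrite /weyl_ratio expr_div_n.
Qed.

Lemma scaled_congruence_count_le i :
  (#|[set xy : {ffun 'I_t -> 'I_q} * {ffun 'I_t -> 'I_q} |
     [forall j : 'I_k, (q%:Z %| (lam i * power_diff (@nat_pos q) xy j)%R)%Z]]| <=
   (\prod_(j < k) (3 * t * q ^ j)) * vinogradov_count k t q)%N.
Proof.
apply: leq_trans (congruence_count_le t_gt0 q_gt0); apply: subset_leq_card.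
apply/fintype.subsetP => xy; rewrite !inE => /forallP xyP; apply/forallP => j.
have := xyP j; rewrite !dvdzE /= abszM Gauss_dvdr //.
by have := @coprime_rough 1 i; rewrite mul1n; apply; rewrite expn_gt0 (ltnW Y_gt1).
Qed.

Lemma sum_ratio_le i : \sum_(a : grid) ratio a i ^+ (2 * t) <= (3 * t)%:R ^+ k * C0.
Proof.
rewrite sum_ratioE; apply: le_trans (ler_wpM2l _ (_ : _ <=
    ((3 * t) ^ k * \prod_(j < k) q ^ j)%:R * (C0 * q%:R ^+ (2 * t - K)))) _.
- by rewrite divr_ge0 ?exprn_ge0.
- have := scaled_congruence_count_le i; rewrite -(ler_nat R) => count_le.
  apply: le_trans count_le _.
  by rewrite natrM big_split /= prod_nat_const card_ord ler_wpM2l // mean_value.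
have powE : q%:R ^+ (2 * t) = q%:R ^+ (2 * t - K) * (\prod_(j < k) q ^ j)%:R * (q ^ k)%:R :> R.
  by rewrite -mulrA -natrM prod_pow_tri_num natrX -exprD subnK.
have prod_neq0 : (\prod_(j < k) q ^ j)%:R != 0 :> R.
  by rewrite pnatr_eq0 -lt0n prodn_gt0 // => j; rewrite expn_gt0 q_gt0.
rewrite powE natrM !natrX le_eqVlt; apply/orP; left; apply/eqP; field.
by rewrite prod_neq0 !expf_neq0.
Qed.

Lemma cong_solutions_fourier : (cong_solutions lam q)%:R * (q ^ k)%:R =
  \sum_a \prod_i weyl_sum q (scale_coef (lam i) (grid_point R (a : grid))) :> C.
Proof.
have := @grid_mean_prod_exp_sum0 R k s lam _ (@nat_pos q) q q_gt0.
rewrite /grid_mean => /(canRL (divfK _)) -> //.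
by rewrite pnatr_eq0 -lt0n expn_gt0 q_gt0.
Qed.

Lemma weyl_sum_zero i : weyl_sum q (scale_coef (lam i) (grid_point R zero)) = q%:R.
Proof.
rewrite /weyl_sum /exp_sum (eq_bigr (fun=> 1)) ?sumr_const ?card_ord // => x _.
rewrite /phase big1 ?e2pi0 // => j _.
by rewrite /scale_coef /grid_point ffunE /= mul0r mulr0 mul0r.
Qed.

Lemma nonzero_frequencies_le (i0 : 'I_s) :
  normc (\sum_(a | a != zero) \prod_i weyl_sum q (scale_coef (lam i) (grid_point R a))) <=
  q%:R ^+ s * (Y%:R^-1 * (s%:R * ((3 * t)%:R ^+ k * C0))).
Proof.
have ratio_sum_ge0 a : 0 <= \sum_i ratio a i ^+ (2 * t).
  by apply: sumr_ge0 => i _; rewrite exprn_ge0 ?weyl_ratio_ge0.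
apply: le_trans (ler_normc_sum _ _ _) _.
apply: (@le_trans _ _ (\sum_a q%:R ^+ s * (Y%:R^-1 * \sum_i ratio a i ^+ (2 * t)))).
  rewrite [leRHS](bigID (fun a => a != zero)) /= -[leLHS]addr0; apply: lerD.
    apply: ler_sum => a a_neq0; rewrite normc_prod_weyl_sum // ler_wpM2l ?exprn_ge0 //.
    apply: le_trans (prod_le_moment (n := 2 * t) i0 (fun i => weyl_ratio_itv _ q_gt0) _) _.
      by rewrite muln_gt0 t_gt0 card_ord.
    by rewrite ler_wpM2r ?nonzero_ratio_small.
  by apply: sumr_ge0 => a _; rewrite !mulr_ge0 ?exprn_ge0 ?invr_ge0.
rewrite -!mulr_sumr !ler_wpM2l ?exprn_ge0 ?invr_ge0 // exchange_big /=.
rewrite -[s in s%:R]card_ord mulr_natl -sumr_const; apply: ler_sum => i _.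
exact: sum_ratio_le.
Qed.

End RoughModulus.

Theorem cong_solutions_rough : exists W : nat, forall q, (0 < q)%N -> rough W q ->
  q%:R ^+ s / q%:R ^+ k / 2 <= (cong_solutions lam q)%:R :> R.
Proof.
pose B : R := s%:R * ((3 * t)%:R ^+ k * C0).
have B_ge0 : 0 <= B by rewrite !mulr_ge0 ?exprn_ge0 // ltW.
pose Y := (Num.bound (C0 + 2 * B)).+2.
have Y_large : C0 + 2 * B <= Y%:R.
  apply: le_trans (ltW (archi_boundP _)) _; first by rewrite addr_ge0 ?mulr_ge0 // ltW.
  by rewrite ler_nat /Y ltnW.
have C0_le : C0 <= Y%:R by apply: le_trans Y_large; rewrite lerDl mulr_ge0.
pose i0 : 'I_s := Ordinal (leq_ltn_trans (leq0n _) ts).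
exists (Y ^ E + coef_norm lam)%N => q q_gt0 q_rough.
have q_gt0R : 0 < q%:R ^+ k :> R by rewrite exprn_gt0 // ltr0n.
rewrite mulrAC ler_pdivrMr //.
have -> : (cong_solutions lam q)%:R * q%:R ^+ k =
    normc (\sum_a \prod_i weyl_sum q (scale_coef (lam i) (grid_point R (a : {ffun 'I_k -> 'I_q})))).
  by rewrite -(cong_solutions_fourier q_gt0) normcM !normc_nat natrX.
rewrite (bigD1 [ffun=> Ordinal q_gt0]) //= (eq_bigr (fun=> q%:R)) => [|i _]; last first.
  exact: weyl_sum_zero.
rewrite prodr_const card_ord.
have := nonzero_frequencies_le q_gt0 (isT : 1 < Y)%N C0_le q_rough i0.
set rest := \sum_(a | _) _ => rest_le.
have := lerB_normc (q%:R ^+ s) (- rest); rewrite opprK normcN normcX normc_nat.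
apply: le_trans; rewrite lerBrDl -lerBrDr; apply: le_trans rest_le _.
rewrite [leRHS](_ : _ = q%:R ^+ s * 2^-1); last by field.
rewrite ler_wpM2l ?exprn_ge0 // -/B ler_pdivrMl // ler_pdivlMr // mulrC.
by apply: le_trans Y_large; rewrite lerDr ltW.
Qed.

End Rough.
End Congruences.

(** * Newton iteration over a field with an absolute value *)

Record absolute_value (F : fieldType) (V : realFieldType) (v : F -> V) : Prop :=
  AbsoluteValue {
    absv0 : v 0 = 0;
    absv_gt0 : forall x, x != 0 -> 0 < v x;
    absvM : forall x y, v (x * y) = v x * v y;
    absvD : forall x y, v (x + y) <= v x + v y }.

Lemma normr_absolute_value (F : realFieldType) : absolute_value (fun x : F => `|x|).
Proof.
split=> [|x|x y|x y]; first exact: normr0.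
- by rewrite normr_gt0.
- exact: normrM.
exact: ler_normD.
Qed.

Lemma positive_lower_bound (V : realFieldType) (I : finType) (P : pred I) (f : I -> V) :
  (forall i, P i -> 0 < f i) -> exists2 eps, 0 < eps <= 1 & forall i, P i -> eps <= f i.
Proof.
move=> f_gt0; exists (\big[Num.min/1]_(i | P i) f i) => [|i Pi]; last first.
  by rewrite (bigD1 i) //= ge_min lexx.
elim/big_rec: _ => [|i y Pi /andP[y_gt0 y_le1]]; first by rewrite ltr01 lexx.
by rewrite lt_min f_gt0 //= y_gt0 ge_min y_le1 orbT.
Qed.

Section AbsoluteValue.
Variables (F : fieldType) (V : realFieldType) (v : F -> V).
Hypothesis v_abs : absolute_value v.

Lemma absv_ge0 x : 0 <= v x.
Proof. by have [->|/(absv_gt0 v_abs)/ltW//] := eqVneq x 0; rewrite (absv0 v_abs). Qed.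

Lemma absv1 : v 1 = 1.
Proof.
have v1_gt0 := absv_gt0 v_abs (oner_neq0 F).
by apply: (mulfI (lt0r_neq0 v1_gt0)); rewrite -(absvM v_abs) !mulr1.
Qed.

Lemma absvN x : v (- x) = v x.
Proof.
suff vN1 : v (- 1) = 1 by rewrite -mulN1r (absvM v_abs) vN1 mul1r.
by apply/eqP; rewrite -(@eqrXn2 _ 2) ?absv_ge0 // expr1n expr2 -(absvM v_abs) mulrNN mulr1 absv1.
Qed.

Lemma absv_sum (I : Type) (r : seq I) (P : pred I) (f : I -> F) :
  v (\sum_(i <- r | P i) f i) <= \sum_(i <- r | P i) v (f i).
Proof.
elim/big_rec2: _ => [|i y x _ IH]; first by rewrite (absv0 v_abs).
by apply: le_trans (absvD v_abs _ _) _; rewrite lerD2l.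
Qed.

Lemma absv_prod (I : Type) (r : seq I) (P : pred I) (f : I -> F) :
  v (\prod_(i <- r | P i) f i) = \prod_(i <- r | P i) v (f i).
Proof. by elim/big_rec2: _ => [|i y x _ <-]; rewrite ?absv1 ?(absvM v_abs). Qed.

Lemma absvX x n : v (x ^+ n) = v x ^+ n.
Proof. by elim: n => [|n IHn]; rewrite ?expr0 ?absv1 // !exprS (absvM v_abs) IHn. Qed.

Lemma absv_nat_le n : v n%:R <= n%:R.
Proof.
elim: n => [|n IHn]; first by rewrite (absv0 v_abs).
by rewrite -natr1 -[in leRHS]natr1; apply: le_trans (absvD v_abs _ _) _; rewrite absv1 lerD2r.
Qed.

Lemma absvV x : x != 0 -> v x^-1 = (v x)^-1.
Proof.
move=> x_neq0; have vx_neq0 := lt0r_neq0 (absv_gt0 v_abs x_neq0).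
by apply: (mulfI vx_neq0); rewrite -(absvM v_abs) !divff ?absv1.
Qed.

Lemma absv_det_le n (M : 'M[F]_n) B : (forall i j, v (M i j) <= B) ->
  v (\det M) <= n`!%:R * B ^+ n.
Proof.
move=> M_le; rewrite /determinant; apply: le_trans (absv_sum _ _ _) _.
apply: (@le_trans _ _ (\sum_(u : {perm 'I_n}) B ^+ n)); last first.
  by rewrite sumr_const card_Sn mulr_natl.
apply: ler_sum => u _; rewrite (absvM v_abs) absvX absvN absv1 expr1n mul1r absv_prod.
by rewrite -[n in leRHS]card_ord -prodr_const; apply: ler_prod => i _; rewrite absv_ge0 M_le.
Qed.

Lemma absv_inverse_le n (M : 'M[F]_n) B d : 1 <= B -> (forall i j, v (M i j) <= B) ->
  0 < d -> d <= v (\det M) ->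
  exists2 W : 'M[F]_n, M *m W = 1%:M & forall i j, v (W i j) <= n`!%:R * B ^+ n / d.
Proof.
move=> B_ge1 M_le d_gt0 d_le.
have det_neq0 : \det M != 0 by apply: contraTneq d_le => ->; rewrite (absv0 v_abs) -ltNge.
exists (invmx M); first by rewrite mulmxV // unitmxE unitfE.
move=> i j; rewrite /invmx unitmxE unitfE det_neq0 !mxE (absvM v_abs) absvV // mulrC.
have B_ge0 : 0 <= B by exact: le_trans B_ge1.
apply: ler_pM; rewrite ?invr_ge0 ?absv_ge0 //; last by rewrite lef_pV2 ?posrE // absv_gt0.
rewrite /cofactor (absvM v_abs) absvX absvN absv1 expr1n mul1r.
case: n M M_le d_le det_neq0 i j => [|n] M M_le d_le det_neq0 i j; first by case: i.
apply: le_trans (absv_det_le (B := B) _) _; first by move=> a b; rewrite !mxE M_le.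
apply: ler_pM; rewrite ?exprn_ge0 //; first by rewrite ler_nat factS leq_pmull.
by apply: ler_weXn2l.
Qed.

Lemma absv_monomial_diff x y c (D r : V) m n : 1 <= D -> v x <= D -> v y <= D -> v c <= D ->
  v (x - c) <= r -> v (y - c) <= r ->
  v (x ^+ m * y ^+ n - c ^+ (m + n)) <= (m + n)%:R * D ^+ (m + n) * r.
Proof.
move=> D_ge1 xD yD cD xr yr; have D_ge0 : 0 <= D by exact: le_trans D_ge1.
have r_ge0 : 0 <= r by exact: le_trans (absv_ge0 _) xr.
have factor w N u : v w <= D -> v (w - c) <= r -> v (u - c ^+ N) <= N%:R * D ^+ N * r ->
   v (w * u - c ^+ N.+1) <= N.+1%:R * D ^+ N.+1 * r.
  move=> wD wr u_near.
  have -> : w * u - c ^+ N.+1 = w * (u - c ^+ N) + (w - c) * c ^+ N by rewrite exprS; ring.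
  apply: le_trans (absvD v_abs _ _) _; rewrite !(absvM v_abs) -natr1 !mulrDl mul1r; apply: lerD.
    have -> : N%:R * D ^+ N.+1 * r = D * (N%:R * D ^+ N * r) by rewrite exprS; ring.
    by apply: ler_pM; rewrite ?absv_ge0.
  rewrite [leRHS]mulrC absvX; apply: ler_pM; rewrite ?exprn_ge0 ?absv_ge0 //.
  apply: (@le_trans _ _ (D ^+ N)); first by rewrite lerXn2r ?nnegrE ?absv_ge0.
  by apply: ler_weXn2l.
elim: m => [|m IHm]; last by rewrite exprS -mulrA addSn; apply: factor.
rewrite expr0 mul1r add0n; elim: n => [|n IHn].
  by rewrite !expr0 subrr (absv0 v_abs) mul0r mul0r.
by rewrite [y ^+ _]exprS; apply: factor.
Qed.

Lemma absv_taylor z h c (D r : V) j n : (j < n)%N -> 1 <= D -> v z <= D -> v (z + h) <= D ->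
  v c <= D -> v (z - c) <= r -> v (z + h - c) <= r ->
  v ((z + h) ^+ j.+1 - z ^+ j.+1 - (c ^+ j *+ j.+1) * h) <= (n * n)%:R * D ^+ n * r * v h.
Proof.
move=> jn D_ge1 zD zhD cD zr zhr; have D_ge0 : 0 <= D by exact: le_trans D_ge1.
have r_ge0 : 0 <= r by exact: le_trans (absv_ge0 _) zr.
have -> : (z + h) ^+ j.+1 - z ^+ j.+1 - (c ^+ j *+ j.+1) * h =
   (\sum_(i < j.+1) ((z + h) ^+ (j - i) * z ^+ i - c ^+ j)) * h.
  rewrite subrXX [z + h - z]addrC addKr sumrB sumr_const card_ord mulrBl; congr (_ - _).
  by rewrite mulrC.
rewrite (absvM v_abs) ler_wpM2r ?absv_ge0 //; apply: le_trans (absv_sum _ _ _) _.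
apply: (@le_trans _ _ (\sum_(i < j.+1) n%:R * D ^+ n * r)).
  apply: ler_sum => i _; have ij : (i <= j)%N by rewrite -ltnS.
  have := absv_monomial_diff (j - i) i D_ge1 zhD zD cD zhr zr; rewrite subnK // => diff_le.
  apply: le_trans diff_le _; rewrite ler_wpM2r // ler_pM ?exprn_ge0 ?ler_nat ?(ltnW jn) //.
  by apply: ler_weXn2l => //; exact: ltnW.
rewrite sumr_const card_ord -[_ *+ j.+1]mulr_natl natrM !mulrA ler_wpM2r // ler_wpM2r ?exprn_ge0 //.
by rewrite ler_wpM2r // ler_nat.
Qed.

End AbsoluteValue.

Section Jacobian.
Variables (F : fieldType) (k : nat) (mu : 'I_k -> F).
Implicit Type z : 'I_k -> F.

Definition power_system z (j : 'I_k) : F := \sum_l mu l * z l ^+ j.+1.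
Definition jacobian z : 'M[F]_k := \matrix_(j, l) (mu l * (z l ^+ j *+ j.+1)).

Lemma det_jacobian z : \det (jacobian z) = (\prod_(j < k) (j.+1)%:R) *
  (\prod_(i < k) \prod_(j < k | (i < j)%N) (z j - z i)) * \prod_l mu l.
Proof.
have -> : jacobian z =
    diag_mx (\row_j (j.+1)%:R) *m Vandermonde k (\row_l z l) *m diag_mx (\row_l mu l).
  by apply/matrixP => j l; rewrite mul_mx_diag mul_diag_mx !mxE mulr_natl mulrC.
rewrite !det_mulmx !det_diag det_Vandermonde; congr (_ * _ * _).
- by apply: eq_bigr => j _; rewrite mxE.
- by apply: eq_bigr => i _; apply: eq_bigr => j _; rewrite !mxE.
by apply: eq_bigr => j _; rewrite mxE.
Qed.

Variables (V : realFieldType) (v : F -> V).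
Hypothesis v_abs : absolute_value v.

Lemma det_jacobian_lower z eps : 0 < eps <= 1 -> (forall l, eps <= v (mu l)) ->
  (forall j : 'I_k, eps <= v (j.+1)%:R) -> (forall l l', l != l' -> eps <= v (z l - z l')) ->
  eps ^+ (k + k * k + k) <= v (\det (jacobian z)).
Proof.
move=> /andP[eps_gt0 eps_le1] mu_ge nat_ge z_sep; rewrite det_jacobian !(absvM v_abs) !exprD.
have prod_ge (f : 'I_k -> F) : (forall i, eps <= v (f i)) -> eps ^+ k <= v (\prod_i f i).
  move=> f_ge; rewrite (absv_prod v_abs) -[k in eps ^+ k]card_ord -prodr_const.
  by apply: ler_prod => i _; rewrite ltW /=.
rewrite !ler_pM ?mulr_ge0 ?exprn_ge0 ?(ltW eps_gt0) ?prod_ge //.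
rewrite (absv_prod v_abs) exprM -[k in X in X <= _]card_ord -prodr_const.
apply: ler_prod => i _; rewrite exprn_ge0 ?(ltW eps_gt0) //= (absv_prod v_abs).
apply: (@le_trans _ _ (\prod_(j < k | (i < j)%N) eps)).
  by rewrite prodr_const; apply: ler_wiXn2l; rewrite ?(ltW eps_gt0) // max_card.
by apply: ler_prod => j ij; rewrite ltW //= z_sep // -(inj_eq val_inj) gtn_eqF.
Qed.

Lemma absv_jacobian_le z D : 1 <= D -> (forall l, v (mu l) <= D) -> (forall l, v (z l) <= D) ->
  forall j l, v (jacobian z j l) <= D * (k%:R * D ^+ k).
Proof.
move=> D_ge1 mu_le z_le j l; have D_ge0 : 0 <= D by exact: le_trans D_ge1.
rewrite mxE (absvM v_abs) -mulr_natl (absvM v_abs) (absvX v_abs).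
apply: ler_pM; rewrite ?mulr_ge0 ?exprn_ge0 ?(absv_ge0 v_abs) //.
apply: ler_pM; rewrite ?exprn_ge0 ?(absv_ge0 v_abs) //.
  by apply: le_trans (absv_nat_le v_abs _) _; rewrite ler_nat.
apply: (@le_trans _ _ (D ^+ j)); first by rewrite lerXn2r ?nnegrE ?(absv_ge0 v_abs).
by apply: ler_weXn2l => //; exact: ltnW.
Qed.

End Jacobian.

Section NewtonIteration.
Variables (F : fieldType) (V : realFieldType) (v : F -> V).
Hypothesis v_abs : absolute_value v.
Variables (k : nat) (mu : 'I_k -> F) (D b : V).
Hypotheses (D_ge1 : 1 <= D) (b_ge0 : 0 <= b).

Let D_ge0 : 0 <= D. Proof. exact: le_trans D_ge1. Qed.
Let D1_ge1 : 1 <= D + 1. Proof. by rewrite lerDr. Qed.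
Let D1_ge0 : 0 <= D + 1. Proof. exact: le_trans D1_ge1. Qed.

Definition newton_constant : V :=
  k%:R * D * ((k * k)%:R * (D + 1) ^+ k) * (2 * k%:R * b) * (k%:R * b).

Definition newton_radius : V := (1 + 2 * k%:R * b + 2 * newton_constant)^-1.

Lemma newton_constant_ge0 : 0 <= newton_constant.
Proof. by rewrite !mulr_ge0 // exprn_ge0. Qed.

Let step_size_ge0 : 0 <= 2 * k%:R * b. Proof. by rewrite !mulr_ge0. Qed.

Lemma newton_radius_gt0 : 0 < newton_radius.
Proof. by rewrite invr_gt0; move: step_size_ge0 newton_constant_ge0; lra. Qed.

Variables (z0 tau : 'I_k -> F) (W : 'M[F]_k) (theta : V).
Hypotheses (W_inverse : jacobian mu z0 *m W = 1%:M) (W_le : forall l j, v (W l j) <= b).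
Hypotheses (z0_le : forall l, v (z0 l) <= D) (mu_le : forall l, v (mu l) <= D).
Hypothesis theta_itv : 0 <= theta <= newton_radius.
Hypothesis initial_defect : forall j, v (power_system mu z0 j - tau j) <= theta.
Implicit Type z : 'I_k -> F.
Local Notation defect z j := (power_system mu z j - tau j).
Local Notation radius := (2 * k%:R * b * theta).

Let theta_ge0 : 0 <= theta. Proof. by case/andP: theta_itv. Qed.

Let theta_small : theta * (1 + 2 * k%:R * b + 2 * newton_constant) <= 1.
Proof.
have /andP[_ theta_le] := theta_itv.
by rewrite -ler_pdivlMr ?div1r // -[ltRHS]invrK invr_gt0; exact: newton_radius_gt0.
Qed.

Lemma newton_ball_le1 : radius <= 1.
Proof.
have := mulr_ge0 theta_ge0 newton_constant_ge0.
by move: theta_small theta_ge0; rewrite [radius]mulrC; nra.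
Qed.

Lemma newton_contraction : 2 * newton_constant * theta <= 1.
Proof.
have := mulr_ge0 theta_ge0 step_size_ge0.
by move: theta_small theta_ge0; rewrite [2 * newton_constant * theta]mulrC; nra.
Qed.

Definition newton_increment z l : F := - \sum_j W l j * defect z j.

Lemma newton_increment_le z e l : (forall j, v (defect z j) <= e) ->
  v (newton_increment z l) <= k%:R * b * e.
Proof.
move=> z_defect; rewrite /newton_increment (absvN v_abs).
apply: le_trans (absv_sum v_abs _ _ _) _.
rewrite -!mulrA -[k in leRHS]card_ord mulr_natl -sumr_const; apply: ler_sum => j _.
by rewrite (absvM v_abs); apply: ler_pM; rewrite ?(absv_ge0 v_abs) ?W_le.
Qed.

Lemma newton_increment_cancels z (j : 'I_k) :
  \sum_l mu l * (z0 l ^+ j *+ j.+1) * newton_increment z l = - defect z j.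
Proof.
rewrite /newton_increment; under eq_bigr => l _ do rewrite mulrN mulr_sumr.
rewrite sumrN; congr (- _); rewrite exchange_big /=.
transitivity (\sum_i (1%:M : 'M[F]_k) j i * defect z i).
  apply: eq_bigr => i _; rewrite -W_inverse !mxE mulr_suml; apply: eq_bigr => l _.
  by rewrite !mxE mulrA.
rewrite (bigD1 j) //= mxE eqxx mul1r big1 ?addr0 // => i ij.
by rewrite mxE eq_sym (negbTE ij) mul0r.
Qed.

Lemma newton_step_defectE z j :
  defect (fun l => z l + newton_increment z l) j = \sum_l mu l *
    ((z l + newton_increment z l) ^+ j.+1 - z l ^+ j.+1 -
     (z0 l ^+ j *+ j.+1) * newton_increment z l).
Proof.
under [RHS]eq_bigr => l _ do rewrite mulrBr mulrBr mulrA.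
by rewrite sumrB sumrB newton_increment_cancels opprK /power_system; ring.
Qed.

Lemma in_newton_ball_le w l : v (w - z0 l) <= radius -> v w <= D + 1.
Proof.
move=> w_near; rewrite -[w](subrK (z0 l)); apply: le_trans (absvD v_abs _ _) _.
by rewrite addrC; apply: lerD => //; exact: le_trans w_near newton_ball_le1.
Qed.

Lemma newton_step_defect z e : (forall l, v (z l - z0 l) <= radius) ->
  (forall l, v (z l + newton_increment z l - z0 l) <= radius) ->
  (forall j, v (defect z j) <= theta * e) -> 0 <= e ->
  forall j, v (defect (fun l => z l + newton_increment z l) j) <= theta * (2^-1 * e).
Proof.
move=> z_near step_near z_defect e_ge0 j; rewrite newton_step_defectE.
apply: le_trans (absv_sum v_abs _ _ _) _.
have cc_ge0 : 0 <= (k * k)%:R * (D + 1) ^+ k by rewrite mulr_ge0 ?exprn_ge0.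
apply: (@le_trans _ _ (\sum_(l < k) D *
    ((k * k)%:R * (D + 1) ^+ k * radius * (k%:R * b * (theta * e))))).
  apply: ler_sum => l _; rewrite (absvM v_abs); apply: ler_pM; rewrite ?(absv_ge0 v_abs) //.
  apply: le_trans (absv_taylor v_abs (ltn_ord j) D1_ge1 (in_newton_ball_le (z_near l))
    (in_newton_ball_le (step_near l)) _ (z_near l) (step_near l)) _.
    by apply: le_trans (z0_le l) _; rewrite lerDl.
  by rewrite ler_wpM2l ?newton_increment_le // mulr_ge0 // mulr_ge0.
rewrite sumr_const card_ord -[_ *+ k]mulr_natl.
have -> : k%:R * (D * ((k * k)%:R * (D + 1) ^+ k * radius * (k%:R * b * (theta * e)))) =
    (2 * newton_constant * theta) * (theta * (2^-1 * e)) by rewrite /newton_constant; field.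
by rewrite ler_piMl ?newton_contraction // !mulr_ge0 ?invr_ge0.
Qed.

Lemma newton_iterate m : exists z, (forall l, v (z l - z0 l) <= radius * (1 - 2^-1 ^+ m)) /\
  (forall j, v (defect z j) <= theta * 2^-1 ^+ m).
Proof.
have radius_ge0 : 0 <= radius by rewrite !mulr_ge0.
have partial_le n : radius * (1 - 2^-1 ^+ n) <= radius.
  by rewrite ler_piMr // lerBlDr lerDl exprn_ge0 ?invr_ge0.
elim: m => [|m [z [z_near z_defect]]].
  by exists z0; split => [l|j]; rewrite ?subrr ?(absv0 v_abs) ?mulr0 // expr0 mulr1.
have step_near l : v (z l + newton_increment z l - z0 l) <= radius * (1 - 2^-1 ^+ m.+1).
  have -> : z l + newton_increment z l - z0 l = (z l - z0 l) + newton_increment z l.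
    by rewrite addrAC.
  apply: le_trans (absvD v_abs _ _) _.
  apply: le_trans (lerD (z_near l) (newton_increment_le l z_defect)) _.
  by rewrite exprS le_eqVlt; apply/orP; left; apply/eqP; field.
exists (fun l => z l + newton_increment z l); split=> // j; rewrite exprS.
apply: newton_step_defect => // [l|l].
  exact: le_trans (z_near l) (partial_le m).
exact: le_trans (step_near l) (partial_le m.+1).
Qed.

Lemma newton_approximation m : exists z, (forall l, v (z l - z0 l) <= radius) /\
  (forall j, v (defect z j) <= theta / 2 ^+ m).
Proof.
have [z [z_near z_defect]] := newton_iterate m; exists z; split=> [l|j]; last by rewrite -exprVn.
by apply: le_trans (z_near l) _; rewrite ler_piMr ?mulr_ge0 // lerBlDr lerDl exprn_ge0 ?invr_ge0.
Qed.

End NewtonIteration.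

Section Split.
Variables (k s : nat) (ic : 'I_k -> 'I_s).
Hypothesis ic_inj : injective ic.

Lemma sum_split (V : nmodType) (f : 'I_s -> V) :
  \sum_i f i = \sum_l f (ic l) + \sum_(i | i \notin codom ic) f i.
Proof.
rewrite (bigID (mem (codom ic))) /=; congr (_ + _).
rewrite (eq_bigl (mem [set ic l | l in 'I_k])) => [|i]; last first.
  by apply/codomP/imsetP => [[l ->]|[l _ ->]]; exists l.
by rewrite big_imset //=; move=> l l' _ _; exact: ic_inj.
Qed.

Definition combine (T : Type) (z : 'I_k -> T) (x : 'I_s -> T) (i : 'I_s) : T :=
  if [pick l | ic l == i] is Some l then z l else x i.

Lemma combine_critical (T : Type) (z : 'I_k -> T) x l : combine z x (ic l) = z l.
Proof.
by rewrite /combine; case: pickP => [l' /eqP/ic_inj -> //|/(_ l)]; rewrite eqxx.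
Qed.

Lemma combine_free (T : Type) (z : 'I_k -> T) x i : i \notin codom ic -> combine z x i = x i.
Proof.
move=> i_free; rewrite /combine; case: pickP => // l /eqP icl.
by case/negP: i_free; rewrite -icl codom_f.
Qed.

Lemma card_free : #|[pred i | i \notin codom ic]| = (s - k)%N.
Proof.
have := cardC (mem (codom ic)); rewrite card_codom // !card_ord => cardE.
have -> : (s - k)%N = #|[predC mem (codom ic)]|.
  by apply/eqP; rewrite -(eqn_add2l k) cardE subnKC // -cardE leq_addr.
by apply: eq_card => i; rewrite !inE.
Qed.

End Split.

(* Solving the system for the critical variables, the free ones being prescribed near
   an approximate solution. *)
Section NewtonSystem.
Variables (F : fieldType) (V : realFieldType) (v : F -> V).
Hypothesis v_abs : absolute_value v.
Variables (k s : nat) (ic : 'I_k -> 'I_s) (mu : 'I_s -> F) (D eps : V).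
Hypotheses (ic_inj : injective ic) (D_ge1 : 1 <= D) (eps_itv : 0 < eps <= 1).
Hypotheses (mu_le : forall i, v (mu i) <= D) (mu_ge : forall l, eps <= v (mu (ic l))).
Hypothesis nat_ge : forall j : 'I_k, eps <= v (j.+1)%:R.
Local Notation mu_crit := (fun l => mu (ic l)).

Let D_ge0 : 0 <= D. Proof. exact: le_trans D_ge1. Qed.
Let slope : V := D * (k%:R * D ^+ k).
Let slope_ge0 : 0 <= slope. Proof. by rewrite !mulr_ge0 ?exprn_ge0. Qed.

Definition inverse_jacobian_bound : V :=
  k`!%:R * (slope + 1) ^+ k / eps ^+ (k + k * k + k).

Definition perturbation_constant : V := 1 + s%:R * slope.

Definition newton_system_radius : V :=
  Num.min (newton_radius k D inverse_jacobian_bound) 1 / perturbation_constant.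

Definition displacement_constant : V := 2 * k%:R * inverse_jacobian_bound * perturbation_constant.

Let eps_gt0 : 0 < eps. Proof. by case/andP: eps_itv. Qed.

Lemma inverse_jacobian_bound_ge0 : 0 <= inverse_jacobian_bound.
Proof. by rewrite divr_ge0 ?mulr_ge0 ?exprn_ge0 ?addr_ge0 // ltW. Qed.

Lemma perturbation_constant_gt0 : 0 < perturbation_constant.
Proof. by rewrite ltr_pwDl // mulr_ge0. Qed.

Lemma newton_system_radius_gt0 : 0 < newton_system_radius.
Proof.
rewrite divr_gt0 ?perturbation_constant_gt0 // lt_min ltr01 andbT.
exact: newton_radius_gt0 D_ge1 inverse_jacobian_bound_ge0.
Qed.

Lemma displacement_constant_ge0 : 0 <= displacement_constant.
Proof.
by rewrite mulr_ge0 ?(ltW perturbation_constant_gt0) // mulr_ge0 ?inverse_jacobian_bound_ge0.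
Qed.

Variables (x y : 'I_s -> F) (theta : V).
Hypothesis theta_itv : 0 <= theta <= newton_system_radius.
Hypotheses (y_le : forall i, v (y i) <= D) (x_le : forall i, v (x i) <= D).
Hypothesis xy_near : forall i, v (x i - y i) <= theta.
Hypothesis y_sep : forall l l', l != l' -> eps <= v (y (ic l) - y (ic l')).
Hypothesis y_solution : forall j : 'I_k, v (\sum_i mu i * y i ^+ j.+1) <= theta.

Definition free_target (j : 'I_k) : F := - \sum_(i | i \notin codom ic) mu i * x i ^+ j.+1.

Lemma critical_defect j :
  v (power_system mu_crit (fun l => y (ic l)) j - free_target j) <= perturbation_constant * theta.
Proof.
have theta_ge0 : 0 <= theta by case/andP: theta_itv.
have -> : power_system mu_crit (fun l => y (ic l)) j - free_target j =
    \sum_i mu i * y i ^+ j.+1 + \sum_(i | i \notin codom ic) mu i * (x i ^+ j.+1 - y i ^+ j.+1).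
  rewrite opprK (sum_split ic_inj (fun i => mu i * y i ^+ j.+1)) -addrA -big_split /=.
  by congr (_ + _); apply: eq_bigr => i _; rewrite -mulrDr addrC subrK.
apply: le_trans (absvD v_abs _ _) _; rewrite mulrDl mul1r; apply: lerD => //.
apply: le_trans (absv_sum v_abs _ _ _) _.
apply: (@le_trans _ _ (\sum_(i < s) slope * theta)); last first.
  by rewrite sumr_const card_ord -[leLHS]mulr_natl mulrA.
rewrite [leRHS](bigID (fun i => i \notin codom ic)) /= -[leLHS]addr0; apply: lerD; last first.
  by apply: sumr_ge0 => i _; rewrite mulr_ge0.
apply: ler_sum => i _; rewrite (absvM v_abs) -mulrA; apply: ler_pM; rewrite ?(absv_ge0 v_abs) //.
have := absv_monomial_diff v_abs j.+1 0 D_ge1 (x_le i) (y_le i) (y_le i) (xy_near i) _.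
rewrite expr0 mulr1 addn0 subrr (absv0 v_abs) => /(_ theta_ge0) diff_le.
apply: le_trans diff_le _; rewrite ler_wpM2r // ler_pM ?exprn_ge0 ?ler_nat //.
by apply: ler_weXn2l.
Qed.

Lemma newton_system m : exists z : 'I_k -> F,
  (forall l, v (z l - y (ic l)) <= displacement_constant * theta) /\
  forall j : 'I_k, v (\sum_l mu (ic l) * z l ^+ j.+1 +
    \sum_(i | i \notin codom ic) mu i * x i ^+ j.+1) <= (2 ^+ m)^-1.
Proof.
have /andP[theta_ge0 theta_le] := theta_itv; set c := perturbation_constant in theta_le.
have c_gt0 := perturbation_constant_gt0; rewrite -/c in c_gt0.
have : c * theta <= Num.min (newton_radius k D inverse_jacobian_bound) 1.
  by rewrite mulrC -ler_pdivlMr.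
rewrite le_min => /andP[c_theta_le c_theta_le1].
have c_theta_itv : 0 <= c * theta <= newton_radius k D inverse_jacobian_bound.
  by rewrite c_theta_le mulr_ge0 // ltW.
have [W W_inverse W_le] : exists2 W : 'M[F]_k,
    jacobian mu_crit (fun l => y (ic l)) *m W = 1%:M &
    forall i j, v (W i j) <= inverse_jacobian_bound.
  apply: (absv_inverse_le v_abs (B := slope + 1)); rewrite ?lerDr ?exprn_gt0 //.
    move=> j l; apply: (@le_trans _ _ slope); last by rewrite lerDl.
    exact: (absv_jacobian_le v_abs).
  exact: (det_jacobian_lower v_abs).
have [z [z_near z_defect]] := newton_approximation v_abs D_ge1 inverse_jacobian_bound_ge0
  W_inverse W_le (fun l => y_le (ic l)) (fun l => mu_le (ic l)) c_theta_itv critical_defect m.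
exists z; split=> [l|j]; first by apply: le_trans (z_near l) _; rewrite mulrA.
have := z_defect j; rewrite opprK => defect_le; apply: le_trans defect_le _.
by rewrite ler_piMl // invr_ge0 exprn_ge0.
Qed.

End NewtonSystem.

Lemma dL_jacobian (T : fieldType) k s (lam : 'I_s -> int) (i : 'I_k -> 'I_s) (x : 'I_s -> T) :
  \matrix_(j < k, l < k) dL lam j.+1 (i l) x =
  jacobian (fun l => (lam (i l))%:~R) (fun l => x (i l)).
Proof. by apply/matrixP => j l; rewrite !mxE dLE. Qed.

Lemma nonsingular_distinct (T : fieldType) k s (lam : 'I_s -> int) (i : 'I_k -> 'I_s)
    (x : 'I_s -> T) :
  \det (\matrix_(j < k, l < k) dL lam j.+1 (i l) x) != 0 -> injective (fun l => x (i l)).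
Proof.
rewrite dL_jacobian det_jacobian => det_neq0.
suff ltn_neq (l l' : 'I_k) : (l < l')%N -> x (i l') != x (i l).
  by move=> l l' xE; have [/ltn_neq|/ltn_neq|/val_inj] := ltngtP l l'; rewrite ?xE ?eqxx.
move=> ll'; apply: contra det_neq0 => /eqP xE.
rewrite mulf_eq0 mulf_eq0; apply/orP; left; apply/orP; right.
by rewrite (bigD1 l) //= (bigD1 l') //= xE subrr !mul0r.
Qed.

Lemma solution_affine (T : comNzRingType) k s (lam : 'I_s -> int) (x : 'I_s -> T) (a b : T) :
  \sum_i lam i = 0 -> solution lam k x -> solution lam k (fun i => a + b * x i).
Proof.
move=> lam_sum0 /forallP x_sol; apply/forallP => j; apply/eqP; rewrite /L.
have powE i : (lam i)%:~R * (a + b * x i) ^+ j.+1 = \sum_(r < j.+2)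
    (a ^+ (j.+1 - r) * b ^+ r *+ 'C(j.+1, r)) * ((lam i)%:~R * x i ^+ r).
  rewrite exprDn mulr_sumr; apply: eq_bigr => r _; rewrite exprMn mulrnAr mulrnAl; congr (_ *+ _).
  by move: (lam i)%:~R (a ^+ _) (b ^+ r) (x i ^+ r) => l A B X; ring.
rewrite (eq_bigr _ (fun i _ => powE i)) exchange_big big1 //= => r _; rewrite -mulr_sumr.
case: r => -[|r] /= r_lt.
  rewrite (eq_bigr (fun i => (lam i)%:~R)) => [|i _]; last by rewrite expr0 mulr1.
  have -> : \sum_i (lam i)%:~R = (\sum_i lam i)%:~R :> T by rewrite rmorph_sum.
  by rewrite lam_sum0 mulr0z mulr0.
have rk : (r < k)%N by apply: leq_trans (ltn_ord j).
by have /eqP := x_sol (Ordinal rk); rewrite /L /= => ->; rewrite mulr0.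
Qed.

(** * p-adic densities *)

Section PadicIntegers.
Variable p : nat.
Hypothesis p_pr : prime p.
Local Notation v := (padic_abs p).

Let p_gt0 : (0 < p)%N. Proof. exact: prime_gt0. Qed.
Let p_gt0Q : 0 < p%:R :> rat. Proof. by rewrite ltr0n. Qed.
Let p_gt1Q : 1 < p%:R :> rat. Proof. by rewrite ltr1n prime_gt1. Qed.

Lemma padic_absolute_value : absolute_value v.
Proof.
split; [exact: padic_abs0 | exact: padic_abs_gt0 | exact: padic_absM | move=> x y].
by apply: le_trans (padic_abs_ultra p x y) _; rewrite ge_max lerDl lerDr !padic_abs_ge0.
Qed.

Lemma padic_abs_sum_le (I : Type) (r : seq I) (P : pred I) (f : I -> rat) c : 0 <= c ->
  (forall i, P i -> v (f i) <= c) -> v (\sum_(i <- r | P i) f i) <= c.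
Proof.
move=> c_ge0 f_le; elim/big_rec: _ => [|i x Pi xc]; first by rewrite padic_abs0.
by apply: le_trans (padic_abs_ultra p _ _) _; rewrite ge_max f_le.
Qed.

Lemma padic_abs_int (z : int) : z != 0 -> v z%:~R = (p%:R ^+ logn p `|z|)^-1.
Proof.
move=> z_neq0; rewrite /padic_abs intr_eq0 (negbTE z_neq0) numq_int denq_int absz1 logn1 sub0r.
by rewrite -invr_expz.
Qed.

Lemma padic_abs_int_le1 (z : int) : v z%:~R <= 1.
Proof.
have [->|z_neq0] := eqVneq z 0; first by rewrite padic_abs0.
by rewrite padic_abs_int // invf_le1 ?exprn_gt0 // exprn_ege1 // ltW.
Qed.

Lemma padic_abs_ppow n : v (p%:R ^+ n) = (p%:R ^+ n)^-1.
Proof.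
have pn_neq0 : (p ^ n)%N%:Z != 0 by rewrite eqz_nat -lt0n expn_gt0 p_gt0.
by have := padic_abs_int pn_neq0; rewrite absz_nat pfactorK // => <-; rewrite -natrX.
Qed.

Lemma padic_abs_le_dvd (z : int) n : (v z%:~R <= (p%:R ^+ n)^-1) = ((p ^ n)%N%:Z %| z)%Z.
Proof.
have [->|z_neq0] := eqVneq z 0.
  by rewrite padic_abs0 dvdz0 invr_ge0 exprn_ge0.
rewrite padic_abs_int // lef_pV2 ?posrE ?exprn_gt0 // ler_eXn2l // dvdzE /= pfactor_dvdn //.
by rewrite absz_gt0.
Qed.

Lemma padic_abs_subX_le x y n : v x <= 1 -> v y <= 1 -> v (x ^+ n - y ^+ n) <= v (x - y).
Proof.
have v_abs := padic_absolute_value.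
move=> x_le1 y_le1; rewrite subrXX padic_absM ler_piMr ?padic_abs_ge0 //.
apply: padic_abs_sum_le => // i _; rewrite padic_absM !(absvX v_abs).
by apply: mulr_ile1; rewrite ?exprn_ile1 ?exprn_ge0 ?padic_abs_ge0.
Qed.

Lemma padic_integer_denom x : v x <= 1 -> ~~ (p %| `|denq x|)%N.
Proof.
move=> vx; have [->|x_neq0] := eqVneq x 0; first by rewrite dvdn1 gtn_eqF ?prime_gt1.
apply/negP => p_den; have p_num : ~~ (p %| `|numq x|)%N.
  apply/negP => p_num; have := coprime_num_den x; rewrite /coprime => /eqP gcd1.
  have : (p %| gcdn `|numq x| `|denq x|)%N by rewrite dvdn_gcd p_num.
  by rewrite gcd1 dvdn1 => /eqP p1; move: p_pr; rewrite p1.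
move: vx; rewrite /padic_abs (negbTE x_neq0) (lognE p `|numq x|) (negbTE p_num) !andbF subr0.
by rewrite leNgt exprn_egt1 // -lt0n logn_gt0 mem_primes p_pr p_den absz_gt0 denq_eq0.
Qed.

Lemma padic_approx x n : v x <= 1 -> exists z : int, v (x - z%:~R) <= (p%:R ^+ n)^-1.
Proof.
move=> /padic_integer_denom den_unit.
have den_coprime : coprime (p ^ n) `|denq x| by rewrite coprimeXl // prime_coprime.
have [u [w bezout]] := Bezoutz (denq x) (p ^ n)%N%:Z.
have gcd1 : gcdz (denq x) (p ^ n)%N%:Z = 1 by rewrite /gcdz absz_nat gcdnC (eqP den_coprime).
have v_den : v (denq x)%:~R = 1.
  by rewrite padic_abs_int ?denq_neq0 // lognE (negbTE den_unit) !andbF expr0 invr1.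
have scaled : (denq x)%:~R * (x - (numq x * u)%:~R) = (numq x * (w * (p ^ n)%N%:Z))%:~R.
  have -> : w * (p ^ n)%N%:Z = 1 - u * denq x by rewrite -gcd1 -bezout; ring.
  by rewrite mulrBr [_ * x]mulrC -numqE !rmorphM rmorphB rmorphM /=; ring.
exists (numq x * u); have := congr1 v scaled; rewrite padic_absM v_den mul1r => ->.
by rewrite padic_abs_le_dvd mulrA dvdz_mull.
Qed.

End PadicIntegers.

Section QpRepr.
Variable p : nat.
Local Notation v := (padic_abs p).
Local Notation pi := (\pi_({ideal_quot (@padic_null p)}))%qT.

Definition cauchy_eval (n : nat) (u : cauchy_seq p) : rat := cauchy_val u n.

Fact cauchy_eval_is_zmod_morphism n : zmod_morphism (cauchy_eval n).
Proof. by []. Qed.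
Fact cauchy_eval_is_monoid_morphism n : monoid_morphism (cauchy_eval n).
Proof. by split. Qed.
HB.instance Definition _ n :=
  GRing.isZmodMorphism.Build _ _ (cauchy_eval n) (cauchy_eval_is_zmod_morphism n).
HB.instance Definition _ n :=
  GRing.isMonoidMorphism.Build _ _ (cauchy_eval n) (cauchy_eval_is_monoid_morphism n).

Definition eventually_nat (P : nat -> Prop) := exists M : nat, forall n, (M <= n)%N -> P n.

Lemma eventually_all (I : finType) (P : I -> nat -> Prop) :
  (forall i, eventually_nat (P i)) -> eventually_nat (fun n => forall i, P i n).
Proof.
move=> /boolp.choice[M PM]; exists (\max_i M i)%N => n n_ge i; apply: PM.
by apply: leq_trans n_ge; exact: leq_bigmax.
Qed.

Lemma cauchy_eval_L (s : nat) (lam : 'I_s -> int) j (u : 'I_s -> cauchy_seq p) n :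
  cauchy_eval n (L lam j u) = L lam j (fun i => cauchy_eval n (u i)).
Proof.
by rewrite /L rmorph_sum; apply: eq_bigr => i _; rewrite rmorphM rmorphXn rmorph_int.
Qed.

Lemma padic_nullE (w : cauchy_seq p) : (w \in @padic_null p) = (pi w == 0).
Proof. by rewrite -(rmorph0 pi) -Quotient.idealrBE subr0. Qed.

Lemma nonnull_bounded_below (w : cauchy_seq p) : w \notin @padic_null p ->
  exists2 eps : rat, 0 < eps & eventually_nat (fun n => eps <= v (w n)).
Proof.
move=> w_nonnull; have [eps eps_gt0 frequently] : exists2 eps : rat, 0 < eps &
    forall M, exists2 n, (M <= n)%N & eps <= v (w n).
  apply: contrapT => none; case/negP: w_nonnull; apply/asboolP => eps eps_gt0.
  apply: contrapT => not_small; apply: none; exists eps => // M.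
  apply: contrapT => no_large; apply: not_small; exists M => n Mn.
  by rewrite ltNge; apply/negP => large; apply: no_large; exists n.
exists eps => //; have /asboolP cauchy := valP w.
have [M close] := cauchy _ eps_gt0; have [n0 Mn0 large] := frequently M.
exists M => m Mm; rewrite leNgt; apply/negP => small.
have := padic_abs_ultra p (w n0 - w m) (w m).
by rewrite subrK => /(le_trans large); rewrite le_max leNgt close //= leNgt small.
Qed.

Lemma Qp_solution_seq (k s : nat) (lam : 'I_s -> int) (x : 'I_s -> Qp p) (ic : 'I_k -> 'I_s) :
  solution lam k x -> injective (fun l => x (ic l)) ->
  exists u : 'I_s -> nat -> rat, exists B eps : rat, [/\ 0 < eps, (forall i n, v (u i n) <= B),
    eventually_nat (fun n => forall ll : 'I_k * 'I_k, ll.1 != ll.2 ->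
       eps <= v (u (ic ll.1) n - u (ic ll.2) n)) &
    forall th : rat, 0 < th -> eventually_nat (fun n => forall j : 'I_k,
       v (L lam j.+1 (fun i => u i n)) <= th)].
Proof.
move=> x_sol x_inj; pose u a : cauchy_seq p := repr (x a).
have xE a : x a = pi (u a) by rewrite reprK.
have [B u_le] : exists B : 'I_s -> rat, forall a n, v (u a n) <= B a.
  suff bounded a : exists B : rat, forall n, v (u a n) <= B.
    by have [B u_le] := boolp.choice bounded; exists B.
  by have [B _ u_le] := padic_cauchy_bounded (valP (u a)); exists B.
have sep (ll : 'I_k * 'I_k) : exists eps : rat, 0 < eps /\ eventually_nat (fun n =>
    ll.1 != ll.2 -> eps <= v (u (ic ll.1) n - u (ic ll.2) n)).
  have [_|ll_neq] := eqVneq ll.1 ll.2; first by exists 1; split => //; exists 0%N.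
  have : u (ic ll.1) - u (ic ll.2) \notin @padic_null p.
    rewrite padic_nullE rmorphB /= -!xE subr_eq0.
    by apply: contra ll_neq => /eqP/x_inj->.
  move=> /nonnull_bounded_below[eps eps_gt0 [M large]].
  by exists eps; split=> //; exists M => n /large.
have [eps epsP] := boolp.choice sep.
have [ep /andP[ep_gt0 _] ep_le] :=
  positive_lower_bound (P := xpredT) (fun ll _ => (epsP ll).1).
exists (fun a n => u a n), (\sum_a `|B a|), ep; split=> // [a n||th th_gt0].
- apply: le_trans (u_le a n) _; apply: le_trans (ler_norm _) _.
  by rewrite (bigD1 a) //= lerDl sumr_ge0.
- apply: eventually_all => ll; have [_ [M large]] := epsP ll.
  by exists M => n Mn ll_neq; apply: le_trans (ep_le ll isT) (large n Mn ll_neq).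
apply: eventually_all => j; have : L lam j.+1 u \in @padic_null p.
  rewrite padic_nullE; have := forallP x_sol j; congr (_ == _).
  by rewrite /L rmorph_sum; apply: eq_bigr => a _; rewrite xE rmorphM rmorphXn rmorph_int.
move=> /asboolP /(_ _ th_gt0) [M small]; exists M => n /small/ltW.
by rewrite -[cauchy_val _ _]/(cauchy_eval n _) cauchy_eval_L.
Qed.

End QpRepr.

Section PadicLift.
Variables (p k s : nat) (lam : 'I_s -> int).
Hypotheses (p_pr : prime p) (lam_neq0 : forall i, lam i != 0).
Local Notation v := (padic_abs p).
Local Notation mu i := ((lam i)%:~R : rat).

Let p_gt0 : (0 < p)%N. Proof. exact: prime_gt0. Qed.
Let p_gt0Q : 0 < p%:R :> rat. Proof. by rewrite ltr0n. Qed.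
Let v_abs : absolute_value v. Proof. exact: padic_absolute_value. Qed.

Lemma ler_ppow_bound (x : rat) : 0 <= x -> x <= p%:R ^+ Num.bound x.
Proof.
move=> x_ge0; apply: le_trans (ltW (archi_boundP x_ge0)) _; rewrite -natrX ler_nat ltnW //.
by rewrite ltn_expl // prime_gt1.
Qed.

Lemma Qp_integral_approx (x : 'I_s -> Qp p) (ic : 'I_k -> 'I_s) :
  solution lam k x -> injective (fun l => x (ic l)) ->
  exists2 eps : rat, 0 < eps & forall th : rat, 0 < th -> exists y : 'I_s -> rat,
    [/\ forall i, v (y i) <= 1, forall l l', l != l' -> eps <= v (y (ic l) - y (ic l')) &
     forall j : 'I_k, v (\sum_i mu i * y i ^+ j.+1) <= th].
Proof.
move=> x_sol x_inj; have [u [B [eps [eps_gt0 u_le u_sep u_sol]]]] := Qp_solution_seq x_sol x_inj.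
pose a := Num.bound `|B|; have pa_gt0 : 0 < p%:R ^+ a :> rat by rewrite exprn_gt0.
have B_le : B <= p%:R ^+ a by apply: le_trans (ler_norm _) _; exact: ler_ppow_bound.
exists (eps / p%:R ^+ a) => [|th th_gt0]; first by rewrite divr_gt0.
have [M1 sep] := u_sep; have [M2 small] := u_sol th th_gt0; pose n := maxn M1 M2.
exists (fun i => p%:R ^+ a * u i n); split=> [i|l l' ll'|j].
- rewrite padic_absM padic_abs_ppow // mulrC ler_pdivrMr // mul1r.
  exact: le_trans (u_le i n) B_le.
- rewrite -mulrBr padic_absM padic_abs_ppow // [leRHS]mulrC ler_wpM2r ?invr_ge0 ?(ltW pa_gt0) //.
  exact: (sep n (leq_maxl _ _) (l, l') ll').
have -> : \sum_i mu i * (p%:R ^+ a * u i n) ^+ j.+1 =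
    (p%:R ^+ a) ^+ j.+1 * L lam j.+1 (fun i => u i n).
  by rewrite /L mulr_sumr; apply: eq_bigr => i _; rewrite exprMn mulrCA.
rewrite padic_absM -exprM padic_abs_ppow //; apply: le_trans (small n (leq_maxr _ _) j).
by rewrite ler_piMl ?padic_abs_ge0 // invf_le1 ?exprn_gt0 // exprn_ege1 // ler1n.
Qed.

Lemma newton_data_lower_bound (ic : 'I_k -> 'I_s) (eps : rat) : 0 < eps ->
  exists2 e : rat, 0 < e <= 1 &
    [/\ e <= eps, forall l, e <= v (mu (ic l)) & forall j : 'I_k, e <= v (j.+1)%:R].
Proof.
move=> eps_gt0; have mu_gt0 l : xpredT l -> 0 < v (mu (ic l)).
  by move=> _; rewrite padic_abs_gt0 // intr_eq0.
have nat_gt0 (j : 'I_k) : xpredT j -> 0 < v (j.+1)%:R.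
  by move=> _; rewrite padic_abs_gt0 // pnatr_eq0.
have [c /andP[c_gt0 c_le1] mu_ge] := positive_lower_bound mu_gt0.
have [d /andP[d_gt0 d_le1] nat_ge] := positive_lower_bound nat_gt0.
exists (Num.min (Num.min c d) eps).
  by rewrite !lt_min !ge_min c_gt0 d_gt0 c_le1 eps_gt0.
split=> [|l|j]; first by rewrite ge_min lexx orbT.
  by rewrite !ge_min mu_ge.
by rewrite !ge_min nat_ge ?orbT.
Qed.

(* Rounding the critical coordinates of a rational near-solution to integers. *)
Lemma round_critical (ic : 'I_k -> 'I_s) (x : 'I_s -> int) (z : 'I_k -> rat) n :
  injective ic -> (forall l, v (z l) <= 1) ->
  (forall j : 'I_k, v (\sum_l mu (ic l) * z l ^+ j.+1 +
     \sum_(i | i \notin codom ic) mu i * (x i)%:~R ^+ j.+1) <= (p%:R ^+ n)^-1) ->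
  exists X : 'I_s -> int, (forall i, i \notin codom ic -> X i = x i) /\
    forall j : 'I_k, ((p ^ n)%N%:Z %| system_value lam X j)%Z.
Proof.
move=> ic_inj z_le1 near; have [Z Z_near] := boolp.choice (fun l => padic_approx p_pr n (z_le1 l)).
exists (combine ic Z x); split=> [i|j]; first exact: combine_free.
have pn_ge0 : 0 <= (p%:R ^+ n)^-1 :> rat by rewrite invr_ge0 exprn_ge0.
rewrite -(padic_abs_le_dvd p_pr).
have -> : (system_value lam (combine ic Z x) j)%:~R = (\sum_l mu (ic l) * z l ^+ j.+1 +
    \sum_(i | i \notin codom ic) mu i * (x i)%:~R ^+ j.+1) -
    \sum_l mu (ic l) * (z l ^+ j.+1 - (Z l)%:~R ^+ j.+1) :> rat.
  rewrite /system_value rmorph_sum (sum_split ic_inj) /= addrAC -sumrB; congr (_ + _).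
    apply: eq_bigr => l _; rewrite combine_critical // rmorphM rmorphXn /= -mulrBr.
    by rewrite opprB addrC subrK.
  by apply: eq_bigr => i i_free; rewrite combine_free // rmorphM rmorphXn.
apply: le_trans (padic_abs_ultra p _ _) _; rewrite ge_max near padic_absN /=.
apply: padic_abs_sum_le => // l _; rewrite padic_absM.
apply: (@le_trans _ _ (1 * (p%:R ^+ n)^-1)); last by rewrite mul1r.
apply: ler_pM; rewrite ?padic_abs_ge0 ?padic_abs_int_le1 //.
have := padic_abs_subX_le j.+1 (z_le1 l) (padic_abs_int_le1 p_pr (Z l)).
by move/le_trans; apply; exact: Z_near.
Qed.

Lemma padic_lift : has_nonsingular_solution (Qp p) lam k ->
  exists2 ic : 'I_k -> 'I_s, injective ic & exists (w : nat) (Y : 'I_s -> int),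
  forall n (x : 'I_s -> int), (forall i, ((p ^ w)%N%:Z %| x i - Y i)%Z) ->
  exists X : 'I_s -> int, (forall i, i \notin codom ic -> X i = x i) /\
    forall j : 'I_k, ((p ^ n)%N%:Z %| system_value lam X j)%Z.
Proof.
move=> [xi [xi_sol [ic /nonsingular_distinct xi_inj]]].
have ic_inj : injective ic by move=> l l' icE; apply: xi_inj; rewrite icE.
have [eps0 /newton_data_lower_bound approx_eps approx] := Qp_integral_approx xi_sol xi_inj.
have [eps eps_itv [eps_le mu_ge nat_ge]] := approx_eps ic.
have mu_le i : v (mu i) <= 1 by exact: padic_abs_int_le1.
have rho_gt0 := newton_system_radius_gt0 k s (lexx 1) eps_itv.
set rho := newton_system_radius k s 1 eps in rho_gt0.
have B_ge0 := displacement_constant_ge0 k s (lexx 1) eps_itv.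
set B := displacement_constant k s 1 eps in B_ge0.
have bound_ge0 : 0 <= rho^-1 + B by rewrite addr_ge0 // invr_ge0 ltW.
pose w := Num.bound (rho^-1 + B); have w_large := ler_ppow_bound bound_ge0; rewrite -/w in w_large.
pose th : rat := (p%:R ^+ w)^-1; have th_gt0 : 0 < th by rewrite invr_gt0 exprn_gt0.
have th_le_rho : th <= rho.
  rewrite -[rho]invrK lef_pV2 ?posrE ?invr_gt0 ?exprn_gt0 //; apply: le_trans w_large.
  by rewrite lerDl.
have B_th_le1 : B * th <= 1.
  by rewrite ler_pdivrMr ?exprn_gt0 // mul1r; apply: le_trans w_large; rewrite lerDr invr_ge0 ltW.
have [y [y_le1 y_sep y_sol]] := approx th th_gt0.
have [Y Y_near] := boolp.choice (fun i => padic_approx p_pr w (y_le1 i)).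
exists ic => //; exists w, Y => n x x_near.
have xy_near i : v ((x i)%:~R - y i) <= th.
  have -> : (x i)%:~R - y i = - (y i - (Y i)%:~R) + (x i - Y i)%:~R by rewrite rmorphB /=; ring.
  apply: le_trans (padic_abs_ultra p _ _) _; rewrite ge_max padic_absN Y_near /=.
  by rewrite padic_abs_le_dvd.
have th_itv : 0 <= th <= rho by rewrite (ltW th_gt0).
have [z [z_near z_sol]] := newton_system v_abs ic_inj (lexx 1) eps_itv mu_le mu_ge nat_ge
  th_itv y_le1 (fun i => padic_abs_int_le1 p_pr (x i)) xy_near
  (fun l l' ll' => le_trans eps_le (y_sep l l' ll')) y_sol (n * p).
apply: (round_critical ic_inj (z := z)) => [l|j].
  rewrite -[z l](subrK (y (ic l))); apply: le_trans (padic_abs_ultra p _ _) _.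
  by rewrite ge_max y_le1 andbT; apply: le_trans (z_near l) B_th_le1.
apply: le_trans (z_sol j) _; rewrite lef_pV2 ?posrE ?exprn_gt0 // -!natrX ler_nat mulnC expnM.
by case: (n) => // n'; rewrite leq_exp2r // ltnW // ltn_expl.
Qed.

End PadicLift.

Lemma dvdz_system_value_congr (s k : nat) (lam : 'I_s -> int) (x y : 'I_s -> int) (q : int)
    (j : 'I_k) : (forall i, (q %| x i - y i)%Z) ->
  (q %| system_value lam x j)%Z = (q %| system_value lam y j)%Z.
Proof.
move=> xy; rewrite -[system_value lam x j](subrK (system_value lam y j)) rpredDl //.
rewrite /system_value -sumrB; apply: rpred_sum => i _; rewrite -mulrBr dvdz_mull //.
by rewrite subrXX dvdz_mulr.
Qed.

Lemma cong_solutions_coprime (s k : nat) (lam : 'I_s -> int) q1 q2 :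
  (0 < q1)%N -> (0 < q2)%N -> coprime q1 q2 ->
  (cong_solutions k lam q1 * cong_solutions k lam q2 <= cong_solutions k lam (q1 * q2))%N.
Proof.
move=> q1_gt0 q2_gt0 co12; have q12_gt0 : (0 < q1 * q2)%N by rewrite muln_gt0 q1_gt0.
pose f (xy : {ffun 'I_s -> 'I_q1} * {ffun 'I_s -> 'I_q2}) : {ffun 'I_s -> 'I_(q1 * q2)} :=
  [ffun i => Ordinal (ltn_pmod (chinese q1 q2 (xy.1 i) (xy.2 i)) q12_gt0)].
have f1 xy i : f xy i = xy.1 i %[mod q1].
  by rewrite ffunE /= modn_dvdm ?dvdn_mulr // chinese_modl.
have f2 xy i : f xy i = xy.2 i %[mod q2].
  by rewrite ffunE /= modn_dvdm ?dvdn_mull // chinese_modr.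
have f_inj : injective f.
  move=> [x1 x2] [y1 y2] fE; congr (_, _); apply/ffunP => i; apply: val_inj => /=.
    by have := f1 (x1, x2) i; rewrite fE f1 /= !modn_small ?ltn_ord.
  by have := f2 (x1, x2) i; rewrite fE f2 /= !modn_small ?ltn_ord.
have modz_dvd (a b q : nat) : a = b %[mod q] -> (q%:Z %| a%:Z - b%:Z)%Z.
  by move=> ab; rewrite -eqz_mod_dvd !modz_nat ab.
rewrite /cong_solutions -cardsX -(card_imset _ f_inj); apply: subset_leq_card.
apply/fintype.subsetP => z /imsetP[xy]; rewrite !inE => /andP[/forallP sol1 /forallP sol2] ->.
apply/forallP => j.
have := sol1 j; rewrite -(dvdz_system_value_congr lam j (fun i => modz_dvd _ _ _ (f1 xy i))).
have := sol2 j; rewrite -(dvdz_system_value_congr lam j (fun i => modz_dvd _ _ _ (f2 xy i))).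
by rewrite !dvdzE /= => dvd2 dvd1; rewrite Gauss_dvd // dvd1.
Qed.

Lemma cong_solutions_gt0 (s k : nat) (lam : 'I_s -> int) q :
  (0 < q)%N -> (0 < cong_solutions k lam q)%N.
Proof.
move=> q_gt0; apply/card_gt0P; exists [ffun=> Ordinal q_gt0]; rewrite inE; apply/forallP => j.
by rewrite /box_value /system_value big1 ?dvdz0 // => i _; rewrite /nat_pos ffunE /= expr0n mulr0.
Qed.

Section PadicDensity.
Variables (p k s : nat) (lam : 'I_s -> int) (ic : 'I_k -> 'I_s) (w : nat) (Y : 'I_s -> int).
Hypotheses (p_pr : prime p) (ic_inj : injective ic).
Hypothesis lifting : forall n (x : 'I_s -> int), (forall i, ((p ^ w)%N%:Z %| x i - Y i)%Z) ->
  exists X : 'I_s -> int, (forall i, i \notin codom ic -> X i = x i) /\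
    forall j : 'I_k, ((p ^ n)%N%:Z %| system_value lam X j)%Z.
Local Notation free := {i : 'I_s | i \notin codom ic}.

Let p_gt0 : (0 < p)%N. Proof. exact: prime_gt0. Qed.

(* Prescribing the free coordinates modulo p^(w+m) in the residue class of Y modulo p^w
   determines distinct solutions of the congruences. *)
Lemma free_residues_le m : ((p ^ m) ^ (s - k) <= cong_solutions k lam (p ^ (w + m)))%N.
Proof.
pose q := (p ^ (w + m))%N; have q_gt0 : (0 < q)%N by rewrite expn_gt0 p_gt0.
have qE : q = (p ^ w * p ^ m)%N by rewrite /q expnD.
pose x (r : {ffun free -> 'I_(p ^ m)}) (i : 'I_s) : int :=
  Y i + (p ^ w)%N%:Z * (if insub i is Some f then (r f : nat)%:Z else 0).
have x_near r i : ((p ^ w)%N%:Z %| x r i - Y i)%Z by rewrite /x addrC addKr dvdz_mulr.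
have [X XP] := boolp.choice (fun r => lifting (w + m) (x_near r)).
pose f r : {ffun 'I_s -> 'I_q} := [ffun i => int_residue q_gt0 (X r i)].
have f_near r i : (q%:Z %| nat_pos (f r i) - X r i)%Z.
  by rewrite -opprB rpredN dvdz_sub_ord ffunE.
have f_inj : injective f.
  move=> r r' /ffunP fE; apply/ffunP => g; apply: val_inj => /=; have := fE (val g).
  rewrite !ffunE => /eqP; rewrite int_residue_eq !(XP _).1 ?(valP g) //.
  rewrite /x valK opprD addrACA subrr add0r -mulrBr qE PoszM dvdz_mul2l; last first.
    by rewrite eqz_nat -lt0n expn_gt0 p_gt0.
  by rewrite -eqz_mod_dvd !modz_small ?ltz_nat ?ltn_ord // => /eqP[].
have -> : ((p ^ m) ^ (s - k) = #|{ffun free -> 'I_(p ^ m)}|)%N.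
  by rewrite card_ffun card_ord card_sig card_free.
rewrite -(card_imset _ f_inj); apply: subset_leq_card; apply/fintype.subsetP => _ /imsetP[r _ ->].
rewrite inE; apply/forallP => j; rewrite (dvdz_system_value_congr lam j (f_near r)).
exact: (XP r).2.
Qed.

End PadicDensity.

Lemma cong_solutions_ppow (p k s : nat) (lam : 'I_s -> int) : prime p ->
  (forall i, lam i != 0) -> has_nonsingular_solution (Qp p) lam k ->
  exists w : nat, forall n, (p ^ (n * (s - k)) <= p ^ w * cong_solutions k lam (p ^ n))%N.
Proof.
move=> p_pr lam_neq0 nonsing; have p_gt0 := prime_gt0 p_pr.
have [ic ic_inj [w [Y lifting]]] := padic_lift p_pr lam_neq0 nonsing.
exists (w * (s - k))%N => n; have [nw|/ltnW wn] := leqP n w.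
  apply: (@leq_trans (p ^ (w * (s - k)))).
    by rewrite leq_exp2l ?prime_gt1 // leq_mul2r nw orbT.
  by rewrite leq_pmulr // cong_solutions_gt0 // expn_gt0 p_gt0.
have := free_residues_le p_pr ic_inj lifting (n - w); rewrite subnKC // -expnM => free_le.
apply: leq_trans (leq_mul (leqnn _) free_le).
by rewrite -expnD -mulnDl subnKC.
Qed.

Section SuperMultiplicative.
Variables (R : realFieldType) (f : nat -> nat) (d : nat).
Hypothesis f_coprime : forall q1 q2, (0 < q1)%N -> (0 < q2)%N -> coprime q1 q2 ->
  (f q1 * f q2 <= f (q1 * q2))%N.
Local Notation lower_bound W := (exists2 c : R, 0 < c &
  forall q, (0 < q)%N -> rough W q -> c * q%:R ^+ d <= (f q)%:R).

Lemma rough_lower_bound_prime p w : prime p ->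
  (forall n, (p ^ (n * d) <= p ^ w * f (p ^ n))%N) -> lower_bound p -> lower_bound p.-1.
Proof.
move=> p_pr ppow_le [c c_gt0 f_ge]; have p_gt0 := prime_gt0 p_pr.
exists (c / (p ^ w)%:R) => [|q q_gt0 q_rough]; first by rewrite divr_gt0 // ltr0n expn_gt0 p_gt0.
have [q' co_pq' qE] := pfactor_coprime p_pr q_gt0; set n := logn p q in qE.
have q'_gt0 : (0 < q')%N by move: q_gt0; rewrite qE muln_gt0 => /andP[].
have q'_rough : rough p q'.
  move=> r r_pr r_dvd; rewrite ltn_neqAle andbC -(prednK p_gt0) q_rough //=; last first.
    by rewrite qE dvdn_mulr.
  rewrite prednK //; apply: contraTneq co_pq' => ->.
  by rewrite prime_coprime // r_dvd.
have := f_coprime (_ : 0 < p ^ n)%N q'_gt0 (coprimeXl _ co_pq').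
rewrite expn_gt0 p_gt0 -(ler_nat R) => /(_ isT) f_prod.
rewrite qE mulnC; apply: le_trans f_prod; rewrite !natrM exprMn.
apply: (@le_trans _ _ ((f (p ^ n))%:R * (c * q'%:R ^+ d))); last by rewrite ler_wpM2l ?f_ge.
have -> : c / (p ^ w)%:R * ((p ^ n)%:R ^+ d * q'%:R ^+ d) =
  (c * q'%:R ^+ d) * ((p ^ n)%:R ^+ d / (p ^ w)%:R) :> R by ring.
rewrite [leRHS]mulrC ler_wpM2l ?mulr_ge0 ?exprn_ge0 ?(ltW c_gt0) //.
by rewrite ler_pdivrMr ?ltr0n ?expn_gt0 ?p_gt0 // -natrX -natrM ler_nat mulnC -expnM.
Qed.

Lemma supermultiplicative_lower_bound W :
  (forall p, prime p -> exists w, forall n, (p ^ (n * d) <= p ^ w * f (p ^ n))%N) ->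
  lower_bound W -> exists2 c : R, 0 < c & forall q, (0 < q)%N -> c * q%:R ^+ d <= (f q)%:R.
Proof.
move=> ppow_le; elim: W => [|W IHW] bound.
  by have [c c_gt0 f_ge] := bound; exists c => // q q_gt0; apply: f_ge => // p /prime_gt0.
apply: IHW; have [W1_pr|W1_composite] := boolP (prime W.+1).
  by have [w ppow_leW] := ppow_le _ W1_pr; apply: (rough_lower_bound_prime W1_pr ppow_leW).
have [c c_gt0 f_ge] := bound; exists c => // q q_gt0 q_rough; apply: f_ge => // p p_pr p_dvd.
rewrite ltn_neqAle q_rough // andbT; apply: contraNneq W1_composite => ->.
exact: p_pr.
Qed.

End SuperMultiplicative.

(** * Lower bound for the number of integral solutions *)

Lemma progression_length (R : realType) (a b N q : R) : 0 < q -> 0 <= N -> 2 * b <= a ->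
  q <= a * N -> exists2 m : nat, b * N / q <= m%:R & m%:R * q <= a * N.
Proof.
move=> q_gt0 N_ge0 b_le q_le; have quot_ge1 : 1 <= a * N / q by rewrite ler_pdivlMr ?mul1r.
pose m := Num.truncn (a * N / q).
have /andP[m_le m_gt] := truncn_itv (le_trans ler01 quot_ge1).
exists m; last by rewrite ler_pdivlMr in m_le.
have m_ge1 : 1 <= m%:R :> R.
  by rewrite ler1n truncn_gt0.
have : 2 * (b * N / q) <= a * N / q by rewrite !mulrA !ler_wpM2r // invr_ge0 ltW.
by move: m_gt m_ge1; rewrite -natr1; lra.
Qed.

Section CongruentNear.
Variables (R : realType) (q : nat).
Hypothesis q_gt0 : (0 < q)%N.
Let qR_gt0 : 0 < q%:R :> R. Proof. by rewrite ltr0n. Qed.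

Definition congr_near (c : R) (b : int) : int := b - q%:Z * Num.floor ((b%:~R - c) / q%:R).

Lemma dvdz_congr_near c b : (q%:Z %| congr_near c b - b)%Z.
Proof. by rewrite addrAC subrr add0r rpredN dvdz_mulr. Qed.

Lemma congr_near_itv c b : c <= (congr_near c b)%:~R <= c + q%:R.
Proof.
have := floor_le_tmp ((b%:~R - c) / q%:R); have := floorD1_gt ((b%:~R - c) / q%:R).
rewrite /congr_near intrD ltr_pdivrMr // ler_pdivlMr // rmorphB rmorphM /=.
rewrite -[(q%:Z)%:~R]/(q%:R) mulrDl mul1r [q%:R * _]mulrC.
by move: (_%:~R * _) => fq; lra.
Qed.

Lemma congr_near_progression (c r : R) (b : int) (N t m : nat) : (0 < N)%N -> (t <= m)%N ->
  m%:R * q%:R <= r * N%:R -> q%:R <= r * N%:R ->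
  `|(congr_near ((c - r) * N%:R) b + q%:Z * t%:Z)%:~R / N%:R - c| <= r.
Proof.
move=> N_gt0 tm m_le q_le; have NR_gt0 : 0 < N%:R :> R by rewrite ltr0n.
have /andP[near_ge near_le] := congr_near_itv ((c - r) * N%:R) b.
rewrite rmorphD rmorphM /= -[(q%:Z)%:~R]/(q%:R) -[(t%:Z)%:~R]/(t%:R).
have qt_le : q%:R * t%:R <= r * N%:R by apply: le_trans m_le; rewrite mulrC ler_wpM2r ?ler_nat.
have qt_ge0 : 0 <= q%:R * t%:R :> R by rewrite mulr_ge0.
rewrite -{2}[c](mulfK (lt0r_neq0 NR_gt0)) -mulrBl normrM normfV (ger0_norm (ltW NR_gt0)).
rewrite ler_pdivrMr // ler_norml; move: near_ge near_le; set x : R := (congr_near _ _)%:~R.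
rewrite mulrBl; move: (c * N%:R) (r * N%:R) (q%:R * t%:R) x q_le qt_le qt_ge0 => a e d x.
by lra.
Qed.

End CongruentNear.

Lemma small_radius (R : realFieldType) (rho B : R) : 0 < rho -> 0 <= B ->
  exists2 dl, 0 < dl <= 8^-1 & dl <= rho /\ B * dl <= 8^-1.
Proof.
move=> rho_gt0 B_ge0; have den_gt0 : 0 < 8 + 8 * B by move: B_ge0; lra.
exists (Num.min rho (8 + 8 * B)^-1); set dl := Num.min _ _; last first.
  split; first by rewrite ge_min lexx.
  apply: (@le_trans _ _ (B * (8 + 8 * B)^-1)); first by rewrite ler_wpM2l // ge_min lexx orbT.
  by rewrite ler_pdivrMr //; move: B_ge0; lra.
rewrite lt_min rho_gt0 invr_gt0 den_gt0 /=; apply: (@le_trans _ _ (8 + 8 * B)^-1).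
  by rewrite ge_min lexx orbT.
by rewrite lef_pV2 ?posrE // lerDl mulr_ge0.
Qed.

Lemma pow2_inv_le (R : realType) (om : R) : 0 < om -> exists m, (2 ^+ m)^-1 <= om.
Proof.
move=> om_gt0; exists (Num.bound om^-1); have omV_ge0 : 0 <= om^-1 by rewrite invr_ge0 ltW.
rewrite -[om in leRHS]invrK lef_pV2 ?posrE ?exprn_gt0 ?invr_gt0 //.
apply: le_trans (ltW (archi_boundP omV_ge0)) _.
by rewrite -natrX ler_nat ltnW // ltn_expl.
Qed.

Section RealLift.
Variables (R : realType) (k s : nat) (lam : 'I_s -> int).
Hypotheses (lam_neq0 : forall i, lam i != 0) (lam_sum0 : \sum_i lam i = 0).
Local Notation mu i := ((lam i)%:~R : R).

(* Translations and dilations move a solution into the middle of the unit cube. *)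
Lemma real_solution_box : has_nonsingular_solution R lam k ->
  exists (y : 'I_s -> R) (ic : 'I_k -> 'I_s), [/\ injective ic, solution lam k y,
    (forall i, 4^-1 <= y i <= 3 / 4) & injective (fun l => y (ic l))].
Proof.
move=> [x [x_sol [ic /nonsingular_distinct x_inj]]].
pose m := 1 + \sum_i `|x i|.
have m_gt0 : 0 < m by rewrite ltr_pwDl // sumr_ge0.
have scale_gt0 : 0 < (4 * m)^-1 by rewrite invr_gt0 mulr_gt0.
exists (fun i => 2^-1 + (4 * m)^-1 * x i), ic; split.
- by move=> l l' icE; apply: x_inj; rewrite icE.
- exact: solution_affine.
- move=> i; have : `|(4 * m)^-1 * x i| <= 4^-1.
    rewrite normrM gtr0_norm // ler_pdivrMl ?mulr_gt0 // mulrAC divff // mul1r.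
    by rewrite /m (bigD1 i) //= addrCA lerDl addr_ge0 // sumr_ge0.
  by rewrite ler_norml; lra.
by move=> l l' /addrI/(mulfI (lt0r_neq0 scale_gt0))/x_inj.
Qed.

Definition mean_slope : R := 1 + \sum_i `|mu i|.

Lemma mean_slope_ge1 : 1 <= mean_slope.
Proof. by rewrite lerDl sumr_ge0. Qed.

Lemma coef_le_slope i : `|mu i| <= mean_slope.
Proof. by rewrite /mean_slope (bigD1 i) //= addrCA lerDl addr_ge0 // sumr_ge0. Qed.

Lemma real_lift : has_nonsingular_solution R lam k ->
  exists (y : 'I_s -> R) (ic : 'I_k -> 'I_s) (dl : R), [/\ injective ic,
    (forall i, 4^-1 <= y i <= 3 / 4), 0 < dl <= 8^-1 &
    forall (om : R) (x : 'I_s -> R), 0 < om -> (forall i, `|x i - y i| <= dl) ->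
    exists z : 'I_k -> R, (forall l, `|z l - y (ic l)| <= 8^-1) /\ forall j : 'I_k,
      `|\sum_l mu (ic l) * z l ^+ j.+1 + \sum_(i | i \notin codom ic) mu i * x i ^+ j.+1| <= om].
Proof.
move=> /real_solution_box[y [ic [ic_inj y_sol y_itv y_inj]]].
have sep_gt0 (ll : 'I_k * 'I_k) : ll.1 != ll.2 -> 0 < `|y (ic ll.1) - y (ic ll.2)|.
  by move=> ll_neq; rewrite normr_gt0 subr_eq0; apply: contra ll_neq => /eqP/y_inj->.
have [eps eps_itv eps_le] := positive_lower_bound sep_gt0.
have /andP[_ eps_le1] := eps_itv; have D_ge1 := mean_slope_ge1.
have mu_ge l : eps <= `|mu (ic l)|.
  apply: le_trans eps_le1 _.
  by rewrite -intr_norm -[1]/(1%:~R) ler_int -gtz0_ge1 normr_gt0.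
have nat_ge (j : 'I_k) : eps <= `|(j.+1)%:R : R|.
  by apply: le_trans eps_le1 _; rewrite normr_nat ler1n.
have rho_gt0 := newton_system_radius_gt0 k s D_ge1 eps_itv.
set rho := newton_system_radius k s mean_slope eps in rho_gt0.
have B_ge0 := displacement_constant_ge0 k s D_ge1 eps_itv.
set B := displacement_constant k s mean_slope eps in B_ge0.
have [dl /andP[dl_gt0 dl_le] [dl_rho B_dl]] := small_radius rho_gt0 B_ge0.
exists y, ic, dl; split=> //; first by rewrite dl_gt0.
move=> om x /pow2_inv_le[m om_ge] x_near; have theta_itv : 0 <= dl <= rho by rewrite (ltW dl_gt0).
have y_le i : `|y i| <= mean_slope.
  by have /andP[] := y_itv i; rewrite ler_norml; move: D_ge1; lra.
have x_le i : `|x i| <= mean_slope.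
  have := x_near i; have /andP[] := y_itv i; rewrite !ler_norml; move: D_ge1 dl_le; lra.
have y_small (j : 'I_k) : `|\sum_i mu i * y i ^+ j.+1| <= dl.
  by have /forallP/(_ j)/eqP := y_sol; rewrite /L => ->; rewrite normr0 ltW.
have [z [z_near z_sol]] := newton_system (normr_absolute_value R) ic_inj D_ge1 eps_itv
  coef_le_slope mu_ge nat_ge theta_itv y_le x_le x_near (fun l l' ll' => eps_le (l, l') ll')
  y_small m.
exists z; split=> [l|j]; first exact: le_trans (z_near l) B_dl.
exact: le_trans (z_sol j) om_ge.
Qed.

End RealLift.

Definition small_values (R : realType) k s (lam : 'I_s -> int) (om : R) q N
    (B : {set {ffun 'I_s -> 'I_N}}) :=
  forall x, x \in B -> forall j : 'I_k,
    (q%:Z %| box_value lam x j)%Z /\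
    `|(box_value lam x j)%:~R| <= om * N%:R ^+ j.+1.

Section RealPoints.
Variables (R : realType) (k s : nat) (lam : 'I_s -> int) (ic : 'I_k -> 'I_s) (y : 'I_s -> R).
Variables (dl om ko : R) (q N m1 m2 : nat).
Hypotheses (ic_inj : injective ic) (y_itv : forall i, 4^-1 <= y i <= 3 / 4).
Hypotheses (q_gt0 : (0 < q)%N) (N_gt0 : (0 < N)%N).
Hypotheses (dl_le : dl <= 8^-1) (ko_le : ko <= 16^-1).
Hypothesis ko_slope : 2 * ((k * k)%:R * mean_slope R lam * ko) <= om.
Hypotheses (m1_le : m1%:R * q%:R <= dl * N%:R) (q_le1 : q%:R <= dl * N%:R).
Hypotheses (m2_le : m2%:R * q%:R <= ko * N%:R) (q_le2 : q%:R <= ko * N%:R).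
Local Notation mu i := ((lam i)%:~R : R).
Local Notation free := {i : 'I_s | i \notin codom ic}.
Local Notation residues := {ffun 'I_s -> 'I_q}.
Local Notation free_data := (residues * {ffun free -> 'I_m1})%type.
Local Notation point_data := (free_data * {ffun 'I_k -> 'I_m2})%type.
Implicit Types (br : free_data) (t : point_data).

Let NR_gt0 : 0 < N%:R :> R. Proof. by rewrite ltr0n. Qed.

Definition free_index br i : nat := if insub i is Some f then br.2 f else 0%N.

Definition free_coord br i : int :=
  congr_near q ((y i - dl) * N%:R) (nat_pos (br.1 i)) + q%:Z * (free_index br i)%:Z.

Lemma free_coord_near br i : `|(free_coord br i)%:~R / N%:R - y i| <= dl.
Proof.
apply: (congr_near_progression q_gt0 _ _ N_gt0 _ m1_le q_le1).
by rewrite /free_index; case: insub => // f; exact: ltnW.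
Qed.

Section LatticePoints.
Variable z : free_data -> 'I_k -> R.
Hypothesis z_near : forall br l, `|z br l - y (ic l)| <= 8^-1.
Hypothesis z_sol : forall br (j : 'I_k), `|\sum_l mu (ic l) * z br l ^+ j.+1 +
  \sum_(i | i \notin codom ic) mu i * ((free_coord br i)%:~R / N%:R) ^+ j.+1| <= om / 2.

Definition critical_coord t l : int :=
  congr_near q ((z t.1 l - ko) * N%:R) (nat_pos (t.1.1 (ic l))) + q%:Z * (t.2 l : nat)%:Z.

Definition lattice_point t : 'I_s -> int := combine ic (critical_coord t) (free_coord t.1).

Lemma critical_coord_near t l : `|(critical_coord t l)%:~R / N%:R - z t.1 l| <= ko.
Proof. exact: (congr_near_progression q_gt0 _ _ N_gt0 (ltnW (ltn_ord _)) m2_le q_le2). Qed.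

Lemma lattice_point_near t i : `|(lattice_point t i)%:~R / N%:R - y i| < 4^-1.
Proof.
have [/codomP[l ->]|i_free] := boolP (i \in codom ic).
  rewrite /lattice_point combine_critical //; have := critical_coord_near t l.
  by have := z_near t.1 l; rewrite !ler_norml ltr_norml; move: ko_le; lra.
rewrite /lattice_point combine_free //; have := free_coord_near t.1 i.
by rewrite ler_norml ltr_norml; move: dl_le; lra.
Qed.

Lemma lattice_point_itv t i : 0 <= ((lattice_point t i)%:~R / N%:R : R) < 1.
Proof.
by have := lattice_point_near t i; have /andP[] := y_itv i; rewrite ltr_norml; lra.
Qed.

Definition box_point_of t : {ffun 'I_s -> 'I_N} :=
  [ffun i => insubd (Ordinal N_gt0) `|lattice_point t i|%N].

Lemma nat_pos_box_point t i : nat_pos (box_point_of t i) = lattice_point t i.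
Proof.
have /andP[point_ge0 point_lt1] := lattice_point_itv t i.
rewrite pmulr_lge0 ?invr_gt0 // ler0z in point_ge0.
rewrite ltr_pdivrMr // mul1r -[N%:R]/((N%:Z)%:~R) ltr_int in point_lt1.
rewrite /nat_pos ffunE insubdK ?gez0_abs //.
by rewrite -topredE /= -ltz_nat gez0_abs.
Qed.

Lemma lattice_point_congr t i : (q%:Z %| lattice_point t i - nat_pos (t.1.1 i))%Z.
Proof.
have progression c b u : (q%:Z %| congr_near q c b + q%:Z * u - b)%Z.
  by rewrite addrAC rpredD ?dvdz_congr_near // dvdz_mulr.
have [/codomP[l ->]|i_free] := boolP (i \in codom ic).
  by rewrite /lattice_point combine_critical //; exact: progression.
by rewrite /lattice_point combine_free //; exact: progression.
Qed.

Lemma lattice_point_inj t t' : lattice_point t =1 lattice_point t' -> t = t'.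
Proof.
move=> same; have qZ_neq0 : q%:Z != 0 by rewrite eqz_nat -lt0n.
have residues_eq : t.1.1 = t'.1.1.
  apply/ffunP => i; apply: val_inj => /=.
  have := rpredB (lattice_point_congr t' i) (lattice_point_congr t i).
  rewrite same opprB addrC addrA subrK -eqz_mod_dvd /nat_pos.
  by rewrite !modz_small ?ltz_nat ?ltn_ord // => /eqP[].
have free_eq : t.1.2 = t'.1.2.
  apply/ffunP => g; apply: val_inj => /=; have := same (val g).
  rewrite /lattice_point !combine_free ?(valP g) // /free_coord residues_eq /free_index valK.
  by move=> /addrI/(mulfI qZ_neq0)[].
have data_eq : t.1 = t'.1.
  by rewrite [t.1]surjective_pairing [t'.1]surjective_pairing residues_eq free_eq.
have critical_eq : t.2 = t'.2.
  apply/ffunP => l; apply: val_inj => /=; have := same (ic l).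
  rewrite /lattice_point !combine_critical // /critical_coord data_eq.
  by move=> /addrI/(mulfI qZ_neq0)[].
by rewrite [t]surjective_pairing [t']surjective_pairing critical_eq data_eq.
Qed.

Lemma box_point_of_inj : injective box_point_of.
Proof.
by move=> t t' tt'; apply: lattice_point_inj => i; rewrite -!nat_pos_box_point tt'.
Qed.

Lemma critical_perturbation t (j : 'I_k) :
  `|\sum_l mu (ic l) * (((critical_coord t l)%:~R / N%:R) ^+ j.+1 - z t.1 l ^+ j.+1)| <= om / 2.
Proof.
apply: le_trans (ler_norm_sum _ _ _) _.
apply: (@le_trans _ _ (\sum_(l < k) mean_slope R lam * (k%:R * ko))); last first.
  by rewrite sumr_const card_ord -[_ *+ k]mulr_natl; move: ko_slope; rewrite natrM; lra.
apply: ler_sum => l _; rewrite normrM; apply: ler_pM => //; first exact: coef_le_slope.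
have z_itv : 0 <= z t.1 l <= 1.
  by have := z_near t.1 l; have /andP[] := y_itv (ic l); rewrite ler_norml; lra.
have crit_itv : 0 <= (critical_coord t l)%:~R / (N%:R : R) <= 1.
  have := lattice_point_itv t (ic l); rewrite /lattice_point combine_critical //.
  by move=> /andP[-> /ltW->].
apply: le_trans (ler_norm_subXn j crit_itv z_itv) _; rewrite expr1n mulr1; apply: ler_pM => //.
  by rewrite ler_nat.
exact: critical_coord_near.
Qed.

Lemma lattice_point_value t (j : 'I_k) :
  `|(system_value lam (lattice_point t) j)%:~R| <= om * N%:R ^+ j.+1.
Proof.
have -> : (system_value lam (lattice_point t) j)%:~R = N%:R ^+ j.+1 *
    ((\sum_l mu (ic l) * z t.1 l ^+ j.+1 +
      \sum_(i | i \notin codom ic) mu i * ((free_coord t.1 i)%:~R / N%:R) ^+ j.+1) +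
     \sum_l mu (ic l) * (((critical_coord t l)%:~R / N%:R) ^+ j.+1 - z t.1 l ^+ j.+1)) :> R.
  have Nj_neq0 : N%:R ^+ j.+1 != 0 :> R by rewrite expf_neq0 // gt_eqF.
  have scaled (w : int) : N%:R ^+ j.+1 * (w%:~R / N%:R) ^+ j.+1 = w%:~R ^+ j.+1 :> R.
    by rewrite expr_div_n mulrC divfK.
  rewrite addrAC -big_split /= /system_value rmorph_sum (sum_split ic_inj) /= mulrDr.
  congr (_ + _); rewrite mulr_sumr; last first.
    apply: eq_bigr => i i_free; rewrite mulrCA scaled rmorphM rmorphXn /=.
    by rewrite /lattice_point combine_free.
  apply: eq_bigr => l _; rewrite -mulrDr [z _ _ ^+ _ + _]addrC subrK mulrCA scaled.
  by rewrite rmorphM rmorphXn /= /lattice_point combine_critical.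
rewrite normrM ger0_norm ?exprn_ge0 // mulrC ler_wpM2r ?exprn_ge0 //.
apply: le_trans (ler_normD _ _) _; rewrite [om in leRHS](splitr om).
by apply: lerD; [exact: z_sol | exact: critical_perturbation].
Qed.

Lemma card_lattice_points : exists B : {set {ffun 'I_s -> 'I_N}},
  #|B| = (cong_solutions k lam q * m1 ^ (s - k) * m2 ^ k)%N /\ small_values k lam om q B.
Proof.
pose dom : {set point_data} := finset.setX (finset.setX [set b : residues |
    [forall j : 'I_k, (q%:Z %| box_value lam b j)%Z]]
    [set: {ffun free -> 'I_m1}]%SET) [set: {ffun 'I_k -> 'I_m2}]%SET.
exists [set box_point_of t | t in dom]; split.
  rewrite card_imset; last exact: box_point_of_inj.
  by rewrite !cardsX !cardsT !card_ffun !card_ord card_sig card_free.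
move=> _ /imsetP[t + ->] j; rewrite !inE !andbT => /forallP t_sol.
have -> : box_value lam (box_point_of t) j =
    system_value lam (lattice_point t) j.
  by apply: eq_bigr => i _; rewrite nat_pos_box_point.
by rewrite (dvdz_system_value_congr lam j (lattice_point_congr t)) t_sol lattice_point_value.
Qed.

End LatticePoints.

Lemma lattice_points_of_lift :
  (forall x : 'I_s -> R, (forall i, `|x i - y i| <= dl) ->
    exists z : 'I_k -> R, (forall l, `|z l - y (ic l)| <= 8^-1) /\ forall j : 'I_k,
      `|\sum_l mu (ic l) * z l ^+ j.+1 + \sum_(i | i \notin codom ic) mu i * x i ^+ j.+1|
        <= om / 2) ->
  exists B : {set {ffun 'I_s -> 'I_N}},
    #|B| = (cong_solutions k lam q * m1 ^ (s - k) * m2 ^ k)%N /\ small_values k lam om q B.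
Proof.
move=> lifting; have [z zP] := boolp.choice (fun br => lifting _ (free_coord_near br)).
exact: (card_lattice_points (fun br => (zP br).1) (fun br => (zP br).2)).
Qed.

End RealPoints.

Lemma small_window (R : realFieldType) (a : R) : 0 <= a -> exists2 ka, 0 < ka &
  forall om, 0 < om <= 1 -> ka * om <= 16^-1 /\ 2 * (a * (ka * om)) <= om.
Proof.
move=> a_ge0; pose ka : R := (16 + 2 * a)^-1.
have ka_gt0 : 0 < ka by rewrite invr_gt0; lra.
have kaE : 16 * ka + 2 * (a * ka) = 1.
  by rewrite [2 * _]mulrA -mulrDl mulfV // gt_eqF // -[ltRHS]invrK invr_gt0.
have a_ka_ge0 : 0 <= a * ka by rewrite mulr_ge0 // ltW.
exists ka => // om /andP[om_gt0 om_le1]; split.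
  by have : ka * om <= ka; [rewrite ler_piMr // ltW | move: kaE a_ka_ge0; lra].
have -> : 2 * (a * (ka * om)) = 2 * (a * ka) * om by ring.
by rewrite ler_piMl ?(ltW om_gt0) //; move: kaE ka_gt0; lra.
Qed.

Lemma many_small_values (R : realType) k s (lam : 'I_s -> int) : (forall i, lam i != 0) ->
  \sum_i lam i = 0 -> has_nonsingular_solution R lam k -> exists2 c : R, 0 < c <= 1 &
  forall (om : R) (q N : nat), 0 < om <= 1 -> (0 < q)%N -> q%:R <= c * om * N%:R ->
  exists B : {set {ffun 'I_s -> 'I_N}}, small_values k lam om q B /\
    (cong_solutions k lam q)%:R * (c * N%:R / q%:R) ^+ s * om ^+ k <= #|B|%:R.
Proof.
move=> lam_neq0 lam_sum0 /(real_lift lam_neq0 lam_sum0).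
move=> [y [ic [dl [ic_inj y_itv /andP[dl_gt0 dl_le] lifting]]]].
have slope_ge0 : 0 <= (k * k)%:R * mean_slope R lam by rewrite mulr_ge0 // addr_ge0 // sumr_ge0.
have [ka ka_gt0 windowP] := small_window slope_ge0.
pose c := Num.min dl ka / 2; have c_gt0 : 0 < c by rewrite divr_gt0 // lt_min dl_gt0.
have [c_dl c_ka] : 2 * c <= dl /\ 2 * c <= ka by rewrite [2 * c]mulrC divfK // !ge_min !lexx orbT.
exists c => [|om q N om_itv q_gt0 q_le]; first by rewrite c_gt0; move: c_dl dl_le; lra.
have /andP[om_gt0 om_le1] := om_itv; have [ko_le ko_slope] := windowP _ om_itv.
have qR_gt0 : 0 < q%:R :> R by rewrite ltr0n.
have N_gt0 : (0 < N)%N by rewrite lt0n; apply: contraTneq q_le => ->; rewrite mulr0 -ltNge.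
have q_le_of a : c * om <= a -> q%:R <= a * N%:R by move=> a_ge; rewrite (le_trans q_le) ?ler_wpM2r.
have q_le1 : q%:R <= dl * N%:R.
  by apply: q_le_of; apply: (@le_trans _ _ c); [rewrite ler_piMr // ltW | move: c_dl c_gt0; lra].
have c_ka_om : 2 * (c * om) <= ka * om by rewrite mulrA ler_wpM2r // ltW.
have q_le2 : q%:R <= ka * om * N%:R.
  by apply: q_le_of; rewrite ler_wpM2r ?(ltW om_gt0) //; move: c_ka c_gt0; lra.
have [m1 m1_ge m1_le] := progression_length qR_gt0 (ler0n _ N) c_dl q_le1.
have [m2 m2_ge m2_le] := progression_length qR_gt0 (ler0n _ N) c_ka_om q_le2.
have [|B [cardB B_small]] := lattice_points_of_lift ic_inj y_itv q_gt0 N_gt0 dl_le ko_le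
  ko_slope m1_le q_le1 m2_le q_le2.
  by move=> x; apply: lifting; rewrite divr_gt0.
exists B; split=> //; rewrite cardB !natrM !natrX.
have ks : (k <= s)%N by have := leq_card _ ic_inj; rewrite !card_ord.
have -> : (c * N%:R / q%:R) ^+ s = (c * N%:R / q%:R) ^+ (s - k) * (c * N%:R / q%:R) ^+ k.
  by rewrite -exprD subnK.
rewrite mulrA -mulrA -exprMn.
have window_ge0 (a : R) : 0 < a -> 0 <= a * N%:R / q%:R by move=> /ltW a_ge0; rewrite !mulr_ge0.
have -> : c * N%:R / q%:R * om = c * om * N%:R / q%:R by ring.
have ? := window_ge0 _ c_gt0; have ? := window_ge0 _ (mulr_gt0 c_gt0 om_gt0).
by apply: ler_pM; rewrite ?mulr_ge0 ?exprn_ge0 ?ler_wpM2l ?lerXn2r ?nnegrE.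
Qed.

Lemma prod_scale_pow (R : realType) k (c : R) (N : nat) :
  \prod_(j < k) (c * N%:R ^+ j.+1) = c ^+ k * N%:R ^+ tri_num k.
Proof.
rewrite big_split prodr_const card_ord -natrX -prod_pow_succ natr_prod.
by congr (_ * _); apply: eq_bigr => j _; rewrite natrX.
Qed.

(* Each value is a multiple of q, so there are at most 3 om N^(j+1) / q of them. *)
Lemma small_values_encoding (R : realType) k s (lam : 'I_s -> int) (om : R) q N
    (B : {set {ffun 'I_s -> 'I_N}}) : (0 < q)%N -> (0 < N)%N -> q%:R <= om * N%:R ->
  0 <= om -> small_values k lam om q B ->
  exists (V : finType) (v : {ffun 'I_s -> 'I_N} -> V) (D : {set V}),
    [/\ #|D|%:R <= (3 * om / q%:R) ^+ k * N%:R ^+ tri_num k, (0 < #|D|)%N,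
      forall x, x \in B -> v x \in D & forall x y, x \in B -> y \in B -> v x = v y ->
      box_value (k := k) lam x =1 box_value lam y].
Proof.
move=> q_gt0 N_gt0 q_le om_ge0 B_small; have qR_gt0 : 0 < q%:R :> R by rewrite ltr0n.
pose bound (j : 'I_k) : R := om * N%:R ^+ j.+1 / q%:R.
have bound_ge1 j : 1 <= bound j.
  rewrite /bound ler_pdivlMr // mul1r exprS mulrA; apply: le_trans q_le _.
  by rewrite ler_peMr ?mulr_ge0 // exprn_ege1 // ler1n.
pose H j := Num.truncn (bound j).
have H_itv j := truncn_itv (le_trans ler01 (bound_ge1 j)).
have multiples x j : x \in B -> (q%:Z %| box_value lam x j)%Z /\
    (`|box_value lam x j| <= H j * q)%N.
  move=> xB; have [q_dvd value_le] := B_small x xB j; split=> //.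
  have /andP[_ bound_lt] := H_itv j; move: q_dvd value_le; rewrite dvdzE absz_nat.
  rewrite -intr_norm -abszE; move: absz => value /dvdnP[d ->]; rewrite leq_mul2r => d_le.
  rewrite -ltnS -(ltr_nat R); apply/orP; right; apply: le_lt_trans bound_lt.
  by rewrite ler_pdivlMr // -natrM.
have [V [v [D [D_card vD v_inj]]]] := small_multiples_encoding q_gt0 multiples.
exists V, v, D; split=> //; last by rewrite D_card prodn_gt0 // => j; rewrite addn1.
rewrite D_card natr_prod -prod_scale_pow; apply: ler_prod => j _; rewrite ler0n /=.
have -> : 3 * om / q%:R * N%:R ^+ j.+1 = 3 * bound j by rewrite /bound; ring.
by have := bound_ge1 j; have /andP[H_le _] := H_itv j; move: H_le; rewrite natrD natrM; lra.
Qed.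

Lemma leq_self_tri_num k : (k <= tri_num k)%N.
Proof.
case: k => // k; rewrite -(leq_pmul2l (isT : 0 < 2)%N) double_tri_num mulnC leq_mul2l.
by rewrite ltnS orbT.
Qed.

Section SolutionsLowerBound.
Variables (R : realType) (k s t : nat) (lam : 'I_s -> int).
Hypotheses (k_gt0 : (0 < k)%N) (lam_neq0 : forall i, lam i != 0).
Hypotheses (Kt : (tri_num k < t)%N) (ts : (2 * t < s)%N).
Local Notation K := (tri_num k).

Let K2t : (K <= 2 * t)%N. Proof. by move: Kt; clear; lia. Qed.
Let Ks : (K <= s)%N. Proof. by move: K2t ts; clear; lia. Qed.
Let ks : (k <= s)%N. Proof. exact: leq_trans (leq_self_tri_num k) Ks. Qed.
Let t_gt0 : (0 < t)%N. Proof. exact: leq_ltn_trans Kt. Qed.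

Lemma cong_solutions_lower_bound :
  (forall p, prime p -> has_nonsingular_solution (Qp p) lam k) ->
  exists2 c : R, 0 < c & forall q, (0 < q)%N -> c * q%:R ^+ (s - k) <= (cong_solutions k lam q)%:R.
Proof.
move=> nonsing; have [C C_gt0 mean_value] := @sharp_mean R k t k_gt0 Kt.
have [E inverse] := @weyl_inverse_theorem R k t.
have [W roughP] := cong_solutions_rough inverse t_gt0 ts K2t lam_neq0 C_gt0 mean_value.
apply: (@supermultiplicative_lower_bound R (cong_solutions k lam) (s - k) _ W).
- exact: cong_solutions_coprime.
- by move=> p p_pr; apply: cong_solutions_ppow (nonsing p p_pr).
exists 2^-1 => [|q q_gt0 q_rough]; first by rewrite invr_gt0.
apply: le_trans (roughP q q_gt0 q_rough); rewrite mulrC ler_wpM2r ?invr_ge0 //.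
by rewrite -{2}(subnK ks) exprD mulfK // expf_neq0 // pnatr_eq0 -lt0n.
Qed.

(* The values of the system on B lie in a set of D possibilities, so that the conclusion bounds
   from below the average number of representations of one of them. *)
Lemma average_small_value : \sum_i lam i = 0 -> has_nonsingular_solution R lam k ->
  (forall p, prime p -> has_nonsingular_solution (Qp p) lam k) ->
  exists c ka : R, [/\ 0 < c, 0 < ka & forall (om : R) (q N : nat), 0 < om <= 1 -> (0 < q)%N ->
    q%:R <= ka * om * N%:R ->
    exists (B : {set {ffun 'I_s -> 'I_N}}) (V : finType) (v : {ffun 'I_s -> 'I_N} -> V)
      (D : {set V}),
      [/\ small_values k lam om q B, c * N%:R ^+ (s - K) <= #|B|%:R / #|D|%:R,
        forall x, x \in B -> v x \in D & forall x y, x \in B -> y \in B -> v x = v y ->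
        box_value (k := k) lam x =1 box_value lam y]].
Proof.
move=> lam_sum0 /(many_small_values lam_neq0 lam_sum0)[ka /andP[ka_gt0 ka_le1] real_points].
move=> /cong_solutions_lower_bound[c c_gt0 cong_ge].
exists (c * ka ^+ s / 3 ^+ k), ka; split=> // [|om q N om_itv q_gt0 q_le].
  by rewrite divr_gt0 ?mulr_gt0 ?exprn_gt0.
have /andP[om_gt0 om_le1] := om_itv; have qR_gt0 : 0 < q%:R :> R by rewrite ltr0n.
have N_gt0 : (0 < N)%N by rewrite lt0n; apply: contraTneq q_le => ->; rewrite mulr0 -ltNge.
have q_le_om : q%:R <= om * N%:R.
  by apply: le_trans q_le _; rewrite ler_wpM2r // ler_piMl // ltW.
have [B [B_small cardB]] := real_points om q N om_itv q_gt0 q_le.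
have [V [v [D [D_le D_gt0 vD v_inj]]]] :=
  small_values_encoding q_gt0 N_gt0 q_le_om (ltW om_gt0) B_small.
exists B, V, v, D; split=> //; rewrite ler_pdivlMr ?ltr0n //; apply: le_trans cardB.
apply: le_trans (ler_wpM2l _ D_le) _.
  by rewrite !mulr_ge0 ?invr_ge0 ?exprn_ge0 // ltW.
apply: le_trans (ler_wpM2r _ (ler_wpM2r _ (cong_ge q q_gt0))); last first.
- by rewrite exprn_ge0 ?divr_ge0 ?mulr_ge0 // ltW.
- by rewrite exprn_ge0 // ltW.
have powNE : N%:R ^+ s = N%:R ^+ (s - K) * N%:R ^+ K :> R by rewrite -exprD subnK.
have powqE : q%:R ^+ s = q%:R ^+ (s - k) * q%:R ^+ k :> R by rewrite -exprD subnK.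
rewrite !expr_div_n !exprMn powNE powqE le_eqVlt; apply/orP; left; apply/eqP; field.
by rewrite !expf_neq0 // gt_eqF.
Qed.

Lemma small_comparison_error (C c : R) : 0 < C -> 0 < c -> exists (Y : nat) (eta : R),
  [/\ (1 < Y)%N, C <= Y%:R, 0 < eta <= 1 & s%:R * comparison_error k Y eta * C <= c].
Proof.
move=> C_gt0 c_gt0; pose a := s%:R * C; have a_ge0 : 0 <= a by rewrite mulr_ge0 // ltW.
have ratio_ge0 : 0 <= 4 * a / c by rewrite divr_ge0 ?mulr_ge0 // ltW.
pose Y := (Num.bound (C + 4 * a / c)).+2.
have Y_large : C + 4 * a / c <= Y%:R.
  apply: le_trans (ltW (archi_boundP (addr_ge0 (ltW C_gt0) ratio_ge0))) _.
  by rewrite ler_nat /Y ltnW.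
have ak_ge0 : 0 <= a * k%:R by rewrite mulr_ge0.
have den_gt0 : 0 < 16 * (1 + a * k%:R) by move: ak_ge0; lra.
exists Y, (Num.min 1 (c / (16 * (1 + a * k%:R)))); set eta := Num.min _ _.
have eta_gt0 : 0 < eta by rewrite lt_min ltr01 divr_gt0.
have eta_le : eta * (16 * (1 + a * k%:R)) <= c by rewrite -ler_pdivlMr // ge_min lexx orbT.
split=> //; first by move: Y_large ratio_ge0; lra.
  by rewrite eta_gt0 ge_min lexx.
have Y_part : a * (2 / Y%:R) <= c / 2.
  have a_le : 4 * a <= Y%:R * c by rewrite -ler_pdivrMr //; move: Y_large C_gt0; lra.
  by rewrite mulrA ler_pdivrMr // [_ / 2 * _]mulrAC [c * _]mulrC; move: a_le; lra.
have -> : s%:R * comparison_error k Y eta * C = a * (2 / Y%:R) + 8 * (eta * (a * k%:R)).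
  by rewrite /comparison_error /a; ring.
by move: eta_le Y_part eta_gt0; rewrite mulrCA mulrDr mulr1; lra.
Qed.

Lemma scaled_mean_value C N : (0 < N)%N -> (vinogradov_count k t N)%:R <= C * N%:R ^+ (2 * t - K) ->
  (vinogradov_count k t N)%:R * N%:R ^+ s / N%:R ^+ (2 * t) <= C * N%:R ^+ (s - K) :> R.
Proof.
move=> N_gt0 count_le; rewrite ler_pdivrMr ?exprn_gt0 ?ltr0n //.
apply: le_trans (ler_wpM2r _ count_le) _; first by rewrite exprn_ge0.
rewrite -!mulrA -!exprD; have -> // : (2 * t - K + s = s - K + 2 * t)%N.
by move: K2t Ks; clear; lia.
Qed.

Theorem solutions_lower_bound : \sum_i lam i = 0 -> has_nonsingular_solution R lam k ->
  (forall p, prime p -> has_nonsingular_solution (Qp p) lam k) ->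
  exists2 c : R, 0 < c & exists N0 : nat, forall N, (N0 <= N)%N ->
    c * N%:R ^+ (s - K) <= (representations (k := k) lam N (fun=> 0))%:R.
Proof.
move=> lam_sum0 real_sol padic_sol.
have [C C_gt0 mean_value] := @sharp_mean R k t k_gt0 Kt.
have [E inverse] := @weyl_inverse_theorem R k t.
have [c [ka [c_gt0 ka_gt0 average]]] := average_small_value lam_sum0 real_sol padic_sol.
have c2_gt0 : 0 < c / 2 by rewrite divr_gt0.
have [Y [eta [Y_gt1 C_le /andP[eta_gt0 eta_le1] error_le]]] := small_comparison_error C_gt0 c2_gt0.
pose i0 : 'I_s := Ordinal (leq_ltn_trans (leq0n _) ts).
pose Q := (Y ^ E)%N; pose q := (`|lam i0| * Q`!)%N; pose om := eta / Q%:R.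
have Q_gt0 : (0 < Q)%N by rewrite expn_gt0 ltnW.
have q_gt0 : (0 < q)%N by rewrite muln_gt0 absz_gt0 lam_neq0 fact_gt0.
have om_gt0 : 0 < om by rewrite divr_gt0 // ltr0n.
have om_itv : 0 < om <= 1.
  by rewrite om_gt0 ler_pdivrMr ?ltr0n // mul1r (le_trans eta_le1) // ler1n.
have quot_ge0 : 0 <= q%:R / (ka * om) by rewrite divr_ge0 // ltW // mulr_gt0.
exists (c / 2) => //; exists (Num.bound (q%:R / (ka * om)) + Q)%N => N N_large.
have Q_le : (Q <= N)%N by apply: leq_trans N_large; rewrite leq_addl.
have N_gt0 : (0 < N)%N := leq_trans Q_gt0 Q_le.
have q_le : q%:R <= ka * om * N%:R.
  rewrite [leRHS]mulrC -ler_pdivrMr; last by rewrite mulr_gt0.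
  apply: le_trans (ltW (archi_boundP quot_ge0)) _.
  by rewrite ler_nat (leq_trans _ N_large) // leq_addr.
have [B [V [v [D [B_small average_ge vD v_inj]]]]] := average om q N om_itv q_gt0 q_le.
have value_dvd x (xB : x \in B) j := (B_small x xB j).1.
have value_small x : x \in B -> forall j : 'I_k,
    Q%:R * `|(box_value lam x j)%:~R| <= eta * N%:R ^+ j.+1.
  move=> xB j; have [_ value_le] := B_small x xB j.
  by rewrite -ler_pdivlMl ?ltr0n // mulrA [Q%:R^-1 * _]mulrC.
have := compare_solutions inverse t_gt0 ts Y_gt1 Q_le lam_neq0 (ltW eta_gt0)
  (vinogradov_count_le_scaled K2t mean_value C_le N_gt0) value_dvd value_small vD v_inj.
have error_ge0 : 0 <= s%:R * comparison_error k Y eta.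
  by rewrite mulr_ge0 // comparison_error_ge0 // ltW.
have := ler_wpM2l error_ge0 (scaled_mean_value N_gt0 (mean_value N N_gt0)); rewrite [leRHS]mulrA.
have main_ge0 : 0 <= N%:R ^+ (s - K) :> R by rewrite exprn_ge0.
move: (ler_wpM2r main_ge0 error_le) average_ge; lra.
Qed.

End SolutionsLowerBound.

(** * Uniform sets *)

Lemma normc_prod_sub_le (R : realType) (I : finType) (u w : I -> R[i]) (m : I -> R) :
  (forall i, normc (u i) <= m i) -> (forall i, normc (w i) <= m i) ->
  normc (\prod_i u i - \prod_i w i) <= \sum_i normc (u i - w i) * \prod_(j | j != i) m j.
Proof.
move=> u_le w_le; have m_ge0 i : 0 <= m i by exact: le_trans (normc_ge0 _) (u_le i).
have : uniq (index_enum I) by exact: index_enum_uniq.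
elim: (index_enum I) => [|x r IHr] /=; first by rewrite !big_nil subrr normc0.
move=> /andP[x_notin r_uniq]; rewrite !big_cons.
have -> : u x * \prod_(j <- r) u j - w x * \prod_(j <- r) w j =
   u x * (\prod_(j <- r) u j - \prod_(j <- r) w j) + (u x - w x) * \prod_(j <- r) w j by ring.
apply: le_trans (le_normcD _ _) _; rewrite !normcM addrC; apply: lerD.
  rewrite ler_wpM2l ?normc_ge0 // eqxx /= normc_prod.
  rewrite [leRHS](_ : _ = \prod_(j <- r) m j); last first.
    rewrite big_seq_cond [RHS]big_seq; apply: eq_bigl => j; rewrite andbC.
    by case: (eqVneq j x) => [->|//]; rewrite (negbTE x_notin).
  by apply: ler_prod => j _; rewrite normc_ge0 w_le.
apply: le_trans (ler_wpM2r (normc_ge0 _) (u_le x)) _.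
apply: le_trans (ler_wpM2l (m_ge0 x) (IHr r_uniq)) _.
rewrite mulr_sumr [leLHS]big_seq [leRHS]big_seq; apply: ler_sum => i i_in.
by rewrite big_cons; have -> : x != i by [apply: contraNneq x_notin => ->]; rewrite mulrCA.
Qed.

Lemma normc_prod_sub_le_moment (R : realType) (I : finType) (u w : I -> R[i]) (B D : R) n :
  0 < B -> (0 < n < #|I|)%N -> (forall i, normc (u i) <= B) -> (forall i, normc (w i) <= B) ->
  (forall i, normc (u i - w i) <= D) ->
  normc (\prod_i u i - \prod_i w i) <= #|I|%:R * D * B ^+ #|I|.-1 / B ^+ n *
    \sum_i (normc (u i) ^+ n + normc (w i) ^+ n).
Proof.
move=> B_gt0 n_itv u_le w_le uw_le; pose m i := Num.max (normc (u i)) (normc (w i)).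
have u_m i : normc (u i) <= m i by rewrite le_max lexx.
have w_m i : normc (w i) <= m i by rewrite le_max lexx orbT.
have m_ge0 i : 0 <= m i by exact: le_trans (normc_ge0 _) (u_m i).
have m_itv i : 0 <= m i / B <= 1.
  by rewrite divr_ge0 ?(ltW B_gt0) //= ler_pdivrMr // mul1r ge_max u_le w_le.
apply: le_trans (normc_prod_sub_le u_m w_m) _.
have -> : #|I|%:R * D * B ^+ #|I|.-1 / B ^+ n * \sum_i (normc (u i) ^+ n + normc (w i) ^+ n) =
    \sum_(i : I) D * (B ^+ #|I|.-1 * \sum_j (normc (u j) ^+ n + normc (w j) ^+ n) / B ^+ n).
  by rewrite sumr_const -mulr_natl -mulr_suml; ring.
apply: ler_sum => i _; apply: ler_pM; rewrite ?normc_ge0 //; first exact: prodr_ge0.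
have -> : \prod_(j | j != i) m j = B ^+ #|I|.-1 * \prod_(j | j != i) (m j / B).
  rewrite -(cardC1 i) -prodr_const -big_split; apply: eq_bigr => j _ /=.
  by rewrite mulrC divfK // gt_eqF.
rewrite ler_wpM2l ?exprn_ge0 ?(ltW B_gt0) //.
apply: le_trans (prod_except_le_moment i m_itv n_itv) _; apply: ler_sum => j _.
rewrite expr_div_n ler_wpM2r ?invr_ge0 ?exprn_ge0 ?(ltW B_gt0) // /m.
by case: (leP (normc (u j)) (normc (w j))) => _; rewrite ?lerDl ?lerDr exprn_ge0 ?normc_ge0.
Qed.

Lemma sum_indicator (T : choiceType) (R : pzRingType) (A B : {fset T}) (F : T -> R) :
  (A `<=` B)%fset -> \sum_(x <- B) (x \in A)%:R * F x = \sum_(x <- A) F x.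
Proof.
move=> AB; rewrite -(big_fset_incl _ AB) => [|x _ /negbTE->]; last by rewrite mul0r.
by rewrite big_seq [RHS]big_seq; apply: eq_bigr => x ->; rewrite mul1r.
Qed.

Lemma card_zitv1 N : #|` zitv 1 N%:Z| = N.
Proof. by rewrite card_zitv; lia. Qed.

Section Density.
Variables (R : realType) (N : nat) (A : {fset int}).
Hypothesis AI : (A `<=` zitv 1 N%:Z)%fset.

Lemma card_density : (0 < N)%N -> #|` A|%:R = density R N A * N%:R.
Proof. by move=> N_gt0; rewrite /density divfK // pnatr_eq0 -lt0n. Qed.

Lemma density_itv : (0 < N)%N -> A != fset0 -> 0 < density R N A <= 1.
Proof.
move=> N_gt0 A_neq0; have NR_gt0 : 0 < N%:R :> R by rewrite ltr0n.
rewrite divr_gt0 ?ltr0n ?cardfs_gt0 //= ler_pdivrMr // mul1r ler_nat.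
by have := fsubset_leq_card AI; rewrite card_zitv1.
Qed.

Lemma sum_balanced_sqr : (0 < N)%N ->
  \sum_(x <- zitv 1 N%:Z) balanced R N A x ^+ 2 =
    density R N A * (1 - density R N A) * N%:R.
Proof.
move=> N_gt0; set de := density R N A.
transitivity (\sum_(x <- zitv 1 N%:Z) (de ^+ 2 + (x \in A)%:R * (1 - 2 * de))).
  rewrite big_seq [RHS]big_seq; apply: eq_bigr => x xI; rewrite /balanced xI -/de.
  by case: (x \in A); rewrite ?mulr1n ?mulr0n; ring.
rewrite big_split /= sum_indicator // !big_const_seq !count_predT !iter_addr_0.
rewrite -[size (zitv _ _)]/(#|` zitv 1 N%:Z|) card_zitv1.
rewrite -[(1 - _) *+ _]mulr_natl -[size A]/(#|` A|) card_density //.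
by rewrite -[_ *+ N]mulr_natl -/de; ring.
Qed.

End Density.

Section FsetSums.
Variables (R : realType) (k N : nat).
Local Notation C := R[i].
Local Notation e2pi := (@e2pi R).
Local Notation I := (zitv 1 N%:Z).
Implicit Types (al : 'I_k -> R) (A : {fset int}).

Definition fset_exp_sum A al : C := exp_sum (fun x : A => val x) al.

Lemma absz_fset_itv A (x : A) : (A `<=` I)%fset ->
  (0 < `|val x| <= N)%N /\ val x = `|val x|%N%:Z.
Proof.
by move=> /fsubsetP/(_ _ (valP x)); rewrite in_zitv; case: (val x) => n //=; rewrite absz_nat.
Qed.

Lemma num_solutions_grid_mean s (lam : 'I_s -> int) A M : (A `<=` I)%fset -> (0 < N)%N ->
  (coef_norm lam * N ^ k < M)%N ->
  (num_solutions lam k A)%:R =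
    grid_mean M (fun al => \prod_i fset_exp_sum A (scale_coef (lam i) al)) :> C.
Proof.
move=> AI N_gt0 M_large; rewrite grid_mean_prod_exp_sum0 ?(leq_ltn_trans _ M_large) //.
congr _%:R; apply: eq_card => x; rewrite !inE solutionE; apply: eq_forallb => j.
rewrite -[system_value lam _ j in RHS]subr0.
rewrite (@dvdz_system_value_sub k s lam (fun i => val (x i)) 0 N) ?absz0 ?addn0 // => i.
by have [/andP[]] := absz_fset_itv (x i) AI.
Qed.

Lemma moment_fset_exp_sum A t M lam : (A `<=` I)%fset -> lam != 0 ->
  (`|lam| * (t * N.+1 ^ k) < M)%N ->
  grid_mean M (fun al => normc (fset_exp_sum A (scale_coef lam al)) ^+ (2 * t)) <=
    (vinogradov_count k t N.+1)%:R.
Proof.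
move=> AI lam_neq0 M_large.
apply: (@moment_le_vinogradov_count R k A (fun x => `|val x|%N)) => //.
- move=> x y xy; apply: val_inj; have [_ ->] := absz_fset_itv x AI.
  by have [_ ->] := absz_fset_itv y AI; rewrite xy.
- by move=> x; have [/andP[]] := absz_fset_itv x AI.
- by move=> x; have [] := absz_fset_itv x AI.
Qed.

Lemma normc_fset_exp_sum_le A al : normc (fset_exp_sum A al) <= #|` A|%:R.
Proof. by apply: le_trans (normc_exp_sum_le _ _) _; rewrite cardfE. Qed.

Lemma fset_exp_sumE A al : fset_exp_sum A al = \sum_(x <- A) e2pi (phase al x).
Proof. by rewrite big_seq_fsetE. Qed.

Lemma fset_exp_sum_balanced A al : (A `<=` I)%fset ->
  interval_sum N (fun x => (balanced R N A x)%:C%C * e2pi (phase al x)) =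
  (density R N A)%:C%C * fset_exp_sum I al - fset_exp_sum A al.
Proof.
move=> AI; rewrite !fset_exp_sumE -(sum_indicator _ AI) mulr_sumr -sumrB /interval_sum.
rewrite big_seq [RHS]big_seq; apply: eq_bigr => x xI.
by rewrite /balanced xI rmorphB mulrBl /= rmorph_nat.
Qed.

Lemma parseval (J : finType) (pos : J -> int) (f : J -> R) M : (0 < k)%N -> (0 < M)%N ->
  (forall x y, (M%:Z %| pos x - pos y)%Z -> x = y) ->
  grid_mean M (fun al => normc (\sum_x (f x)%:C%C * e2pi (phase al (pos x))) ^+ 2) =
    \sum_x f x ^+ 2.
Proof.
move=> k_gt0 M_gt0 pos_inj; apply: (@complexI R); rewrite -grid_mean_real.
transitivity (grid_mean M (fun al => \sum_(xy : J * J) (f xy.1 * f xy.2)%:C%C *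
   e2pi (\sum_j al j * (pos xy.1 ^+ j.+1 - pos xy.2 ^+ j.+1)%:~R))).
  apply: eq_grid_mean => al; rewrite normc_sqr.
  have -> : (\sum_x (f x)%:C%C * e2pi (phase al (pos x)))^*%C =
      \sum_x (f x)%:C%C * e2pi (- phase al (pos x)).
    by rewrite rmorph_sum; apply: eq_bigr => x _; rewrite e2piN -[in RHS]conjc_real -conjcM.
  rewrite mulr_suml.
  under eq_bigr => x _ do rewrite mulr_sumr.
  rewrite pair_bigA; apply: eq_bigr => -[x y] _; rewrite [fst _]/= [snd _]/=.
  have -> : \sum_j al j * (pos x ^+ j.+1 - pos y ^+ j.+1)%:~R =
      phase al (pos x) - phase al (pos y).
    by rewrite /phase -sumrB; apply: eq_bigr => j _; rewrite rmorphB !rmorphXn mulrBr.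
  by rewrite e2piD rmorphM; ring.
rewrite grid_mean_count // rmorph_sum.
rewrite (eq_bigl (fun xy : J * J => xy.2 == xy.1)) => [|[x y] /=]; last first.
  apply/forallP/eqP => [same_powers|-> j]; last by rewrite subrr dvdz0.
  by apply/esym/pos_inj; have := same_powers (Ordinal k_gt0); rewrite !expr1.
rewrite -(pair_big_dep xpredT (fun x y => y == x) (fun x y => (f x * f y)%:C%C)) /=.
by apply: eq_bigr => x _; rewrite big_pred1_eq expr2.
Qed.

Lemma sum_sqr_le_of_interval_sum (f : int -> R) (B : R) : (0 < k)%N ->
  (forall al, normc (interval_sum N (fun x => (f x)%:C%C * e2pi (phase al x))) <= B) ->
  \sum_(x <- I) f x ^+ 2 <= B ^+ 2.
Proof.
move=> k_gt0 f_le; have B_ge0 : 0 <= B by exact: le_trans (normc_ge0 _) (f_le (fun=> 0)).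
have pos_inj (x y : I) : (N.+1%:Z %| val x - val y)%Z -> x = y.
  move=> xy_dvd; apply/val_inj/eqP; rewrite -subr_eq0; apply/eqP.
  apply: dvdz_small_eq0 xy_dvd; move: (valP x) (valP y); rewrite !in_zitv.
  by move: (val x) (val y); clear; lia.
rewrite big_seq_fsetE /= -(parseval (fun x : I => f (val x)) k_gt0 (ltn0Sn N) pos_inj).
apply: (@le_trans _ _ (grid_mean (k := k) N.+1 (fun=> B ^+ 2))).
  apply: ler_grid_mean => al; rewrite lerXn2r ?nnegrE ?normc_ge0 //.
  by apply: le_trans (f_le al); rewrite /interval_sum big_seq_fsetE.
by rewrite /grid_mean sumr_const card_ffun !card_ord -[_ *+ (N.+1 ^ k)]mulr_natr mulfK //.
Qed.

End FsetSums.

Definition phase_uniform (R : realType) k N (A : {fset int}) (B : R) := forall al : 'I_k -> R,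
  normc (interval_sum N (fun x => (balanced R N A x)%:C%C * e2pi (phase al x))) <= B.

Lemma phase_uniform_of_uniform (R : realType) k N (A : {fset int}) (a ka : R) m : (0 < N)%N ->
  0 <= ka -> uniform_of_degree N A a k ->
  a <= ka ^+ (2 ^ k.+1) * density R N A ^+ (2 ^ k.+1 * m) ->
  phase_uniform k N A (2 * ka * density R N A ^+ m * N%:R).
Proof.
move=> N_gt0 ka_ge0 uniform a_le al; have de_ge0 : 0 <= density R N A by rewrite divr_ge0.
rewrite -(@ler_pXn2r _ (2 ^ k.+1)) ?nnegrE ?expn_gt0 ?normc_ge0 ?mulr_ge0 ?exprn_ge0 //.
apply: le_trans (uniform_phase al N_gt0 uniform) _.
apply: le_trans (ler_wpM2r _ a_le) _; first by rewrite exprn_ge0.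
rewrite mulnC exprM -!exprMn natrM le_eqVlt; apply/orP; left; apply/eqP.
by congr (_ ^+ _); ring.
Qed.

Section NumSolutions.
Variables (R : realType) (k s t N : nat) (lam : 'I_s -> int) (A : {fset int}) (D : R).
Hypotheses (lam_neq0 : forall i, lam i != 0) (t_gt0 : (0 < t)%N) (ts : (2 * t < s)%N).
Hypotheses (N_gt0 : (0 < N)%N) (AI : (A `<=` zitv 1 N%:Z)%fset) (A_neq0 : A != fset0).
Hypothesis A_uniform : phase_uniform k N A D.
Local Notation I := (zitv 1 N%:Z).
Local Notation de := (density R N A).
Local Notation sum_A al i := (fset_exp_sum A (scale_coef (lam i) al) : R[i]).
Local Notation sum_I al i := (de%:C%C * fset_exp_sum I (scale_coef (lam i) al) : R[i]).
Local Notation count := ((vinogradov_count k t N.+1)%:R : R).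
Implicit Types al : 'I_k -> R.

Let de_gt0 : 0 < de. Proof. by have /andP[] := density_itv R AI N_gt0 A_neq0. Qed.

Lemma normc_sum_sub_le al i : normc (sum_A al i - sum_I al i) <= D.
Proof.
apply: le_trans (A_uniform (scale_coef (lam i) al)).
by rewrite fset_exp_sum_balanced // normc_distC.
Qed.

Lemma normc_sum_prod_sub_le al : normc (\prod_i sum_A al i - \prod_i sum_I al i) <=
  s%:R * D * (de * N%:R) ^+ s.-1 / (de * N%:R) ^+ (2 * t) *
    \sum_i (normc (sum_A al i) ^+ (2 * t) + normc (sum_I al i) ^+ (2 * t)).
Proof.
rewrite -[s in s%:R]card_ord -[s.-1](congr1 predn (card_ord s)).
apply: normc_prod_sub_le_moment => [|||i|i].
- by rewrite mulr_gt0 // ltr0n.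
- by rewrite card_ord muln_gt0 t_gt0.
- by move=> i; rewrite -card_density //; exact: normc_fset_exp_sum_le.
- rewrite normcM normc_real gtr0_norm // ler_pM2l //.
  by apply: le_trans (normc_fset_exp_sum_le _ _) _; rewrite card_zitv1.
exact: normc_sum_sub_le.
Qed.

Lemma grid_mean_moments_le M : (coef_norm lam * (t * N.+1 ^ k) < M)%N ->
  grid_mean M (fun al => \sum_i (normc (sum_A al i) ^+ (2 * t) + normc (sum_I al i) ^+ (2 * t)))
    <= s%:R * (2 * count).
Proof.
move=> M_large; have M_large_i i : (`|lam i| * (t * N.+1 ^ k) < M)%N.
  by apply: leq_ltn_trans M_large; rewrite leq_mul2r leq_coef_norm orbT.
rewrite grid_mean_sum -[s in s%:R]card_ord mulr_natl -sumr_const; apply: ler_sum => i _.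
have -> : grid_mean M (fun al => normc (sum_A al i) ^+ (2 * t) + normc (sum_I al i) ^+ (2 * t)) =
    grid_mean M (fun al => normc (sum_A al i) ^+ (2 * t)) +
    grid_mean M (fun al => normc (sum_I al i) ^+ (2 * t)).
  by rewrite /grid_mean big_split mulrDl.
rewrite mulr2n mulrDl mul1r; apply: lerD; first exact: moment_fset_exp_sum.
apply: le_trans (moment_fset_exp_sum R (fsubset_refl I) (lam_neq0 i) (M_large_i i)).
apply: ler_grid_mean => al; rewrite normcM normc_real gtr0_norm // exprMn.
rewrite ler_piMl ?exprn_ge0 ?normc_ge0 // exprn_ile1 //; first exact: ltW.
by have /andP[] := density_itv R AI N_gt0 A_neq0.
Qed.

Lemma num_solutions_sub_le :
  `|(num_solutions lam k A)%:R - de ^+ s * (num_solutions lam k I)%:R| <=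
  s%:R * D * (de * N%:R) ^+ s.-1 / (de * N%:R) ^+ (2 * t) * (s%:R * (2 * count)).
Proof.
pose M := (coef_norm lam * (t * N.+1 ^ k + N ^ k)).+1.
have M_large1 : (coef_norm lam * N ^ k < M)%N by rewrite ltnS leq_mul2l leq_addl orbT.
have M_large2 : (coef_norm lam * (t * N.+1 ^ k) < M)%N by rewrite ltnS leq_mul2l leq_addr orbT.
have -> : `|(num_solutions lam k A)%:R - de ^+ s * (num_solutions lam k I)%:R| =
    normc (grid_mean M (fun al => \prod_i sum_A al i - \prod_i sum_I al i)).
  rewrite -normc_real rmorphB rmorphM rmorphXn /= !rmorph_nat grid_meanB.
  rewrite (num_solutions_grid_mean R AI N_gt0 M_large1).
  rewrite (num_solutions_grid_mean R (fsubset_refl I) N_gt0 M_large1) -grid_meanZ.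
  congr (normc (_ - _)); apply: eq_grid_mean => al.
  by rewrite big_split /= prodr_const card_ord.
apply: le_trans (normc_grid_mean_le _ _) _.
apply: le_trans (ler_grid_mean M normc_sum_prod_sub_le) _.
have D_ge0 : 0 <= D by exact: le_trans (normc_ge0 _) (A_uniform (fun=> 0)).
rewrite grid_meanZ ler_wpM2l ?grid_mean_moments_le //.
by rewrite !mulr_ge0 ?invr_ge0 ?exprn_ge0 ?mulr_ge0 // ltW.
Qed.

End NumSolutions.

Lemma uniform_error_le (R : realType) s t K (de n ka C c J : R) : (2 * t < s)%N -> (K <= 2 * t)%N ->
  0 < de <= 1 -> 0 < n -> 0 <= ka -> 0 <= C -> J <= C * (2 * n) ^+ (2 * t - K) ->
  ka * (8 * (s * s)%:R * C * 2 ^+ (2 * t - K)) <= c ->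
  s%:R * (2 * ka * de ^+ (2 * t + 2) * n) * (de * n) ^+ s.-1 / (de * n) ^+ (2 * t) *
    (s%:R * (2 * J)) <= c / 2 * de ^+ s * n ^+ (s - K).
Proof.
move=> ts Kt /andP[de_gt0 de_le1] n_gt0 ka_ge0 C_ge0 J_le ka_le.
have sE : s = (2 * t + (s.-1 - 2 * t)).+1 by move: ts; clear; lia.
move: (s.-1 - 2 * t)%N sE => d sE.
have X_neq0 : (de * n) ^+ (2 * t) != 0 by rewrite expf_neq0 // mulf_neq0 // gt_eqF.
have -> : (de * n) ^+ s.-1 = (de * n) ^+ (2 * t) * (de ^+ d * n ^+ d).
  by rewrite -exprMn -exprD sE.
have -> : n ^+ (s - K) = n ^+ (2 * t - K) * n ^+ d * n.
  by rewrite -exprD -exprSr; congr (_ ^+ _); move: sE Kt; clear; lia.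
have -> : de ^+ s = de ^+ (2 * t) * de ^+ d * de by rewrite -exprD -exprSr -sE.
rewrite [de ^+ (_ + 2)]exprD; rewrite exprMn in J_le.
set a := de ^+ (2 * t); set b := de ^+ d; set p := n ^+ (2 * t - K) in J_le *; set q := n ^+ d.
set X := _ ^+ (2 * t) in X_neq0 *; have [de_ge0 n_ge0] := (ltW de_gt0, ltW n_gt0).
have main_ge0 : 0 <= a * b * de * (p * q * n) by rewrite !mulr_ge0 ?exprn_ge0.
set Z := a * b * de * _ in main_ge0.
have -> : s%:R * (2 * ka * (a * de ^+ 2) * n) * (X * (b * q)) / X * (s%:R * (2 * J)) =
    4 * (s * s)%:R * ka * (a * b * de ^+ 2) * (n * q) * J by rewrite natrM; field.
apply: le_trans (ler_wpM2l _ J_le) _; first by rewrite !mulr_ge0 ?exprn_ge0.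
have -> : 4 * (s * s)%:R * ka * (a * b * de ^+ 2) * (n * q) * (C * (2 ^+ (2 * t - K) * p)) =
    ka * (8 * (s * s)%:R * C * 2 ^+ (2 * t - K)) / 2 * (de * Z) by rewrite /Z; field.
have -> : c / 2 * (a * b * de) * (p * q * n) = c / 2 * Z by rewrite /Z; ring.
by apply: ler_pM; rewrite ?ler_pM2r ?mulr_ge0 ?exprn_ge0 ?invr_ge0 ?ler_piMl.
Qed.

Lemma uniform_count (R : realType) k s (lam : 'I_s -> int) t (C c : R) N1 :
  (forall i, lam i != 0) -> (0 < t)%N -> (2 * t < s)%N -> (tri_num k <= 2 * t)%N ->
  0 < C -> 0 < c ->
  (forall N, (0 < N)%N -> (vinogradov_count k t N)%:R <= C * N%:R ^+ (2 * t - tri_num k)) ->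
  (forall N, (N1 <= N)%N ->
    c * N%:R ^+ (s - tri_num k) <= (num_solutions lam k (zitv 1 N%:Z))%:R) ->
  exists2 ka : R, 0 < ka <= 4^-1 & forall N (A : {fset int}), (N1 <= N)%N -> (0 < N)%N ->
    (A `<=` zitv 1 N%:Z)%fset -> A != fset0 ->
    phase_uniform k N A (2 * ka * density R N A ^+ (2 * t + 2) * N%:R) ->
    c / 2 * density R N A ^+ s * N%:R ^+ (s - tri_num k) <= (num_solutions lam k A)%:R.
Proof.
move=> lam_neq0 t_gt0 ts Kt C_gt0 c_gt0 mean_value interval_lower.
pose C1 : R := 8 * (s * s)%:R * C * 2 ^+ (2 * t - tri_num k).
have C1_gt0 : 0 < C1.
  by rewrite !mulr_gt0 ?exprn_gt0 // ltr0n muln_gt0 (leq_ltn_trans _ ts).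
exists (Num.min 4^-1 (c / C1)); first by rewrite lt_min invr_gt0 ltr0n divr_gt0 // ge_min lexx.
set ka := Num.min _ _; have ka_gt0 : 0 < ka by rewrite lt_min invr_gt0 ltr0n divr_gt0.
have ka_le : ka * C1 <= c by rewrite -ler_pdivlMr // ge_min lexx orbT.
move=> N A N1_le N_gt0 AI A_neq0 A_uniform; set de := density R N A in A_uniform *.
have de_itv : 0 < de <= 1 by exact: density_itv.
have count_le : (vinogradov_count k t N.+1)%:R <= C * (2 * N%:R) ^+ (2 * t - tri_num k).
  apply: le_trans (mean_value N.+1 isT) _; rewrite ler_pM2l // lerXn2r ?nnegrE ?mulr_ge0 //.
  by rewrite -natrM ler_nat mul2n -addnn -addn1 leq_add2l.
have NR_gt0 : 0 < N%:R :> R by rewrite ltr0n.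
have := num_solutions_sub_le lam_neq0 t_gt0 ts N_gt0 AI A_neq0 A_uniform.
move=> /le_trans/(_ (uniform_error_le ts Kt de_itv NR_gt0 (ltW ka_gt0) (ltW C_gt0) count_le ka_le)).
have /andP[de_gt0 _] := de_itv.
have := ler_wpM2l (exprn_ge0 s (ltW de_gt0)) (interval_lower N N1_le).
rewrite -/de ler_norml => main_le /andP[+ _]; move: main_le.
have -> : c / 2 * de ^+ s * N%:R ^+ (s - tri_num k) =
  de ^+ s * (c * N%:R ^+ (s - tri_num k)) / 2 by field.
by lra.
Qed.

Lemma s0_double (R : realType) k : (2 <= k)%N ->
  exists2 t : nat, s0 R k = (2 * t)%N%:Z & (3 * k ^ 2 + 3 <= t)%N.
Proof.
move=> k_ge2; rewrite /s0; set y := k%:R * _; set f := Num.floor y.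
have kR_ge2 : 2 <= k%:R :> R by rewrite (ler_nat R 2).
have ln2_ge : 2^-1 <= ln (2 : R).
  have half_gt : -1 < - 2^-1 :> R by lra.
  have := le_ln1Dx half_gt; rewrite (_ : 1 + - 2^-1 = 2^-1 :> R); last by field.
  by rewrite lnV ?posrE //; lra.
have ln2_le : ln (2 : R) <= 1 by have := @le_ln1Dx R 1 ltac:(lra).
have lnk_ge : 2^-1 <= ln (k%:R : R) by apply: le_trans ln2_ge _; rewrite ler_ln ?posrE //; lra.
have lnlnk_ge : -1 <= ln (ln (k%:R : R)).
  apply: (@le_trans _ _ (ln (2^-1 : R))); first by rewrite lnV ?posrE //; lra.
  by rewrite ler_ln ?posrE //; lra.
have f_ge : - (2 * k)%N%:Z <= f.
  rewrite floor_ge_int rmorphN /= -pmulrn natrM /y.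
  have : 0 <= k%:R * (ln k%:R + 2 * ln (ln k%:R) + 2) :> R by apply: mulr_ge0 => //; lra.
  by rewrite mulrDr; lra.
have kf_ge : - (2 * k ^ 2)%N%:Z <= k%:Z * f.
  apply: le_trans (ler_wpM2l (isT : 0 <= k%:Z) f_ge).
  by rewrite mulrN -PoszM lerN2 lez_nat expnS expn1; lia.
exists `|(k%:Z * f + (5 * k ^ 2 + 3)%N%:Z)%R|%N.
  rewrite PoszM mulrAC [2%:Z * f * _]mulrAC -mulrA.
  by move: kf_ge; move: (k ^ 2)%N (k%:Z * f) => *; lia.
by move: kf_ge; move: (k ^ 2)%N (k%:Z * f) => *; lia.
Qed.

Lemma representations_le_num_solutions s (lam : 'I_s -> int) k N : \sum_i lam i = 0 ->
  (representations (k := k) lam N (fun=> 0) <= num_solutions lam k (zitv 1 N%:Z))%N.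
Proof.
move=> lam_sum0; rewrite representations0.
have mem (i : 'I_N) : 1 + nat_pos i \in zitv 1 N%:Z.
  by rewrite in_zitv /nat_pos; have := ltn_ord i; lia.
pose shift (x : {ffun 'I_s -> 'I_N}) : {ffun 'I_s -> zitv 1 N%:Z} :=
  [ffun i => FSetSub (mem (x i))].
rewrite -(@card_imset _ _ shift) => [|x y /ffunP xy]; last first.
  apply/ffunP => i; apply: val_inj; have := congr1 val (xy i).
  by rewrite !ffunE /= /nat_pos => /addrI[].
apply/subset_leq_card/fintype.subsetP => _ /imsetP[x + ->]; rewrite !inE => x_sol.
rewrite (_ : (fun i => _) = fun i => 1 + 1 * nat_pos (x i)); first exact: solution_affine.
by apply/funext => i; rewrite ffunE /= mul1r.
Qed.

Lemma card_trivial_partition s (lam : 'I_s -> int) (P : {set {set 'I_s}}) :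
  (forall i, lam i != 0) -> finset.partition P [set: 'I_s]%SET ->
  (forall B, B \in P -> \sum_(i in B) lam i = 0) -> (#|P| <= s./2)%N.
Proof.
move=> lam_neq0 P_part P_sum0; have := card_partition P_part; rewrite cardsT card_ord => sE.
rewrite geq_half_double [X in (_ <= X)%N]sE -muln2 -sum_nat_const; apply: leq_sum => B BP.
have /set0Pn[i iB] : B != finset.set0.
  by have /and3P[_ _ P_neq0] := P_part; apply: contraNneq P_neq0 => <-.
rewrite ltnNge; apply/negP => B_le1; have BE : B = [set i]%SET.
  by apply/esym/eqP; rewrite eqEcard cards1 B_le1 finset.sub1set iB.
by have /eqP := P_sum0 _ BP; rewrite BE big_set1 (negbTE (lam_neq0 i)).
Qed.

Lemma leq_card_imset_factor (aT rT rT' : finType) (f : aT -> rT) (g : aT -> rT') :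
  (forall i j, g i = g j -> f i = f j) ->
  (#|[set f i | i in [set: aT]]%SET| <= #|[set g i | i in [set: aT]]%SET|)%N.
Proof.
move=> fg; pose h y := omap f [pick i | g i == y].
rewrite -(card_imset _ (@Some_inj _)); apply: leq_trans (leq_imset_card h _).
apply/subset_leq_card/fintype.subsetP => _ /imsetP[_ /imsetP[i _ ->] ->].
apply/imsetP; exists (g i); rewrite ?imset_f // /h.
by case: pickP => [j /eqP/fg <-|/(_ i)]; rewrite ?eqxx.
Qed.

Lemma card_trivial_values s (lam : 'I_s -> int) (A : {fset int}) (x : {ffun 'I_s -> A}) :
  (forall i, lam i != 0) -> trivial_solution lam (fun i => val (x i)) ->
  (#|[set x i | i in [set: 'I_s]]%SET| <= s./2)%N.
Proof.
move=> lam_neq0 [P P_part P_triv].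
apply: leq_trans (card_trivial_partition lam_neq0 P_part (fun B BP => (P_triv B BP).1)).
have in_cover i : i \in finset.cover P by rewrite (finset.cover_partition P_part) inE.
apply: (@leq_trans #|[set finset.pblock P i | i in [set: 'I_s]]%SET|); last first.
  apply/subset_leq_card/fintype.subsetP => _ /imsetP[i _ ->].
  exact: finset.pblock_mem.
apply: leq_card_imset_factor => i j same_block; apply: val_inj.
have [_ x_const] := P_triv _ (finset.pblock_mem (in_cover i)).
by apply: x_const; rewrite ?finset.mem_pblock // same_block finset.mem_pblock.
Qed.

Lemma card_trivial_solutions s (lam : 'I_s -> int) (A : {fset int}) :
  (forall i, lam i != 0) -> (0 < s)%N ->
  (#|[set x : {ffun 'I_s -> A} | `[< trivial_solution lam (fun i => val (x i)) >]]| <=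
   s./2 ^ s * #|` A| ^ s./2)%N.
Proof.
move=> lam_neq0 s_gt0; set h := s./2; pose i0 := Ordinal s_gt0.
pose G (p : {ffun 'I_s -> 'I_h} * {ffun 'I_h -> A}) : {ffun 'I_s -> A} := [ffun i => p.2 (p.1 i)].
apply: (@leq_trans #|[set G p | p in [set: {ffun 'I_s -> 'I_h} * {ffun 'I_h -> A}]]%SET|).
  apply/subset_leq_card/fintype.subsetP => x; rewrite inE => /asboolP x_triv.
  pose values := [set x i | i in [set: 'I_s]]%SET.
  have index_lt i : (index (x i) (enum values) < h)%N.
    apply: leq_trans (card_trivial_values lam_neq0 x_triv).
    by rewrite [ltnRHS]cardE index_mem mem_enum imset_f.
  apply/imsetP; exists ([ffun i => Ordinal (index_lt i)],
    [ffun j : 'I_h => nth (x i0) (enum values) j]); rewrite ?inE //.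
  by apply/ffunP => i; rewrite !ffunE /= nth_index // mem_enum imset_f.
apply: leq_trans (leq_imset_card _ _) _.
by rewrite cardsT card_prod !card_ffun !card_ord -cardfE.
Qed.

Lemma exists_nontrivial_solution s (lam : 'I_s -> int) k (A : {fset int}) :
  (forall i, lam i != 0) -> (0 < s)%N ->
  (s./2 ^ s * #|` A| ^ s./2 < num_solutions lam k A)%N ->
  exists x : 'I_s -> int,
    [/\ forall i, x i \in A, solution lam k x & ~ trivial_solution lam x].
Proof.
move=> lam_neq0 s_gt0; apply: contraPP => no_nontrivial; apply/negP; rewrite -leqNgt.
apply: leq_trans (card_trivial_solutions A lam_neq0 s_gt0).
apply/subset_leq_card/fintype.subsetP => x; rewrite !inE => x_sol.
apply: contrapT => x_nontriv; apply: no_nontrivial.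
exists (fun i => val (x i)); split=> // i; exact: fsvalP.
Qed.

(* Parseval bounds the mean square of the exponential sum of the balanced
   function from below, so that a sparse set cannot be very uniform. *)
Lemma density_pow4_ge (R : realType) k N (A : {fset int}) t (ka : R) :
  (0 < k)%N -> (16 <= N)%N -> (A `<=` zitv 1 N%:Z)%fset -> A != fset0 -> (0 < t)%N ->
  0 < ka <= 4^-1 -> phase_uniform k N A (2 * ka * density R N A ^+ (2 * t + 2) * N%:R) ->
  1 <= density R N A ^+ 4 * N%:R.
Proof.
move=> k_gt0 N_ge16 AI A_neq0 t_gt0 /andP[ka_gt0 ka_le] A_uniform.
have N_gt0 : (0 < N)%N by exact: leq_trans N_ge16.
have NR_ge16 : 16 <= N%:R :> R by rewrite (ler_nat R 16).
have NR_gt0 : 0 < N%:R :> R by rewrite ltr0n.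
have /andP[de_gt0 de_le1] := density_itv R AI N_gt0 A_neq0.
have := sum_sqr_le_of_interval_sum k_gt0 A_uniform; rewrite sum_balanced_sqr //.
move: (density R N A) de_gt0 de_le1 => de de_gt0 de_le1.
have [dense|sparse] := lerP 2^-1 de.
  have : (2^-1) ^+ 4 <= de ^+ 4 by rewrite lerXn2r ?nnegrE ?invr_ge0 ?(ltW de_gt0).
  rewrite exprVn => de4_ge _; apply: le_trans (ler_pM _ _ de4_ge NR_ge16) => //.
  by rewrite -ler_pdivrMl ?invr_gt0 ?exprn_gt0 // invrK; lra.
have upper : (2 * ka * de ^+ (2 * t + 2) * N%:R) ^+ 2 <= 4^-1 * (de ^+ 5 * N%:R ^+ 2).
  have -> : (2 * ka * de ^+ (2 * t + 2) * N%:R) ^+ 2 =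
      (2 * ka) ^+ 2 * (de ^+ ((2 * t + 2) * 2) * N%:R ^+ 2).
    by rewrite exprM; move: (de ^+ _) => z; ring.
  apply: ler_pM; rewrite ?mulr_ge0 ?exprn_ge0 ?(ltW de_gt0) ?(ltW ka_gt0) //.
    by move: ka_gt0 ka_le; clear; nra.
  rewrite ler_wpM2r ?exprn_ge0 //; apply: ler_wiXn2l; rewrite ?(ltW de_gt0) //.
  by move: t_gt0; clear; lia.
move=> /le_trans/(_ upper); have deN_gt0 : 0 < de * N%:R / 4 by rewrite divr_gt0 // mulr_gt0.
have -> : 4^-1 * (de ^+ 5 * N%:R ^+ 2) = de ^+ 4 * N%:R * (de * N%:R / 4) by field.
move=> le4; rewrite -(ler_pM2r deN_gt0); apply: le_trans le4.
have : 2^-1 * (de * N%:R) <= (1 - de) * (de * N%:R).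
  by rewrite ler_pM2r ?mulr_gt0 //; move: sparse; lra.
by rewrite [(1 - de) * _]mulrA [(1 - de) * _]mulrC; move: deN_gt0; lra.
Qed.

Lemma trivial_bound_lt_main_term (R : realType) s K (c : R) : (4 * K < 3 * (s - s./2))%N ->
  0 < c -> exists N0 : nat, forall N a (de : R), (N0 <= N)%N -> 0 <= de -> a%:R = de * N%:R ->
    1 <= de ^+ 4 * N%:R -> (s./2 ^ s * a ^ s./2)%N%:R < c * de ^+ s * N%:R ^+ (s - K) :> R.
Proof.
move=> K_lt c_gt0; set h := s./2; set u := (s - h)%N in K_lt.
have hs : (h <= s)%N by rewrite /h; lia.
pose B : R := ((h ^ s)%:R / c) ^+ 4; have B_ge0 : 0 <= B by rewrite exprn_ge0 // divr_ge0 // ltW.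
exists (Num.bound B) => N a de N_large de_ge0 aE de4_ge.
have N_gt : B < N%:R by apply: lt_le_trans (archi_boundP B_ge0) _; rewrite ler_nat.
have N_gt0 : (0 < N)%N by rewrite -(ltr_nat R); apply: le_lt_trans N_gt.
have de_gt0 : 0 < de.
  rewrite lt_neqAle de_ge0 andbT; apply/eqP => de0; move: de4_ge.
  by rewrite -de0 expr0n mul0r ler10.
pose Z := de ^+ u * N%:R ^+ (u - K); have Z_ge0 : 0 <= Z by rewrite mulr_ge0 ?exprn_ge0.
have N_le_Z4 : N%:R <= Z ^+ 4.
  have -> : Z ^+ 4 = (de ^+ 4 * N%:R) ^+ u * N%:R ^+ (3 * u - 4 * K).
    have -> : (de ^+ 4 * N%:R) ^+ u = de ^+ (u * 4) * N%:R ^+ u by rewrite exprMn -exprM mulnC.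
    rewrite exprMn -!exprM -mulrA -exprD; congr (_ * _ ^+ _).
    by move: K_lt; clear; lia.
  rewrite -[leLHS]mul1r; apply: ler_pM => //; first exact: exprn_ege1.
  by rewrite -[leLHS]expr1; apply: ler_weXn2l; rewrite ?ler1n // subn_gt0.
have Z_gt : (h ^ s)%:R / c < Z.
  by rewrite -(@ltr_pXn2r _ 4) ?nnegrE ?divr_ge0 ?(ltW c_gt0) //; exact: lt_le_trans N_gt N_le_Z4.
have -> : c * de ^+ s * N%:R ^+ (s - K) = (c * Z) * (de * N%:R) ^+ h.
  have -> : de ^+ s = de ^+ u * de ^+ h by rewrite -exprD subnK.
  have -> : N%:R ^+ (s - K) = N%:R ^+ (u - K) * N%:R ^+ h :> R.
    by rewrite -exprD; congr (_ ^+ _); move: K_lt hs; rewrite /u; clear; lia.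
  by rewrite exprMn /Z; ring.
rewrite natrM [(a ^ h)%:R]natrX aE ltr_pM2r ?exprn_gt0 ?mulr_gt0 ?ltr0n //.
by rewrite mulrC -ltr_pdivrMr.
Qed.

Definition solvable_in_uniform_sets (R : realType) k s (lam : 'I_s -> int) (K : R) N0 :=
  exists c : R, 0 < c /\ forall (N : nat) (A : {fset int}) (a : R),
    (N0 <= N)%N -> (A `<=` zitv 1 N%:Z)%fset -> A != fset0 -> uniform_of_degree N A a k ->
    a <= K * density R N A ^ ((2 ^ k.+1)%N%:Z * (s0 R k + 2)) ->
    (exists x : 'I_s -> int,
       [/\ forall i, x i \in A, solution lam k x & ~ trivial_solution lam x]) /\
    c * density R N A ^+ s * N%:R ^ (s%:Z - ((k * k.+1)./2)%:Z) <= (num_solutions lam k A)%:R.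

Lemma solvable_in_uniform_setsW (R : realType) k s (lam : 'I_s -> int) (K K' : R) N0 N0' :
  K' <= K -> (N0 <= N0')%N ->
  solvable_in_uniform_sets k lam K N0 -> solvable_in_uniform_sets k lam K' N0'.
Proof.
move=> K_le N0_le [c [c_gt0 solvable]]; exists c; split=> // N A a N_ge AI A_neq0 uniform a_le.
apply: (solvable N A a) => //; first exact: leq_trans N_ge.
by apply: le_trans a_le _; rewrite ler_wpM2r // exprz_ge0 // divr_ge0.
Qed.

Theorem exists_solvable_in_uniform_sets (R : realType) k s (lam : 'I_s -> int) :
  (forall i, lam i != 0) -> \sum_i lam i = 0 -> (2 <= k)%N -> s0 R k < s%:Z ->
  has_nonsingular_solution R lam k ->
  (forall p, prime p -> has_nonsingular_solution (Qp p) lam k) ->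
  exists2 K : R, 0 < K & exists N0, solvable_in_uniform_sets k lam K N0.
Proof.
move=> lam_neq0 lam_sum0 k_ge2 s_gt real_sol padic_sol.
have [t s0E t_ge] := s0_double R k_ge2; rewrite s0E ltz_nat in s_gt.
have k_gt0 : (0 < k)%N by exact: leq_trans k_ge2.
have tri2 := double_tri_num k; rewrite -mulnn in t_ge.
have Kt : (tri_num k < t)%N by move: t_ge tri2; clear; nia.
have K2t : (tri_num k <= 2 * t)%N by move: Kt; clear; lia.
have Ks : (tri_num k <= s)%N by move: K2t s_gt; clear; lia.
have t_gt0 : (0 < t)%N by exact: leq_ltn_trans Kt.
have [c c_gt0 [N1 interval_lower]] :=
  solutions_lower_bound k_gt0 lam_neq0 Kt s_gt lam_sum0 real_sol padic_sol.
have [C C_gt0 mean_value] := @sharp_mean R k t k_gt0 Kt.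
have [N N1_le|ka /andP[ka_gt0 ka_le] count_lower] :=
  @uniform_count R k s lam t C c N1 lam_neq0 t_gt0 s_gt K2t C_gt0 c_gt0 mean_value.
  apply: le_trans (interval_lower N N1_le) _.
  by rewrite ler_nat representations_le_num_solutions.
have c2_gt0 : 0 < c / 2 by rewrite divr_gt0.
have [|N2 trivial_lt] := @trivial_bound_lt_main_term R s (tri_num k) (c / 2) _ c2_gt0.
  by move: t_ge s_gt tri2; clear; nia.
exists (ka ^+ (2 ^ k.+1)); first by rewrite exprn_gt0.
exists (maxn N1 (maxn N2 16)), (c / 2); split=> // N A a.
rewrite !geq_max s0E => /and3P[N1_le N2_le N_ge16] AI A_neq0 uniform a_le.
have N_gt0 : (0 < N)%N by exact: leq_trans N_ge16.
have A_uniform := phase_uniform_of_uniform N_gt0 (ltW ka_gt0) uniform a_le.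
have A_count := count_lower N A N1_le N_gt0 AI A_neq0 A_uniform.
have ka_itv : 0 < ka <= 4^-1 by rewrite ka_gt0.
have dense := density_pow4_ge k_gt0 N_ge16 AI A_neq0 t_gt0 ka_itv A_uniform.
split; last by rewrite -/(tri_num k) subzn.
apply: (exists_nontrivial_solution lam_neq0 (leq_ltn_trans (leq0n _) s_gt)).
rewrite -(ltr_nat R); apply: lt_le_trans A_count; apply: trivial_lt => //.
  by rewrite divr_ge0.
exact: card_density.
Qed.

Lemma uniform_choice (R : realDomainType) (P : nat -> R -> nat -> Prop) n :
  (forall k K K' N N', K' <= K -> (N <= N')%N -> P k K N -> P k K' N') ->
  (forall k, exists2 K, 0 < K & exists N, P k K N) ->
  exists2 K, 0 < K & exists N, forall k, (k < n)%N -> P k K N.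
Proof.
move=> P_mono P_ex; elim: n => [|n [K K_gt0 [N PK]]]; first by exists 1 => //; exists 0%N.
have [K1 K1_gt0 [N1 PK1]] := P_ex n.
exists (Num.min K K1); first by rewrite lt_min K_gt0.
exists (maxn N N1) => k; rewrite ltnS leq_eqVlt => /orP[/eqP->|k_lt].
  by apply: P_mono PK1; rewrite ?ge_min ?lexx ?orbT ?leq_maxr.
by apply: P_mono (PK k k_lt); rewrite ?ge_min ?lexx ?leq_maxl.
Qed.

Lemma ltn_s0 (R : realType) k s : (2 <= k)%N -> s0 R k < s%:Z -> (k < s)%N.
Proof.
move=> /(s0_double R)[t -> t_ge]; rewrite ltz_nat; apply: leq_trans.
by move: t_ge; rewrite -mulnn; clear; nia.
Qed.

Theorem theorem2 (R : realType) (s : nat) (lam : 'I_s -> int)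
    (lam_neq0 : forall i, lam i != 0) (lam_sum0 : \sum_(i < s) lam i = 0) :
  exists K : R, 0 < K /\
  exists N0 : nat,
  forall k : nat, (2 <= k)%N ->
  s0 R k < s%:Z ->
  has_nonsingular_solution R lam k ->
  (forall p : nat, prime p -> has_nonsingular_solution (Qp p) lam k) ->
  exists c : R, 0 < c /\
  forall (N : nat) (A : {fset int}) (a : R),
    (N0 <= N)%N ->
    (A `<=` zitv 1 N%:Z)%fset ->
    A != fset0 ->
    uniform_of_degree N A a k ->
    a <= K * density R N A ^ ((2 ^ k.+1)%N%:Z * (s0 R k + 2)) ->
    (exists x : 'I_s -> int,
       [/\ forall i, x i \in A, solution lam k x & ~ trivial_solution lam x]) /\
    c * density R N A ^+ s * N%:R ^ (s%:Z - ((k * k.+1)./2)%:Z)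
      <= (num_solutions lam k A)%:R.
Proof.
pose hyps k := [/\ (2 <= k)%N, s0 R k < s%:Z, has_nonsingular_solution R lam k &
  forall p : nat, prime p -> has_nonsingular_solution (Qp p) lam k].
have [||K K_gt0 [N0 solvable]] := @uniform_choice R
  (fun k K N0 => hyps k -> solvable_in_uniform_sets k lam K N0) s.
- by move=> k K K' N N' K_le N_le solvable /solvable; exact: solvable_in_uniform_setsW.
- move=> k; have [[k_ge2 s_gt real_sol padic_sol]|not_hyps] := pselect (hyps k); last first.
    by exists 1 => //; exists 0%N => /not_hyps.
  have [K K_gt0 [N0 solvable]] :=
    exists_solvable_in_uniform_sets lam_neq0 lam_sum0 k_ge2 s_gt real_sol padic_sol.
  by exists K => //; exists N0.
exists K; split=> //; exists N0 => k k_ge2 s_gt real_sol padic_sol.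
by apply: solvable; [exact: ltn_s0 s_gt | split].
Qed.
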